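(* Let $\Omega\subset\mathbb{R}^2$ be a bounded polygonal Lipschitz domain with mesh $\mathcal{T}$ and let $f\in L_2(\Omega)$. Consider the Kirchhoff--Love problem $$-\mathrm{div\,\mathbf{div}}\,\mathbf{M}=f,\qquad \mathbf{M}+\mathcal{C}\boldsymbol\varepsilon\nabla u=0\quad\text{in }\Omega\qquad(\mathrm{KL})$$ with either the clamped boundary condition $u=0$, $\nabla u=0$ on $\partial\Omega$ (then set $U:=U_c$), or the simply supported boundary condition $u=0$, $\boldsymbol{n}\cdot\mathbf{M}\boldsymbol{n}=0$ on $\partial\Omega$ (then set $U:=U_s$). The variational formulation: find $\boldsymbol{u}=(u,\mathbf{M},\widehat{\boldsymbol u},\widehat{\boldsymbol m})\in U$ such that $$b(\boldsymbol{u};\boldsymbol{v})=L(\boldsymbol{v})\quad\forall\,\boldsymbol{v}=(v,\mathbf{Q})\in V\qquad(\mathrm{VF})$$ is well posed and equivalent to (KL). Specifically, if $(u,\mathbf{M})\in H^2(\Omega)\times\mathbb{H}(\mathrm{div\,\mathbf{div}},\Omega)$ solves (KL) with one of the two boundary conditions, then $\boldsymbol{u}=(u,\mathbf{M},\mathrm{tr}^{\mathrm{Ggrad}}(u),\mathrm{tr}^{\mathrm{dDiv}}(\mathbf{M}))\in U$ solves (VF). Correspondingly, the solution $\boldsymbol{u}=(u,\mathbf{M},\widehat{\boldsymbol u},\widehat{\boldsymbol m})\in U$ of (VF) satisfies $\widehat{\boldsymbol u}=\mathrm{tr}^{\mathrm{Ggrad}}(u)$, $\widehat{\boldsymbol m}=\mathrm{tr}^{\mathrm{dDiv}}(\mathbf{M})$,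 and $(u,\mathbf{M})\in H^2(\Omega)\times\mathbb{H}(\mathrm{div\,\mathbf{div}},\Omega)$ solves (KL) with the corresponding boundary condition. Furthermore, for any finite-dimensional subspace $U_h\subset U$ there exists a unique solution $\boldsymbol{u}_h\in U_h$ to the DPG scheme $$b(\boldsymbol{u}_h;\boldsymbol{v})=L(\boldsymbol{v})\quad\forall\,\boldsymbol{v}\in\Theta_d(U_h).$$ Assuming that $\|v\|\le d(\Omega)^2\|\boldsymbol\varepsilon\nabla v\|$ holds for all $v\in H^2_0(\Omega)$ in the clamped case, respectively for all $v\in H^2(\Omega)\cap H^1_0(\Omega)$ in the simply supported case, and that the scaling parameter is chosen as $d=d(\Omega)$, $\boldsymbol{u}_h$ satisfies $$\|\boldsymbol{u}-\boldsymbol{u}_h\|_{U,d}\le C\,\inf\{\|\boldsymbol{u}-\boldsymbol{w}\|_{U,d};\ \boldsymbol{w}\in U_h\}$$ with a constant $C>0$ that is independent of $f$, $U_h$, $\mathcal{T}$ and $\Omega$. Here $\boldsymbol{u}\in U$ is the solution to (VF).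
   Context: $\mathcal{C}$ is a fixed symmetric, positive definite tensor of order four (acting on symmetric $2\times2$ tensors). $\boldsymbol{n}$ is the exterior unit normal on $\partial\Omega$. Mesh: $\mathcal{T}$ is a finite collection of pairwise disjoint open Lipschitz subdomains (elements) $T\subset\Omega$ with $\bar\Omega=\bigcup_{T\in\mathcal{T}}\bar T$. $(\cdot,\cdot)_\omega$ and $\|\cdot\|_\omega$ are the $L_2(\omega)$ bilinear form and norm for scalar, vector or tensor functions (index dropped for $\omega=\Omega$); $(\cdot,\cdot)_{\mathcal{T}}:=\sum_{T\in\mathcal{T}}(\cdot,\cdot)_T$ with differential operators applied elementwise. The scaling parameter $d$ is a positive number. Operators: $\boldsymbol\varepsilon(\boldsymbol\psi):=\frac12(\nabla\boldsymbol\psi+(\nabla\boldsymbol\psi)^{\mathsf T})$, so $\boldsymbol\varepsilon\nabla v$ is the Hessian of $v$; $\mathrm{div}$ is the divergence and $\mathbf{div}$ the row-wise divergence of $2\times2$ tensor functions. Spaces: $\mathbb{L}_2^s(\omega)$ is the space of symmetric $2\times2$ tensors with $L_2(\omega)$ components; $\mathbb{H}(\mathrm{div\,\mathbf{div}},\omega):=\{\mathbf{Q}\in\mathbb{L}_2^s(\omega);\ \mathrm{div\,\mathbf{div}}\,\mathbf{Q}\in L_2(\omega)\}$; $H^2_s(\Omega):=H^2(\Omega)\cap H^1_0(\Omega)$. Broken spaces: $H^2(\mathcal{T}):=\prod_{T\in\mathcal{T}}H^2(T)$, $\mathbb{H}(\mathrm{div\,\mathbf{div}},\mathcal{T}):=\prod_{T\in\mathcal{T}}\mathbb{H}(\mathrm{div\,\mathbf{div}},T)$.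 Trace operators: $\mathrm{tr}^{\mathrm{Ggrad}}:H^2(\mathcal{T})\to(\mathbb{H}(\mathrm{div\,\mathbf{div}},\mathcal{T}))'$ and $\mathrm{tr}^{\mathrm{dDiv}}:\mathbb{H}(\mathrm{div\,\mathbf{div}},\mathcal{T})\to(H^2(\mathcal{T}))'$ are defined by $$\langle\mathrm{tr}^{\mathrm{Ggrad}}(v),\boldsymbol\delta\mathbf{Q}\rangle_{\mathcal{S}}:=(v,\mathrm{div\,\mathbf{div}}\,\boldsymbol\delta\mathbf{Q})_{\mathcal{T}}-(\boldsymbol\varepsilon\nabla v,\boldsymbol\delta\mathbf{Q})_{\mathcal{T}},\qquad \langle\mathrm{tr}^{\mathrm{dDiv}}(\mathbf{Q}),\delta v\rangle_{\mathcal{S}}:=(\mathrm{div\,\mathbf{div}}\,\mathbf{Q},\delta v)_{\mathcal{T}}-(\mathbf{Q},\boldsymbol\varepsilon\nabla\delta v)_{\mathcal{T}}.$$ $\mathbb{H}_0(\mathrm{div\,\mathbf{div}},\Omega):=\{\mathbf{Q}\in\mathbb{H}(\mathrm{div\,\mathbf{div}},\Omega);\ \langle\mathrm{tr}^{\mathrm{dDiv}}(\mathbf{Q}),\delta v\rangle_{\mathcal{S}}=0\ \forall\,\delta v\in H^2_s(\Omega)\}$. For $u\in H^2(\Omega)$, $\mathbf{M}\in\mathbb{H}(\mathrm{div\,\mathbf{div}},\Omega)$ the clamped condition means $u\in H^2_0(\Omega)$, and the simply supported condition means $u\in H^2_s(\Omega)$ and $\mathbf{M}\in\mathbb{H}_0(\mathrm{div\,\mathbf{div}},\Omega)$.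 Trace spaces: clamped case $\boldsymbol{H}^{3/2,1/2}_c(\mathcal{S}):=\mathrm{tr}^{\mathrm{Ggrad}}(H^2_0(\Omega))$, $\boldsymbol{H}^{-3/2,-1/2}_c(\mathcal{S}):=\mathrm{tr}^{\mathrm{dDiv}}(\mathbb{H}(\mathrm{div\,\mathbf{div}},\Omega))$; simply supported case $\boldsymbol{H}^{3/2,1/2}_s(\mathcal{S}):=\mathrm{tr}^{\mathrm{Ggrad}}(H^2_s(\Omega))$, $\boldsymbol{H}^{-3/2,-1/2}_s(\mathcal{S}):=\mathrm{tr}^{\mathrm{dDiv}}(\mathbb{H}_0(\mathrm{div\,\mathbf{div}},\Omega))$. Their elements act on $\mathbb{H}(\mathrm{div\,\mathbf{div}},\mathcal{T})$ and $H^2(\mathcal{T})$, respectively, via $\langle\cdot,\cdot\rangle_{\mathcal{S}}$. Scaled norms: $\|v\|_{2,d,\omega}^2:=d^{-4}\|v\|_\omega^2+\|\boldsymbol\varepsilon\nabla v\|_\omega^2$, $\|\mathbf{Q}\|_{\mathrm{div\,\mathbf{div}},d,\omega}^2:=\|\mathbf{Q}\|_\omega^2+d^4\|\mathrm{div\,\mathbf{div}}\,\mathbf{Q}\|_\omega^2$ (index dropped for $\omega=\Omega$), with product norms $\|\cdot\|_{2,d,\mathcal{T}}$, $\|\cdot\|_{\mathrm{div\,\mathbf{div}},d,\mathcal{T}}$ (square root of sum over $T$ of squared local norms); $\|\widehat{\boldsymbol v}\|_{3/2,1/2,d,\mathcal{S}}:=\inf\{\|v\|_{2,d};\ v\in H^2(\Omega),\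 \mathrm{tr}^{\mathrm{Ggrad}}(v)=\widehat{\boldsymbol v}\}$, $\|\widehat{\boldsymbol q}\|_{-3/2,-1/2,d,\mathcal{S}}:=\inf\{\|\mathbf{Q}\|_{\mathrm{div\,\mathbf{div}},d};\ \mathbf{Q}\in\mathbb{H}(\mathrm{div\,\mathbf{div}},\Omega),\ \mathrm{tr}^{\mathrm{dDiv}}(\mathbf{Q})=\widehat{\boldsymbol q}\}$. Trial and test spaces: for $a\in\{c,s\}$, $U_a:=L_2(\Omega)\times\mathbb{L}_2^s(\Omega)\times\boldsymbol{H}^{3/2,1/2}_a(\mathcal{S})\times\boldsymbol{H}^{-3/2,-1/2}_a(\mathcal{S})$, and $V:=H^2(\mathcal{T})\times\mathbb{H}(\mathrm{div\,\mathbf{div}},\mathcal{T})$, with norms $$\|(u,\mathbf{M},\widehat{\boldsymbol u},\widehat{\boldsymbol m})\|_{U,d}^2:=d^{-4}\|u\|^2+\|\mathbf{M}\|^2+\|\widehat{\boldsymbol u}\|_{3/2,1/2,d,\mathcal{S}}^2+\|\widehat{\boldsymbol m}\|_{-3/2,-1/2,d,\mathcal{S}}^2,\qquad \|(v,\mathbf{Q})\|_{V,d}^2:=\|v\|_{2,d,\mathcal{T}}^2+\|\mathbf{Q}\|_{\mathrm{div\,\mathbf{div}},d,\mathcal{T}}^2,$$ and inner product in $V$ $$\langle(v,\mathbf{Q}),(\delta v,\boldsymbol\delta\mathbf{Q})\rangle_{V,d}:=d^{-4}(v,\delta v)+(\boldsymbol\varepsilon\nabla v,\boldsymbol\varepsilon\nabla\delta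 v)_{\mathcal{T}}+(\mathbf{Q},\boldsymbol\delta\mathbf{Q})+d^4(\mathrm{div\,\mathbf{div}}\,\mathbf{Q},\mathrm{div\,\mathbf{div}}\,\boldsymbol\delta\mathbf{Q})_{\mathcal{T}}.$$ Forms: $$b(u,\mathbf{M},\widehat{\boldsymbol u},\widehat{\boldsymbol m};v,\mathbf{Q}):=(\mathbf{M},\boldsymbol\varepsilon\nabla v+\mathcal{C}^{-1}\mathbf{Q})_{\mathcal{T}}+(u,\mathrm{div\,\mathbf{div}}\,\mathbf{Q})_{\mathcal{T}}-\langle\widehat{\boldsymbol u},\mathbf{Q}\rangle_{\mathcal{S}}+\langle\widehat{\boldsymbol m},v\rangle_{\mathcal{S}},\qquad L(v,\mathbf{Q}):=-(f,v).$$ Trial-to-test operator $\Theta_d:U\to V$: $\langle\Theta_d\boldsymbol{u},\boldsymbol{v}\rangle_{V,d}=b(\boldsymbol{u};\boldsymbol{v})$ for all $\boldsymbol{v}\in V$. Well posed means: for every $f\in L_2(\Omega)$ there is a unique solution in $U$, depending continuously on the data. The constant $C$ may depend on the fixed tensor $\mathcal{C}$. *)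

(* Defs.v *)
From HB Require Import structures.
From mathcomp Require Import all_boot all_order all_algebra.
From mathcomp Require Import all_classical all_reals all_analysis.
Set Implicit Arguments.
Unset Strict Implicit.
Unset Printing Implicit Defensive.
Import Order.TTheory GRing.Theory Num.Theory.
Import numFieldNormedType.Exports.
Local Open Scope classical_set_scope.
Local Open Scope ring_scope.

Notation leb2 R := (@lebesgue_measure R \x @lebesgue_measure R)%E.

Definition frontier {T : topologicalType} (D : set T) : set T :=
  closure D `\` interior D.

Definition subdomain {R : realType} (D : set (R * R)) : Prop :=
  [/\ open D, connected D & D !=set0].

(* At each boundary point p there are a rotated frame (with second axis the
   unit vector e) and a cylinder in which D is the strict epigraph of a
   Lipschitz function g. Then the boundary is the graph of g there. *)
Definition lipschitz_boundary {R : realType} (D : set (R * R)) : Prop :=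
  forall p, frontier D p ->
  exists (e : R * R) (g : R -> R) (r h : R),
  [/\ e.1 ^+ 2 + e.2 ^+ 2 = 1, 0 < r, 0 < h,
      [lipschitz g s | s in [set: R]] &
      forall s t, `|s| < r -> `|t| < h ->
        D (p.1 + s * e.2 + t * e.1, p.2 - s * e.1 + t * e.2) <-> g s < t].

Definition polygonal {R : realType} (D : set (R * R)) : Prop :=
  exists l : seq ((R * R) * (R * R)), forall x,
  frontier D x <->
  exists ab t, [/\ ab \in l, 0 <= t <= 1 &
                   x = ((1 - t) * ab.1.1 + t * ab.2.1,
                        (1 - t) * ab.1.2 + t * ab.2.2)].

Definition polygonal_lipschitz_domain {R : realType} (Omega : set (R * R)) :=
  [/\ subdomain Omega, bounded_set Omega, polygonal Omega
    & lipschitz_boundary Omega].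

Definition is_mesh {R : realType} (Omega : set (R * R)) m
    (T : 'I_m -> set (R * R)) : Prop :=
  [/\ forall i, [/\ subdomain (T i), lipschitz_boundary (T i)
                  & T i `<=` Omega],
      forall i j, i != j -> T i `&` T j = set0
    & closure Omega = \bigcup_i closure (T i)].

Section Tensors.
Context {R : realType}.

Definition symmetric_tensor (A : 'M[R]_2) : Prop := A^T = A.

Definition ddot (A B : 'M[R]_2) : R := \sum_i \sum_j A i j * B i j.

(* An order-four tensor acting on symmetric tensors is given as a linear map of
   2 x 2 matrices, of which only the restriction to symmetric ones matters. *)
Definition spd_tensor (C : {linear 'M[R]_2 -> 'M[R]_2}) : Prop :=
  [/\ forall A, symmetric_tensor A -> symmetric_tensor (C A),
      forall A B, symmetric_tensor A -> symmetric_tensor B ->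
        ddot (C A) B = ddot A (C B)
    & forall A, symmetric_tensor A -> A != 0 -> 0 < ddot (C A) A].

Definition tensor_inv (C : {linear 'M[R]_2 -> 'M[R]_2}) (A : 'M[R]_2) :
    'M[R]_2 :=
  get [set B | symmetric_tensor B /\ C B = A].

End Tensors.

Section L2.
Context {R : realType}.
Implicit Types (w : set (R * R)) (f g : R * R -> R) (P Q : R * R -> 'M[R]_2).

(* Functions are total on the plane; only their values on w matter. *)
Definition L2 w f : Prop :=
  measurable_fun w f /\
  (leb2 R).-integrable w (EFin \o (fun x => f x ^+ 2)).

Definition L2s w Q : Prop :=
  {ae leb2 R, forall x, w x -> symmetric_tensor (Q x)} /\
  forall i j, L2 w (fun x => Q x i j).

Definition ip w f g : R := \int[leb2 R]_(x in w) (f x * g x).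
Definition ipM w P Q : R := \int[leb2 R]_(x in w) ddot (P x) (Q x).

Definition nrm w f : R := Num.sqrt (ip w f f).
Definition nrmM w Q : R := Num.sqrt (ipM w Q Q).

End L2.

Section Sobolev.
Context {R : realType}.
Implicit Types (w : set (R * R)) (v phi : R * R -> R) (Q : R * R -> 'M[R]_2).

Definition ebase (i : 'I_2) : R * R := if i == ord0 then (1, 0) else (0, 1).

Definition partial (i : 'I_2) (f : R * R -> R) : R * R -> R :=
  fun x => 'D_(ebase i) f x.

Definition smooth (f : R * R -> R) : Prop :=
  forall s : seq 'I_2, let g := foldr partial f s in
  continuous g /\ forall i x, derivable g x (ebase i).

Definition test_fun w phi : Prop :=
  let supp := closure [set x | phi x != 0] in
  [/\ smooth phi, compact supp & supp `<=` w].

Definition is_wpartial w (i : 'I_2) v (g : R * R -> R) : Prop :=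
  forall phi, test_fun w phi -> ip w v (partial i phi) = - ip w g phi.

(* Representatives of weak derivatives are chosen by [get]; they are
   meaningful only when a weak derivative in L2 exists. *)
Definition wpartial w i v : R * R -> R :=
  get [set g | L2 w g /\ is_wpartial w i v g].

Definition H1 w v : Prop :=
  L2 w v /\ forall i, exists g, L2 w g /\ is_wpartial w i v g.

Definition H2 w v : Prop := H1 w v /\ forall i, H1 w (wpartial w i v).

Definition wgrad w v : R * R -> 'cV[R]_2 := fun x => \col_i wpartial w i v x.

Definition wjacobian w (psi : R * R -> 'cV[R]_2) : R * R -> 'M[R]_2 :=
  fun x => \matrix_(i, j) wpartial w j (fun y => psi y i 0) x.

Definition eps w (psi : R * R -> 'cV[R]_2) : R * R -> 'M[R]_2 :=
  fun x => 2^-1 *: (wjacobian w psi x + (wjacobian w psi x)^T).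

Definition epsgrad w v : R * R -> 'M[R]_2 := eps w (wgrad w v).

Definition hessian phi : R * R -> 'M[R]_2 :=
  fun x => \matrix_(i, j) partial j (partial i phi) x.

(* The distribution div Div Q is phi |-> (Q, hessian phi). *)
Definition is_divDiv w Q (q : R * R -> R) : Prop :=
  forall phi, test_fun w phi -> ip w q phi = ipM w Q (hessian phi).

Definition divDiv w Q : R * R -> R :=
  get [set q | L2 w q /\ is_divDiv w Q q].

Definition HdivDiv w Q : Prop :=
  L2s w Q /\ exists q, L2 w q /\ is_divDiv w Q q.

(* Unscaled squared Sobolev norms, used for closures of test functions. *)
Definition H1normsq w v : R :=
  ip w v v + \sum_i ip w (wpartial w i v) (wpartial w i v).
Definition H2normsq w v : R :=
  ip w v v + \sum_i H1normsq w (wpartial w i v).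

Definition H10 w v : Prop := H1 w v /\
  forall e, 0 < e -> exists2 phi, test_fun w phi & H1normsq w (v - phi) < e.
Definition H20 w v : Prop := H2 w v /\
  forall e, 0 < e -> exists2 phi, test_fun w phi & H2normsq w (v - phi) < e.

Definition H2s w v : Prop := H2 w v /\ H10 w v.

Definition norm2 (d : R) w v : R :=
  Num.sqrt (d ^- 4 * nrm w v ^+ 2 + nrmM w (epsgrad w v) ^+ 2).
Definition normdD (d : R) w Q : R :=
  Num.sqrt (nrmM w Q ^+ 2 + d ^+ 4 * nrm w (divDiv w Q) ^+ 2).

End Sobolev.

Variant bc := Clamped | SimplySupported.

(* Broken functions are families indexed by the elements; a function on Omega
   is identified with the corresponding constant family [fun=> v], as only the
   values of the i-th member on T i matter. *)
Section Broken.
Context {R : realType} {m : nat}.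
Implicit Types (Omega : set (R * R)) (T : 'I_m -> set (R * R)).

Definition bscal : Type := 'I_m -> (R * R -> R).
Definition btens : Type := 'I_m -> (R * R -> 'M[R]_2).

Definition H2b T (v : bscal) : Prop := forall i, H2 (T i) (v i).
Definition HdivDivb T (Q : btens) : Prop := forall i, HdivDiv (T i) (Q i).

Definition trGgrad T (v : bscal) : btens -> R := fun dQ =>
  \sum_i ip (T i) (v i) (divDiv (T i) (dQ i)) -
  \sum_i ipM (T i) (epsgrad (T i) (v i)) (dQ i).
Definition trdDiv T (Q : btens) : bscal -> R := fun dv =>
  \sum_i ip (T i) (divDiv (T i) (Q i)) (dv i) -
  \sum_i ipM (T i) (Q i) (epsgrad (T i) (dv i)).

(* Functionals are compared only on the broken spaces they are dual to. *)
Definition eqGgrad T (uh uh' : btens -> R) : Prop :=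
  forall dQ, HdivDivb T dQ -> uh dQ = uh' dQ.
Definition eqdDiv T (mh mh' : bscal -> R) : Prop :=
  forall dv, H2b T dv -> mh dv = mh' dv.

Definition HdivDiv0 Omega T (Q : R * R -> 'M[R]_2) : Prop :=
  HdivDiv Omega Q /\
  forall dv, H2s Omega dv -> trdDiv T (fun=> Q) (fun=> dv) = 0.

Definition H2bc (a : bc) Omega (v : R * R -> R) : Prop :=
  match a with Clamped => H20 Omega v | SimplySupported => H2s Omega v end.
Definition HdivDivbc (a : bc) Omega T (Q : R * R -> 'M[R]_2) : Prop :=
  match a with
  | Clamped => HdivDiv Omega Q
  | SimplySupported => HdivDiv0 Omega T Q
  end.

Definition traceGgrad (a : bc) Omega T (uh : btens -> R) : Prop :=
  exists2 v, H2bc a Omega v & eqGgrad T (trGgrad T (fun=> v)) uh.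
Definition tracedDiv (a : bc) Omega T (mh : bscal -> R) : Prop :=
  exists2 Q, HdivDivbc a Omega T Q & eqdDiv T (trdDiv T (fun=> Q)) mh.

Definition normGgrad (d : R) Omega T (uh : btens -> R) : R :=
  inf [set norm2 d Omega v | v in
    [set v | H2 Omega v /\ eqGgrad T (trGgrad T (fun=> v)) uh]].
Definition normdDiv (d : R) Omega T (mh : bscal -> R) : R :=
  inf [set normdD d Omega Q | Q in
    [set Q | HdivDiv Omega Q /\ eqdDiv T (trdDiv T (fun=> Q)) mh]].

Definition trial : Type :=
  ((R * R -> R) * (R * R -> 'M[R]_2) *
   (('I_m -> R * R -> 'M[R]_2) -> R) * (('I_m -> R * R -> R) -> R))%type.
Definition test : Type :=
  (('I_m -> R * R -> R) * ('I_m -> R * R -> 'M[R]_2))%type.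

Definition Uspace (a : bc) Omega T : set trial :=
  [set w | let: (u, M, uh, mh) := w in
    [/\ L2 Omega u, L2s Omega M, traceGgrad a Omega T uh
      & tracedDiv a Omega T mh]].

Definition Vspace T : set test := [set v | H2b T v.1 /\ HdivDivb T v.2].

Definition Ueq Omega T (w w' : trial) : Prop :=
  let: (u, M, uh, mh) := w in
  let: (u', M', uh', mh') := w' in
  [/\ ae_eq (leb2 R) Omega u u', ae_eq (leb2 R) Omega M M',
      eqGgrad T uh uh' & eqdDiv T mh mh'].

Definition normU (d : R) Omega T (w : trial) : R :=
  let: (u, M, uh, mh) := w in
  Num.sqrt (d ^- 4 * nrm Omega u ^+ 2 + nrmM Omega M ^+ 2 +
            normGgrad d Omega T uh ^+ 2 + normdDiv d Omega T mh ^+ 2).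

Definition ipV (d : R) T (v dv : test) : R :=
  d ^- 4 * (\sum_i ip (T i) (v.1 i) (dv.1 i)) +
  \sum_i ipM (T i) (epsgrad (T i) (v.1 i)) (epsgrad (T i) (dv.1 i)) +
  \sum_i ipM (T i) (v.2 i) (dv.2 i) +
  d ^+ 4 *
    (\sum_i ip (T i) (divDiv (T i) (v.2 i)) (divDiv (T i) (dv.2 i))).

Definition b (C : {linear 'M[R]_2 -> 'M[R]_2}) T (w : trial) (v : test) : R :=
  let: (u, M, uh, mh) := w in
  \sum_i ipM (T i) M
    (fun x => epsgrad (T i) (v.1 i) x + tensor_inv C (v.2 i x)) +
  \sum_i ip (T i) u (divDiv (T i) (v.2 i)) -
  uh v.2 + mh v.1.

Definition L T (f : R * R -> R) (v : test) : R :=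
  - \sum_i ip (T i) f (v.1 i).

Definition Theta C (d : R) T (w : trial) : test :=
  get [set v | Vspace T v /\
               forall dv, Vspace T dv -> ipV d T v dv = b C T w dv].

Definition solves_VF C (a : bc) Omega T f (w : trial) : Prop :=
  Uspace a Omega T w /\ forall v, Vspace T v -> b C T w v = L T f v.

Definition solves_DPG C (d : R) T f (Uh : set trial) (wh : trial) : Prop :=
  Uh wh /\ forall v, (Theta C d T @` Uh) v -> b C T wh v = L T f v.

Definition solves_KL (C : {linear 'M[R]_2 -> 'M[R]_2}) (a : bc) Omega T f
    (u : R * R -> R) (M : R * R -> 'M[R]_2) : Prop :=
  [/\ H2 Omega u /\ HdivDiv Omega M,
      ae_eq (leb2 R) Omega (fun x => - divDiv Omega M x) f,
      ae_eq (leb2 R) Omega (fun x => M x + C (epsgrad Omega u x)) (fun=> 0)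
    & match a with
      | Clamped => H20 Omega u
      | SimplySupported => H2s Omega u /\ HdivDiv0 Omega T M
      end].

(* Elements of the trial space are identified up to [Ueq]. *)
Definition fin_dim_subspace (a : bc) Omega T (Uh : set trial) : Prop :=
  exists n (w : 'I_n -> trial), (forall i, Uspace a Omega T (w i)) /\
  forall u, Uh u <-> Uspace a Omega T u /\
    exists c : 'I_n -> R, Ueq Omega T u (\sum_i c i *: w i).

End Broken.
Arguments trial : clear implicits.
Arguments test : clear implicits.

(* Main.v *)
Require Import Defs.
From HB Require Import structures.
From mathcomp Require Import all_boot all_order all_algebra.
From mathcomp Require Import all_classical all_reals all_analysis.
From mathcomp Require Import measurable_realfun ring lra.
Set Implicit Arguments.
Unset Strict Implicit.
Unset Printing Implicit Defensive.
Import Order.TTheory GRing.Theory Num.Theory.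
Import numFieldNormedType.Exports.
Local Open Scope classical_set_scope.
Local Open Scope ring_scope.

(** The unknowns of the ultraweak formulation are the fields [(u, M)] and two
    functionals on the broken test spaces, which are traces of conforming
    functions and tensors. The traces enter through Green's formula, their
    definition; everything else rests on the Riesz theorem and on one
    regularity theorem.

    Equivalence with the plate problem. A plate solution and its traces solve
    the formulation by elementwise testing ([KL_VF]). Conversely, conforming
    test tensors remove the trace unknowns, and a pair [(u, - C^-1 M)] that
    satisfies Green's formula against all conforming tensors consists of a
    conforming function and its Hessian ([adjoint_char], [VF_KL]). Existence
    is the Riesz theorem for the bending energy, which is coercive by the
    Poincare inequality ([poincare], [energy_solve]).

    Regularity. On a bounded Lipschitz domain a square integrable function
    with square integrable second distributional derivatives belongs to H2
    ([weak_hess_H2]): near each point of the closure the domain can be pushed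
    into itself along two independent directions, along which a first
    derivative is a difference quotient up to second derivatives. Hence the
    test space is complete for its norm, which omits first derivatives
    ([dform_complete]), and the trial-to-test operator exists
    ([Theta_spec]). Lipschitz boundaries are moreover null sets, so that the
    elements exhaust the domain up to a null set ([mesh_null]).

    The scheme is the Galerkin method for the inner product
    [energy w z = b (w; Theta z)], whence its unique solvability and the best
    approximation property in the energy norm. Quasi-optimality is the
    equivalence of this norm with the trial norm. One direction is the
    continuity of [b] ([energy_bound]). For the other ([stability]), solving an
    adjoint bending problem bounds the fields by conforming test functions
    ([field_test]). Then each trace is a bounded functional, and its minimum
    norm is attained by a representative that is orthogonal to all conforming
    functions without traces. The Euler equation of this minimization says
    that the negative Hessian of the function, or a multiple of the divergence
    of the tensor, is a test function of the same norm in every element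
    ([normGgrad_bound], [normdDiv_bound]). With the scaling by the Poincare
    constant, only bounds for C and its inverse enter the constants. *)

(** * Semi-inner products and the Riesz representation theorem *)

Section SemiHilbert.
Context {R : realType} {X : lmodType R}.
Implicit Types (S : set X) (B : X -> X -> R).

(** One carrier, the functions on the plane, bears many forms that degenerate
    on functions vanishing almost everywhere; hence a predicate on a set and a
    form instead of a structure on a type. *)
Record semi_inner S B : Prop := SemiInner {
  si_0 : S 0;
  si_lin : forall a x y, S x -> S y -> S (a *: x + y);
  si_sym : forall x y, S x -> S y -> B x y = B y x;
  si_linl : forall a x y z, S x -> S y -> S z ->
    B (a *: x + y) z = a * B x z + B y z;
  si_ge0 : forall x, S x -> 0 <= B x x }.

Definition cvg_wrt B (u : nat -> X) (x : X) : Prop :=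
  forall e, 0 < e -> exists N, forall n, (N <= n)%N -> B (u n - x) (u n - x) < e.

Definition cauchy_wrt B (u : nat -> X) : Prop :=
  forall e, 0 < e -> exists N, forall m n, (N <= m)%N -> (N <= n)%N ->
    B (u m - u n) (u m - u n) < e.

Definition complete_wrt S B : Prop :=
  forall u : nat -> X, (forall n, S (u n)) -> cauchy_wrt B u ->
    exists2 x, S x & cvg_wrt B u x.

Lemma discriminant_le (a b c : R) : 0 <= c ->
  (forall t, 0 <= a + 2 * t * b + t ^+ 2 * c) -> b ^+ 2 <= a * c.
Proof.
rewrite le_eqVlt => /predU1P[<- h|c0 h].
  have [->|b0] := eqVneq b 0; first by rewrite expr0n mulr0.
  have := h (- (a + 1) / (2 * b)).
  have -> : a + 2 * (- (a + 1) / (2 * b)) * b +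
    (- (a + 1) / (2 * b)) ^+ 2 * 0 = -1 by field.
  by rewrite lerNr oppr0 ler10.
have := h (- b / c).
have -> : a + 2 * (- b / c) * b + (- b / c) ^+ 2 * c = (a * c - b ^+ 2) / c.
  by field; rewrite gt_eqF.
by rewrite pmulr_lge0 ?invr_gt0// subr_ge0.
Qed.

Section Theory.
Variables (S : set X) (B : X -> X -> R) (HB : semi_inner S B).

Lemma si_linr a x y z : S x -> S y -> S z ->
  B z (a *: x + y) = a * B z x + B z y.
Proof.
move=> Sx Sy Sz; have Sxy := si_lin HB a Sx Sy.
by rewrite (si_sym HB)// (si_linl HB)// (si_sym HB Sx)// (si_sym HB Sy).
Qed.

Lemma si_scale a x : S x -> S (a *: x).
Proof. by move=> Sx; rewrite -[_ *: _]addr0; apply: (si_lin HB) => //; apply: (si_0 HB). Qed.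

Lemma si_add x y : S x -> S y -> S (x + y).
Proof. by move=> Sx Sy; rewrite -[x]scale1r; apply: (si_lin HB). Qed.

Lemma si_sub x y : S x -> S y -> S (x - y).
Proof. by move=> Sx Sy; rewrite addrC -scaleN1r; apply: (si_lin HB). Qed.

Lemma si_scalel a x z : S x -> S z -> B (a *: x) z = a * B x z.
Proof.
move=> Sx Sz; have S0 := si_0 HB.
have := si_linl HB 1 S0 S0 Sz; rewrite scale1r addr0 => h.
by rewrite -[_ *: _]addr0 (si_linl HB)//; lra.
Qed.

Lemma si_scaler a x z : S x -> S z -> B z (a *: x) = a * B z x.
Proof.
move=> Sx Sz; rewrite (si_sym HB)// ?si_scalel// ?(si_sym HB Sx)//.
exact: si_scale.
Qed.

Lemma si_subl x y z : S x -> S y -> S z -> B (x - y) z = B x z - B y z.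
Proof. by move=> Sx Sy Sz; rewrite addrC -scaleN1r (si_linl HB)//; ring. Qed.

Lemma si_subr x y z : S x -> S y -> S z -> B z (x - y) = B z x - B z y.
Proof. by move=> Sx Sy Sz; rewrite addrC -scaleN1r si_linr//; ring. Qed.

Lemma si_quad t x y : S x -> S y ->
  B (t *: y + x) (t *: y + x) = B x x + 2 * t * B x y + t ^+ 2 * B y y.
Proof.
move=> Sx Sy; have Sxy := si_lin HB t Sy Sx.
rewrite (si_linl HB)// !si_linr// (si_sym HB Sy Sx); ring.
Qed.

Lemma cauchy_schwarz x y : S x -> S y -> B x y ^+ 2 <= B x x * B y y.
Proof.
move=> Sx Sy; apply: discriminant_le => [|t]; [exact: (si_ge0 HB)|]; rewrite -si_quad//.
exact/(si_ge0 HB)/(si_lin HB).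
Qed.

Lemma cvg_wrt_inner u x y e : (forall n, S (u n)) -> S x -> S y ->
  cvg_wrt B u x -> 0 < e -> exists N, forall n, (N <= n)%N ->
    `|B (u n) y - B x y| < e.
Proof.
move=> Su Sx Sy ux e0.
have y0 := si_ge0 HB Sy.
have p0 : 0 < B y y + 1 by lra.
have [N hN] := ux (e ^+ 2 / (B y y + 1)) (divr_gt0 (exprn_gt0 _ e0) p0).
exists N => n /hN; rewrite ltr_pdivlMr// => h.
rewrite -si_subl// -(ltr_pXn2r (n := 2)) ?nnegrE//; last exact: ltW.
rewrite real_normK ?num_real//.
apply: le_lt_trans (cauchy_schwarz (si_sub (Su n) Sx) Sy) _.
apply: le_lt_trans h.
have := si_ge0 HB (si_sub (Su n) Sx); nra.
Qed.

End Theory.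

(** A sequence minimizing [B x x - 2 l x] over [S] is Cauchy by the
    parallelogram identity, and its limit in [S'] represents [l]. With [S] the
    test functions this turns an L2 bound on a distribution into an L2
    function. *)
Lemma riesz_dense S S' B (l : X -> R) (c : R) :
  semi_inner S B -> semi_inner S' B -> S `<=` S' -> complete_wrt S' B ->
  (forall a x y, S x -> S y -> l (a *: x + y) = a * l x + l y) ->
  (forall x, S x -> l x ^+ 2 <= c * B x x) ->
  exists2 y, S' y & forall x, S x -> B y x = l x.
Proof.
move=> HB HB' sS HC ll lc.
have S0 := si_0 HB.
pose J x := B x x - 2 * l x.
wlog c0 : c lc / 0 <= c.
  move=> h; apply: (h `|c|) => // x Sx; apply: le_trans (lc _ Sx) _.
  by apply: ler_wpM2r; [exact: (si_ge0 HB)|exact: ler_norm].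
have Jlb x : S x -> - c <= J x.
  move=> Sx; rewrite /J; have := lc _ Sx; have := si_ge0 HB Sx.
  set b := B x x; set r := l x => b0 rb.
  have : (2 * r) ^+ 2 <= (b + c) ^+ 2.
    have := sqr_ge0 (b - c); rewrite !exprMn; nra.
  move=> h; have : 2 * r <= b + c; last by lra.
  apply: le_trans (ler_norm _) _.
  rewrite -(ler_pXn2r (n := 2)) ?nnegrE//; last lra.
  by rewrite real_normK ?num_real.
pose I := inf [set J x | x in S].
have hI : has_inf [set J x | x in S].
  split; first by exists (J 0), 0.
  by exists (- c) => _ [x Sx <-]; exact: Jlb.
have Ile x : S x -> I <= J x.
  by move=> Sx; apply: ge_inf; [exact: hI.2|exists x].
pose ep (n : nat) : R := n.+1%:R^-1.
have ep0 n : 0 < ep n by rewrite invr_gt0.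
have [u hu] : exists u : nat -> X, forall n, S (u n) /\ J (u n) < I + ep n.
  suff : forall n, exists x, S x /\ J x < I + ep n.
    by move=> /choice[u hu]; exists u.
  move=> n; have [_ [x Sx <-] hx] := inf_adherent (ep0 n) hI.
  by exists x.
have Su n : S (u n) by case: (hu n).
(* near-minimality against the competitors [u n + t *: y] *)
have key t y n : S y -> - ep n <= 2 * t * (B (u n) y - l y) + t ^+ 2 * B y y.
  move=> Sy; have := Ile _ (si_lin HB t Sy (Su n)).
  have := (hu n).2; rewrite /J (si_quad HB)// ll//; lra.
have key2 y n : S y -> (B (u n) y - l y) ^+ 2 <= ep n * B y y.
  move=> Sy; apply: discriminant_le => [|t]; [exact: (si_ge0 HB)|]; have := key t y n Sy; lra.
have small e : 0 < e -> exists N, forall n, (N <= n)%N -> ep n < e.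
  move=> e0; exists (Num.truncn e^-1) => n hn.
  rewrite /ep -[ltRHS]invrK ltf_pV2 ?posrE ?invr_gt0//.
  apply: lt_le_trans (truncnS_gt _) _.
  by rewrite ler_nat ltnS.
have [x Sx ux] : exists2 x, S' x & cvg_wrt B u x.
  apply: HC => [n|e e0]; first exact/sS.
  have e4 : 0 < e / 4 by lra.
  have [N hN] := small _ e4.
  exists N => m n /hN hm /hN hn.
  have Sd := si_sub HB (Su m) (Su n).
  have Sy : S (2^-1 *: (u m + u n)) by exact/(si_scale HB)/(si_add HB).
  have h := Ile _ Sy.
  have Jm := (hu m).2; have Jn := (hu n).2.
  move: h Jm Jn; rewrite /J.
  have -> : u m - u n = (-1) *: u n + u m by rewrite scaleN1r addrC.
  have -> : 2^-1 *: (u m + u n) = 2^-1 *: u n + 2^-1 *: u m.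
    by rewrite scalerDr addrC.
  have Sm2 : S (2^-1 *: u m) by exact: (si_scale HB).
  rewrite !(si_quad HB)// !ll//.
  have -> : l (2^-1 *: u m) = 2^-1 * l (u m).
    rewrite -[_ *: _]addr0 ll//; have := ll 1 0 0 S0 S0.
    by rewrite scale1r addr0; lra.
  rewrite !(si_scalel HB)// (si_scaler HB)//; lra.
exists x => // y Sy.
apply/eqP; rewrite -subr_eq0 -normr_le0; apply/ler_addgt0Pl => e e0; rewrite addr0.
have e20 : 0 < e / 2 by lra.
have [N1 h1] := cvg_wrt_inner HB' (fun n => sS _ (Su n)) Sx (sS _ Sy) ux e20.
have y0 := si_ge0 HB Sy.
have p0 : 0 < B y y + 1 by lra.
have [N2 h2] := small ((e / 2) ^+ 2 / (B y y + 1)) (divr_gt0 (exprn_gt0 _ e20) p0).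
pose n := maxn N1 N2.
have /= := h1 n (leq_maxl _ _); have := h2 n (leq_maxr _ _).
rewrite ltr_pdivlMr// => g2 g1.
have g3 : `|B (u n) y - l y| <= e / 2.
  rewrite -(ler_pXn2r (n := 2)) ?nnegrE//; last exact: ltW.
  rewrite real_normK ?num_real//.
  apply: le_trans (key2 y n Sy) _; have := ep0 n; nra.
have -> : B x y - l y = (B (u n) y - l y) - (B (u n) y - B x y) by ring.
apply: le_trans (ler_normB _ _) _; lra.
Qed.

Lemma riesz S B (HB : semi_inner S B) (l : X -> R) (c : R) : complete_wrt S B ->
  (forall a x y, S x -> S y -> l (a *: x + y) = a * l x + l y) ->
  (forall x, S x -> l x ^+ 2 <= c * B x x) ->
  exists2 y, S y & forall x, S x -> B y x = l x.
Proof. exact: (riesz_dense HB HB). Qed.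

End SemiHilbert.

(** * Square integrable functions on the plane *)

(** The plane carries two convertible measurable structures that unification
    does not identify: the product of the canonical structures of the real line
    and the product of the ones on which Lebesgue measure is defined. The
    latter is used throughout. *)
Notation T2 R := (measurableTypeR R * measurableTypeR R)%type.
Notation pmeas := (@measurable _ (T2 _)).
Notation pmfun w f := (@measurable_fun _ _ (T2 _) _ w f).

Section PlaneMeasurability.
Context {R : realType}.

Definition oorect (a1 b1 a2 b2 : R) : set (R * R) := `]a1, b1[ `*` `]a2, b2[.
Definition ccrect (a1 b1 a2 b2 : R) : set (R * R) := `[a1, b1] `*` `[a2, b2].

Lemma oorect_measurable a1 b1 a2 b2 : pmeas (oorect a1 b1 a2 b2).
Proof. by apply: measurableX; exact: measurable_itv. Qed.

Lemma ccrect_measurable a1 b1 a2 b2 : pmeas (ccrect a1 b1 a2 b2).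
Proof. by apply: measurableX; exact: measurable_itv. Qed.

Lemma open_rat_rect (w : set (R * R)) x : open w -> w x ->
  exists p1 q1 p2 q2 : rat,
    oorect (ratr p1) (ratr q1) (ratr p2) (ratr q2) x /\
    ccrect (ratr p1) (ratr q1) (ratr p2) (ratr q2) `<=` w.
Proof.
move=> ow wx; have /nbhs_ballP[e /= e0 hb] := open_nbhs_nbhs (conj ow wx).
have itv (y : R) : exists p q : rat,
    [/\ y - e < ratr p, (ratr p : R) < y, y < ratr q & ratr q < y + e].
  have [p] := @rat_in_itvoo R (y - e) y ltac:(lra).
  have [q] := @rat_in_itvoo R y (y + e) ltac:(lra).
  by rewrite !in_itv/= => /andP[? ?] /andP[? ?]; exists p, q.
have [p1 [q1 [a1 b1 c1 d1]]] := itv x.1.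
have [p2 [q2 [a2 b2 c2 d2]]] := itv x.2.
exists p1, q1, p2, q2; split; first by split; rewrite /= in_itv/=; apply/andP.
case=> y1 y2 [/=]; rewrite !in_itv/= => /andP[h1 h2] /andP[h3 h4]; apply: hb.
by split; rewrite /ball/= ltr_distlC; apply/andP; split; lra.
Qed.

Lemma open_rat_cover (w : set (R * R)) : open w ->
  w = \bigcup_(i : rat * rat * rat * rat)
    (if `[< ccrect (ratr i.1.1.1) (ratr i.1.1.2) (ratr i.1.2) (ratr i.2) `<=` w >]
     then oorect (ratr i.1.1.1) (ratr i.1.1.2) (ratr i.1.2) (ratr i.2) else set0).
Proof.
move=> ow; apply/seteqP; split=> [x wx|x [i _]].
  have [p1 [q1 [p2 [q2 [h1 h2]]]]] := open_rat_rect ow wx.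
  by exists (p1, q1, p2, q2) => //; case: asboolP.
case: asboolP => // h [h1 h2]; apply: h.
by split; exact: subset_itv_oo_cc.
Qed.

Lemma open_measurable2 (w : set (R * R)) : open w -> pmeas w.
Proof.
move=> ow; rewrite (open_rat_cover ow).
apply: countable_bigcupT_measurable => [|i]; first exact: countableP.
by case: asboolP => // _; exact: oorect_measurable.
Qed.

Lemma continuous_measurable2 (f : R * R -> R) : continuous f -> pmfun setT f.
Proof.
move=> /continuousP cf; apply: (measurability _ (RGenOpens.measurableE R)).
move=> _ [_ [a [b ->] <-]]; rewrite setTI; apply: open_measurable2.
exact/cf/interval_open.
Qed.

End PlaneMeasurability.

Section L2Theory.
Context {R : realType}.
Implicit Types (w : set (R * R)) (f g h : R * R -> R).
Local Notation mu := (leb2 R).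

Lemma linE a f g x : (a *: f + g) x = a * f x + g x.
Proof. by []. Qed.

Lemma L2P w f : L2 w f <->
  pmfun w f /\ mu.-integrable w (EFin \o (fun x => f x ^+ 2)).
Proof. by []. Qed.

Lemma L2_mul_integrable w f g : pmeas w -> L2 w f -> L2 w g ->
  mu.-integrable w (EFin \o (fun x => f x * g x)).
Proof.
move=> mw /L2P[mf f2] /L2P[mg g2].
apply: (le_integrable mw _ _ (integrableD mw f2 g2)).
  by apply/measurable_EFinP; exact: measurable_funM.
move=> x wx /=; rewrite lee_fin [leRHS]ger0_norm ?addr_ge0 ?sqr_ge0//.
have := sqr_ge0 (f x - g x); have := sqr_ge0 (f x + g x).
by rewrite ler_norml => ? ?; apply/andP; split; nra.
Qed.

Lemma L2_lin w a f g : pmeas w -> L2 w f -> L2 w g -> L2 w (a *: f + g).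
Proof.
move=> mw Lf Lg; have /L2P[mf f2] := Lf; have /L2P[mg g2] := Lg.
have m1 : pmfun w (fun x => a * f x) by exact: measurable_funM.
apply/L2P; split; first exact: measurable_funD.
have h1 := integrableZl mw (a ^+ 2) f2.
have h2 := integrableZl mw (2 * a) (L2_mul_integrable mw Lf Lg).
have := integrableD mw h1 (integrableD mw h2 g2).
apply: eq_integrable => // x _; rewrite /comp linE/= -!EFinM -!EFinD.
by congr EFin; ring.
Qed.

Lemma L2_0 w : pmeas w -> L2 w 0.
Proof.
move=> mw; apply/L2P; split; first exact: measurable_cst.
have := integrable0 mu w; apply: eq_integrable => // x _ /=.
by rewrite /GRing.zero/= expr0n.
Qed.

Lemma ip_sym w f g : ip w f g = ip w g f.
Proof. by apply: eq_Rintegral => x _; rewrite mulrC. Qed.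

Lemma ip_linl w a f g h : pmeas w -> L2 w f -> L2 w g -> L2 w h ->
  ip w (a *: f + g) h = a * ip w f h + ip w g h.
Proof.
move=> mw Lf Lg Lh.
have i1 := L2_mul_integrable mw Lf Lh; have i2 := L2_mul_integrable mw Lg Lh.
rewrite /ip -RintegralZl// -RintegralD//; last first.
  by have := integrableZl mw a i1; apply: eq_integrable.
by apply: eq_Rintegral => x _; rewrite linE; ring.
Qed.

Lemma ip_ge0 w f : 0 <= ip w f f.
Proof. by apply: Rintegral_ge0 => x _; rewrite -expr2 sqr_ge0. Qed.

Lemma L2_semi_inner w : pmeas w -> semi_inner (L2 w) (ip w).
Proof.
move=> mw; split.
- exact: L2_0.
- by move=> *; exact: L2_lin.
- by move=> *; exact: ip_sym.
- by move=> *; exact: ip_linl.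
- by move=> *; exact: ip_ge0.
Qed.

Lemma ip_ae w f f' g : pmeas w -> L2 w f -> L2 w f' -> L2 w g ->
  ae_eq mu w f f' -> ip w f g = ip w f' g.
Proof.
move=> mw Lf Lf' Lg ff'; congr fine; apply: ae_eq_integral => //.
- exact: measurable_int (L2_mul_integrable mw Lf Lg).
- exact: measurable_int (L2_mul_integrable mw Lf' Lg).
- by apply: filterS ff' => x h /h ->.
Qed.

Lemma ip_eq0_ae w f : pmeas w -> L2 w f -> ip w f f = 0 -> ae_eq mu w f 0.
Proof.
move=> mw Lf f0.
have hi := L2_mul_integrable mw Lf Lf.
pose F : R * R -> \bar R := EFin \o (fun x => f x * f x).
have I0 : (\int[mu]_(x in w) `|F x| = 0)%E.
  rewrite -[RHS](_ : (ip w f f)%:E = 0%:E); last by rewrite f0.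
  rewrite /ip /Rintegral fineK; last exact: integrable_fin_num.
  by apply: eq_integral => x _ /=; rewrite ger0_norm// -expr2 sqr_ge0.
have := (ae_eq_integral_abs mu mw (measurable_int _ hi)).1 I0.
by apply: filterS => x h /h /= [] /eqP; rewrite mulf_eq0 => /orP[]/eqP.
Qed.

Lemma L2_integral w f : pmeas w -> L2 w f ->
  (\int[mu]_(x in w) (f x ^+ 2)%:E = (ip w f f)%:E)%E.
Proof.
move=> mw /L2P[mf f2]; rewrite /ip /Rintegral.
under [in RHS]eq_integral do rewrite -expr2.
by rewrite fineK//; exact: integrable_fin_num.
Qed.

Lemma L2_subset w w' f : pmeas w -> pmeas w' -> w' `<=` w ->
  L2 w f -> L2 w' f.
Proof.
move=> mw mw' sw /L2P[mf f2]; apply/L2P; split; first exact: measurable_funS mf.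
exact: integrableS f2.
Qed.

Lemma ip_support w w' f g : pmeas w -> pmeas w' -> w' `<=` w ->
  (forall x, w x -> ~ w' x -> f x * g x = 0) -> ip w f g = ip w' f g.
Proof.
move=> mw mw' sw h; rewrite /ip Rintegral_mkcond [in RHS]Rintegral_mkcond.
apply: eq_Rintegral => x _; rewrite !patchE.
have [w'x|nw'x] := pselect (w' x); first by rewrite !mem_set//; exact: sw.
rewrite (memNset nw'x); have [wx|nwx] := pselect (w x).
  by rewrite mem_set// h.
by rewrite memNset.
Qed.

Lemma L2_bound w f g c : pmeas w -> pmfun w f -> L2 w g ->
  (forall x, w x -> `|f x| <= c * `|g x|) -> L2 w f.
Proof.
move=> mw mf Lg h; apply/L2P; split => //; have /L2P[_ g2] := Lg.
apply: (le_integrable mw _ _ (integrableZl mw (c ^+ 2) g2)).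
  by apply/measurable_EFinP; exact: measurable_funX.
move=> x wx /=; rewrite lee_fin [leLHS]ger0_norm ?sqr_ge0// [leRHS]ger0_norm; last first.
  by apply: mulr_ge0; exact: sqr_ge0.
have {}h := h x wx.
rewrite -(real_normK (num_real (f x))) -(real_normK (num_real (g x))) -exprMn.
by rewrite ler_pXn2r ?nnegrE// (le_trans (normr_ge0 _) h).
Qed.

End L2Theory.

Section L2Complete.
Context {R : realType}.
Implicit Types (w : set (R * R)) (f g h : R * R -> R).
Local Notation mu := (leb2 R).

Lemma limn_einf_le (a : (\bar R)^nat) (c : \bar R) N :
  (forall k, (N <= k)%N -> (a k <= c)%E) -> (limn_einf a <= c)%E.
Proof.
move=> h; rewrite limn_einf_lim; apply: lime_le; first exact: is_cvg_einfs.
near=> n; apply: ge_ereal_inf; exists (a (n + N)%N); last by apply: h; exact: leq_addl.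
by exists (n + N)%N => //=; exact: leq_addr.
Unshelve. all: by end_near. Qed.

(** With increments of squared norm at most [8 ^- k] the sums [4 ^+ k *
    increment ^+ 2] still have a convergent integral, which gives pointwise
    geometric convergence almost everywhere. *)
Lemma cauchy_fast_subseq (B : (R * R -> R) -> (R * R -> R) -> R) u :
  cauchy_wrt B u -> exists phi : nat -> nat,
    (forall k, (k <= phi k)%N) /\
    forall k, B (u (phi k.+1) - u (phi k)) (u (phi k.+1) - u (phi k)) < 8 ^- k.
Proof.
move=> cu.
have /choice[N hN] : forall k : nat, exists N, forall m n, (N <= m)%N -> (N <= n)%N ->
    B (u m - u n) (u m - u n) < 8 ^- k.
  by move=> k; apply: cu; rewrite invr_gt0 exprn_gt0.
exists (fun k => \sum_(j < k.+1) N j + k)%N; split=> k; first exact: leq_addl.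
have h : (N k <= \sum_(j < k.+1) N j)%N by rewrite big_ord_recr/= leq_addl.
apply: hN; last exact: leq_trans h (leq_addr _ _).
by rewrite big_ord_recr/=; apply: leq_trans h _; rewrite -addnA leq_addr.
Qed.

Lemma geometric_increments_cvg (a : R^nat) (M : R) :
  (forall k, 4 ^+ k * (a k.+1 - a k) ^+ 2 <= M ^+ 2) -> 0 <= M -> cvgn a.
Proof.
move=> h M0.
have hd k : `|telescope a k| <= geometric M (2^-1) k.
  rewrite /telescope/= -(ler_pXn2r (n := 2)) ?nnegrE// ?mulr_ge0 ?exprn_ge0 ?invr_ge0//.
  rewrite real_normK ?num_real// exprMn -exprM mulnC exprM.
  have -> : (2^-1 ^+ 2) = (4 : R)^-1 by field.
  by rewrite exprVn ler_pdivlMr ?exprn_gt0// mulrC.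
have cs : cvgn (series (telescope a)).
  apply: normed_cvg; apply: series_le_cvg hd _ => //.
    by move=> k; rewrite /geometric/= mulr_ge0// exprn_ge0.
  by apply: is_cvg_geometric_series; rewrite ger0_norm ?invf_lt1 ?ltr1n.
have -> : a = (fun n => a 0%N + series (telescope a) n).
  by apply/funext => n; exact: eq_sum_telescope.
by apply: is_cvgD => //; exact: is_cvg_cst.
Qed.

(** Riesz--Fischer: a fast subsequence converges pointwise off a null set, and
    Fatou's lemma bounds the distance of the sequence to the limit. *)
Lemma L2_complete w : pmeas w -> complete_wrt (L2 w) (@ip R w).
Proof.
move=> mw u Lu cu.
have HB := L2_semi_inner mw.
have [phi [phik hphi]] := cauchy_fast_subseq cu.
pose v k := u (phi k).
have Lv k : L2 w (v k) by exact: Lu.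
have mv k : pmfun w (v k) by have /L2P[] := Lv k.
have Ld k : L2 w (v k.+1 - v k) by exact: (si_sub HB).
pose F k (x : R * R) : \bar R := (4 ^+ k * (v k.+1 x - v k x) ^+ 2)%:E.
have mF k : pmfun w (F k).
  apply/measurable_EFinP; apply: measurable_funM => //.
  by apply: measurable_funX; exact: measurable_funB.
have F0 k x : w x -> (0 <= F k x)%E.
  by move=> _; rewrite /F lee_fin; apply: mulr_ge0; [rewrite exprn_ge0|exact: sqr_ge0].
pose S x := (\sum_(k <oo) F k x)%E.
have mS : pmfun w S by apply: ge0_emeasurable_sum => [k x ? _|//]; exact: F0.
have S0 x : w x -> (0 <= S x)%E by move=> wx; apply: nneseries_ge0 => k _ _; exact: F0.
have IF k : (\int[mu]_(x in w) F k x <= (2^-1 ^+ k)%:E)%E.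
  have -> : (\int[mu]_(x in w) F k x = (4 ^+ k * ip w (v k.+1 - v k) (v k.+1 - v k))%:E)%E.
    rewrite EFinM -L2_integral// -ge0_integralZl//;
      first [by move=> x _; rewrite lee_fin sqr_ge0|by rewrite lee_fin exprn_ge0
            |by apply/measurable_EFinP; apply: measurable_funX; exact: measurable_funB
            |idtac].
  rewrite lee_fin; have := ltW (hphi k); rewrite -/(v k) -/(v k.+1) => h.
  apply: le_trans (ler_wpM2l (exprn_ge0 _ _) h) _ => //.
  by rewrite -exprVn -exprMn; have -> : 4 / 8 = 2^-1 :> R by field.
have IS : (\int[mu]_(x in w) S x < +oo)%E.
  rewrite integral_nneseries//.
  apply: (@le_lt_trans _ _ (\sum_(0 <= k <oo) (2^-1 ^+ k)%:E)%E).
    by apply: lee_nneseries => [k _ _|k _]; [apply: integral_ge0 => x; exact: F0|exact: IF].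
  have /cvg_lim := @cvg_geometric_eseries_half R 2 0.
  rewrite /eseries/= => /(_ (@ereal_hausdorff R)).
  under eq_fun do under eq_bigr do rewrite addn1 expnS natrM invfM mulrA divff// mul1r natrX -exprVn.
  by move=> ->; rewrite ltry.
(* off [E0] the weighted increments of the subsequence are summable *)
have [E0 [mE mE0 hE]] : mu.-negligible [set x | ~ (w x -> (S x < +oo)%E)].
  have : mu.-integrable w S.
    by apply/integrableP; split => //; under eq_integral => x /set_mem wx do
      rewrite gee0_abs ?S0//.
  move=> /(integrable_ae mw); apply: filterS => x h wx.
  by have := h wx; rewrite ge0_fin_numE// S0.
pose w' := w `\` E0.
have mw' : pmeas w' by exact: measurableD.
have cv x : w' x -> cvgn (v ^~ x).
  move=> [wx nE]; have Sx : (S x < +oo)%E.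
    by have := contra_not (hE x) nE => /contrapT; exact.
  have Sf : S x \is a fin_num by rewrite ge0_fin_numE// S0.
  apply: (@geometric_increments_cvg _ (Num.sqrt (fine (S x)))); last exact: sqrtr_ge0.
  move=> k; rewrite sqr_sqrtr ?fine_ge0 ?S0// -lee_fin fineK//.
  apply: le_trans (nneseries_lim_ge k.+1 _); last by move=> n ? ?; exact: F0.
  rewrite big_nat_recr//= leeDr// sume_ge0// => n _; exact: F0.
pose f := (fun x => limn (v ^~ x)) \_ w'.
have mf : pmfun w f.
  apply/measurable_restrict => //.
  apply: (measurable_fun_cvg (h := v)) => [k|x [_ w'x]].
    by apply: measurable_funS (mv k).
  exact: cv.
have cvf x : w' x -> v ^~ x @ \oo --> f x.
  by move=> w'x; rewrite /f patchE mem_set//; exact: cv.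
have mE0' : mu E0 = 0%E by [].
have key e N n : 0 < e -> (N <= n)%N -> (forall m n, (N <= m)%N -> (N <= n)%N ->
    ip w (u m - u n) (u m - u n) < e) ->
    (\int[mu]_(x in w) ((f x - u n x) ^+ 2)%:E <= e%:E)%E.
  move=> e0 Nn hN.
  have mu_ k : pmfun w (u k) by have /L2P[] := Lu k.
  have mg k : pmfun w (fun x => ((v k x - u n x) ^+ 2)%:E).
    by apply/measurable_EFinP; apply: measurable_funX; exact: measurable_funB.
  rewrite (ge0_negligible_integral mE mw)//; first last.
    by move=> x _; rewrite lee_fin sqr_ge0.
    by apply/measurable_EFinP; apply: measurable_funX; exact: measurable_funB.
  rewrite -/w'.
  have -> : (\int[mu]_(x in w') ((f x - u n x) ^+ 2)%:E =
     \int[mu]_(x in w') limn_einf (fun k => ((v k x - u n x) ^+ 2)%:E))%E.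
    apply: eq_integral => x /set_mem w'x.
    have h : (fun k => ((v k x - u n x) ^+ 2)%:E) @ \oo --> ((f x - u n x) ^+ 2)%:E.
      apply: cvg_EFin; first exact: nearW.
      by apply: cvgM; apply: cvgB; (try exact: cvf); exact: cvg_cst.
    rewrite is_cvg_limn_einfE; first by apply/esym/cvg_lim.
    by apply/cvg_ex; exists ((f x - u n x) ^+ 2)%:E.
  apply: le_trans (fatou mu mw' _ _) _ => [k|k x _|].
  - by apply: measurable_funS (mg k) => //; exact: subDsetl.
  - by rewrite lee_fin sqr_ge0.
  apply: (@limn_einf_le _ _ N) => k Nk.
  apply: (@le_trans _ _ (\int[mu]_(x in w) ((v k x - u n x) ^+ 2)%:E)%E).
    apply: ge0_subset_integral => //; last exact: subDsetl.
    by move=> x _; rewrite lee_fin sqr_ge0.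
  have -> : (\int[mu]_(x in w) ((v k x - u n x) ^+ 2)%:E =
    (ip w (v k - u n) (v k - u n))%:E)%E.
    by rewrite -L2_integral//; exact: (si_sub HB).
  by rewrite lee_fin ltW// hN//; exact: leq_trans Nk (phik k).
have Lfu e N n : 0 < e -> (N <= n)%N -> (forall m n, (N <= m)%N -> (N <= n)%N ->
    ip w (u m - u n) (u m - u n) < e) -> L2 w (f - u n).
  move=> e0 Nn hN; have /L2P[mun _] := Lu n.
  apply/L2P; split; first exact: measurable_funB.
  apply/integrableP; split.
    by apply/measurable_EFinP; apply: measurable_funX; exact: measurable_funB.
  apply: le_lt_trans (ltry e); apply: le_trans (key _ _ _ e0 Nn hN).
  rewrite le_eqVlt; apply/orP; left; apply/eqP; apply: eq_integral => x _ /=.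
  by rewrite ger0_norm// sqr_ge0.
have Lf : L2 w f.
  have [N hN] := cu 1 ltr01.
  have -> : f = 1 *: (f - u N) + u N by rewrite scale1r subrK.
  by apply: L2_lin => //; exact: Lfu ltr01 (leqnn N) hN.
exists f => // e e0.
have e20 : 0 < e / 2 by lra.
have [N hN] := cu _ e20; exists N => n Nn.
have /(L2_integral mw) := Lfu _ _ _ e20 Nn hN.
have := key _ _ _ e20 Nn hN; move=> h1 h2.
have -> : u n - f = (-1) *: (f - u n) by rewrite scaleN1r opprB.
have Lq := Lfu _ _ _ e20 Nn hN.
rewrite (si_scalel HB)// ?(si_scaler HB)//; last exact: (si_scale HB).
rewrite mulN1r mulN1r opprK -lte_fin -h2.
by apply: le_lt_trans h1 _; rewrite lte_fin; lra.
Qed.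

End L2Complete.

(** * Smooth functions and test functions *)

Section FlatFunctions.
Context {R : realType}.
Implicit Types (p : {poly R}).

(** For [p = 1] this is the classical smooth function that is flat at the
    origin; the polynomial factor makes the family closed under derivation. *)
Definition flat p (y : R) : R :=
  if 0 < y then p.[y^-1] * expR (- y^-1) else 0.

Lemma poly_expR_bound p :
  exists2 M, 0 <= M & forall t, 0 <= t -> `|p.[t]| * expR (- t) <= M.
Proof.
exists (\sum_(i < size p) `|p`_i| * i`!%:R); first by rewrite sumr_ge0.
move=> t t0; rewrite expRN ler_pdivrMr ?expR_gt0// mulr_suml horner_coef.
apply: le_trans (ler_norm_sum _ _ _) _; apply: ler_sum => i _.
rewrite normrM -mulrA ler_wpM2l// normrX (ger0_norm t0).
case: (nat_of_ord i) => [|n].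
  by rewrite expr0 fact0 mul1r; apply: le_trans (expR_ge1Dx t); rewrite lerDl.
have := expR_ge1Dxn n t0.
have f0 : (0 : R) < n.+1`!%:R by rewrite ltr0n fact_gt0.
move=> h; rewrite mulrC -ler_pdivrMr//; lra.
Qed.

Lemma flat_sq_bound p : exists2 M, 0 <= M & forall y, `|flat p y| <= M * y ^+ 2.
Proof.
have [M M0 hM] := poly_expR_bound ('X^2 * p).
exists M => // y; rewrite /flat; case: ifPn => y0; last first.
  by rewrite normr0 mulr_ge0 ?sqr_ge0.
have yi0 : 0 <= y^-1 by rewrite invr_ge0 ltW.
have h := hM _ yi0; rewrite !hornerE !normrM (ger0_norm yi0) in h.
have y20 : 0 < y ^+ 2 by rewrite exprn_gt0.
rewrite normrM (ger0_norm (expR_ge0 _)).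
have -> : `|p.[y^-1]| * expR (- y^-1) = y^-1 * y^-1 * `|p.[y^-1]| * expR (- y^-1) * y ^+ 2.
  by field; rewrite gt_eqF.
exact: (ler_wpM2r (ltW y20) h).
Qed.

Lemma is_derive0_sq (f : R -> R) M : (forall y, `|f y| <= M * y ^+ 2) ->
  is_derive (0 : R) 1 f 0.
Proof.
move=> h.
have f0 : f 0 = 0.
  by apply/eqP; rewrite -normr_le0; have := h 0; rewrite expr0n mulr0.
have cv : (fun t : R => t^-1 *: ((f \o shift 0) (t *: 1) - f 0)) @ 0^' --> (0 : R).
  apply/cvgr0Pnorm_lt => e e0; near=> t.
  have t0 : t != 0 by near: t; exact: nbhs_dnbhs_neq.
  rewrite /= f0 addr0 subr0 /GRing.scale/= mulr1 normrM normfV.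
  have : `|t| < e / (`|M| + 1).
    by near: t; apply: dnbhs0_lt; rewrite divr_gt0// ltr_wpDl.
  have M1 : 0 < `|M| + 1 by rewrite ltr_wpDl.
  have tp : 0 < `|t| by rewrite normr_gt0.
  rewrite ltr_pdivlMr// => te; rewrite mulrC ltr_pdivrMr//.
  apply: le_lt_trans (h t) _; rewrite -real_normK ?num_real//.
  have := ler_norm M; nra.
apply: DeriveDef; first by apply/cvg_ex; exists 0.
exact/cvg_lim.
Unshelve. all: by end_near. Qed.

Lemma is_derive_flat p (y : R) :
  is_derive y 1 (flat p) (flat ('X^2 * (p - p^`())) y).
Proof.
have [y0|y0|<-] := ltgtP 0 y.
- have yn0 : y != 0 by rewrite gt_eqF.
  have dV : is_derive y 1 (fun t : R => t^-1) (- y ^- 2 *: 1) by exact: is_deriveV.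
  have dp : is_derive y 1 (fun t : R => p.[t^-1]) (p^`().[y^-1] * (- y ^- 2 *: 1)).
    exact: (@is_derive1_comp _ (horner p) (fun t : R => t^-1) y _ _ (is_derive_poly p y^-1) dV).
  have dN : is_derive y 1 (fun t : R => - t^-1) (- (- y ^- 2 *: 1)) by exact: is_deriveN.
  have de : is_derive y 1 (fun t : R => expR (- t^-1)) (expR (- y^-1) * (- (- y ^- 2 *: 1))).
    exact: (@is_derive1_comp _ expR (fun t => - t^-1)).
  have D : is_derive y 1 (fun t : R => p.[t^-1] * expR (- t^-1)) (flat ('X^2 * (p - p^`())) y).
    apply: (is_derive_eq (is_deriveM dp de)).
    rewrite /flat y0 !hornerE /GRing.scale/= exprVn; ring.
  apply: near_eq_is_derive D.
  near=> t; rewrite /flat ifT//; near: t; exact: lt_nbhsr.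
- have D : is_derive y 1 (cst 0 : R -> R) (flat ('X^2 * (p - p^`())) y).
    by rewrite /flat ltNge ltW//=; exact: is_derive_cst.
  apply: near_eq_is_derive D.
  near=> t; rewrite /flat ifF//; apply/negbTE; rewrite -leNgt ltW//.
  near: t; exact: lt_nbhsl.
- have [M _ hM] := flat_sq_bound p.
  by rewrite {2}/flat ltxx; exact: is_derive0_sq hM.
Unshelve. all: by end_near. Qed.

Lemma flat1_gt0 y : 0 < y -> 0 < flat 1 y.
Proof. by move=> y0; rewrite /flat y0 hornerC mul1r expR_gt0. Qed.

Lemma flat_le0 p y : y <= 0 -> flat p y = 0.
Proof. by move=> y0; rewrite /flat ltNge y0. Qed.

Lemma flat1_ge0 y : 0 <= flat 1 y.
Proof. by rewrite /flat; case: ifP => // _; rewrite hornerC mul1r expR_ge0. Qed.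

Lemma flat1_le1 y : flat 1 y <= 1.
Proof.
rewrite /flat; case: ifPn => // y0.
by rewrite hornerC mul1r -expR0 ler_expR oppr_le0 invr_ge0 ltW.
Qed.

Lemma flat1_cvg (y : R) : 0 < y -> (fun n : nat => flat 1 (n.+1%:R * y)) @ \oo --> (1 : R).
Proof.
move=> y0; have -> : (fun n : nat => flat 1 (n.+1%:R * y)) = (fun n => expR (- (harmonic n * y^-1))).
  apply/funext => n; rewrite /flat ifT ?hornerC ?mul1r ?invfM//.
  by rewrite mulr_gt0// ltr0n.
rewrite -[X in _ --> X](@expR0 R); apply: continuous_cvg; first exact: continuous_expR.
rewrite -oppr0; apply: cvgN; rewrite -(mul0r y^-1); apply: cvgMl.
exact: cvg_harmonic.
Qed.

End FlatFunctions.

Section Smooth.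
Context {R : realType}.
Implicit Types (F G : R * R -> R) (x : R * R) (i j : 'I_2).

Definition crd i x : R := if i == ord0 then x.1 else x.2.
Definition upd i x (t : R) : R * R := if i == ord0 then (t, x.2) else (x.1, t).

Lemma upd_crd i x : upd i x (crd i x) = x.
Proof. by rewrite /upd /crd; case: x => a b; case: (i == ord0). Qed.

Lemma upd_shift i x (h : R) : h *: ebase i + x = upd i x (h + crd i x).
Proof.
rewrite /upd /crd /ebase [LHS]surjective_pairing; case: ifP => _ /=;
by congr pair; rewrite /GRing.scale/= ?mulr1 ?mulr0 ?add0r.
Qed.

Lemma growth_slice i F x :
  (fun h : R => h^-1 *: ((F \o shift x) (h *: ebase i) - F x)) =
  (fun h : R => h^-1 *: (((F \o upd i x) \o shift (crd i x)) (h *: 1) - (F \o upd i x) (crd i x))).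
Proof.
apply/funext => h /=; rewrite upd_shift upd_crd.
by rewrite /GRing.scale/= mulr1.
Qed.

Lemma is_derive_slice i F x df :
  is_derive (crd i x) 1 (F \o upd i x) df <-> is_derive x (ebase i) F df.
Proof.
by split=> -[d <-]; apply: DeriveDef;
  move: d; rewrite /derivable /derive growth_slice.
Qed.

Lemma derivable_slice i F x :
  derivable (F \o upd i x) (crd i x) 1 <-> derivable F x (ebase i).
Proof. by rewrite /derivable growth_slice. Qed.

Lemma partial_slice i F x : partial i F x = 'D_1 (F \o upd i x) (crd i x).
Proof. by rewrite /partial /derive growth_slice. Qed.

Definition derivable2 F := forall i x, derivable F x (ebase i).

Lemma is_derive_partial F i x : derivable2 F -> is_derive x (ebase i) F (partial i F x).
Proof. by move=> dF; apply: DeriveDef => //; exact: dF. Qed.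

(** Coinduction for smoothness: it suffices to exhibit a set of functions
    closed under partial derivatives. *)
Lemma smooth_stable (S : set (R * R -> R)) :
  (forall F, S F -> [/\ continuous F, derivable2 F & forall i, S (partial i F)]) ->
  forall F, S F -> smooth F.
Proof.
move=> hS F SF s; suff /hS[? ? _] : S (foldr partial F s) by [].
by elim: s => //= i s /hS[].
Qed.

Lemma smoothP F : smooth F <->
  [/\ continuous F, derivable2 F & forall i, smooth (partial i F)].
Proof.
split=> [sF|[cF dF sF] s].
  split=> [||i s]; [exact: (sF [::]).1|exact: (sF [::]).2|].
  by have := sF (rcons s i); rewrite foldr_rcons.
elim/last_ind: s => [|s i _]; first by split.
by rewrite foldr_rcons; exact: sF.
Qed.

Lemma smooth_cont F : smooth F -> continuous F. Proof. by case/smoothP. Qed.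
Lemma smooth_der F : smooth F -> derivable2 F. Proof. by case/smoothP. Qed.
Lemma smooth_partial F i : smooth F -> smooth (partial i F).
Proof. by case/smoothP. Qed.

Lemma partial_lin i a F G : derivable2 F -> derivable2 G ->
  partial i (a *: F + G) = a *: partial i F + partial i G.
Proof.
move=> dF dG; apply/funext => x; rewrite /partial deriveD//; last exact: derivableZ.
by rewrite deriveZ.
Qed.

Lemma derivable2_lin a F G : derivable2 F -> derivable2 G -> derivable2 (a *: F + G).
Proof. by move=> dF dG i x; apply: derivableD => //; exact: derivableZ. Qed.

Lemma continuous_lin a F G : continuous F -> continuous G -> continuous (a *: F + G).
Proof.
move=> cF cG x; apply: cvgD; last exact: cG.
by apply: cvgZr; exact: cF.
Qed.

Lemma smooth_lin a F G : smooth F -> smooth G -> smooth (a *: F + G).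
Proof.
move=> sF sG.
apply: (@smooth_stable [set H | exists F G, [/\ smooth F, smooth G & H = a *: F + G]]).
  move=> _ [F' [G' [/smoothP[cF dF pF] /smoothP[cG dG pG] ->]]]; split=> [||i].
  - exact: continuous_lin.
  - exact: derivable2_lin.
  - exists (partial i F'), (partial i G'); split; [exact: pF|exact: pG|exact: partial_lin].
by exists F, G.
Qed.

Lemma smooth_cst a : smooth (cst a : R * R -> R).
Proof.
apply: (@smooth_stable [set H | exists a, H = cst a]); last by exists a.
move=> _ [b ->]; split=> [|i x|i]; [exact: cst_continuous|exact: derivable_cst|].
by exists 0; apply/funext => x; rewrite /partial derive_cst.
Qed.

Lemma smooth_add F G : smooth F -> smooth G -> smooth (F + G).
Proof. by move=> sF sG; rewrite -[F]scale1r; exact: smooth_lin. Qed.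

Lemma partialM i F G x : derivable2 F -> derivable2 G ->
  partial i (fun x => F x * G x) x = F x * partial i G x + G x * partial i F x.
Proof. by move=> dF dG; rewrite /partial deriveM. Qed.

Lemma derivable2M F G : derivable2 F -> derivable2 G -> derivable2 (fun x => F x * G x).
Proof. by move=> dF dG i x; exact: derivableM. Qed.

Lemma continuousM2 F G : continuous F -> continuous G -> continuous (fun x => F x * G x).
Proof. by move=> cF cG x; apply: cvgM; [exact: cF|exact: cG]. Qed.

Inductive prodspan : (R * R -> R) -> Prop :=
| ProdSpan F G of smooth F & smooth G : prodspan (fun x => F x * G x)
| ProdSpanAdd F G of prodspan F & prodspan G : prodspan (F + G).

(** Derivatives of products are sums of products, so products are shown smooth
    by closing them under sums. *)
Lemma prodspan_stable H : prodspan H ->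
  [/\ continuous H, derivable2 H & forall i, prodspan (partial i H)].
Proof.
elim=> {H} [F G sF sG|F G _ [cF dF pF] _ [cG dG pG]].
  have [cF dF pF] := (smoothP F).1 sF; have [cG dG pG] := (smoothP G).1 sG.
  split=> [||i]; [exact: continuousM2|exact: derivable2M|].
  have -> : partial i (fun x => F x * G x) =
      (fun x => F x * partial i G x) + (fun x => G x * partial i F x).
    by apply/funext => x; rewrite partialM.
  exact: (ProdSpanAdd (ProdSpan sF (pG i)) (ProdSpan sG (pF i))).
split=> [x|i x|i].
- by apply: cvgD; [exact: cF|exact: cG].
- by apply: derivableD; [exact: dF|exact: dG].
- have -> : partial i (F + G) = partial i F + partial i G.
    by apply/funext => x; rewrite /partial deriveD//.
  exact: ProdSpanAdd.
Qed.

Lemma smoothM F G : smooth F -> smooth G -> smooth (fun x => F x * G x).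
Proof.
by move=> sF sG; apply: (smooth_stable prodspan_stable); exact: ProdSpan.
Qed.

Lemma crd_continuous i : continuous (crd i : R * R -> R).
Proof. by rewrite /crd; case: (i == ord0) => x; [exact: cvg_fst|exact: cvg_snd]. Qed.

Lemma crd_upd i j x t : crd j (upd i x t) = if j == i then t else crd j x.
Proof.
rewrite /crd /upd; case: i => -[|[|//]] hi; case: j => -[|[|//]] hj //=.
Qed.

Lemma is_derive_comp_crd (f : R -> R) i j x (a b df : R) :
  is_derive (a * crd i x + b) 1 f df ->
  is_derive x (ebase j) (fun x => f (a * crd i x + b)) (if i == j then df * a else 0).
Proof.
move=> hf; apply/is_derive_slice.
have -> : (fun x => f (a * crd i x + b)) \o upd j x =
    (fun t => f (a * (if i == j then t else crd i x) + b)).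
  by apply/funext => t /=; rewrite crd_upd.
case: eqP => [ij|_]; last exact: is_derive_cst.
subst j; have hl : is_derive (crd i x) 1 (fun t : R => a * t + b) a.
  have h1 : is_derive (crd i x) 1 (fun t : R => a * t) (a * 1) by exact: is_deriveZ.
  have h2 : is_derive (crd i x) 1 (cst b : R -> R) 0 by exact: is_derive_cst.
  by have := is_deriveD h1 h2; rewrite mulr1 addr0; exact.
exact: (@is_derive1_comp _ f (fun t => a * t + b)).
Qed.

Lemma smooth_flat (p : {poly R}) (a b : R) i : smooth (fun x => flat p (a * crd i x + b)).
Proof.
apply: (@smooth_stable [set F | exists p, F = fun x => flat p (a * crd i x + b)]); last by exists p.
move=> _ [{}p ->].
have H j x := @is_derive_comp_crd _ i j x a b _ (is_derive_flat p (a * crd i x + b)).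
split=> [x|j x|j].
- have cf : {for a * crd i x + b, continuous (flat p)}.
    by apply/differentiable_continuous/derivable1_diffP; case: (is_derive_flat p (a * crd i x + b)).
  apply: (@continuous_comp _ _ _ (fun x => a * crd i x + b) (flat p)) => //.
  apply: cvgD; last exact: cvg_cst.
  by apply: cvgMr; exact: crd_continuous.
- by case: (H j x).
- exists (if i == j then a%:P * ('X^2 * (p - p^`())) else 0).
  apply/funext => x; rewrite /partial; case: (H j x) => _ ->.
  case: ifP => _; last by rewrite /flat; case: ifP => //; rewrite horner0 mul0r.
  by rewrite /flat; case: ifP => _; rewrite ?mul0r// [in RHS]hornerM hornerC; ring.
Qed.

(** Derivatives of [F * G^-1 ^+ n] are again of this form. *)
Lemma smooth_inv G : smooth G -> (forall x, G x != 0) -> smooth (fun x => (G x)^-1).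
Proof.
move=> sG G0.
apply: (@smooth_stable [set H | exists F n, smooth F /\ H = fun x => F x * (G x)^-1 ^+ n]); last first.
  by exists (cst 1), 1%N; split; [exact: smooth_cst|apply/funext => x; rewrite mul1r].
have [cG dG pG] := (smoothP G).1 sG.
move=> _ [F [n [sF ->]]]; have [cF dF pF] := (smoothP F).1 sF.
have hd i x : is_derive x (ebase i) (fun x => F x * (G x)^-1 ^+ n)
   ((partial i F x * G x + - n%:R * (F x * partial i G x)) * (G x)^-1 ^+ n.+1).
  have h1 := is_derive_partial i x dF.
  have h2 := is_derive_partial i x dG.
  have hV : is_derive x (ebase i) (fun x => (G x)^-1) (- (G x) ^- 2 *: partial i G x).
    constructor; first by apply: derivableV => //; exact: dG.
    by rewrite deriveV//; exact: dG.
  have hX : is_derive x (ebase i) (fun x => (G x)^-1 ^+ n)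
     (n%:R * (G x)^-1 ^+ n.-1 * (- (G x) ^- 2 *: partial i G x)).
    have -> : (fun x => (G x)^-1 ^+ n) = (fun x => (G x)^-1) ^+ n.
      by apply/funext => y; rewrite exprfctE.
    exact: is_deriveX.
  apply: (is_derive_eq (is_deriveM h1 hX)).
  rewrite /GRing.scale/= -exprVn; case: n hX => [|n] _ /=.
    by rewrite !expr0 expr1; field; exact: G0.
  by rewrite !exprSr; field; exact: G0.
split=> [x|i x|i].
- apply: cvgM; first exact: cF.
  have cV : {for x, continuous (fun x => (G x)^-1)}.
    by apply: cvgV; [exact: G0|exact: cG].
  have cX : {for (G x)^-1, continuous (fun t : R => t ^+ n)} by exact: exprn_continuous.
  exact: (continuous_comp cV cX).
- by case: (hd i x).
- exists (fun x => partial i F x * G x + - n%:R * (F x * partial i G x)), n.+1; split.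
    have -> : (fun x => partial i F x * G x + - n%:R * (F x * partial i G x)) =
      (- n%:R) *: (fun x => F x * partial i G x) + (fun x => partial i F x * G x).
      by apply/funext => x; rewrite linE addrC.
    exact: (smooth_lin _ (smoothM sF (pG i)) (smoothM (pF i) sG)).
  by apply/funext => x; rewrite {1}/partial; case: (hd i x).
Qed.

End Smooth.

Section CompactSupport.
Context {R : realType}.
Implicit Types (F G phi psi : R * R -> R) (x : R * R) (i j : 'I_2) (w : set (R * R)).
Local Notation mu := (leb2 R).

Definition off_box (r : R) F := forall x, r < `|x.1| \/ r < `|x.2| -> F x = 0.

Definition box (r : R) : set (R * R) := `[- r, r] `*` `[- r, r].

Lemma box_compact r : compact (box r).
Proof. by apply: compact_setX; exact: segment_compact. Qed.

Lemma box_measurable r : pmeas (box r).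
Proof. by apply: measurableX; exact: measurable_itv. Qed.

Lemma boxNP r x : ~ box r x -> r < `|x.1| \/ r < `|x.2|.
Proof.
move=> h; apply: contrapT => /not_orP[/negP + /negP]; rewrite -!leNgt !ler_norml => h1 h2.
by apply: h; split; rewrite /= in_itv.
Qed.

Lemma off_box_eq r F : off_box r F -> F \_ (box r) = F.
Proof.
move=> h; apply/funext => x; rewrite patchE; case: ifPn => // /negP nx.
by rewrite h//; apply: boxNP => bx; apply: nx; rewrite inE.
Qed.

Lemma continuous_compact_bound F (A : set (R * R)) : continuous F -> compact A ->
  exists2 M, 0 < M & forall x, A x -> `|F x| <= M.
Proof.
move=> cF cA.
have /compact_bounded[M [_ hM]] : compact (F @` A).
  by apply: continuous_compact => //; exact: continuous_subspaceT.
exists (`|M| + 1); first by rewrite ltr_wpDl.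
by move=> x Ax; apply: (hM (`|M| + 1)); [rewrite (le_lt_trans (ler_norm M))// ltrDl|exists x].
Qed.

Lemma integrable_box r F : continuous F -> off_box r F ->
  mu.-integrable setT (EFin \o F).
Proof.
move=> cF oF; rewrite -(off_box_eq oF) -restrict_EFin.
have mb := box_measurable r.
apply/integrable_restrict => //; rewrite setTI.
apply: measurable_bounded_integrable => //.
- rewrite [X in (X < _)%E](product_measure1E (@lebesgue_measure R) (@lebesgue_measure R))//.
  by rewrite lte_mul_pinfty//= lebesgue_measure_itv/=; case: ifP => // _;
    rewrite -EFinB ltry.
- by apply: measurable_funTS; exact: continuous_measurable2.
- have [M M0 hM] := continuous_compact_bound cF (@box_compact r).
  exists M; split; first exact: num_real.
  by move=> N MN x bx; apply: le_trans (hM x bx) (ltW MN).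
Qed.

Lemma L2_off_box w r F : pmeas w -> continuous F -> off_box r F -> L2 w F.
Proof.
move=> mw cF oF; apply/L2P; split.
  by apply: measurable_funTS; exact: continuous_measurable2.
apply: (@integrableS _ _ _ _ setT) => //.
apply: (@integrable_box r (fun x => F x ^+ 2)).
  by move=> x; apply: cvgM; exact: cF.
by move=> x /oF ->; rewrite expr0n.
Qed.

Lemma integral_derive_line (f : R -> R) (r : R) : (forall t : R, derivable f t 1) ->
  continuous (fun t : R => 'D_1 f t) -> (forall t : R, r < `|t| -> f t = 0) ->
  (\int[lebesgue_measure]_t ('D_1 f t)%:E = 0)%E.
Proof.
move=> df cdf f0.
pose s := `|r| + 1.
have rs : r < s by rewrite /s (le_lt_trans (ler_norm r))// ltrDl.
have s0 : 0 < s by rewrite /s ltr_wpDl.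
have df0 (x : R) : s <= `|x| -> 'D_1 f x = 0.
  move=> sx; have <- : 'D_1 (cst 0 : R -> R) x = 0 by rewrite derive_cst.
  apply: near_eq_derive.
  have : `|x| > r by exact: lt_le_trans sx.
  move=> h; near=> y; apply: f0; near: y.
  have cn : {for x, continuous (fun y : R => `|y|)} by exact: norm_continuous.
  exact: (cn _ (lt_nbhsr h)).
have -> : (\int[lebesgue_measure]_x ('D_1 f x)%:E =
   \int[lebesgue_measure]_(x in `[(- s)%R, s]) ('D_1 f x)%:E)%E.
  rewrite [RHS]integral_mkcond; apply: eq_integral => x _.
  rewrite patchE; case: ifPn => //; rewrite notin_setE /= in_itv/= -ler_norml => /negP.
  by rewrite -ltNge => /ltW /df0 ->.
rewrite (@continuous_FTC2 _ _ f)//.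
- rewrite !f0 ?subee//.
  + by rewrite normrN ger0_norm// ltW.
  + by rewrite ger0_norm// ltW.
- by rewrite gtrN.
- exact: continuous_subspaceT.
- have cf (x : R) : {for x, continuous f}.
    by apply/differentiable_continuous/derivable1_diffP.
  split=> //.
  + by apply: cvg_at_right_filter; exact: cf.
  + by apply: cvg_at_left_filter; exact: cf.
- by move=> x _; rewrite derive1E.
Unshelve. all: by end_near. Qed.

Lemma upd_continuous i x : continuous (upd i x).
Proof.
rewrite /upd; case: (i == ord0) => t; apply/cvg_ballP => e e0; near=> u;
  (have tu : ball t e u by near: u; apply/nbhs_ballP; exists e);
  split => //=; exact: ballxx.
Unshelve. all: by end_near.
Qed.

(** Fubini reduces this to the fundamental theorem of calculus on lines. *)
Lemma integral_partial0 i r F : derivable2 F -> continuous (partial i F) ->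
  off_box r F -> off_box r (partial i F) ->
  \int[mu]_x partial i F x = 0.
Proof.
move=> dF cpF oF opF.
have iF := integrable_box cpF opF.
have slice x : (\int[lebesgue_measure]_t (partial i F (upd i x t))%:E = 0)%E.
  have E t : partial i F (upd i x t) = 'D_1 (F \o upd i x) t.
    rewrite partial_slice; have -> : crd i (upd i x t) = t by rewrite crd_upd eqxx.
    congr ('D_1 _ t); apply/funext => u /=; congr F.
    by rewrite /upd; case: (i == ord0).
  under eq_integral do rewrite E.
  apply: (@integral_derive_line _ r).
  - move=> t; have := (derivable_slice i F (upd i x t)).2 (dF i _).
    have -> : crd i (upd i x t) = t by rewrite crd_upd eqxx.
    congr (derivable _ t 1); apply/funext => u /=; congr F.
    by rewrite /upd; case: (i == ord0).
  - have -> : (fun t => 'D_1 (F \o upd i x) t) = partial i F \o upd i x.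
      by apply/funext => t /=.
    by move=> t; apply: continuous_comp; [exact: upd_continuous|exact: cpF].
  - by move=> t rt /=; apply: oF; rewrite /upd; case: (i == ord0) => /=; [left|right].
rewrite /Rintegral.
have [i0|i0] := boolP (i == ord0).
  rewrite -integral21_prod_meas1// /fubini_G.
  rewrite (eq_integral (cst 0%E)) ?integral0//= => y _.
  by have := slice (0, y); rewrite /upd i0.
rewrite -integral12_prod_meas1// /fubini_F.
rewrite (eq_integral (cst 0%E)) ?integral0//= => y _.
by have := slice (y, 0); rewrite /upd (negbTE i0).
Qed.

Lemma partial_off_supp i F x : ~ closure [set x | F x != 0] x -> partial i F x = 0.
Proof.
move=> nx; have <- : 'D_(ebase i) (cst 0 : R * R -> R) x = 0 by rewrite derive_cst.
apply: near_eq_derive.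
have : nbhs x (~` closure [set x | F x != 0]).
  by apply: open_nbhs_nbhs; split => //; apply: closed_openC; exact: closed_closure.
apply: filterS => y ny; apply: contrapT => /eqP Fy; apply: ny.
exact: subset_closure.
Qed.

Lemma test_fun_smooth w phi : test_fun w phi -> smooth phi.
Proof. by case. Qed.

Lemma test_fun_sub w phi F : test_fun w phi -> smooth F ->
  (forall x, ~ closure [set x | phi x != 0] x -> F x = 0) -> test_fun w F.
Proof.
move=> [sphi cphi hphi] sF h.
have hs : closure [set x | F x != 0] `<=` closure [set x | phi x != 0].
  rewrite [X in _ `<=` X](closure_id _).1; last exact: closed_closure.
  by apply: closureS => x /eqP hx; apply: contrapT => /h.
split => //; last exact: subset_trans hphi.
by apply: (subclosed_compact _ cphi hs); exact: closed_closure.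
Qed.

Lemma test_fun_partial w i phi : test_fun w phi -> test_fun w (partial i phi).
Proof.
move=> tphi; apply: (test_fun_sub tphi); first exact/smooth_partial/(test_fun_smooth tphi).
exact: partial_off_supp.
Qed.

Lemma test_funM w phi F : test_fun w phi -> smooth F -> test_fun w (fun x => phi x * F x).
Proof.
move=> tphi sF; apply: (test_fun_sub tphi); first exact: (smoothM (test_fun_smooth tphi) sF).
move=> x nx; suff -> : phi x = 0 by rewrite mul0r.
by apply: contrapT => /eqP h; apply: nx; exact: subset_closure.
Qed.

Lemma test_fun_lin w a phi psi : test_fun w phi -> test_fun w psi ->
  test_fun w (a *: phi + psi).
Proof.
move=> [sp cp hp] [sq cq hq].
have hs : closure [set x | (a *: phi + psi) x != 0] `<=`
    closure [set x | phi x != 0] `|` closure [set x | psi x != 0].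
  rewrite -closureU; apply: closureS => x /=; rewrite linE => h.
  have [p0|p0] := eqVneq (phi x) 0; last by left.
  by right; move: h; rewrite p0 mulr0 add0r.
split; first exact: smooth_lin.
- apply: (subclosed_compact (@closed_closure _ _) _ hs).
  exact: (compactU cp cq).
- by move=> x /hs[/hp|/hq].
Qed.

Lemma test_fun0 w : test_fun w (0 : R * R -> R).
Proof.
have E : [set x : R * R | (0 : R * R -> R) x != 0] = set0.
  by apply/seteqP; split => x //=; rewrite eqxx.
split; [exact: (smooth_cst 0)|rewrite E closure0; exact: compact0|].
by rewrite E closure0.
Qed.

Lemma test_fun_subset w w' phi : w `<=` w' -> test_fun w phi -> test_fun w' phi.
Proof. by move=> ww' [? ? h]; split => //; exact: subset_trans ww'. Qed.

Lemma test_fun_off w phi x : test_fun w phi -> ~ w x -> phi x = 0.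
Proof.
move=> [_ _ h] nx; apply: contrapT => /eqP px; apply: nx; apply: h.
exact: subset_closure.
Qed.

Lemma test_fun_box w phi : test_fun w phi -> exists2 r, 0 < r & off_box r phi.
Proof.
move=> [_ /compact_bounded[M [_ hM]] _].
exists (`|M| + 1); first by rewrite ltr_wpDl.
have /hM hb : M < `|M| + 1 by rewrite (le_lt_trans (ler_norm M))// ltrDl.
move=> x hx; apply: contrapT => /eqP px.
have := hb x (@subset_closure _ [set y | phi y != 0] x px); rewrite /= prod_normE/= ge_max => /andP[h1 h2].
by case: hx; rewrite ltNge ?h1 ?h2.
Qed.

Lemma off_box_partial r i F : off_box r F -> off_box r (partial i F).
Proof.
move=> oF x hx; apply: partial_off_supp => cx.
have : closure (box r) x.
  apply: closureS cx => y /eqP Fy; apply: contrapT => /boxNP /oF; exact: Fy.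
rewrite -(closure_id _).1; last by apply: compact_closed; [exact: norm_hausdorff|exact: box_compact].
move=> []; rewrite /= !in_itv/= -!ler_norml => h1 h2.
by case: hx; rewrite ltNge ?h1 ?h2.
Qed.

Lemma test_fun_L2 w w' phi : pmeas w -> test_fun w' phi -> L2 w phi.
Proof.
move=> mw tphi; have [r _ or] := test_fun_box tphi.
exact: L2_off_box (smooth_cont (test_fun_smooth tphi)) or.
Qed.

Lemma ip_test w w' f phi : pmeas w -> pmeas w' -> w' `<=` w -> test_fun w' phi ->
  ip w f phi = ip w' f phi.
Proof.
move=> mw mw' sw tphi; apply: ip_support => // x _ nx.
by rewrite (test_fun_off tphi nx) mulr0.
Qed.

(** The integral of the derivative of the product [phi * psi] vanishes. *)
Lemma ip_partial_smooth w i phi psi : pmeas w -> test_fun w phi -> smooth psi ->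
  ip w psi (partial i phi) = - ip w (partial i psi) phi.
Proof.
move=> mw tphi spsi; have sphi := test_fun_smooth tphi.
have [r _ or] := test_fun_box tphi.
have mT : pmeas (setT : set (R * R)) by exact: measurableT.
have tT := test_fun_subset (@subsetT _ w) tphi.
rewrite -(ip_test _ mT mw (@subsetT _ w) (test_fun_partial i tphi)).
rewrite -(ip_test _ mT mw (@subsetT _ w) tphi).
have [[cF dF pF] [cG dG pG]] := ((smoothP psi).1 spsi, (smoothP phi).1 sphi).
pose H x := psi x * phi x.
have oH : off_box r H by move=> x hx; rewrite /H or// mulr0.
have sH : smooth H by exact: smoothM.
have [cH dH pH] := (smoothP H).1 sH.
have := @integral_partial0 i r H dH (smooth_cont (pH i)) oH (@off_box_partial r i H oH).
have -> : partial i H = fun x => psi x * partial i phi x + phi x * partial i psi x.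
  by apply/funext => x; exact: partialM.
have ib F G : continuous F -> continuous G -> off_box r G ->
    mu.-integrable setT (EFin \o (fun x => F x * G x)).
  move=> cF' cG' oG'; apply: (@integrable_box r (fun x => F x * G x)).
    exact: continuousM2.
  by move=> x /oG' ->; rewrite mulr0.
rewrite RintegralD//; first last.
- have -> : (fun x => phi x * partial i psi x) = (fun x => partial i psi x * phi x).
    by apply/funext => x; rewrite mulrC.
  exact: (ib _ _ (smooth_cont (pF i)) cG or).
- exact: (ib _ _ cF (smooth_cont (pG i)) (@off_box_partial r i phi or)).
move/eqP; rewrite addr_eq0 => /eqP; rewrite -/(ip setT psi (partial i phi)) => ->.
by rewrite -/(ip setT phi (partial i psi)) ip_sym.
Qed.

End CompactSupport.

(** * The fundamental lemma of the calculus of variations *)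

Section FundamentalLemma.
Context {R : realType}.
Implicit Types (f g phi : R * R -> R) (x : R * R) (i j : 'I_2) (w : set (R * R)).
Local Notation mu := (leb2 R).

Lemma indic_rect_L2 w a1 b1 a2 b2 : pmeas w -> L2 w (\1_(ccrect a1 b1 a2 b2)).
Proof.
move=> mw; have mr := @ccrect_measurable R a1 b1 a2 b2.
apply/L2P; split; first by apply: measurable_funTS; exact: measurable_indic.
apply: (@integrableS _ _ _ _ setT) => //.
have -> : (EFin \o (fun x => (\1_(ccrect a1 b1 a2 b2) x : R) ^+ 2)) =
    (fun x => (\1_(ccrect a1 b1 a2 b2) x : R)%:E).
  apply/funext => x /=; rewrite indicE; case: (_ \in _) => /=; first by rewrite expr1n.
  by rewrite expr0n.
apply/integrableP; split.
  by apply/measurable_EFinP; exact: measurable_indic.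
under eq_integral do rewrite gee0_abs ?lee_fin//.
rewrite integral_indic// setIT.
rewrite [X in (X < _)%E](product_measure1E (@lebesgue_measure R) (@lebesgue_measure R))//.
by rewrite lte_mul_pinfty//= lebesgue_measure_itv/=; case: ifP => // _;
  rewrite -EFinB ltry.
Qed.

Definition rect_bump (a b : R) i (n : nat) x : R :=
  flat 1 (n.+1%:R * crd i x + n.+1%:R * - a) * flat 1 (- n.+1%:R * crd i x + n.+1%:R * b).

(** Tensor products of flat bumps that increase to the indicator of a
    rectangle; these test functions suffice for all identifications of L2
    functions. *)
Definition rect_test (a1 b1 a2 b2 : R) (n : nat) x : R :=
  rect_bump a1 b1 ord0 n x * rect_bump a2 b2 (lift ord0 ord0) n x.

Lemma smooth_rect_bump a b i n : smooth (rect_bump a b i n).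
Proof. by apply: smoothM; exact: smooth_flat. Qed.

Lemma rect_bumpE a b i n x :
  rect_bump a b i n x = flat 1 (n.+1%:R * (crd i x - a)) * flat 1 (n.+1%:R * (b - crd i x)).
Proof. by rewrite /rect_bump; congr (flat _ _ * flat _ _); ring. Qed.

Lemma rect_bump_off a b i n x : ~~ (a < crd i x < b) -> rect_bump a b i n x = 0.
Proof.
rewrite rect_bumpE negb_and -!leNgt => /orP[h|h].
  by rewrite flat_le0 ?mul0r// pmulr_rle0 ?ltr0n// subr_le0.
by rewrite [X in _ * X]flat_le0 ?mulr0// pmulr_rle0 ?ltr0n// subr_le0.
Qed.

Lemma rect_bump_bound a b i n x : 0 <= rect_bump a b i n x <= 1.
Proof.
rewrite mulr_ge0 ?flat1_ge0//=; apply: mulr_ile1; (try exact: flat1_ge0); exact: flat1_le1.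
Qed.

Lemma rect_bump_cvg a b i x : a < crd i x < b ->
  (fun n => rect_bump a b i n x) @ \oo --> (1 : R).
Proof.
move=> /andP[h1 h2]; under eq_fun do rewrite rect_bumpE.
have := @cvgM _ _ _ _ (fun n : nat => flat 1 (n.+1%:R * (crd i x - a)))
  (fun n : nat => flat 1 (n.+1%:R * (b - crd i x))) 1 1.
by rewrite mulr1; apply; apply: flat1_cvg; rewrite subr_gt0.
Qed.

Lemma rect_test_off a1 b1 a2 b2 n x : ~ oorect a1 b1 a2 b2 x -> rect_test a1 b1 a2 b2 n x = 0.
Proof.
move=> h; rewrite /rect_test; have [h1|h1] := boolP (a1 < crd ord0 x < b1); last first.
  by rewrite rect_bump_off ?mul0r.
rewrite [X in _ * X]rect_bump_off ?mulr0//.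
by apply/negP => h2; apply: h; split; rewrite /= in_itv.
Qed.

Lemma rect_test_cvg a1 b1 a2 b2 x :
  (fun n => rect_test a1 b1 a2 b2 n x) @ \oo --> (\1_(oorect a1 b1 a2 b2) x : R).
Proof.
rewrite indicE; have [h|h] := pselect (oorect a1 b1 a2 b2 x).
  rewrite mem_set//=; move: h => [/=]; rewrite !in_itv/= => h1 h2.
  by rewrite -(mulr1 1); apply: cvgM; exact: rect_bump_cvg.
rewrite memNset//=; under eq_fun do rewrite rect_test_off//.
exact: cvg_cst.
Qed.

Lemma rect_test_bound a1 b1 a2 b2 n x : `|rect_test a1 b1 a2 b2 n x| <= \1_(ccrect a1 b1 a2 b2) x.
Proof.
rewrite indicE; have [h|h] := pselect (ccrect a1 b1 a2 b2 x).
  rewrite mem_set//= normrM.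
  have /andP[p1 q1] := rect_bump_bound a1 b1 ord0 n x.
  have /andP[p2 q2] := rect_bump_bound a2 b2 (lift ord0 ord0) n x.
  by rewrite !ger0_norm// mulr_ile1.
rewrite rect_test_off ?normr0// => -[h1 h2]; apply: h.
by split; exact: subset_itv_oo_cc.
Qed.

Lemma rect_test_fun w a1 b1 a2 b2 n : ccrect a1 b1 a2 b2 `<=` w ->
  test_fun w (rect_test a1 b1 a2 b2 n).
Proof.
have cc : compact (ccrect a1 b1 a2 b2) by apply: compact_setX; exact: segment_compact.
have clc : closed (ccrect a1 b1 a2 b2) by apply: compact_closed => //; exact: norm_hausdorff.
move=> h; have hs : closure [set x | rect_test a1 b1 a2 b2 n x != 0] `<=` ccrect a1 b1 a2 b2.
  rewrite [X in _ `<=` X](closure_id _).1//; apply: closureS => x /eqP hx.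
  have [h1 h2] : oorect a1 b1 a2 b2 x by apply: contrapT => /(@rect_test_off _ _ _ _ n).
  by split; exact: subset_itv_oo_cc.
split; [apply: smoothM; exact: smooth_rect_bump| |exact: subset_trans h].
by apply: subclosed_compact cc hs; exact: closed_closure.
Qed.

Lemma partial_indep (F : R * R -> R) k l : k != l ->
  (forall x t, F (upd k x t) = F x) -> forall x t, partial l F (upd k x t) = partial l F x.
Proof.
move=> kl hF x t; rewrite !partial_slice crd_upd eq_sym (negbTE kl).
suff -> : F \o upd l (upd k x t) = F \o upd l x by [].
apply/funext => u /=; rewrite -[RHS](hF _ t); congr F.
by move: kl; rewrite /upd; case: k {hF} => -[|[|//]] ?; case: l => -[|[|//]] ? //=.
Qed.

Lemma partial_indep0 (F : R * R -> R) k :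
  (forall x t, F (upd k x t) = F x) -> partial k F = cst 0.
Proof.
move=> hF; apply/funext => x; rewrite partial_slice.
rewrite (_ : F \o upd k x = cst (F x)) ?derive_cst//.
by apply/funext => t; rewrite /= hF.
Qed.

Lemma partialM_smooth k (F G : R * R -> R) : smooth F -> smooth G ->
  partial k (fun x => F x * G x) = fun x => F x * partial k G x + G x * partial k F x.
Proof. by move=> sF sG; apply/funext => x; apply: partialM; exact: smooth_der. Qed.

(** On tensor products the mixed partial derivatives visibly commute; with the
    fundamental lemma this yields their commutation in general. *)
Lemma tensor_mixed (A B : R * R -> R) k l : k != l -> smooth A -> smooth B ->
  (forall x t, A (upd l x t) = A x) -> (forall x t, B (upd k x t) = B x) ->
  partial k (partial l (fun x => A x * B x)) = partial l (partial k (fun x => A x * B x)).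
Proof.
move=> kl sA sB hA hB; have lk : l != k by rewrite eq_sym.
have A1 := partial_indep0 hA; have B0 := partial_indep0 hB.
have A01 := partial_indep0 (partial_indep lk hA).
have B10 := partial_indep0 (partial_indep kl hB).
rewrite (partialM_smooth k sA sB) (partialM_smooth l sA sB) A1 B0.
have -> : (fun x => A x * cst 0 x + B x * partial k A x) = fun x => B x * partial k A x.
  by apply/funext => x; rewrite mulr0 add0r.
have -> : (fun x => A x * partial l B x + B x * cst 0 x) = fun x => A x * partial l B x.
  by apply/funext => x; rewrite mulr0 addr0.
rewrite (partialM_smooth k sA (smooth_partial l sB)) (partialM_smooth l sB (smooth_partial k sA)).
by rewrite B10 A01; apply/funext => x; rewrite !mulr0 !add0r mulrC.
Qed.

Lemma rect_test_mixed a1 b1 a2 b2 n i j :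
  partial i (partial j (rect_test a1 b1 a2 b2 n)) =
  partial j (partial i (rect_test a1 b1 a2 b2 n)).
Proof.
have [->//|ij] := eqVneq i j.
have two (k l : 'I_2) : k != l -> (k == ord0) && (l == lift ord0 ord0) || (l == ord0) && (k == lift ord0 ord0).
  by case: k => -[|[|//]] hk; case: l => -[|[|//]] hl.
have key : partial ord0 (partial (lift ord0 ord0) (rect_test a1 b1 a2 b2 n)) =
    partial (lift ord0 ord0) (partial ord0 (rect_test a1 b1 a2 b2 n)).
  apply: (tensor_mixed _ (smooth_rect_bump a1 b1 ord0 n) (smooth_rect_bump a2 b2 (lift ord0 ord0) n)).
  - by [].
  - by move=> x t; rewrite /rect_bump !crd_upd.
  - by move=> x t; rewrite /rect_bump !crd_upd.
case/orP: (two _ _ ij) => /andP[/eqP -> /eqP ->]; [exact: key|exact: (esym key)].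
Qed.

Lemma rect_integral_eq0 w g a1 b1 a2 b2 : pmeas w -> L2 w g ->
  ccrect a1 b1 a2 b2 `<=` w ->
  (forall n, ip w g (rect_test a1 b1 a2 b2 n) = 0) ->
  (\int[mu]_(x in oorect a1 b1 a2 b2) (g x)%:E = 0)%E.
Proof.
move=> mw Lg hr h0.
have /L2P[mg _] := Lg.
have L1 := indic_rect_L2 a1 b1 a2 b2 mw.
have mo := @oorect_measurable R a1 b1 a2 b2.
have mt n : pmfun w (rect_test a1 b1 a2 b2 n).
  by have /L2P[] := test_fun_L2 mw (rect_test_fun n hr).
have L2t n := test_fun_L2 mw (rect_test_fun n hr).
have ig := L2_mul_integrable mw Lg (test_fun_L2 mw (rect_test_fun 0 hr)).
have := @dominated_convergence _ _ _ mu w mw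
  (fun n x => (g x * rect_test a1 b1 a2 b2 n x)%:E)
  (fun x => (g x * \1_(oorect a1 b1 a2 b2) x)%:E)
  (fun x => `|(g x * \1_(ccrect a1 b1 a2 b2) x)%:E|)%E.
case.
- by move=> n; apply/measurable_EFinP; exact: measurable_funM.
- by apply/measurable_EFinP; apply: measurable_funM.
- apply: aeW => x wx; apply: cvg_EFin; first exact: nearW.
  by apply: cvgMr; exact: rect_test_cvg.
- by apply: integrable_abse; exact: L2_mul_integrable.
- apply: aeW => x n wx; rewrite lee_fin (normrM (g x)) [leRHS](normrM (g x)); apply: ler_wpM2l => //.
  apply: le_trans (rect_test_bound a1 b1 a2 b2 n x) _; exact: ler_norm.
move=> _ _ cv.
have E n : (\int[mu]_(x in w) (g x * rect_test a1 b1 a2 b2 n x)%:E = 0)%E.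
  rewrite -[RHS](_ : (ip w g (rect_test a1 b1 a2 b2 n))%:E = 0%E); last by rewrite h0.
  by rewrite /ip /Rintegral fineK//; apply: integrable_fin_num => //; exact: L2_mul_integrable.
have : (fun n => \int[mu]_(x in w) (g x * rect_test a1 b1 a2 b2 n x)%:E)%E @ \oo --> 0%E.
  by under eq_fun do rewrite E; exact: cvg_cst.
move/cvg_lim: cv => /(_ (@ereal_hausdorff R)) cv /cvg_lim => /(_ (@ereal_hausdorff R)).
rewrite cv => <-.
have ow : oorect a1 b1 a2 b2 `<=` w.
  by move=> x [h1 h2]; apply: hr; split; exact: subset_itv_oo_cc.
rewrite -[in LHS](setIidr ow) integral_mkcondr; apply: eq_integral => x _.
rewrite patchE indicE; case: ifP => /=; [by rewrite mulr1|by rewrite mulr0].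
Qed.

Lemma measurable_rects : (@measurable _ (T2 R)) `<=`
  <<s [set E | exists a1 b1 a2 b2, E = oorect a1 b1 a2 b2] >>.
Proof.
set G := [set E | _].
have m1 : @measurable_fun _ _ (g_sigma_algebraType G) (measurableTypeR R) setT (@fst R R).
  apply: (measurability _ (RGenOpens.measurableE R)) => _ [_ [a [b ->] <-]].
  have -> : [set: R * R] `&` fst @^-1` `]a, b[ = \bigcup_n oorect a b (- n%:R) n%:R.
    apply/seteqP; split=> [[x y] [_ /= h]|[x y] [n _ [/= h _]]//].
    have := archi_boundP (normr_ge0 y); rewrite ltr_norml => hy.
    by exists (Num.bound `|y|) => //; split; rewrite /= ?in_itv.
  apply: bigcupT_measurable => n; apply: sub_sigma_algebra.
  by exists a, b, (- n%:R), n%:R.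
have m2 : @measurable_fun _ _ (g_sigma_algebraType G) (measurableTypeR R) setT (@snd R R).
  apply: (measurability _ (RGenOpens.measurableE R)) => _ [_ [a [b ->] <-]].
  have -> : [set: R * R] `&` snd @^-1` `]a, b[ = \bigcup_n oorect (- n%:R) n%:R a b.
    apply/seteqP; split=> [[x y] [_ /= h]|[x y] [n _ [/= _ h]]//].
    have := archi_boundP (normr_ge0 x); rewrite ltr_norml => hx.
    by exists (Num.bound `|x|) => //; split; rewrite /= ?in_itv.
  apply: bigcupT_measurable => n; apply: sub_sigma_algebra.
  by exists (- n%:R), n%:R, a, b.
rewrite measurable_prod_measurableType.
apply: smallest_sub; first exact: smallest_sigma_algebra.
move=> _ [A mA [B mB <-]].
have -> : A `*` B = ([set: R * R] `&` fst @^-1` A) `&` ([set: R * R] `&` snd @^-1` B).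
  by apply/seteqP; split=> -[x y] /= [h1 h2]; [|move: h1 h2 => [_ ?] [_ ?]].
apply: (@measurableI _ (g_sigma_algebraType G)); [exact: m1|exact: m2].
Qed.

Lemma oorectI (a1 b1 a2 b2 c1 d1 c2 d2 : R) :
  oorect a1 b1 a2 b2 `&` oorect c1 d1 c2 d2 =
  oorect (Num.max a1 c1) (Num.min b1 d1) (Num.max a2 c2) (Num.min b2 d2).
Proof.
apply/seteqP; split=> -[x y]; rewrite /oorect /= !in_itv/= ?gt_max ?lt_min.
  by move=> [[/= /andP[-> ->] /andP[-> ->]] [/= /andP[-> ->] /andP[-> ->]]].
by move=> [/andP[/andP[p1 p2] /andP[p3 p4]] /andP[/andP[p5 p6] /andP[p7 p8]]];
  split; split; rewrite /=; apply/andP.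
Qed.

Lemma rects_setI_closed :
  setI_closed [set E | exists a1 b1 a2 b2 : R, E = oorect a1 b1 a2 b2].
Proof.
move=> _ _ [a1 [b1 [a2 [b2 ->]]]] [c1 [d1 [c2 [d2 ->]]]].
by rewrite oorectI; do 4!eexists.
Qed.

(** The measurable sets on which the integral of [h] vanishes form a lambda
    system, so it suffices to look at rectangles. *)
Lemma ae_eq0_rects (h : R * R -> R) : mu.-integrable setT (EFin \o h) ->
  (forall a1 b1 a2 b2, (\int[mu]_(x in oorect a1 b1 a2 b2) (h x)%:E = 0)%E) ->
  ae_eq mu setT h 0.
Proof.
move=> ih h0.
have mh : pmfun setT (EFin \o h) by exact: measurable_int ih.
pose N := [set E : set (T2 R) | measurable E /\ (\int[mu]_(x in E) (h x)%:E = 0)%E].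
have iE E : measurable E -> mu.-integrable E (EFin \o h).
  by move=> mE; apply: integrableS ih.
have NU (F : (set (T2 R))^nat) : trivIset setT F -> (forall n, N (F n)) -> N (\bigcup_n F n).
  move=> tF nF; have mF n : measurable (F n) by case: (nF n).
  have mU : measurable (\bigcup_n F n) by exact: bigcupT_measurable.
  split => //; rewrite (@integral_bigcup _ _ _ mu F (EFin \o h))//; last exact: iE.
  by apply: eseries0 => n _ _; case: (nF n).
have NT : N setT.
  split; first exact: measurableT.
  pose F (n : nat) : set (T2 R) := oorect (- n%:R) n%:R (- n%:R) n%:R.
  have UF : [set: T2 R] = \bigcup_n F n.
    apply/seteqP; split=> // -[x y] _.
    pose k := maxn (Num.bound `|x|) (Num.bound `|y|).
    have hx : `|x| < k%:R by apply: lt_le_trans (archi_boundP (normr_ge0 _)) _; rewrite ler_nat leq_maxl.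
    have hy : `|y| < k%:R by apply: lt_le_trans (archi_boundP (normr_ge0 _)) _; rewrite ler_nat leq_maxr.
    by exists k => //; split; rewrite /= in_itv/= -ltr_norml.
  have mF n : measurable (F n) by exact: oorect_measurable.
  have ndF : nondecreasing_seq F.
    move=> m n mn; apply/subsetPset => -[x y] [/=]; rewrite !in_itv/= -!ltr_norml => hx hy.
    have mnR : (m%:R : R) <= n%:R by rewrite ler_nat.
    by split; rewrite /= in_itv/= -ltr_norml; exact: lt_le_trans mnR.
  have ip0 n : (\int[mu]_(x in F n) (h x)%:E = 0)%E by exact: h0.
  have cp := @ge0_nondecreasing_set_cvg_integral _ _ _ F ((EFin \o h)^\+)%E mu ndF mF
    (fun i : nat => measurable_funTS (measurable_funepos mh)) (fun (i : nat) x _ => funepos_ge0 _ x).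
  have cm := @ge0_nondecreasing_set_cvg_integral _ _ _ F ((EFin \o h)^\-)%E mu ndF mF
    (fun i : nat => measurable_funTS (measurable_funeneg mh)) (fun (i : nat) x _ => funeneg_ge0 _ x).
  rewrite -UF in cp cm.
  have E n : (\int[mu]_(x in F n) ((EFin \o h)^\+)%E x = \int[mu]_(x in F n) ((EFin \o h)^\-)%E x)%E.
    have := ip0 n; rewrite integralE => e0.
    by rewrite -[LHS](subeK _ (integrable_neg_fin_num (mF n) (iE _ (mF n)))) [X in (X + _)%E]e0 add0e.
  have cp' : (fun n => \int[mu]_(x in F n) ((EFin \o h)^\-)%E x)%E @ \oo -->
      (\int[mu]_x ((EFin \o h)^\+)%E x)%E.
    by apply: cvg_trans cp; apply: near_eq_cvg; apply: nearW => n; rewrite E.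
  have -> : (\int[mu]_x (h x)%:E = \int[mu]_x (EFin \o h) x)%E by [].
  rewrite integralE (cvg_unique _ cp' cm) ?subee//.
  exact: integrable_neg_fin_num.
have NC : setC_closed N.
  move=> A [mA A0]; split; first exact: measurableC.
  have := @integral_setU _ _ _ mu A (~` A) (EFin \o h) mA (measurableC mA).
  rewrite setUv => /(_ mh); rewrite A0 add0e => <-//.
  - by case: NT.
  - by apply/disj_setPS; rewrite setICr.
have dN : dynkin N by split.
have sub : <<s [set E | exists a1 b1 a2 b2 : R, E = oorect a1 b1 a2 b2] >> `<=` N.
  apply: (@lambda_system_subset _ _ rects_setI_closed setT).
  - exact/dynkin_lambda_system.
  - move=> _ [a1 [b1 [a2 [b2 ->]]]]; split; [exact: oorect_measurable|exact: h0].
  - by [].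
have := @integral_ae_eq _ _ _ mu setT measurableT (cst 0%E) (EFin \o h) ih.
have H : ae_eq mu setT (EFin \o h) (cst 0%E).
  apply: integral_ae_eq => // E _ mE.
  rewrite integral0; by case: (sub _ (measurable_rects mE)).
by move=> _; apply: filterS H => x hx /hx [].
Qed.

(** Dominated convergence turns the tested identities into vanishing integrals
    over the rectangles contained in [w]; as [w] is a countable union of
    rational rectangles, the function vanishes almost everywhere on [w]. *)
Theorem fundamental_lemma w g : open w -> L2 w g ->
  (forall a1 b1 a2 b2 n, ccrect a1 b1 a2 b2 `<=` w ->
     ip w g (rect_test a1 b1 a2 b2 n) = 0) ->
  ae_eq mu w g 0.
Proof.
move=> ow Lg h0; have mw := open_measurable2 ow.
have key a1 b1 a2 b2 : ccrect a1 b1 a2 b2 `<=` w -> ae_eq mu (oorect a1 b1 a2 b2) g 0.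
  move=> hr; pose K := oorect a1 b1 a2 b2; pose h := g \_ K.
  have mK : pmeas K by exact: oorect_measurable.
  have Kc : K `<=` ccrect a1 b1 a2 b2 by move=> x [p1 p2]; split; exact: subset_itv_oo_cc.
  have Kw : K `<=` w by exact: subset_trans hr.
  have ih : mu.-integrable setT (EFin \o h).
    rewrite /h -restrict_EFin; apply/integrable_restrict => //; rewrite setTI.
    have := integrableS mw mK Kw (L2_mul_integrable mw Lg (indic_rect_L2 a1 b1 a2 b2 mw)).
    apply: eq_integrable => // x /set_mem /Kc cx /=.
    by rewrite indicE mem_set//= mulr1.
  have H : ae_eq mu setT h 0.
    apply: ae_eq0_rects => // c1 d1 c2 d2.
    have -> : (\int[mu]_(x in oorect c1 d1 c2 d2) (h x)%:E =
        \int[mu]_(x in oorect c1 d1 c2 d2 `&` K) (g x)%:E)%E.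
      by rewrite [RHS]integral_mkcondr; apply: eq_integral => x _; rewrite /h !patchE; case: ifP.
    rewrite oorectI; apply: (rect_integral_eq0 mw Lg) => [|n].
      apply: subset_trans hr => -[x y] [/=]; rewrite !in_itv/= !ge_max !le_min.
      move=> /andP[/andP[_ p1] /andP[_ p2]] /andP[/andP[_ p3] /andP[_ p4]].
      by split; rewrite /= in_itv/=; apply/andP.
    apply: h0; apply: subset_trans hr => -[x y] [/=]; rewrite !in_itv/= !ge_max !le_min.
    move=> /andP[/andP[_ p1] /andP[_ p2]] /andP[/andP[_ p3] /andP[_ p4]].
    by split; rewrite /= in_itv/=; apply/andP.
  apply: filterS H => x hx Kx; have := hx Logic.I; rewrite /h patchE.
  by rewrite mem_set.
pose I := (rat * rat * rat * rat)%type.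
have H (i : I) : mu.-negligible [set x | ~ ((if `[< ccrect (ratr i.1.1.1) (ratr i.1.1.2) (ratr i.1.2) (ratr i.2) `<=` w >]
     then oorect (ratr i.1.1.1) (ratr i.1.1.2) (ratr i.1.2) (ratr i.2) else set0) x -> g x = 0)].
  case: asboolP => [/key //|_].
  rewrite (_ : [set x | _] = set0); first exact: negligible_set0.
  by apply/seteqP; split => x //=; apply.
pose F (n : nat) := if (unpickle n : option I) is Some i then [set x | ~ ((if `[< ccrect (ratr i.1.1.1) (ratr i.1.1.2) (ratr i.1.2) (ratr i.2) `<=` w >]
     then oorect (ratr i.1.1.1) (ratr i.1.1.2) (ratr i.1.2) (ratr i.2) else set0) x -> g x = 0)] else set0.
have HF n : mu.-negligible (F n).
  by rewrite /F; case: unpickle => [i|]; [exact: H|exact: negligible_set0].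
have := negligible_bigcup HF; apply: negligibleS => x /= /not_implyP[wx gx].
move: (wx); rewrite {1}(open_rat_cover ow) => -[i _ hi].
exists (pickle i); first exact: Logic.I.
by rewrite /F pickleK; apply/not_implyP; split; [exact: hi|exact: gx].
Qed.

End FundamentalLemma.

(** * Weak derivatives and the space H2 *)

Section L2Maps.
Context {R : realType} {X : lmodType R}.
Implicit Types (S : set X) (B : X -> X -> R) (w : set (R * R)).
Local Notation mu := (leb2 R).

Definition subspace S := S 0 /\ forall a x y, S x -> S y -> S (a *: x + y).

Lemma si_subspace S B : semi_inner S B -> subspace S.
Proof. by case=> *; split. Qed.

Lemma si_plus S B1 B2 c : semi_inner S B1 -> semi_inner S B2 -> 0 <= c ->
  semi_inner S (fun x y => B1 x y + c * B2 x y).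
Proof.
move=> H1 H2 c0; split.
- exact: (si_0 H1).
- by move=> *; exact: (si_lin H1).
- by move=> x y Sx Sy; rewrite (si_sym H1 Sx Sy) (si_sym H2 Sx Sy).
- by move=> a x y z Sx Sy Sz; rewrite (si_linl H1)// (si_linl H2)//; ring.
- by move=> x Sx; rewrite addr_ge0 ?mulr_ge0 ?(si_ge0 H1) ?(si_ge0 H2).
Qed.

Lemma si_sum (I : finType) S (B : I -> X -> X -> R) : subspace S ->
  (forall i, semi_inner S (B i)) -> semi_inner S (fun x y => \sum_i B i x y).
Proof.
move=> [S0 SL] H; split => //.
- by move=> x y Sx Sy; apply: eq_bigr => i _; exact: (si_sym (H i)).
- move=> a x y z Sx Sy Sz; rewrite mulr_sumr -big_split; apply: eq_bigr => i _.
  exact: (si_linl (H i)).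
- by move=> x Sx; apply: sumr_ge0 => i _; exact: (si_ge0 (H i)).
Qed.

Lemma si_subset S S' B : subspace S' -> S' `<=` S -> semi_inner S B -> semi_inner S' B.
Proof.
move=> [S0 SL] ss H; split => //.
- by move=> x y /ss Sx /ss Sy; exact: (si_sym H).
- by move=> a x y z /ss Sx /ss Sy /ss Sz; exact: (si_linl H).
- by move=> x /ss; exact: (si_ge0 H).
Qed.

(** Weak derivatives are only determined almost everywhere, so the operators
    below are linear only up to null sets. *)
Record L2map S w (A : X -> R * R -> R) : Prop := L2Map {
  L2map_L2 : forall x, S x -> L2 w (A x);
  L2map_lin : forall a x y, S x -> S y ->
    ae_eq mu w (A (a *: x + y)) (a *: A x + A y) }.

Lemma L2map_subset S S' w A : S' `<=` S -> L2map S w A -> L2map S' w A.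
Proof. by move=> ss [h1 h2]; split => [x /ss /h1|a x y /ss Sx /ss Sy]//; exact: h2. Qed.

Lemma L2map_inner S w A : pmeas w -> subspace S -> L2map S w A ->
  semi_inner S (fun x y => ip w (A x) (A y)).
Proof.
move=> mw [S0 SL] [h1 h2]; split => //.
- by move=> *; exact: ip_sym.
- move=> a x y z Sx Sy Sz; rewrite -ip_linl//; try exact: h1.
  apply: ip_ae => //; [exact/h1/SL|by apply: L2_lin => //; exact: h1|exact: h1|exact: h2].
- by move=> *; exact: ip_ge0.
Qed.

Lemma L2map_subr S w A : pmeas w -> subspace S -> L2map S w A -> forall x y, S x -> S y ->
  ae_eq mu w (A (x - y)) (A x - A y).
Proof.
move=> mw _ [_ h2] x y Sx Sy.
have -> : x - y = -1 *: y + x by rewrite scaleN1r addrC.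
have -> : A x - A y = -1 *: A y + A x by rewrite scaleN1r addrC.
exact: h2.
Qed.

(** A graph norm is complete when the graph is closed. *)
Lemma complete_graph (I : finType) S B w (A : I -> X -> R * R -> R) (c : R) :
  pmeas w -> semi_inner S B -> (forall i, L2map S w (A i)) ->
  (forall x i, S x -> ip w (A i x) (A i x) <= c * B x x) ->
  (forall x, S x -> B x x <= c * \sum_i ip w (A i x) (A i x)) ->
  (forall (u : nat -> X) (g : I -> R * R -> R), (forall n, S (u n)) ->
    (forall i, L2 w (g i)) -> (forall i, cvg_wrt (@ip R w) (fun n => A i (u n)) (g i)) ->
    exists2 x, S x & forall i, ae_eq mu w (A i x) (g i)) ->
  complete_wrt S B.
Proof.
move=> mw HB HA AB BA HG u Su cu.
have HL := L2_semi_inner mw.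
have HS := si_subspace HB.
wlog c0 : c AB BA / 0 < c.
  move=> h; apply: (h (`|c| + 1)); last by rewrite ltr_wpDl.
  - move=> x i Sx; apply: le_trans (AB x i Sx) _; apply: ler_wpM2r; first exact: (si_ge0 HB).
    by apply: le_trans (ler_norm c) _; rewrite lerDl.
  - move=> x Sx; apply: le_trans (BA x Sx) _; apply: ler_wpM2r.
      by apply: sumr_ge0 => i _; exact: ip_ge0.
    by apply: le_trans (ler_norm c) _; rewrite lerDl.
have LA i x : S x -> L2 w (A i x) by exact: (L2map_L2 (HA i)).
have dA i x y : S x -> S y -> ip w (A i (x - y)) (A i (x - y)) =
    ip w (A i x - A i y) (A i x - A i y).
  move=> Sx Sy; have Sxy : S (x - y) by exact: (si_sub HB).
  have Lxy : L2 w (A i x - A i y) by apply: (si_sub HL); exact: LA.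
  have E := L2map_subr mw HS (HA i) Sx Sy.
  rewrite (ip_ae mw (LA i _ Sxy) Lxy (LA i _ Sxy) E) ip_sym.
  by rewrite (ip_ae mw (LA i _ Sxy) Lxy Lxy E).
have /choice[g hg] : forall i, exists g, L2 w g /\ cvg_wrt (@ip R w) (fun n => A i (u n)) g.
  move=> i; have [||g Lg ug] := @L2_complete R w mw (fun n => A i (u n)).
  - by move=> n; exact: LA.
  - move=> e e0; have [N hN] := cu _ (divr_gt0 e0 c0); exists N => m n hm hn.
    rewrite -dA//; apply: le_lt_trans (AB _ i (si_sub HB (Su m) (Su n))) _.
    by rewrite mulrC -ltr_pdivlMr//; exact: hN.
  - by exists g.
have [|x Sx hx] := HG u g Su (fun i => (hg i).1); first by move=> i; exact: (hg i).2.
exists x => // e e0.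
have k0 : 0 < c * (#|I|%:R + 1) by rewrite mulr_gt0// ltr_wpDl.
have /choice[N hN] : forall i, exists N, forall n, (N <= n)%N ->
    ip w (A i (u n) - g i) (A i (u n) - g i) < e / (c * (#|I|%:R + 1)).
  by move=> i; exact: ((hg i).2 _ (divr_gt0 e0 k0)).
exists (\sum_i N i)%N => n hn.
apply: le_lt_trans (BA _ (si_sub HB (Su n) Sx)) _.
have : \sum_i ip w (A i (u n - x)) (A i (u n - x)) <= \sum_(i : I) e / (c * (#|I|%:R + 1)).
  apply: ler_sum => i _; rewrite dA//.
  have Lg : L2 w (g i) := (hg i).1.
  have L1 : L2 w (A i (u n) - A i x) by apply: (si_sub HL); exact: LA.
  have L2' : L2 w (A i (u n) - g i) by apply: (si_sub HL) => //; exact: LA.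
  have E : ae_eq mu w (A i (u n) - A i x) (A i (u n) - g i).
    by apply: filterS (hx i) => y h wy; congr (_ - _); exact: h.
  rewrite (ip_ae mw L1 L2' L1 E) ip_sym (ip_ae mw L1 L2' L2' E).
  apply/ltW/hN; apply: leq_trans hn; rewrite (bigD1 i)//=; exact: leq_addr.
rewrite sumr_const => h; apply: le_lt_trans (ler_wpM2l (ltW c0) h) _.
rewrite (_ : #|xpredT| = #|I|)// -(mulr_natr (e / (c * (#|I|%:R + 1))) #|I|).
have k1 : 0 < #|I|%:R + 1 :> R by rewrite ltr_wpDl.
have -> : c * (e / (c * (#|I|%:R + 1)) * #|I|%:R) = e * (#|I|%:R / (#|I|%:R + 1)).
  by field; rewrite !gt_eqF.
by rewrite gtr_pMr// ltr_pdivrMr// mul1r ltrDl.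
Qed.

End L2Maps.

Section WeakDerivatives.
Context {R : realType}.
Implicit Types (f g v phi : R * R -> R) (x : R * R) (i j : 'I_2) (w : set (R * R)).
Local Notation mu := (leb2 R).

Lemma ip_ae2 w f f' g : pmeas w -> L2 w f -> L2 w f' -> L2 w g ->
  ae_eq mu w f f' -> ip w g f = ip w g f'.
Proof. by move=> mw Lf Lf' Lg E; rewrite ip_sym (ip_ae mw Lf Lf' Lg E) ip_sym. Qed.

Lemma ip_subl w f g h : pmeas w -> L2 w f -> L2 w g -> L2 w h ->
  ip w (f - g) h = ip w f h - ip w g h.
Proof. by move=> mw *; rewrite (si_subl (L2_semi_inner mw)). Qed.

(** Testing against the rectangle bumps already identifies an L2 function. *)
Lemma L2_eq_tested w f g : open w -> L2 w f -> L2 w g ->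
  (forall a1 b1 a2 b2 n, ccrect a1 b1 a2 b2 `<=` w ->
     ip w f (rect_test a1 b1 a2 b2 n) = ip w g (rect_test a1 b1 a2 b2 n)) ->
  ae_eq mu w f g.
Proof.
move=> ow Lf Lg h; have mw := open_measurable2 ow.
have HL := L2_semi_inner mw.
have := @fundamental_lemma R w (f - g) ow (si_sub HL Lf Lg).
have H : ae_eq mu w (f - g) 0.
  apply: fundamental_lemma => //; first exact: (si_sub HL).
  move=> a1 b1 a2 b2 n hr; rewrite ip_subl// ?h ?subrr//.
  exact: (test_fun_L2 mw (rect_test_fun n hr)).
by move=> _; apply: filterS H => y hy wy; apply/eqP; rewrite -subr_eq0; apply/eqP; exact: hy.
Qed.

Lemma cvg_wrt_ip w u v g : pmeas w -> (forall n, L2 w (u n)) -> L2 w v -> L2 w g ->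
  cvg_wrt (@ip R w) u v -> forall a, (forall n, ip w (u n) g = a n) ->
  forall l, (forall e, 0 < e -> exists N, forall n, (N <= n)%N -> `|a n - l| < e) ->
  ip w v g = l.
Proof.
move=> mw Lu Lv Lg uv a ha l hl; apply/eqP; rewrite -subr_eq0 -normr_le0.
apply/ler_addgt0Pl => e e0; rewrite addr0.
have e20 : 0 < e / 2 by lra.
have [N1 h1] := cvg_wrt_inner (L2_semi_inner mw) Lu Lv Lg uv e20.
have [N2 h2] := hl _ e20.
have := h1 (maxn N1 N2) (leq_maxl _ _); have := h2 (maxn N1 N2) (leq_maxr _ _).
rewrite ha => g2 g1.
have -> : ip w v g - l = (a (maxn N1 N2) - l) - (a (maxn N1 N2) - ip w v g) by ring.
apply: le_trans (ler_normB _ _) _; lra.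
Qed.

(** The form in which the defining identities of weak derivatives pass to
    limits. *)
Lemma ip_limit w u v g u' v' g' : pmeas w -> (forall n, L2 w (u n)) -> L2 w v -> L2 w g ->
  (forall n, L2 w (u' n)) -> L2 w v' -> L2 w g' ->
  cvg_wrt (@ip R w) u v -> cvg_wrt (@ip R w) u' v' ->
  forall s, (forall n, ip w (u n) g = s * ip w (u' n) g') -> ip w v g = s * ip w v' g'.
Proof.
move=> mw Lu Lv Lg Lu' Lv' Lg' uv uv' s h.
apply: (cvg_wrt_ip mw Lu Lv Lg uv h) => e e0.
have k0 : 0 < e / (`|s| + 1) by rewrite divr_gt0// ltr_wpDl.
have [N hN] := cvg_wrt_inner (L2_semi_inner mw) Lu' Lv' Lg' uv' k0.
exists N => n /hN; rewrite ltr_pdivlMr ?ltr_wpDl// -mulrBr normrM => hn.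
apply: le_lt_trans hn; rewrite mulrC; apply: ler_wpM2l => //.
by rewrite lerDl.
Qed.

Lemma wpartial_spec w i v : (exists g, L2 w g /\ is_wpartial w i v g) ->
  L2 w (wpartial w i v) /\ is_wpartial w i v (wpartial w i v).
Proof. by move=> [g hg]; apply: (@getPex _ [set g | L2 w g /\ is_wpartial w i v g]); exists g. Qed.

Lemma is_wpartial_uniq w i v g g' : open w -> L2 w g -> L2 w g' ->
  is_wpartial w i v g -> is_wpartial w i v g' -> ae_eq mu w g g'.
Proof.
move=> ow Lg Lg' h h'; apply: L2_eq_tested => // a1 b1 a2 b2 n hr.
have t := rect_test_fun n hr.
by apply: oppr_inj; rewrite -h// -h'.
Qed.

Lemma wpartial_ae w i v g : open w -> L2 w g -> is_wpartial w i v g ->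
  ae_eq mu w (wpartial w i v) g.
Proof.
move=> ow Lg h; have [L h'] := wpartial_spec (ex_intro _ g (conj Lg h)).
exact: is_wpartial_uniq L Lg h' h.
Qed.

Lemma is_wpartial_lin w i a v v' g g' : pmeas w -> L2 w v -> L2 w v' -> L2 w g -> L2 w g' ->
  is_wpartial w i v g -> is_wpartial w i v' g' ->
  is_wpartial w i (a *: v + v') (a *: g + g').
Proof.
move=> mw Lv Lv' Lg Lg' h h' phi tphi.
have Lp := test_fun_L2 mw tphi; have Lp' := test_fun_L2 mw (test_fun_partial i tphi).
by rewrite ip_linl// h// h'// ip_linl//; ring.
Qed.

Lemma is_wpartial_sub w w' i v g : pmeas w -> pmeas w' -> w' `<=` w ->
  is_wpartial w i v g -> is_wpartial w' i v g.
Proof.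
move=> mw mw' sw h phi tphi.
rewrite -(ip_test _ mw mw' sw (test_fun_partial i tphi)) -(ip_test _ mw mw' sw tphi).
exact: h (test_fun_subset sw tphi).
Qed.

Lemma is_wpartial_smooth w i v : pmeas w -> smooth v -> is_wpartial w i v (partial i v).
Proof. by move=> mw sv phi tphi; exact: ip_partial_smooth. Qed.

Lemma is_wpartial_ae w i v v' g : pmeas w -> L2 w v -> L2 w v' -> ae_eq mu w v v' ->
  is_wpartial w i v g -> is_wpartial w i v' g.
Proof.
move=> mw Lv Lv' E h phi tphi; rewrite -h//; apply/esym/ip_ae => //.
exact: (test_fun_L2 mw (test_fun_partial i tphi)).
Qed.

(** The choice made by [wpartial] depends only on the predicate it chooses
    from, and this predicate only on the class of the function. *)
Lemma wpartial_ext w i v v' : pmeas w -> L2 w v -> L2 w v' -> ae_eq mu w v v' ->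
  wpartial w i v = wpartial w i v'.
Proof.
move=> mw Lv Lv' E; rewrite /wpartial; congr (get _); apply/seteqP; split=> g /= [Lg h];
  split => //; apply: is_wpartial_ae h => //; exact: ae_eq_sym.
Qed.

Lemma is_wpartial_limit w i u v u' g : pmeas w -> (forall n, L2 w (u n)) -> L2 w v ->
  (forall n, L2 w (u' n)) -> L2 w g ->
  cvg_wrt (@ip R w) u v -> cvg_wrt (@ip R w) u' g ->
  (forall n, is_wpartial w i (u n) (u' n)) -> is_wpartial w i v g.
Proof.
move=> mw Lu Lv Lu' Lg uv ug h phi tphi.
have Lp := test_fun_L2 mw tphi; have Lp' := test_fun_L2 mw (test_fun_partial i tphi).
rewrite -mulN1r; apply: (ip_limit mw Lu Lv Lp' Lu' Lg Lp uv ug) => n.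
by rewrite mulN1r; exact: h.
Qed.

End WeakDerivatives.

Section MatrixFunctions.
Context {R : realType}.
Implicit Types (P Q : R * R -> 'M[R]_2) (x : R * R) (i j : 'I_2) (w : set (R * R)).
Local Notation mu := (leb2 R).

Definition ent Q i j : R * R -> R := fun x => Q x i j.

Definition LM w Q := forall i j, L2 w (ent Q i j).

Lemma Rintegral_sum w (I : Type) (s : seq I) (F : I -> R * R -> R) : pmeas w ->
  (forall k, mu.-integrable w (EFin \o F k)) ->
  \int[mu]_(x in w) (\sum_(i <- s) F i x) = \sum_(i <- s) \int[mu]_(x in w) F i x.
Proof.
move=> mw iF; elim: s => [|i s IH].
  rewrite big_nil; under eq_Rintegral do rewrite big_nil.
  by rewrite /Rintegral integral0.
rewrite big_cons; under eq_Rintegral do rewrite big_cons.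
rewrite RintegralD ?IH//.
have := integrable_sum mw s (P := xpredT) (fun k _ => iF k).
apply: eq_integrable => // x _ /=; by rewrite sumEFin.
Qed.

Lemma ipME w P Q : pmeas w -> LM w P -> LM w Q ->
  ipM w P Q = \sum_i \sum_j ip w (ent P i j) (ent Q i j).
Proof.
move=> mw LP LQ; rewrite /ipM /ddot.
have ig i j : mu.-integrable w (EFin \o (fun x => P x i j * Q x i j)).
  exact: (L2_mul_integrable mw (LP i j) (LQ i j)).
rewrite Rintegral_sum//; last first.
  move=> i; have := integrable_sum mw (index_enum 'I_2) (P := xpredT) (fun j _ => ig i j).
  by apply: eq_integrable => // x _ /=; rewrite sumEFin.
by apply: eq_bigr => i _; rewrite Rintegral_sum.
Qed.

Lemma entL i j a P Q : ent (a *: P + Q) i j = a *: ent P i j + ent Q i j.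
Proof. by apply/funext => x; rewrite /ent linE /GRing.scale/= /GRing.add/= !mxE. Qed.

Lemma entB i j P Q : ent (P - Q) i j = ent P i j - ent Q i j.
Proof. by rewrite addrC -scaleN1r entL scaleN1r addrC. Qed.

Lemma LM_0 w : pmeas w -> LM w 0.
Proof.
move=> mw i j; have -> : ent (0 : R * R -> 'M[R]_2) i j = 0.
  by apply/funext => x; rewrite /ent /GRing.zero/= mxE.
exact: L2_0.
Qed.

Lemma LM_subspace w : pmeas w -> subspace (LM w).
Proof.
move=> mw; split=> [|a P Q LP LQ i j]; first exact: LM_0.
by rewrite entL; exact: L2_lin.
Qed.

Lemma ent_map w i j : L2map (LM w) w (fun Q => ent Q i j).
Proof. by split=> [Q LQ|a P Q _ _]; [exact: LQ|rewrite entL; exact: ae_eq_refl]. Qed.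

Lemma LM_inner w : pmeas w ->
  semi_inner (LM w) (fun P Q => \sum_i \sum_j ip w (ent P i j) (ent Q i j)).
Proof.
move=> mw; have S := LM_subspace mw.
apply: si_sum => // i; apply: si_sum => // j.
exact: (L2map_inner mw S (ent_map w i j)).
Qed.

Lemma LM_ipM_inner w : pmeas w -> semi_inner (LM w) (@ipM R w).
Proof.
move=> mw; have H := LM_inner mw; split.
- exact: (si_0 H).
- exact: (si_lin H).
- by move=> x y Sx Sy; rewrite !ipME//; exact: (si_sym H).
- move=> a x y z Sx Sy Sz; rewrite !ipME//; last exact: (si_lin H).
  exact: (si_linl H).
- by move=> x Sx; rewrite ipME//; exact: (si_ge0 H).
Qed.

Lemma ipM_ae w P P' Q : pmeas w -> LM w P -> LM w P' -> LM w Q ->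
  (forall i j, ae_eq mu w (ent P i j) (ent P' i j)) -> ipM w P Q = ipM w P' Q.
Proof.
move=> mw LP LP' LQ E; rewrite !ipME//; apply: eq_bigr => i _; apply: eq_bigr => j _.
exact: ip_ae.
Qed.

Lemma ipM_sym w P Q : ipM w P Q = ipM w Q P.
Proof.
apply: eq_Rintegral => x _; apply: eq_bigr => i _; apply: eq_bigr => j _.
exact: mulrC.
Qed.

Lemma ent_ae w P Q : (forall i j, ae_eq mu w (ent P i j) (ent Q i j)) <-> ae_eq mu w P Q.
Proof.
split=> [H|H i j]; last by apply: filterS H => x h /h; rewrite /ent => ->.
apply: filterS (filterI (filterI (H ord0 ord0) (H ord0 (lift ord0 ord0)))
  (filterI (H (lift ord0 ord0) ord0) (H (lift ord0 ord0) (lift ord0 ord0)))) => x [[h00 h01] [h10 h11]] wx.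
apply/matrixP => i j.
have two (k : 'I_2) : k = ord0 \/ k = lift ord0 ord0.
  by case: k => -[|[|//]] hk; [left|right]; exact/val_inj.
case: (two i) => ->; case: (two j) => ->; [exact: h00|exact: h01|exact: h10|exact: h11].
Qed.

Lemma LM_sub w w' Q : pmeas w -> pmeas w' -> w' `<=` w -> LM w Q -> LM w' Q.
Proof. by move=> mw mw' sw LQ i j; exact: L2_subset (LQ i j). Qed.

Lemma ent_hessian phi i j : ent (hessian phi) i j = partial j (partial i phi) :> (R * R -> R).
Proof. by apply/funext => x; rewrite /ent /hessian mxE. Qed.

Lemma LM_hessian w phi : pmeas w -> test_fun w phi -> LM w (hessian phi).
Proof.
move=> mw tphi i j; rewrite ent_hessian.
exact: (test_fun_L2 mw (test_fun_partial j (test_fun_partial i tphi))).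
Qed.

End MatrixFunctions.

Section H2Space.
Context {R : realType}.
Implicit Types (f g v phi : R * R -> R) (G Q : R * R -> 'M[R]_2) (x : R * R) (i j : 'I_2) (w : set (R * R)).
Local Notation mu := (leb2 R).

(** Sealed copies of the weak derivatives: their definition by choice must not
    be unfolded when terms are compared. *)
Fact D1_sig : {D : set (R * R) -> 'I_2 -> (R * R -> R) -> R * R -> R |
  forall w i v, wpartial w i v = D w i v}.
Proof. by exists (@wpartial R). Qed.
Fact D2_sig : {D : set (R * R) -> 'I_2 -> 'I_2 -> (R * R -> R) -> R * R -> R |
  forall w i j v, wpartial w j (wpartial w i v) = D w i j v}.
Proof. by exists (fun w i j v => wpartial w j (wpartial w i v)). Qed.
Fact Eps_sig : {E : set (R * R) -> (R * R -> R) -> R * R -> 'M[R]_2 |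
  forall w v, epsgrad w v = E w v}.
Proof. by exists (@epsgrad R). Qed.
Fact dd_sig : {D : set (R * R) -> (R * R -> 'M[R]_2) -> R * R -> R |
  forall w Q, divDiv w Q = D w Q}.
Proof. by exists (@divDiv R). Qed.

Definition D1 := sval D1_sig.
Definition D2 := sval D2_sig.
Definition Eps := sval Eps_sig.
Definition dd := sval dd_sig.

Lemma D1E w i v : wpartial w i v = D1 w i v. Proof. exact: (svalP D1_sig). Qed.
Lemma D2E w i j v : wpartial w j (wpartial w i v) = D2 w i j v. Proof. exact: (svalP D2_sig). Qed.
Lemma EpsE w v : epsgrad w v = Eps w v. Proof. exact: (svalP Eps_sig). Qed.
Lemma ddE w Q : divDiv w Q = dd w Q. Proof. exact: (svalP dd_sig). Qed.

Lemma ent_Eps w v i j : ent (Eps w v) i j = 2^-1 *: (D2 w i j v + D2 w j i v).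
Proof.
rewrite -EpsE -!D2E; apply/funext => x; rewrite /ent /epsgrad /eps /wjacobian !mxE.
have E k : (fun y => wgrad w v y k 0) = wpartial w k v.
  by apply/funext => y; rewrite /wgrad mxE.
by rewrite !E.
Qed.

Lemma Eps_sym w v x : symmetric_tensor (Eps w v x).
Proof.
rewrite /symmetric_tensor; apply/matrixP => i j; rewrite mxE.
have E k l : Eps w v x k l = ent (Eps w v) k l x by [].
by rewrite (E i j) (E j i) !ent_Eps (addrC (D2 w i j v)).
Qed.

(** The Hessian is described through [v] alone, without first derivatives:
    this is what the double divergence provides, and the regularity theorem
    below recovers the gradient. *)
Definition weak_hess w v G := forall i j phi, test_fun w phi ->
  ip w v (partial i (partial j phi)) = ip w (ent G i j) phi.

Lemma weak_hess_uniq w v G G' : open w -> LM w G -> LM w G' ->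
  weak_hess w v G -> weak_hess w v G' -> forall i j, ae_eq mu w (ent G i j) (ent G' i j).
Proof.
move=> ow LG LG' h h' i j.
apply: (L2_eq_tested ow (LG i j) (LG' i j)) => a1 b1 a2 b2 n hr.
have t := rect_test_fun n hr; rewrite -(h i j _ t); exact: h'.
Qed.

Lemma H1_D1 w v i : H1 w v -> L2 w (D1 w i v) /\ is_wpartial w i v (D1 w i v).
Proof. by move=> [_ h]; rewrite -D1E; exact: wpartial_spec. Qed.

Lemma H2_H1 w v : H2 w v -> H1 w v. Proof. by case. Qed.

Lemma H2_D1 w v i : H2 w v -> L2 w (D1 w i v) /\ is_wpartial w i v (D1 w i v).
Proof. by move=> /H2_H1; exact: H1_D1. Qed.

Lemma H2_D2 w v i j : H2 w v ->
  L2 w (D2 w i j v) /\ is_wpartial w j (D1 w i v) (D2 w i j v).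
Proof.
move=> [_ h]; rewrite -D2E -D1E; apply: wpartial_spec; case: (h i) => _ {}h; exact: h.
Qed.

Lemma H2_L2 w v : H2 w v -> L2 w v. Proof. by case=> -[]. Qed.

Lemma H2_D2_tested w v i j phi : H2 w v -> test_fun w phi ->
  ip w v (partial i (partial j phi)) = ip w (D2 w i j v) phi.
Proof.
move=> hv tphi; have [_ h1] := H2_D1 i hv; have [_ h2] := H2_D2 i j hv.
rewrite (h1 _ (test_fun_partial j tphi)) (h2 _ tphi); exact: opprK.
Qed.

(** The distributional mixed derivatives agree because they do on the
    rectangle bumps. *)
Lemma H2_hess_sym w v i j : open w -> H2 w v -> ae_eq mu w (D2 w i j v) (D2 w j i v).
Proof.
move=> ow hv; have [L1 _] := H2_D2 i j hv; have [L2' _] := H2_D2 j i hv.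
apply: (L2_eq_tested ow L1 L2') => a1 b1 a2 b2 n hr; have t := rect_test_fun n hr.
rewrite -(H2_D2_tested i j hv t) rect_test_mixed; exact: H2_D2_tested.
Qed.

Lemma Eps_D2_ae w v i j : open w -> H2 w v -> ae_eq mu w (ent (Eps w v) i j) (D2 w i j v).
Proof.
move=> ow hv; rewrite ent_Eps; apply: filterS (H2_hess_sym i j ow hv) => x h wx.
have -> : (2^-1 *: (D2 w i j v + D2 w j i v)) x = 2^-1 * (D2 w i j v x + D2 w j i v x) by [].
by rewrite -(h wx); lra.
Qed.

Lemma H2_LM w v : open w -> H2 w v -> LM w (Eps w v).
Proof.
move=> ow hv i j; have mw := open_measurable2 ow.
have [L1 _] := H2_D2 i j hv; have [L2' _] := H2_D2 j i hv.
rewrite ent_Eps; apply: (si_scale (L2_semi_inner mw)).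
exact: (si_add (L2_semi_inner mw)).
Qed.

Lemma H2_weak_hess w v : open w -> H2 w v -> weak_hess w v (Eps w v).
Proof.
move=> ow hv i j phi tphi; have mw := open_measurable2 ow.
rewrite (H2_D2_tested i j hv tphi); apply/esym/ip_ae => //.
- exact: H2_LM.
- by case: (H2_D2 i j hv).
- exact: (test_fun_L2 mw tphi).
- exact: Eps_D2_ae.
Qed.

Lemma Eps_ae w v G : open w -> H2 w v -> LM w G -> weak_hess w v G ->
  forall i j, ae_eq mu w (ent (Eps w v) i j) (ent G i j).
Proof.
move=> ow hv LG h; exact: (weak_hess_uniq ow (H2_LM ow hv) LG (H2_weak_hess ow hv) h).
Qed.

Lemma H2_intro w v (g : 'I_2 -> R * R -> R) (h : 'I_2 -> 'I_2 -> R * R -> R) : open w ->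
  L2 w v -> (forall i, L2 w (g i)) -> (forall i j, L2 w (h i j)) ->
  (forall i, is_wpartial w i v (g i)) -> (forall i j, is_wpartial w j (g i) (h i j)) ->
  H2 w v.
Proof.
move=> ow Lv Lg Lh vg gh; have mw := open_measurable2 ow.
split; first by split => // i; exists (g i).
move=> i; have [L1 h1] := wpartial_spec (ex_intro _ (g i) (conj (Lg i) (vg i))).
have E := is_wpartial_uniq ow (Lg i) L1 (vg i) h1.
by split => // j; exists (h i j); split => //; exact: (is_wpartial_ae mw (Lg i) L1 E (gh i j)).
Qed.

Lemma D1_ae w v i g : open w -> L2 w g -> is_wpartial w i v g -> ae_eq mu w (D1 w i v) g.
Proof. by rewrite -D1E; exact: wpartial_ae. Qed.

Lemma D2_ae w v i j g h : open w -> L2 w g -> L2 w h -> is_wpartial w i v g ->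
  is_wpartial w j g h -> ae_eq mu w (D2 w i j v) h.
Proof.
move=> ow Lg Lh vg gh; have mw := open_measurable2 ow; rewrite -D2E.
have [L1 h1] := wpartial_spec (ex_intro _ g (conj Lg vg)).
have E := is_wpartial_uniq ow Lg L1 vg h1.
exact: (wpartial_ae ow Lh (is_wpartial_ae mw Lg L1 E gh)).
Qed.

Lemma is_wpartial0 w i : pmeas w -> is_wpartial w i (0 : R * R -> R) 0.
Proof.
move=> mw phi tphi; have L := test_fun_L2 mw tphi.
have L' := test_fun_L2 mw (test_fun_partial i tphi).
have Z f : L2 w f -> ip w 0 f = 0.
  by move=> Lf; have := si_scalel (L2_semi_inner mw) 0 (L2_0 mw) Lf; rewrite scale0r mul0r.
by rewrite (Z _ L) (Z _ L') oppr0.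
Qed.

Lemma H1_subspace w : open w -> subspace (H1 w).
Proof.
move=> ow; have mw := open_measurable2 ow; split.
  split; first exact: L2_0.
  by move=> i; exists 0; split; [exact: L2_0|exact: is_wpartial0].
move=> a u v [Lu hu] [Lv hv]; split; first exact: L2_lin.
move=> i; have [g [Lg ug]] := hu i; have [h [Lh vh]] := hv i.
by exists (a *: g + h); split; [exact: L2_lin|exact: is_wpartial_lin].
Qed.

Lemma H2_subspace w : open w -> subspace (H2 w).
Proof.
move=> ow; have mw := open_measurable2 ow; split.
  by apply: (@H2_intro _ _ (fun=> 0) (fun _ _ => 0) ow) => *; try exact: L2_0; exact: is_wpartial0.
move=> a u v hu hv.
apply: (@H2_intro _ _ (fun i => a *: D1 w i u + D1 w i v)
   (fun i j => a *: D2 w i j u + D2 w i j v) ow) => [|i|i j|i|i j].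
- exact: (L2_lin a mw (H2_L2 hu) (H2_L2 hv)).
- by case: (H2_D1 i hu) (H2_D1 i hv) => ? _ [? _]; exact: L2_lin.
- by case: (H2_D2 i j hu) (H2_D2 i j hv) => ? _ [? _]; exact: L2_lin.
- case: (H2_D1 i hu) (H2_D1 i hv) => ? ? [? ?].
  by apply: is_wpartial_lin => //; exact: H2_L2.
- case: (H2_D2 i j hu) (H2_D2 i j hv) => ? ? [? ?].
  case: (H2_D1 i hu) (H2_D1 i hv) => ? ? [? ?].
  exact: is_wpartial_lin.
Qed.

Lemma id_map w S : S `<=` L2 w -> L2map S w (fun v : R * R -> R => v).
Proof. by move=> ss; split => // a x y _ _; exact: ae_eq_refl. Qed.

Lemma D1_map w i : open w -> L2map (H1 w) w (D1 w i).
Proof.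
move=> ow; have mw := open_measurable2 ow; split=> [v hv|a u v hu hv].
  by case: (H1_D1 i hv).
have [L1 h1] := H1_D1 i hu; have [L2' h2] := H1_D1 i hv.
apply: (D1_ae ow (L2_lin a mw L1 L2')).
exact: (is_wpartial_lin a mw hu.1 hv.1 L1 L2' h1 h2).
Qed.

Lemma D2_map w i j : open w -> L2map (H2 w) w (D2 w i j).
Proof.
move=> ow; have mw := open_measurable2 ow; split=> [v hv|a u v hu hv].
  by case: (H2_D2 i j hv).
case: (H2_D2 i j hu) (H2_D2 i j hv) => a1 b1 [a2 b2].
case: (H2_D1 i hu) (H2_D1 i hv) => a3 b3 [a4 b4].
apply: (@D2_ae _ _ _ _ (a *: D1 w i u + D1 w i v) _ ow (L2_lin a mw a3 a4) (L2_lin a mw a1 a2)).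
  exact: (is_wpartial_lin a mw (H2_L2 hu) (H2_L2 hv) a3 a4 b3 b4).
exact: is_wpartial_lin.
Qed.

Lemma Eps_map w i j : open w -> L2map (H2 w) w (fun v => ent (Eps w v) i j).
Proof.
move=> ow; have mw := open_measurable2 ow; split=> [v hv|a u v hu hv].
  exact: H2_LM.
have huv := (H2_subspace ow).2 a _ _ hu hv.
have h4 := L2map_lin (D2_map i j ow) a hu hv.
have h1 := Eps_D2_ae i j ow hu; have h2 := Eps_D2_ae i j ow hv.
have h3 := Eps_D2_ae i j ow huv.
apply: filterS (filterI (filterI h1 h2) (filterI h3 h4)) => x [[k1 k2] [k3 k4]] wx.
by rewrite (k3 wx) (k4 wx) !linE (k1 wx) (k2 wx).
Qed.

Lemma H2_sub w w' v : open w -> open w' -> w' `<=` w -> H2 w v -> H2 w' v.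
Proof.
move=> ow ow' sw hv; have mw := open_measurable2 ow; have mw' := open_measurable2 ow'.
apply: (@H2_intro _ _ (fun i => D1 w i v) (fun i j => D2 w i j v) ow') => [|i|i j|i|i j].
- exact: L2_subset (H2_L2 hv).
- by case: (H2_D1 i hv) => h _; exact: (L2_subset mw mw' sw h).
- by case: (H2_D2 i j hv) => h _; exact: (L2_subset mw mw' sw h).
- by case: (H2_D1 i hv) => _ h; exact: (is_wpartial_sub mw mw' sw h).
- by case: (H2_D2 i j hv) => _ h; exact: (is_wpartial_sub mw mw' sw h).
Qed.

Lemma weak_hess_sub w w' v G : open w -> open w' -> w' `<=` w ->
  weak_hess w v G -> weak_hess w' v G.
Proof.
move=> ow ow' sw h i j phi tphi; have mw := open_measurable2 ow; have mw' := open_measurable2 ow'.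
rewrite -(ip_test _ mw mw' sw (test_fun_partial i (test_fun_partial j tphi))).
rewrite -(ip_test _ mw mw' sw tphi); exact: (h i j _ (test_fun_subset sw tphi)).
Qed.

Lemma Eps_sub w w' v : open w -> open w' -> w' `<=` w -> H2 w v ->
  forall i j, ae_eq mu w' (ent (Eps w' v) i j) (ent (Eps w v) i j).
Proof.
move=> ow ow' sw hv; have mw := open_measurable2 ow; have mw' := open_measurable2 ow'.
apply: (Eps_ae ow' (H2_sub ow ow' sw hv)).
- exact: (LM_sub mw mw' sw (H2_LM ow hv)).
- exact: (weak_hess_sub ow ow' sw (H2_weak_hess ow hv)).
Qed.

Lemma H2_test w phi : open w -> test_fun w phi -> H2 w phi.
Proof.
move=> ow tphi; have mw := open_measurable2 ow.
have sphi := test_fun_smooth tphi.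
apply: (@H2_intro _ _ (fun i => partial i phi) (fun i j => partial j (partial i phi)) ow) => [|i|i j|i|i j].
- exact: (test_fun_L2 mw tphi).
- exact: (test_fun_L2 mw (test_fun_partial i tphi)).
- exact: (test_fun_L2 mw (test_fun_partial j (test_fun_partial i tphi))).
- exact: (is_wpartial_smooth i mw sphi).
- exact: (is_wpartial_smooth j mw (smooth_partial i sphi)).
Qed.

Lemma D1_test_ae w phi i : open w -> test_fun w phi -> ae_eq mu w (D1 w i phi) (partial i phi).
Proof.
move=> ow tphi; have mw := open_measurable2 ow.
apply: (D1_ae ow (test_fun_L2 mw (test_fun_partial i tphi))).
exact: (is_wpartial_smooth i mw (test_fun_smooth tphi)).
Qed.

Lemma D2_test_ae w phi i j : open w -> test_fun w phi ->
  ae_eq mu w (D2 w i j phi) (partial j (partial i phi)).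
Proof.
move=> ow tphi; have mw := open_measurable2 ow; have sphi := test_fun_smooth tphi.
have t1 := test_fun_partial i tphi.
apply: (@D2_ae _ _ _ _ (partial i phi) _ ow (test_fun_L2 mw t1) (test_fun_L2 mw (test_fun_partial j t1))).
- exact: (is_wpartial_smooth i mw sphi).
- exact: (is_wpartial_smooth j mw (smooth_partial i sphi)).
Qed.

Lemma Eps_test_ae w phi i j : open w -> test_fun w phi ->
  ae_eq mu w (ent (Eps w phi) i j) (partial j (partial i phi)).
Proof.
move=> ow tphi; have h1 := Eps_D2_ae i j ow (H2_test ow tphi).
exact: (ae_eq_trans h1 (D2_test_ae i j ow tphi)).
Qed.

Lemma H2_ae w v v' : open w -> L2 w v' -> ae_eq mu w v v' -> H2 w v -> H2 w v'.
Proof.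
move=> ow Lv' E hv; have mw := open_measurable2 ow.
apply: (@H2_intro _ _ (fun i => D1 w i v) (fun i j => D2 w i j v) ow Lv') => [i|i j|i|i j].
- by case: (H2_D1 i hv).
- by case: (H2_D2 i j hv).
- by case: (H2_D1 i hv) => _ h; exact: (is_wpartial_ae mw (H2_L2 hv) Lv' E h).
- by case: (H2_D2 i j hv).
Qed.

Lemma D1_ext w i v v' : pmeas w -> L2 w v -> L2 w v' -> ae_eq mu w v v' -> D1 w i v = D1 w i v'.
Proof. by move=> mw Lv Lv' E; rewrite -!D1E; exact: wpartial_ext. Qed.

Lemma D2_ext w i j v v' : pmeas w -> L2 w v -> L2 w v' -> ae_eq mu w v v' -> D2 w i j v = D2 w i j v'.
Proof. by move=> mw Lv Lv' E; rewrite -!D2E (wpartial_ext i mw Lv Lv' E). Qed.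

Lemma Eps_ext w v v' : pmeas w -> L2 w v -> L2 w v' -> ae_eq mu w v v' -> Eps w v = Eps w v'.
Proof.
move=> mw Lv Lv' E; apply/funext => x; apply/matrixP => i j.
have K u : Eps w u x i j = ent (Eps w u) i j x by [].
by rewrite !K !ent_Eps (D2_ext i j mw Lv Lv' E) (D2_ext j i mw Lv Lv' E).
Qed.

Definition H1form w u v : R := ip w u v + \sum_i ip w (D1 w i u) (D1 w i v).
Definition H2form w u v : R :=
  H1form w u v + \sum_i \sum_j ip w (D2 w i j u) (D2 w i j v).

Lemma H1normsqE w v : H1normsq w v = H1form w v v.
Proof. by rewrite /H1normsq /H1form; congr (_ + _); apply: eq_bigr => i _; rewrite D1E. Qed.

Lemma H2normsqE w v : H2normsq w v = H2form w v v.
Proof.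
rewrite /H2normsq /H2form /H1form -addrA; congr (_ + _).
rewrite -big_split; apply: eq_bigr => i _.
rewrite /H1normsq D1E; congr (_ + _); apply: eq_bigr => j _.
by rewrite -D2E -D1E.
Qed.

Lemma H1form_inner w : open w -> semi_inner (H1 w) (@H1form w).
Proof.
move=> ow; have mw := open_measurable2 ow; have S := H1_subspace ow.
have h1 := L2map_inner mw S (@id_map w (H1 w) (fun v hv => hv.1)).
have h2 := si_sum S (fun i => L2map_inner mw S (D1_map i ow)).
have := si_plus h1 h2 ler01; congr (semi_inner _ _).
by apply/funext => u; apply/funext => v; rewrite mul1r.
Qed.

Lemma H2form_inner w : open w -> semi_inner (H2 w) (@H2form w).
Proof.
move=> ow; have mw := open_measurable2 ow; have S := H2_subspace ow.
have h1 := si_subset S (@H2_H1 w) (H1form_inner ow).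
have h2 := si_sum S (fun i => si_sum S (fun j => L2map_inner mw S (D2_map i j ow))).
have := si_plus h1 h2 ler01; congr (semi_inner _ _).
by apply/funext => u; apply/funext => v; rewrite mul1r.
Qed.

End H2Space.

(** * Regularity on Lipschitz domains *)

Section SmoothTaylor.
Context {R : realType}.
Implicit Types (F phi : R * R -> R) (x y z : R * R) (i j : 'I_2).

Lemma mvt_line (f df : R -> R) (a b : R) : (forall t : R, is_derive t 1 f (df t)) ->
  exists2 c, `|c - a| <= `|b - a| & f b - f a = df c * (b - a).
Proof.
move=> hf; have cf : continuous f.
  by move=> t; apply/differentiable_continuous/derivable1_diffP; case: (hf t).
have [ab|ba|<-] := ltgtP a b.
- have [c] := @MVT _ f df a b ab (fun t _ => hf t) (continuous_subspaceT cf).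
  by rewrite in_itv/= => /andP[h1 h2] e; exists c => //; rewrite !ger0_norm ?subr_ge0; lra.
- have [c] := @MVT _ f df b a ba (fun t _ => hf t) (continuous_subspaceT cf).
  rewrite in_itv/= => /andP[h1 h2] e; exists c; last by rewrite -opprB e -mulrN opprB.
  by rewrite !ler0_norm ?subr_le0; lra.
- by exists a; rewrite ?subrr ?mulr0.
Qed.

Lemma is_derive_upd F i x (t : R) : smooth F ->
  is_derive t 1 (F \o upd i x) (partial i F (upd i x t)).
Proof.
move=> sF; have := is_derive_partial i (upd i x t) (smooth_der sF).
move=> /(is_derive_slice i F (upd i x t) _).2.
have -> : crd i (upd i x t) = t by rewrite crd_upd eqxx.
suff -> : F \o upd i (upd i x t) = F \o upd i x by [].
by apply/funext => s; rewrite /= /upd; case: (i == ord0).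
Qed.

Lemma mvt_slice F i x (t : R) : smooth F -> exists2 c, `|c - crd i x| <= `|t - crd i x| &
  F (upd i x t) - F x = partial i F (upd i x c) * (t - crd i x).
Proof.
move=> sF; have [c hc e] := mvt_line (crd i x) t (fun t => is_derive_upd i x t sF).
by exists c => //; rewrite -e /= upd_crd.
Qed.

Notation i0 := (ord0 : 'I_2).
Notation i1 := (lift ord0 ord0 : 'I_2).

Lemma smooth_lipschitz F M x y : smooth F -> (forall i z, `|partial i F z| <= M) ->
  `|F y - F x| <= M * (`|y.1 - x.1| + `|y.2 - x.2|).
Proof.
move=> sF hM.
have [c _ e1] := mvt_slice i0 x y.1 sF.
have [c' _ e2] := mvt_slice i1 (y.1, x.2) y.2 sF.
have -> : F y - F x = (F (upd i1 (y.1, x.2) y.2) - F (y.1, x.2)) + (F (upd i0 x y.1) - F x).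
  by rewrite /upd /= -surjective_pairing; ring.
rewrite e1 e2 /crd /=; apply: le_trans (ler_normD _ _) _; rewrite !normrM.
rewrite mulrDr addrC; apply: lerD; apply: ler_wpM2r => //; exact: hM.
Qed.

Lemma partial_cst i (a : R) : partial i (cst a : R * R -> R) = 0.
Proof. by apply/funext => x; rewrite /partial derive_cst. Qed.

Lemma partial_scale i (a : R) F : smooth F -> partial i (a *: F) = a *: partial i F.
Proof.
by move=> sF; apply/funext => x; rewrite /partial deriveZ//; exact: (smooth_der sF).
Qed.

Definition dirp z F := z.1 *: partial i0 F + z.2 *: partial i1 F.

Lemma smooth_scale (a : R) F : smooth F -> smooth (a *: F).
Proof.
move=> sF; have -> : a *: F = a *: F + cst 0 by apply/funext => x; rewrite linE addr0.
exact: (smooth_lin a sF (smooth_cst 0)).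
Qed.

Lemma smooth_dirp z F : smooth F -> smooth (dirp z F).
Proof.
move=> sF; exact: (smooth_lin z.1 (smooth_partial i0 sF) (smooth_scale z.2 (smooth_partial i1 sF))).
Qed.

(** Two mean value steps along the axes. *)
Lemma smooth_taylor F M x z : smooth F -> (forall i j y, `|partial i (partial j F) y| <= M) ->
  `|F (x + z) - F x - dirp z F x| <= M * (`|z.1| + `|z.2|) ^+ 2.
Proof.
move=> sF hM.
have M0 : 0 <= M by apply: le_trans (hM i0 i0 x).
have [c hc e1] := mvt_slice i0 (x.1, (x + z).2) (x + z).1 sF.
have [c' hc' e2] := mvt_slice i1 x (x + z).2 sF.
move: e1 e2 hc hc'; rewrite /upd /crd /= -/(x.1 + z.1) -/(x.2 + z.2).
have -> : ((x.1 + z.1, x.2 + z.2) : R * R) = x + z by [].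
have -> : x.1 + z.1 - x.1 = z.1 by ring.
have -> : x.2 + z.2 - x.2 = z.2 by ring.
move=> e1 e2 hc hc'.
have -> : F (x + z) - F x - dirp z F x =
   (partial i0 F (c, x.2 + z.2) - partial i0 F x) * z.1 + (partial i1 F (x.1, c') - partial i1 F x) * z.2.
  have -> : F (x + z) - F x = (F (x + z) - F (x.1, x.2 + z.2)) + (F (x.1, x.2 + z.2) - F x) by ring.
  rewrite e1 e2; have -> : dirp z F x = z.1 * partial i0 F x + z.2 * partial i1 F x by [].
  ring.
have h1 := smooth_lipschitz x (c, x.2 + z.2) (smooth_partial i0 sF) (fun i => hM i i0).
have h2 := smooth_lipschitz x (x.1, c') (smooth_partial i1 sF) (fun i => hM i i1).
move: h1 h2; rewrite /= subrr normr0 add0r.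
have -> : x.2 + z.2 - x.2 = z.2 by ring.
move: (partial i0 F (c, x.2 + z.2) - partial i0 F x) => A.
move: (partial i1 F (x.1, c') - partial i1 F x) => B h1 h2.
apply: le_trans (ler_normD _ _) _; rewrite !normrM expr2 mulrA mulrDr.
apply: lerD; apply: ler_wpM2r => //.
  by apply: le_trans h1 _; apply: ler_wpM2l => //; rewrite lerD2r.
by apply: le_trans h2 _; apply: ler_wpM2l => //; rewrite ler_wpDl.
Qed.

Definition translate z F := fun x => F (x - z).

Lemma growth_translate i z F x :
  (fun h : R => h^-1 *: ((translate z F \o shift x) (h *: ebase i) - translate z F x)) =
  (fun h : R => h^-1 *: ((F \o shift (x - z)) (h *: ebase i) - F (x - z))).
Proof. by apply/funext => h; rewrite /translate /= addrA. Qed.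

Lemma partial_translate i z F : partial i (translate z F) = translate z (partial i F).
Proof.
by apply/funext => x; rewrite /partial /derive growth_translate.
Qed.

Lemma translate_cont z F : continuous F -> continuous (translate z F).
Proof.
move=> cF x; apply: (continuous_comp (f := fun y => y - z)); last exact: cF.
by apply: cvgB; [exact: cvg_id|exact: cvg_cst].
Qed.

Lemma smooth_translate z F : smooth F -> smooth (translate z F).
Proof.
move=> sF; apply: (@smooth_stable _ [set H | exists2 F, smooth F & H = translate z F]); last by exists F.
move=> _ [{sF}F sF ->]; split.
- exact: (translate_cont (smooth_cont sF)).
- move=> i x; rewrite /derivable growth_translate; exact: (@smooth_der R F sF i (x - z)).
- by move=> i; exists (partial i F); [exact: (smooth_partial i sF)|exact: partial_translate].
Qed.

Lemma dirp_translate z' z F : dirp z' (translate z F) = translate z (dirp z' F).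
Proof. by apply/funext => x; rewrite /dirp !partial_translate. Qed.

Lemma test_fun_translate w z phi : (forall x, closure [set x | phi x != 0] x -> w (x + z)) ->
  test_fun setT phi -> test_fun w (translate z phi).
Proof.
move=> h [sphi cphi _].
pose K := (fun x => x + z) @` closure [set x | phi x != 0].
have cK : compact K.
  apply: continuous_compact => //; apply: continuous_subspaceT => x.
  by apply: cvgD; [exact: cvg_id|exact: cvg_cst].
have sK : closure [set x | translate z phi x != 0] `<=` K.
  have clK : closed K by apply: compact_closed => //; exact: norm_hausdorff.
  rewrite [X in _ `<=` X](closure_id _).1//; apply: closureS => x hx.
  by exists (x - z); [exact: subset_closure|rewrite subrK].
split.
- exact: (smooth_translate z sphi).
- by apply: subclosed_compact cK _ => //; exact: closed_closure.
- by move=> x /sK[y hy <-]; exact: h.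
Qed.

Lemma test_fun_bound w phi : test_fun w phi -> exists2 M, 0 < M & forall x, `|phi x| <= M.
Proof.
move=> tphi; have [r r0 or] := test_fun_box tphi.
have [M M0 hM] := continuous_compact_bound (smooth_cont (test_fun_smooth tphi)) (@box_compact R r).
exists M => // x; have [/hM//|/boxNP/or ->] := pselect (box r x).
by rewrite normr0 ltW.
Qed.

Lemma test_fun_bound2 w phi : test_fun w phi ->
  exists2 M, 0 < M & forall i j x, `|partial i (partial j phi) x| <= M.
Proof.
move=> tphi.
have /choice[M hM] : forall ij : 'I_2 * 'I_2, exists M, 0 < M /\ forall x, `|partial ij.1 (partial ij.2 phi) x| <= M.
  by move=> [i j]; have [M] := test_fun_bound (test_fun_partial i (test_fun_partial j tphi)); exists M.
exists (\sum_ij M ij).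
  rewrite (bigD1 (i0, i0))//=; apply: ltr_wpDr; last exact: (hM _).1.
  by apply: sumr_ge0 => ij _; apply: ltW; exact: (hM _).1.
move=> i j x; apply: le_trans ((hM (i, j)).2 x) _; rewrite (bigD1 (i, j))//= lerDl.
by apply: sumr_ge0 => ij _; apply: ltW; exact: (hM _).1.
Qed.

End SmoothTaylor.

Section InnerExtra.
Context {R : realType}.
Implicit Types (f g : R * R -> R) (w : set (R * R)).
Local Notation mu := (leb2 R).

Lemma ip_le w f g : pmeas w -> L2 w f -> L2 w g -> (forall x, w x -> `|f x| <= `|g x|) ->
  ip w f f <= ip w g g.
Proof.
move=> mw Lf Lg h; apply: le_Rintegral => //; try exact: L2_mul_integrable.
move=> x wx; rewrite -!expr2 -[f x ^+ 2]real_normK ?num_real// -[g x ^+ 2]real_normK ?num_real//.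
by rewrite ler_pXn2r ?nnegrE//; exact: h.
Qed.

Lemma ip_eq w f g f' g' : (forall x, f x * g x = f' x * g' x) -> ip w f g = ip w f' g'.
Proof. by move=> h; apply: eq_Rintegral => x _; exact: h. Qed.

End InnerExtra.

(* Comparing terms with different derivatives must not unfold them. *)
Opaque partial ip.

Section Translates.
Context {R : realType}.
Implicit Types (F phi f g v : R * R -> R) (G : R * R -> 'M[R]_2) (x y z : R * R) (i j : 'I_2) (w : set (R * R)).
Local Notation mu := (leb2 R).
Notation i0 := (ord0 : 'I_2).
Notation i1 := (lift ord0 ord0 : 'I_2).

Lemma bounded_in_box w : bounded_set w -> exists2 r, 0 < r & w `<=` box r.
Proof.
move=> [M [_ hM]]; exists (`|M| + 1); first by rewrite ltr_wpDl.
have /hM hb : M < `|M| + 1 by rewrite (le_lt_trans (ler_norm M))// ltrDl.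
move=> x /hb; rewrite /= prod_normE ge_max => /andP[h1 h2].
by split; rewrite /= in_itv /= -ler_norml.
Qed.

Lemma L2_continuous w F : bounded_set w -> pmeas w -> continuous F -> L2 w F.
Proof.
move=> bw mw cF; have [r r0 wr] := bounded_in_box bw.
have [M M0 hM] := continuous_compact_bound cF (@box_compact R r).
apply: (@L2_bound R w F (\1_(ccrect (- r) r (- r) r)) M mw).
- by apply: measurable_funTS; exact: continuous_measurable2.
- exact: indic_rect_L2.
- by move=> x /wr hx; rewrite indicE mem_set//= normr1 mulr1; exact: hM.
Qed.

Lemma ip_nrm w f g : pmeas w -> L2 w f -> L2 w g -> `|ip w f g| <= nrm w f * nrm w g.
Proof.
move=> mw Lf Lg; rewrite /nrm -sqrtrM ?ip_ge0// -sqrtr_sqr ler_wsqrtr//.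
exact: (cauchy_schwarz (L2_semi_inner mw)).
Qed.

Lemma ip_sup_bound w v : bounded_set w -> pmeas w -> L2 w v ->
  exists2 c, 0 <= c & forall F M, continuous F -> (forall x, `|F x| <= M) -> `|ip w v F| <= c * M.
Proof.
move=> bw mw Lv; have L1 := L2_continuous bw mw (@cst_continuous (R * R)%type R 1).
exists (nrm w v * nrm w (cst 1)); first by rewrite mulr_ge0 ?sqrtr_ge0.
move=> F M cF hM; have LF := L2_continuous bw mw cF.
have M0 : 0 <= M by apply: le_trans (hM 0).
apply: le_trans (ip_nrm mw Lv LF) _; rewrite -mulrA; apply: ler_wpM2l; first exact: sqrtr_ge0.
have LM1 : L2 w (M *: cst 1) := si_scale (L2_semi_inner mw) M L1.
rewrite -[X in _ <= _ * X]ger0_norm// -sqrtr_sqr /nrm -sqrtrM ?ip_ge0//; apply: ler_wsqrtr.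
have -> : ip w (cst 1) (cst 1) * M ^+ 2 = ip w (M *: cst 1) (M *: cst 1).
  rewrite (si_scalel (L2_semi_inner mw))// (si_scaler (L2_semi_inner mw))//; ring.
apply: ip_le => // x _; rewrite (_ : (M *: cst 1) x = M * 1)// mulr1 (ger0_norm M0); exact: hM.
Qed.

Lemma is_derive_quad (f : R -> R) (s d K : R) :
  (forall t, `|f (s + t) - f s - t * d| <= K * t ^+ 2) -> is_derive s 1 f d.
Proof.
move=> h; pose g t := f (s + t) - f s - t * d.
have hg : is_derive (0 : R) 1 g 0 by exact: (@is_derive0_sq R g K).
have -> : f = (g \o (fun u => u - s)) + ((fun u => (u - s) * d) + cst (f s)).
  apply/funext => u; have -> : (g \o (fun u => u - s) + ((fun u => (u - s) * d) + cst (f s))) u =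
   g (u - s) + ((u - s) * d + f s) by [].
  by rewrite /g (_ : s + (u - s) = u); ring.
have h1 : is_derive s 1 (fun u : R => u - s) 1.
  by have := is_deriveB (is_derive_id s 1) (is_derive_cst s s 1); rewrite subr0.
have h2 : is_derive s 1 (g \o (fun u => u - s)) (0 * 1).
  by apply: is_derive1_comp => //; rewrite subrr.
have h3 : is_derive s 1 (fun u : R => (u - s) * d) d.
  have := is_deriveM h1 (is_derive_cst d s 1).
  by rewrite /GRing.scale/= mulr0 add0r mulr1.
have := is_deriveD h2 (is_deriveD h3 (is_derive_cst (f s) s 1)).
by rewrite mul0r add0r addr0.
Qed.

Lemma test_fun_scale w (a : R) phi : test_fun w phi -> test_fun w (a *: phi).
Proof.
move=> t; have -> : a *: phi = a *: phi + 0 by rewrite addr0.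
exact: (test_fun_lin a t (test_fun0 w)).
Qed.

Lemma test_fun_dirp w z phi : test_fun w phi -> test_fun w (dirp z phi).
Proof.
move=> t; apply: (test_fun_lin z.1 (test_fun_partial i0 t)).
exact: (test_fun_scale z.2 (test_fun_partial i1 t)).
Qed.

(** Taylor's formula with a uniform remainder, integrated against [v]. *)
Lemma is_derive_ip_translate w v z phi (s : R) : bounded_set w -> pmeas w -> L2 w v ->
  test_fun setT phi ->
  is_derive s 1 (fun s => ip w v (translate (s *: z) phi)) (- ip w v (translate (s *: z) (dirp z phi))).
Proof.
move=> bw mw Lv tphi; have sphi := test_fun_smooth tphi.
have [M M0 hM] := test_fun_bound2 tphi.
have [c c0 hc] := ip_sup_bound bw mw Lv.
apply: (@is_derive_quad _ _ _ (c * (M * (`|z.1| + `|z.2|) ^+ 2))) => t.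
have ct (a : R) : continuous (translate (a *: z) phi) := translate_cont (smooth_cont sphi).
have cd : continuous (translate (s *: z) (dirp z phi)) := translate_cont (smooth_cont (smooth_dirp z sphi)).
have LL F : continuous F -> L2 w F := @L2_continuous w F bw mw.
have HL := L2_semi_inner mw.
have -> : ip w v (translate ((s + t) *: z) phi) - ip w v (translate (s *: z) phi) -
  t * - ip w v (translate (s *: z) (dirp z phi)) =
  ip w v (t *: translate (s *: z) (dirp z phi) + (translate ((s + t) *: z) phi - translate (s *: z) phi)).
  have l1 := LL _ cd; have l2 := LL _ (ct (s + t)); have l3 := LL _ (ct s).
  rewrite (si_linr HL t l1 (si_sub HL l2 l3) Lv) (si_subr HL l2 l3 Lv).
  by move: (ip w v _) (ip w v _) (ip w v _) => a1 a2 a3; ring.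
rewrite -mulrA; apply: hc.
  apply: continuous_lin => //; move=> x.
  apply: cvgB; exact: ct.
move=> x; have := smooth_taylor (x - s *: z) (- t *: z) sphi hM.
have -> : `|(- t *: z).1| + `|(- t *: z).2| = `|t| * (`|z.1| + `|z.2|).
  by rewrite /= /GRing.scale/= !normrM normrN -mulrDr.
rewrite exprMn real_normK ?num_real// mulrCA mulrC.
have -> : x - s *: z + - t *: z = x - (s + t) *: z by rewrite scaleNr scalerDl opprD addrA.
have -> : dirp (- t *: z) phi (x - s *: z) = - t * dirp z phi (x - s *: z).
  have E z' y : dirp z' phi y = z'.1 * partial i0 phi y + z'.2 * partial i1 phi y by [].
  by rewrite !E /= /GRing.scale/=; ring.
have -> : (t *: translate (s *: z) (dirp z phi) + (translate ((s + t) *: z) phi - translate (s *: z) phi)) x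
  = t * dirp z phi (x - s *: z) + (phi (x - (s + t) *: z) - phi (x - s *: z)) by [].
move: (dirp z phi _) (phi _) (phi _) => A B D.
by have -> : D - B - - t * A = t * A + (D - B) by ring.
Qed.

(** Landau's inequality: the derivative at the endpoint is a difference
    quotient up to second derivatives. *)
Lemma derivative_bound (h h1 h2 : R -> R) (A K tau : R) : 0 < tau ->
  (forall s : R, is_derive s 1 h (h1 s)) -> (forall s : R, is_derive s 1 h1 (h2 s)) ->
  (forall s, 0 <= s <= tau -> `|h s| <= A) -> (forall s, 0 <= s <= tau -> `|h2 s| <= K) ->
  `|h1 0| <= 2 * A / tau + K * tau.
Proof.
move=> t0 dh dh1 hA hK.
have ct (f df : R -> R) : (forall s : R, is_derive s 1 f (df s)) -> continuous f.
  by move=> hf t; apply/differentiable_continuous/derivable1_diffP; case: (hf t).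
have [c] := @MVT _ h h1 0 tau t0 (fun t _ => dh t) (continuous_subspaceT (ct _ _ dh)).
rewrite in_itv/= subr0 => /andP[c0 ctau] e1.
have [c'] := @MVT _ h1 h2 0 c c0 (fun t _ => dh1 t) (continuous_subspaceT (ct _ _ dh1)).
rewrite in_itv/= subr0 => /andP[c'0 c'c] e2.
have -> : h1 0 = (h tau - h 0) / tau - h2 c' * c.
  rewrite -e2 e1; field; exact: lt0r_neq0.
apply: le_trans (ler_normB _ _) _; apply: lerD.
  rewrite normrM normfV (gtr0_norm t0) ler_pM2r ?invr_gt0//.
  apply: le_trans (ler_normB _ _) _.
  by have := hA tau; have := hA 0; rewrite !lexx (ltW t0) => /(_ isT) a1 /(_ isT) a2; lra.
rewrite normrM (gtr0_norm c0); apply: ler_pM => //; first exact: ltW; last exact: ltW.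
by apply: hK; lra.
Qed.

Lemma ip_one_partial w i phi : pmeas w -> test_fun w phi -> ip w (cst 1) (partial i phi) = 0.
Proof.
move=> mw tphi; rewrite (ip_partial_smooth i mw tphi (smooth_cst 1)).
rewrite partial_cst.
have := si_scalel (L2_semi_inner mw) 0 (L2_0 mw) (test_fun_L2 mw tphi).
by rewrite scale0r mul0r => ->; rewrite oppr0.
Qed.

Lemma ip_dirp w v z phi : pmeas w -> L2 w v -> test_fun w phi ->
  ip w v (dirp z phi) = z.1 * ip w v (partial i0 phi) + z.2 * ip w v (partial i1 phi).
Proof.
move=> mw Lv t; have HL := L2_semi_inner mw.
have L0 := test_fun_L2 mw (test_fun_partial i0 t).
have L1 := test_fun_L2 mw (test_fun_partial i1 t).
by rewrite /dirp (si_linr HL _ L0 (si_scale HL _ L1) Lv) (si_scaler HL _ L1 Lv).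
Qed.

(** Translations that keep the support inside [w] preserve the L2 norm: the
    derivative of the norm along the translation is the integral of a
    derivative of a test function. *)
Lemma ip_translate w z phi (tau : R) : bounded_set w -> pmeas w -> test_fun w phi -> 0 < tau ->
  (forall s, 0 <= s <= tau -> test_fun w (translate (s *: z) phi)) ->
  forall s, 0 <= s <= tau ->
    ip w (translate (s *: z) phi) (translate (s *: z) phi) = ip w phi phi.
Proof.
move=> bw mw tphi tau0 tt s /andP[]; rewrite le_eqVlt => /predU1P[<- _|s0 stau].
  have -> // : translate (0 *: z) phi = phi.
  by apply/funext => x; rewrite /translate scale0r subr0.
have sphi := test_fun_smooth tphi.
pose q := fun x => phi x * phi x.
have tq : test_fun w q := test_funM tphi sphi.
have tqT : test_fun setT q := test_fun_subset (@subsetT _ w) tq.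
have L1 := L2_continuous bw mw (@cst_continuous (R * R)%type R 1).
have dn t := is_derive_ip_translate z t bw mw L1 tqT.
have E t : ip w (cst 1) (translate (t *: z) q) = ip w (translate (t *: z) phi) (translate (t *: z) phi).
  by apply: ip_eq => x; rewrite mul1r.
have cn : continuous (fun t : R => ip w (cst 1) (translate (t *: z) q)).
  by move=> t; apply/differentiable_continuous/derivable1_diffP; case: (dn t).
have [c] := @MVT _ _ _ 0 s s0 (fun t _ => dn t) (continuous_subspaceT cn).
rewrite in_itv/= => /andP[c0 cs].
have tc : test_fun w (translate (c *: z) q).
  have hc : 0 <= c <= tau by apply/andP; split; [exact: ltW|exact: le_trans (ltW cs) stau].
  exact: (test_funM (tt c hc) (smooth_translate _ sphi)).
rewrite -dirp_translate (ip_dirp z mw L1 tc) !(ip_one_partial _ mw tc) !mulr0 addr0 oppr0 mul0r.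
rewrite E scale0r => /eqP; rewrite subr_eq0 => /eqP ->.
by apply: ip_eq => x; rewrite /translate subr0 mul1r.
Qed.

Lemma weak_hess_dirp w v G z phi : pmeas w -> L2 w v -> LM w G -> weak_hess w v G -> test_fun w phi ->
  ip w v (dirp z (dirp z phi)) =
  ip w (z.1 *: (z.1 *: ent G i0 i0 + z.2 *: ent G i0 i1) +
        z.2 *: (z.1 *: ent G i1 i0 + z.2 *: ent G i1 i1)) phi.
Proof.
move=> mw Lv LG h t; have HL := L2_semi_inner mw.
have Lp := test_fun_L2 mw t.
have td := test_fun_dirp z t.
have E i : ip w v (partial i (dirp z phi)) =
   z.1 * ip w (ent G i i0) phi + z.2 * ip w (ent G i i1) phi.
  have s0 := smooth_der (smooth_partial i0 (test_fun_smooth t)).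
  have s1 := smooth_der (smooth_partial i1 (test_fun_smooth t)).
  have s1' := smooth_der (smooth_scale z.2 (smooth_partial i1 (test_fun_smooth t))).
  rewrite /dirp (partial_lin i z.1 s0 s1').
  rewrite (partial_scale i z.2 (smooth_partial i1 (test_fun_smooth t))).
  have L0 := test_fun_L2 mw (test_fun_partial i (test_fun_partial i0 t)).
  have L1 := test_fun_L2 mw (test_fun_partial i (test_fun_partial i1 t)).
  rewrite (si_linr HL _ L0 (si_scale HL _ L1) Lv) (si_scaler HL _ L1 Lv).
  by congr (_ * _ + _ * _); [exact: (h i i0 phi t)|exact: (h i i1 phi t)].
apply: (etrans (ip_dirp z mw Lv td)).
apply: (@etrans _ _ (z.1 * (z.1 * ip w (ent G i0 i0) phi + z.2 * ip w (ent G i0 i1) phi) +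
   z.2 * (z.1 * ip w (ent G i1 i0) phi + z.2 * ip w (ent G i1 i1) phi))).
  by congr (_ * _ + _ * _); [exact: (E i0)|exact: (E i1)].
have S i : L2 w (z.1 *: ent G i i0 + z.2 *: ent G i i1).
  exact: (L2_lin _ mw (LG i i0) (si_scale HL _ (LG i i1))).
have K i : ip w (z.1 *: ent G i i0 + z.2 *: ent G i i1) phi =
  z.1 * ip w (ent G i i0) phi + z.2 * ip w (ent G i i1) phi.
  by rewrite (si_linl HL _ (LG i i0) (si_scale HL _ (LG i i1)) Lp) (si_scalel HL _ (LG i i1) Lp).
by rewrite (si_linl HL _ (S i0) (si_scale HL _ (S i1)) Lp) (si_scalel HL _ (S i1) Lp) !K.
Qed.

(** If supports may be pushed inside [w] along [z], a function with square
    integrable second derivatives has a square integrable derivative along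
    [z]: it is a difference quotient up to second derivatives. *)
Lemma dirp_bound w v G N z (tau : R) : open w -> bounded_set w -> L2 w v -> LM w G ->
  weak_hess w v G -> 0 < tau ->
  (forall x s, w x -> N x -> 0 <= s <= tau -> w (x + s *: z)) ->
  exists2 c, 0 <= c & forall phi, test_fun (w `&` N) phi ->
    ip w v (dirp z phi) ^+ 2 <= c * ip w phi phi.
Proof.
move=> ow bw Lv LG h tau0 hN; have mw := open_measurable2 ow.
have HL := L2_semi_inner mw.
pose H := z.1 *: (z.1 *: ent G i0 i0 + z.2 *: ent G i0 i1) +
        z.2 *: (z.1 *: ent G i1 i0 + z.2 *: ent G i1 i1).
have LH : L2 w H.
  have S i : L2 w (z.1 *: ent G i i0 + z.2 *: ent G i i1).
    exact: (L2_lin _ mw (LG i i0) (si_scale HL _ (LG i i1))).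
  exact: (L2_lin _ mw (S i0) (si_scale HL _ (S i1))).
exists ((2 * nrm w v / tau + nrm w H * tau) ^+ 2); first exact: sqr_ge0.
move=> phi tN; have tphi : test_fun w phi := test_fun_subset (@subIsetl _ w N) tN.
have tT : test_fun setT phi := test_fun_subset (@subsetT _ w) tphi.
have tt s : 0 <= s <= tau -> test_fun w (translate (s *: z) phi).
  move=> hs; apply: (test_fun_translate _ tT) => x; case: tN => _ _ hx /hx[wx Nx]; exact: hN.
have nt s : 0 <= s <= tau -> nrm w (translate (s *: z) phi) = nrm w phi.
  by move=> hs; rewrite /nrm (ip_translate bw mw tphi tau0 tt hs).
have d1 s := is_derive_ip_translate z s bw mw Lv tT.
have d2 (s : R) : is_derive s 1 (fun s => - ip w v (translate (s *: z) (dirp z phi)))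
    (ip w v (translate (s *: z) (dirp z (dirp z phi)))).
  have := is_deriveN (is_derive_ip_translate z s bw mw Lv (test_fun_dirp z tT)).
  by rewrite opprK.
have := @derivative_bound _ _ _ (nrm w v * nrm w phi) (nrm w H * nrm w phi) tau tau0 d1 d2.
have hA s : 0 <= s <= tau -> `|ip w v (translate (s *: z) phi)| <= nrm w v * nrm w phi.
  move=> hs; rewrite -(nt s hs); exact: (ip_nrm mw Lv (test_fun_L2 mw (tt s hs))).
have hB s : 0 <= s <= tau -> `|ip w v (translate (s *: z) (dirp z (dirp z phi)))| <= nrm w H * nrm w phi.
  move=> hs; rewrite -!dirp_translate (weak_hess_dirp z mw Lv LG h (tt s hs)) -/H -(nt s hs).
  exact: (ip_nrm mw LH (test_fun_L2 mw (tt s hs))).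
move=> /(_ hA hB); rewrite normrN scale0r.
have -> : translate 0 (dirp z phi) = dirp z phi by apply/funext => x; rewrite /translate subr0.
have -> : 2 * (nrm w v * nrm w phi) / tau + nrm w H * nrm w phi * tau =
  (2 * nrm w v / tau + nrm w H * tau) * nrm w phi by ring.
have -> : ip w phi phi = nrm w phi ^+ 2 by rewrite sqr_sqrtr// ip_ge0.
rewrite -exprMn => hh; rewrite -real_normK ?num_real// ler_pXn2r ?nnegrE//.
apply: mulr_ge0; last exact: sqrtr_ge0.
apply: addr_ge0; [apply: divr_ge0|apply: mulr_ge0]; try exact: ltW; try exact: sqrtr_ge0.
by apply: mulr_ge0 => //; exact: sqrtr_ge0.
Qed.

End Translates.

Section Regularity.
Context {R : realType}.
Implicit Types (F phi f g v chi : R * R -> R) (G : R * R -> 'M[R]_2) (x y z p : R * R) (i j : 'I_2) (w N : set (R * R)).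
Local Notation mu := (leb2 R).
Notation i0 := (ord0 : 'I_2).
Notation i1 := (lift ord0 ord0 : 'I_2).

Lemma ord2 i : i = i0 \/ i = i1.
Proof. by case: i => -[|[|//]] hi; [left|right]; exact/val_inj. Qed.

Lemma ball2E p (r : R) x : ball p r x <-> forall i, `|crd i x - crd i p| < r.
Proof.
split=> [[h1 h2] i|h].
  by case: (ord2 i) => ->; rewrite distrC.
by split; rewrite /ball /= distrC; [exact: (h i0)|exact: (h i1)].
Qed.

(** The quotient [A / (A + B)], where [A] is positive exactly on the square of
    half-side [2 * r] and [B] vanishes exactly on the one of half-side [r]. *)
Lemma smooth_cutoff p (r : R) : 0 < r -> exists chi, [/\ smooth chi,
  forall x, 0 <= chi x <= 1, forall x, ball p r x -> chi x = 1 &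
  closure [set x | chi x != 0] `<=` ball p (3 * r)].
Proof.
move=> r0.
pose fl (s : R) i (a : R) x := flat 1 (s * crd i x + a).
have sfl s i a : smooth (fl s i a) by exact: smooth_flat.
pose A x := (fl 1 i0 (2 * r - crd i0 p) x * fl (-1) i0 (2 * r + crd i0 p) x) *
  (fl 1 i1 (2 * r - crd i1 p) x * fl (-1) i1 (2 * r + crd i1 p) x).
pose B := (fl 1 i0 (- r - crd i0 p) + fl (-1) i0 (crd i0 p - r)) +
  (fl 1 i1 (- r - crd i1 p) + fl (-1) i1 (crd i1 p - r)).
have sA : smooth A.
  exact: (smoothM (smoothM (sfl _ _ _) (sfl _ _ _)) (smoothM (sfl _ _ _) (sfl _ _ _))).
have sB : smooth B.
  exact: (smooth_add (smooth_add (sfl _ _ _) (sfl _ _ _)) (smooth_add (sfl _ _ _) (sfl _ _ _))).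
have A0 x : 0 <= A x by rewrite !mulr_ge0 ?flat1_ge0.
have B0 x : 0 <= B x by rewrite !addr_ge0 ?flat1_ge0.
have Apos x : (forall i, `|crd i x - crd i p| < 2 * r) -> 0 < A x.
  move=> h; have := h i0; have := h i1; rewrite !ltr_norml => /andP[a1 a2] /andP[a3 a4].
  by rewrite !mulr_gt0// flat1_gt0//; lra.
have Bpos x i : r < `|crd i x - crd i p| -> 0 < B x.
  move=> h; have [h1|h1] : r < crd i x - crd i p \/ crd i x - crd i p < - r.
  - by move: h; rewrite lter_normr => /orP[]; [left|right; rewrite ltrNr].
  - have [ei|ei] := ord2 i; rewrite ei in h1.
      by apply: ltr_wpDr; [rewrite addr_ge0// flat1_ge0|apply: ltr_wpDr; [exact: flat1_ge0|apply: flat1_gt0; lra]].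
    by apply: ltr_wpDl; [rewrite addr_ge0// flat1_ge0|apply: ltr_wpDr; [exact: flat1_ge0|apply: flat1_gt0; lra]].
  - have [ei|ei] := ord2 i; rewrite ei in h1.
      by apply: ltr_wpDr; [rewrite addr_ge0// flat1_ge0|apply: ltr_wpDl; [exact: flat1_ge0|apply: flat1_gt0; lra]].
    by apply: ltr_wpDl; [rewrite addr_ge0// flat1_ge0|apply: ltr_wpDl; [exact: flat1_ge0|apply: flat1_gt0; lra]].
have ABpos x : 0 < A x + B x.
  have [/Apos h|] := pselect (forall i, `|crd i x - crd i p| < 2 * r).
    by rewrite ltr_pwDl.
  move=> /existsNP[i /negP]; rewrite -leNgt => h; rewrite ltr_pwDr//.
  by apply: (Bpos x i); lra.
have Azero x i : 2 * r <= `|crd i x - crd i p| -> A x = 0.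
  move=> h; have [h1|h1] : 2 * r <= crd i x - crd i p \/ crd i x - crd i p <= - (2 * r).
  - by move: h; rewrite lter_normr => /orP[]; [left|right; rewrite lerNr].
  - have [ei|ei] := ord2 i; rewrite ei in h1.
      by rewrite /A (_ : fl (-1) i0 (2 * r + crd i0 p) x = 0) ?mulr0 ?mul0r ?mulr0// /fl flat_le0//; lra.
    by rewrite /A (_ : fl (-1) i1 (2 * r + crd i1 p) x = 0) ?mulr0 ?mul0r ?mulr0// /fl flat_le0//; lra.
  - have [ei|ei] := ord2 i; rewrite ei in h1.
      by rewrite /A (_ : fl 1 i0 (2 * r - crd i0 p) x = 0) ?mulr0 ?mul0r ?mulr0// /fl flat_le0//; lra.
    by rewrite /A (_ : fl 1 i1 (2 * r - crd i1 p) x = 0) ?mulr0 ?mul0r ?mulr0// /fl flat_le0//; lra.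
have Bzero x : (forall i, `|crd i x - crd i p| < r) -> B x = 0.
  move=> h; have := h i0; have := h i1; rewrite !ltr_norml => /andP[a1 a2] /andP[a3 a4].
  have E (a b c d : R * R -> R) : (a + b + (c + d)) x = a x + b x + (c x + d x) by [].
  by rewrite /B E /fl !flat_le0 ?addr0//; lra.
exists (fun x => A x * (A x + B x)^-1); split.
- apply: (smoothM sA); apply: (smooth_inv (smooth_add sA sB)) => x.
  by apply: lt0r_neq0; exact: ABpos.
- move=> x; rewrite divr_ge0//=; last exact: ltW.
  by rewrite ler_pdivrMr// mul1r lerDl.
- move=> x /ball2E/Bzero h; rewrite -[RHS](mulfV (x := A x + B x)) ?gt_eqF// h.
  by rewrite addr0.
- move=> x hx; apply/ball2E => i; rewrite ltNge; apply/negP => h.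
  have [|y [Ay hy]] := hx (ball x r); first exact: nbhsx_ballx.
  move: Ay => /=; rewrite (Azero y i) ?mul0r ?eqxx//.
  have /ball2E/(_ i) := hy; rewrite distrC => hy'.
  have := ler_normB (crd i x - crd i y) (crd i p - crd i y).
  have -> : crd i x - crd i y - (crd i p - crd i y) = crd i x - crd i p by ring.
  rewrite (distrC (crd i p)); lra.
Qed.

(** The distributional gradient of [v] is an L2 function near [N], expressed
    without representing it. *)
Definition D1bound w v N := exists2 c, 0 <= c & forall phi i, test_fun (w `&` N) phi ->
  ip w v (partial i phi) ^+ 2 <= c * ip w phi phi.

Lemma sq_sum_le (a b : R) : (a + b) ^+ 2 <= 2 * a ^+ 2 + 2 * b ^+ 2.
Proof. have := sqr_ge0 (a - b); nra. Qed.

(** The coordinate derivatives are linear combinations of the derivatives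
    along two independent directions. *)
Lemma D1bound_dirs w v N z z' : pmeas w -> L2 w v ->
  z.1 * z'.2 - z.2 * z'.1 != 0 ->
  (exists2 c, 0 <= c & forall phi, test_fun (w `&` N) phi -> ip w v (dirp z phi) ^+ 2 <= c * ip w phi phi) ->
  (exists2 c, 0 <= c & forall phi, test_fun (w `&` N) phi -> ip w v (dirp z' phi) ^+ 2 <= c * ip w phi phi) ->
  D1bound w v N.
Proof.
move=> mw Lv D0 [c c0 hc] [c' c'0 hc'].
set D := z.1 * z'.2 - z.2 * z'.1 in D0.
(* [m] bounds the squared coefficients of the inverse of the 2 x 2 system *)
pose m := 2 * ((z'.2 / D) ^+ 2 + (z.2 / D) ^+ 2 + (z'.1 / D) ^+ 2 + (z.1 / D) ^+ 2).
have m0 : 0 <= m by rewrite mulr_ge0// !addr_ge0 ?sqr_ge0.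
exists (m * c + m * c'); first by apply: addr_ge0; exact: mulr_ge0.
move=> phi i tN; have t : test_fun w phi := test_fun_subset (@subIsetl _ w N) tN.
have := hc _ tN; have := hc' _ tN.
rewrite (ip_dirp z mw Lv t) (ip_dirp z' mw Lv t).
have n0 := ip_ge0 w phi.
have key (s s' a b e : R) : 2 * s ^+ 2 <= m -> 2 * s' ^+ 2 <= m ->
  a ^+ 2 <= c' * ip w phi phi -> b ^+ 2 <= c * ip w phi phi -> e = s * b + s' * a ->
  e ^+ 2 <= (m * c + m * c') * ip w phi phi.
  move=> hs hs' ha hb ->; apply: le_trans (sq_sum_le _ _) _; rewrite !exprMn.
  rewrite [leRHS]mulrDl; apply: lerD; rewrite mulrA -(mulrA m).
    by apply: ler_pM => //; [apply: mulr_ge0 => //|]; exact: sqr_ge0.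
  by apply: ler_pM => //; [apply: mulr_ge0 => //|]; exact: sqr_ge0.
have [q1 q2 q3 q4] : [/\ 2 * (z'.2 / D) ^+ 2 <= m, 2 * (- (z.2 / D)) ^+ 2 <= m,
    2 * (- (z'.1 / D)) ^+ 2 <= m & 2 * (z.1 / D) ^+ 2 <= m].
  have := sqr_ge0 (z'.2 / D); have := sqr_ge0 (z.2 / D).
  have := sqr_ge0 (z'.1 / D); have := sqr_ge0 (z.1 / D).
  by rewrite !sqrrN /m => *; split; lra.
have [->|->] := ord2 i => ha hb.
- apply: (key _ _ _ _ _ q1 q2 ha hb).
  by move: (ip w v (partial i0 phi)) (ip w v (partial i1 phi)) => X Y; rewrite /D; field.
- apply: (key _ _ _ _ _ q3 q4 ha hb).
  by move: (ip w v (partial i0 phi)) (ip w v (partial i1 phi)) => X Y; rewrite /D; field.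
Qed.

Lemma smooth_sub F F' : smooth F -> smooth F' -> smooth (F - F').
Proof. by move=> sF sF'; rewrite addrC -scaleN1r; exact: smooth_lin. Qed.

Lemma ip_mulbound w phi chi : pmeas w -> test_fun w phi -> smooth chi ->
  (forall x, 0 <= chi x <= 1) -> ip w (fun x => phi x * chi x) (fun x => phi x * chi x) <= ip w phi phi.
Proof.
move=> mw t schi hchi; apply: ip_le => //.
- exact: (test_fun_L2 mw (test_funM t schi)).
- exact: (test_fun_L2 mw t).
- move=> x _; have /andP[h1 h2] := hchi x.
  by rewrite normrM (ger0_norm h1) ler_piMr.
Qed.

(** A test function supported in the union is split by a cutoff function at
    [p]; the cutoff is bounded by one, so the L2 norms of the parts do not
    exceed that of the whole, and no derivative of the cutoff enters the
    bound. *)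
Lemma D1bound_union w v N p (r : R) : pmeas w -> L2 w v -> 0 < r ->
  D1bound w v (ball p (3 * r)) -> D1bound w v N -> D1bound w v (ball p r `|` N).
Proof.
move=> mw Lv r0 [c c0 hc] [c' c'0 hc'].
have [chi [schi chi01 chi1 suppchi]] := smooth_cutoff p r0.
exists (2 * c + 2 * c'); first lra.
move=> phi i tN; have t : test_fun w phi := test_fun_subset (@subIsetl _ w (ball p r `|` N)) tN.
pose psi := cst 1 - chi.
have spsi : smooth psi := smooth_sub (smooth_cst 1) schi.
have psi01 x : 0 <= psi x <= 1.
  by have /andP[h1 h2] := chi01 x; rewrite (_ : psi x = 1 - chi x)//; lra.
have t1 : test_fun (w `&` ball p (3 * r)) (fun x => phi x * chi x).
  have [a b d] := test_funM t schi; split => // x hx; split; first exact: d.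
  by apply: suppchi; apply: closureS hx => y /eqP h; apply/eqP => h'; apply: h; rewrite h' mulr0.
have t2 : test_fun (w `&` N) (fun x => phi x * psi x).
  have [a b d] := test_funM t spsi; split => // x hx; split; first exact: d.
  have [_ _ e] := tN; have hs : closure [set x | phi x * psi x != 0] `<=` closure [set x | phi x != 0].
    by apply: closureS => y /eqP h; apply/eqP => h'; apply: h; rewrite h' mul0r.
  have [_ []//] := e _ (hs _ hx).
  move=> hb; have [|y [hy by_]] := hx (ball p r).
    by apply: open_nbhs_nbhs; split => //; exact: ball_open.
  by exfalso; move: hy => /eqP; apply; rewrite (_ : psi y = 1 - chi y)// chi1// subrr mulr0.
have -> : phi = (fun x => phi x * chi x) + (fun x => phi x * psi x).
  apply/funext => x; have -> : ((fun x => phi x * chi x) + (fun x => phi x * psi x)) x =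
    phi x * chi x + phi x * (1 - chi x) by [].
  ring.
have -> : partial i ((fun x => phi x * chi x) + (fun x => phi x * psi x)) =
   partial i (fun x => phi x * chi x) + partial i (fun x => phi x * psi x).
  rewrite -[X in partial i (X + _)]scale1r (partial_lin i 1) ?scale1r//.
  - exact: (smooth_der (test_fun_smooth t1)).
  - exact: (smooth_der (test_fun_smooth t2)).
have L1 := test_fun_L2 mw (test_fun_partial i t1); have L2' := test_fun_L2 mw (test_fun_partial i t2).
rewrite -[X in ip w v (X + _)]scale1r (si_linr (L2_semi_inner mw) 1 L1 L2' Lv) mul1r.
have -> : (fun x => phi x * chi x) + (fun x => phi x * psi x) = phi.
  apply/funext => x; have -> : ((fun x => phi x * chi x) + (fun x => phi x * psi x)) x =
    phi x * chi x + phi x * (1 - chi x) by [].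
  ring.
have a1 := hc _ i t1; have a2 := hc' _ i t2.
have b1 := ler_wpM2l c0 (ip_mulbound mw t schi chi01).
have b2 := ler_wpM2l c'0 (ip_mulbound mw t spsi psi01).
apply: le_trans (sq_sum_le _ _) _; move: a1 a2 b1 b2.
set p1 := ip w v _; set p2 := ip w v _; set p5 := ip w phi phi.
set q := fun x => phi x * chi x; set q' := fun x => phi x * psi x.
move: p1 p2 p5 (ip w q q) (ip w q' q') => p1 p2 p5 p3 p4; lra.
Qed.

(** Near [p] the set can be pushed into itself along two independent
    directions; this is the form in which the Lipschitz condition enters the
    regularity theorem. *)
Definition good_point w p (r : R) := exists z z' (tau : R),
  [/\ z.1 * z'.2 - z.2 * z'.1 != 0, 0 < tau,
     forall x s, w x -> ball p (3 * r) x -> 0 <= s <= tau -> w (x + s *: z) &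
     forall x s, w x -> ball p (3 * r) x -> 0 <= s <= tau -> w (x + s *: z')].

(** Coordinates of [x] in the frame with origin [p] and second axis [e]. *)
Definition frame1 (e p x : R * R) : R := (x.1 - p.1) * e.2 - (x.2 - p.2) * e.1.
Definition frame2 (e p x : R * R) : R := (x.1 - p.1) * e.1 + (x.2 - p.2) * e.2.

Section Frame.
Variables (e p : R * R).
Hypothesis e_unit : e.1 ^+ 2 + e.2 ^+ 2 = 1.

Lemma frameK x : (p.1 + frame1 e p x * e.2 + frame2 e p x * e.1,
  p.2 - frame1 e p x * e.1 + frame2 e p x * e.2) = x.
Proof.
rewrite [RHS]surjective_pairing; congr pair; rewrite /frame1 /frame2.
  by transitivity (p.1 + (x.1 - p.1) * (e.1 ^+ 2 + e.2 ^+ 2)); [ring|rewrite e_unit; ring].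
by transitivity (p.2 + (x.2 - p.2) * (e.1 ^+ 2 + e.2 ^+ 2)); [ring|rewrite e_unit; ring].
Qed.

Lemma unit_le1 : `|e.1| <= 1 /\ `|e.2| <= 1.
Proof.
have := sqr_ge0 e.1; have := sqr_ge0 e.2 => h2 h1; split;
by rewrite -(@ler_pXn2r _ 2) ?nnegrE// real_normK ?num_real// expr1n -e_unit ?lerDl ?lerDr.
Qed.

Lemma frame_ball (q : R) x : ball p (3 * q) x ->
  `|frame1 e p x| < 6 * q /\ `|frame2 e p x| < 6 * q.
Proof.
have [e1le e2le] := unit_le1.
rewrite /frame1 /frame2 => -[]; rewrite /ball /= distrC => x1; rewrite distrC => x2.
have m1 : `|(x.1 - p.1) * e.2| <= `|x.1 - p.1| by rewrite normrM ler_piMr.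
have m2 : `|(x.2 - p.2) * e.1| <= `|x.2 - p.2| by rewrite normrM ler_piMr.
have m3 : `|(x.1 - p.1) * e.1| <= `|x.1 - p.1| by rewrite normrM ler_piMr.
have m4 : `|(x.2 - p.2) * e.2| <= `|x.2 - p.2| by rewrite normrM ler_piMr.
split; [apply: le_lt_trans (ler_normB _ _) _|apply: le_lt_trans (ler_normD _ _) _]; lra.
Qed.

Lemma frame1D (a : R) x s : frame1 e p (x + s *: (e.1 + a * e.2, e.2 - a * e.1)) = frame1 e p x + a * s.
Proof.
rewrite /frame1 /= /GRing.scale/=.
by transitivity (frame1 e p x + a * s * (e.1 ^+ 2 + e.2 ^+ 2)); [rewrite /frame1; ring|rewrite e_unit mulr1].
Qed.

Lemma frame2D (a : R) x s : frame2 e p (x + s *: (e.1 + a * e.2, e.2 - a * e.1)) = frame2 e p x + s.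
Proof.
rewrite /frame2 /= /GRing.scale/=.
by transitivity (frame2 e p x + s * (e.1 ^+ 2 + e.2 ^+ 2)); [rewrite /frame2; ring|rewrite e_unit mulr1].
Qed.

End Frame.

(** The factor 12 leaves room for points of the ball of radius [3 * q] and for
    their translates by [q], measured in the rotated frame. *)
Lemma lipschitz_chart w p : lipschitz_boundary w -> frontier w p ->
  exists e (g : R -> R) (L q : R), [/\ e.1 ^+ 2 + e.2 ^+ 2 = 1, 0 <= L, 0 < q,
    forall s t, `|g s - g t| <= L * `|s - t| &
    forall x, `|frame1 e p x| < 12 * q -> `|frame2 e p x| < 12 * q ->
      (w x <-> g (frame1 e p x) < frame2 e p x)].
Proof.
move=> lw fp; have [e [g [r [h [/= nE r0 h0 lg hg]]]]] := lw _ fp.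
have [L hL] : exists L, forall s t, `|g s - g t| <= L * `|s - t|.
  have [M [_ hM]] := lg; exists (M + 1) => s t.
  have /hM : M < M + 1 by rewrite ltrDl.
  by move=> /(_ (s, t)) /=; exact.
have [q q0 [qr qh]] : exists2 q : R, 0 < q & 12 * q <= r /\ 12 * q <= h.
  have [rh|hr] := leP r h; [exists (r / 12)|exists (h / 12)]; rewrite ?divr_gt0//; split; lra.
exists e, g, `|L|, q; split => // [s t|x hs ht].
  by apply: le_trans (hL s t) _; apply: ler_wpM2r => //; exact: ler_norm.
rewrite -{1}(frameK p nE x); apply: hg; lra.
Qed.

(** In the frame of the epigraph the vertical direction and one tilted by a
    slope below the inverse Lipschitz constant keep the epigraph invariant; at
    an interior point the axes do. *)
Lemma lipschitz_good_point w p : open w -> lipschitz_boundary w -> closure w p ->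
  exists2 r, 0 < r & good_point w p r.
Proof.
move=> ow lw cp; have [wp|nwp] := pselect (w p).
  have /nbhs_ballP[e /= e0 he] : nbhs p w by exact: open_nbhs_nbhs.
  have e4 : 0 < e / 6 by rewrite divr_gt0.
  exists (e / 6) => //; exists (1, 0), (0, 1), (e / 6); split => //.
  - by rewrite /= mul1r mul0r subr0 oner_neq0.
  - move=> x s wx [hx1 hx2] /andP[s0 se]; apply: he; move: hx1 hx2; rewrite /ball/= => hx1 hx2.
    split; rewrite /ball/= /GRing.scale/= ?mulr1 ?mulr0 ?addr0; last lra.
    by rewrite opprD addrA; apply: le_lt_trans (ler_normB _ _) _; rewrite (ger0_norm s0); lra.
  - move=> x s wx [hx1 hx2] /andP[s0 se]; apply: he; move: hx1 hx2; rewrite /ball/= => hx1 hx2.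
    split; rewrite /ball/= /GRing.scale/= ?mulr1 ?mulr0 ?addr0; first lra.
    by rewrite opprD addrA; apply: le_lt_trans (ler_normB _ _) _; rewrite (ger0_norm s0); lra.
have fp : frontier w p by split => //; rewrite (interior_id _).1.
have [e [g [L [q [nE L0 q0 hL wE]]]]] := lipschitz_chart lw fp.
pose k := (1 + L)^-1.
have k0 : 0 < k by rewrite invr_gt0 ltr_pwDl.
have k1 : k <= 1 by rewrite invf_le1 ?lerDl// ltr_pwDl.
have Lk : L * k <= 1 by rewrite ler_pdivrMr ?ltr_pwDl// mul1r lerDr.
(* the frame direction tilted by a slope that the graph cannot exceed *)
have push a x s : 0 <= a -> a <= 1 -> L * a <= 1 -> w x -> ball p (3 * q) x -> 0 <= s <= q ->
    w (x + s *: (e.1 + a * e.2, e.2 - a * e.1)).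
  move=> a0 a1 La wx /(frame_ball nE)[hS hT] /andP[s0 sq].
  have ht : `|frame2 e p x + s| < 12 * q by apply: le_lt_trans (ler_normD _ _) _; rewrite (ger0_norm s0); lra.
  have ks0 : 0 <= a * s by rewrite mulr_ge0.
  have ks : a * s <= s by rewrite ler_piMl.
  have hs : `|frame1 e p x + a * s| < 12 * q by apply: le_lt_trans (ler_normD _ _) _; rewrite (ger0_norm ks0); lra.
  apply/wE; rewrite ?(frame1D p nE) ?(frame2D p nE)//.
  have hx : g (frame1 e p x) < frame2 e p x by apply/wE => //; lra.
  have := hL (frame1 e p x + a * s) (frame1 e p x).
  rewrite (_ : frame1 e p x + a * s - frame1 e p x = a * s) ?(ger0_norm ks0); last ring.
  have := ler_norm (g (frame1 e p x + a * s) - g (frame1 e p x)).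
  have : L * (a * s) <= s by rewrite mulrA ler_piMl.
  lra.
exists q => //; exists (e.1 + 0 * e.2, e.2 - 0 * e.1), (e.1 + k * e.2, e.2 - k * e.1), q; split => //.
- have -> : (e.1 + 0 * e.2, e.2 - 0 * e.1).1 * (e.1 + k * e.2, e.2 - k * e.1).2 -
     (e.1 + 0 * e.2, e.2 - 0 * e.1).2 * (e.1 + k * e.2, e.2 - k * e.1).1 = - k * (e.1 ^+ 2 + e.2 ^+ 2).
    by rewrite /=; ring.
  by rewrite nE mulr1 oppr_eq0 gt_eqF.
- by move=> x s wx bx hs; apply: push => //; rewrite mulr0.
- by move=> x s wx bx hs; apply: push => //; exact: ltW.
Qed.

Lemma D1bound_good w v G p (r : R) : open w -> bounded_set w -> L2 w v -> LM w G ->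
  weak_hess w v G -> good_point w p r -> D1bound w v (ball p (3 * r)).
Proof.
move=> ow bw Lv LG h [z [z' [tau [D0 tau0 hz hz']]]]; have mw := open_measurable2 ow.
apply: (D1bound_dirs mw Lv D0).
- exact: (dirp_bound ow bw Lv LG h tau0 hz).
- exact: (dirp_bound ow bw Lv LG h tau0 hz').
Qed.

Lemma closure_compact w : bounded_set w -> compact (closure w).
Proof.
move=> bw; have [r _ wr] := bounded_in_box bw.
apply: subclosed_compact (@box_compact R r) _; first exact: closed_closure.
have cb : closed (box r) by apply: compact_closed; [exact: norm_hausdorff|exact: box_compact].
by rewrite [X in _ `<=` X](closure_id _).1//; exact: closureS.
Qed.

Lemma D1bound_subset w v N N' : N' `<=` N -> D1bound w v N -> D1bound w v N'.
Proof.
move=> sN [c c0 hc]; exists c => // phi i t; apply: hc.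
by apply: test_fun_subset t; exact: setIS.
Qed.

Let PlanePT := HB.pack_for ptopologicalType (R * R)%type
  (Pointed.on (R * R)%type) (Topological.on (R * R)%type).

Lemma finite_ball_cover (A : set (R * R)) (r : R * R -> R) : compact A ->
  (forall p, A p -> 0 < r p) -> exists2 s : seq (R * R), (forall p, p \in s -> A p) &
    A `<=` \bigcup_(p in [set` s]) ball p (r p).
Proof.
move=> cA hr; have cA' : cover_compact A by rewrite -(@compact_cover PlanePT).
have [p Ap|p Ap|D sD cD] := cA' _ A (fun p => ball p (r p)).
- by apply: ball_open; exact: hr.
- by exists p => //; apply: ballxx; exact: hr.
- exists (finmap.enum_fset D) => // p hp; have := sD p hp; rewrite inE; exact.
Qed.

(** If the second distributional derivatives are square integrable, then near
    every point of the compact closure the first derivatives along two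
    independent inward directions are bounded functionals for the L2 norm. The
    local bounds are glued over a finite cover, and the Riesz theorem yields
    the first derivatives. *)
Theorem weak_hess_H2 w v G : open w -> bounded_set w -> lipschitz_boundary w ->
  L2 w v -> LM w G -> weak_hess w v G -> H2 w v.
Proof.
move=> ow bw lw Lv LG h; have mw := open_measurable2 ow.
have HL := L2_semi_inner mw.
have [c c0 hc] : D1bound w v (closure w).
  have /choice[r hr] : forall p, exists r, closure w p -> 0 < r /\ good_point w p r.
    move=> p; have [cp|ncp] := pselect (closure w p); last by exists 0.
    by have [r r0 gr] := lipschitz_good_point ow lw cp; exists r.
  have [s sD cD] := finite_ball_cover (closure_compact bw) (fun p cp => (hr p cp).1).
  apply: (D1bound_subset cD); move: s sD {cD}.
      elim=> [_|p s IH hs].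
        exists 0 => // phi i [_ _ hphi].
        have -> : phi = cst 0.
          apply/funext => x; apply: contrapT => /eqP hx.
          by have [_ []] : (w `&` \bigcup_(p in [set` [::]]) ball p (r p)) x by apply: hphi; exact: subset_closure.
        rewrite partial_cst mul0r; have := si_scaler HL 0 (L2_0 mw) Lv.
        by rewrite scale0r mul0r => ->; rewrite expr0n.
      have cp : closure w p by apply: hs; rewrite inE eqxx.
      have [rp gp] := hr p cp.
      have := D1bound_union mw Lv rp (D1bound_good ow bw Lv LG h gp)
        (IH (fun q hq => hs q (@mem_behead _ (p :: s) q hq))).
      apply: D1bound_subset => x [q] /=.
      by rewrite inE => /predU1P[->|hq] hx; [left|right; exists q].
have tw phi : test_fun w phi -> test_fun (w `&` closure w) phi.
  by apply: test_fun_subset => x wx; split => //; exact: subset_closure.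
have Ht : semi_inner (test_fun w) (@ip R w).
  apply: (si_subset (S := L2 w)) => //.
  - by split=> [|a x y]; [exact: test_fun0|exact: test_fun_lin].
  - by move=> phi; exact: test_fun_L2.
have /choice[g hg] : forall i, exists g, L2 w g /\ is_wpartial w i v g.
  move=> i; have [||g Lg hg] := @riesz_dense R _ (test_fun w) (L2 w) (@ip R w) (fun phi => - ip w v (partial i phi)) c
     Ht HL (fun phi => test_fun_L2 mw) (L2_complete mw).
  - move=> a phi psi tp tq; have d1 := smooth_der (test_fun_smooth tp); have d2 := smooth_der (test_fun_smooth tq).
    rewrite (partial_lin i a d1 d2) (si_linr HL a (test_fun_L2 mw (test_fun_partial i tp)) (test_fun_L2 mw (test_fun_partial i tq)) Lv).
    by rewrite opprD mulrN.
  - by move=> phi tp; rewrite sqrrN; exact/hc/tw.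
  - by exists g; split => // phi tp; rewrite (hg _ tp) opprK.
apply: (@H2_intro _ _ _ g (fun i j => ent G i j) ow Lv) => [i|i j|i|i j].
- by case: (hg i).
- exact: LG.
- by case: (hg i).
- move=> phi tp; have [_ hi] := hg i.
  have := hi _ (test_fun_partial j tp); rewrite (h i j _ tp) => e.
  by rewrite e opprK.
Qed.

End Regularity.

(** * Null frontiers and meshes *)

Transparent partial ip.

Section NullFrontier.
Context {R : realType}.
Implicit Types (f g : R * R -> R) (x y p : R * R) (w : set (R * R)).
Local Notation mu := (leb2 R).

Lemma ccrect_measure (a1 b1 a2 b2 : R) : a1 < b1 -> a2 < b2 ->
  mu (ccrect a1 b1 a2 b2) = ((b1 - a1) * (b2 - a2))%:E.
Proof.
move=> h1 h2; rewrite /ccrect product_measure1E//.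
have K (a c : R) : a < c -> lebesgue_measure `[a, c]%classic = (c - a)%:E.
  by move=> ac; rewrite lebesgue_measure_itv/= lte_fin ac.
by transitivity ((b1 - a1)%:E * (b2 - a2)%:E)%E => //; congr (_ * _)%E; exact: K.
Qed.

Lemma frontier_measurable w : open w -> pmeas (frontier w).
Proof.
move=> ow; rewrite /frontier (interior_id _).1//.
have mc : pmeas (closure w).
  by rewrite -[closure w]setCK; apply: measurableC; apply: open_measurable2; apply: closed_openC; exact: closed_closure.
apply: measurableD => //; exact: open_measurable2.
Qed.

(** Near a boundary point the frontier is the graph of a Lipschitz function; N
    squares of side O(1/N) cover it. *)
Lemma frontier_null_near w p : open w -> lipschitz_boundary w -> frontier w p ->
  exists2 r, 0 < r & mu.-negligible (frontier w `&` ball p r).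
Proof.
move=> ow lw fp; have [e [g [L [q [nE L0 q0 hL wE]]]]] := lipschitz_chart lw fp.
exists (3 * q); first by rewrite mulr_gt0.
set F := frontier w `&` _.
have mF : pmeas F.
  apply: measurableI; first exact: frontier_measurable.
  by apply: open_measurable2; apply: ball_open; rewrite mulr_gt0.
apply/(negligibleP _ mF).
have cc (h : R * R -> R) (a c : R) : continuous h -> continuous (fun x => (h x - a) * c).
  by move=> ch x; apply: cvgM; [apply: cvgB; [exact: ch|exact: cvg_cst]|exact: cvg_cst].
have cf : continuous (fst : R * R -> R) by move=> x; exact: cvg_fst.
have cs : continuous (snd : R * R -> R) by move=> x; exact: cvg_snd.
have c1 : continuous (frame1 e p) by move=> x; apply: cvgB; exact: cc.
have c2 : continuous (frame2 e p) by move=> x; apply: cvgD; exact: cc.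
(* a frontier point below the graph would have no points of [w] nearby *)
have graph x : F x -> [/\ `|frame1 e p x| < 6 * q, `|frame2 e p x| < 6 * q & frame2 e p x = g (frame1 e p x)].
  move=> [[cx nx] /(frame_ball nE)[h1 h2]]; split => //.
  have nwx : ~ w x by rewrite (interior_id _).1 in nx.
  have hx1 : `|frame1 e p x| < 12 * q by lra.
  have hx2 : `|frame2 e p x| < 12 * q by lra.
  have : frame2 e p x <= g (frame1 e p x) by rewrite leNgt; apply/negP => /(wE x hx1 hx2).
  rewrite le_eqVlt => /predU1P[//|lt]; exfalso.
  pose dl := (g (frame1 e p x) - frame2 e p x) / (2 * (1 + L)).
  have dl0 : 0 < dl by rewrite divr_gt0 ?subr_gt0// mulr_gt0// ltr_pwDl.
  have dlE : dl * (1 + L) * 2 = g (frame1 e p x) - frame2 e p x.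
    by rewrite /dl; field; rewrite gt_eqF// ltr_pwDl.
  pose eta := Num.min dl q.
  have eta0 : 0 < eta by rewrite lt_min dl0.
  have : nbhs x [set y | `|frame1 e p y - frame1 e p x| < eta /\ `|frame2 e p y - frame2 e p x| < eta].
    have n1 := @cvgr_dist_lt _ _ _ _ _ _ _ (c1 x) _ eta0.
    have n2 := @cvgr_dist_lt _ _ _ _ _ _ _ (c2 x) _ eta0.
    by apply: filterS (filterI (n1 (nbhs_filter x)) (n2 (nbhs_filter x))) => y [k1 k2]; split; rewrite distrC.
  move=> /cx[y [wy [+ +]]]; rewrite !lt_min => /andP[d1 d2] /andP[d3 d4].
  have hy1 : `|frame1 e p y| < 12 * q.
    rewrite -[frame1 e p y](subrK (frame1 e p x)); apply: le_lt_trans (ler_normD _ _) _; lra.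
  have hy2 : `|frame2 e p y| < 12 * q.
    rewrite -[frame2 e p y](subrK (frame2 e p x)); apply: le_lt_trans (ler_normD _ _) _; lra.
  have /(wE y hy1 hy2) gy := wy.
  have := hL (frame1 e p y) (frame1 e p x); have := ler_norm (g (frame1 e p x) - g (frame1 e p y)).
  rewrite (distrC (g _)); have := ler_wpM2l L0 (ltW d1); have := ler_norm (frame2 e p y - frame2 e p x).
  lra.
(* [N] squares of half-side [c / N] centred on the graph; [c] absorbs the
   width of the chart and the Lipschitz constant *)
pose c : R := 12 * q * (1 + L).
have c0 : 0 < c by rewrite !mulr_gt0// ltr_pwDl.
have bound N : (mu F <= (4 * c ^+ 2 / N.+1%:R)%:E)%E.
  have [M N0 MN] : exists2 M : R, 0 < M & N.+1%:R = M by exists N.+1%:R.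
  rewrite MN.
  pose s (k : nat) : R := - (6 * q) + 12 * q * (k%:R / M).
  pose y (k : nat) : R * R := (p.1 + s k * e.2 + g (s k) * e.1, p.2 - s k * e.1 + g (s k) * e.2).
  pose rr : R := c / M.
  have rr0 : 0 < rr by rewrite divr_gt0.
  pose Q k := ccrect ((y k).1 - rr) ((y k).1 + rr) ((y k).2 - rr) ((y k).2 + rr).
  have mQ k : pmeas (Q k) by exact: ccrect_measurable.
  have FQ : F `<=` \big[setU/set0]_(k < N.+1) Q k.
    move=> x /graph[h1 h2 h3].
    pose u := (frame1 e p x + 6 * q) * M / (12 * q).
    have /andP[l1 l2] : - (6 * q) < frame1 e p x < 6 * q by rewrite -ltr_norml.
    have u0 : 0 <= u by rewrite divr_ge0 ?mulr_ge0//; lra.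
    have uN : u < M by rewrite ltr_pdivrMr ?mulr_gt0// mulrC ltr_pM2l//; lra.
    have /andP[k1 k2] := truncn_itv u0.
    set k := Num.truncn u in k1 k2.
    have kN : (k < N.+1)%N by rewrite -(ltr_nat R) MN; exact: le_lt_trans uN.
    rewrite (bigD1 (Ordinal kN))//=; left.
    have ds : `|frame1 e p x - s k| <= 12 * q / M.
      have -> : frame1 e p x - s k = (u - k%:R) * (12 * q / M).
        by rewrite /u /s; field; rewrite !gt_eqF.
      rewrite normrM [X in _ * X]ger0_norm; last by rewrite divr_ge0// ltW// mulr_gt0.
      rewrite ler_piMl//; first by rewrite divr_ge0// ltW// mulr_gt0.
      rewrite ger0_norm ?subr_ge0//; move: k2; rewrite -natr1; lra.
    have dt : `|frame2 e p x - g (s k)| <= L * (12 * q / M).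
      by rewrite h3; apply: le_trans (hL _ _) _; exact: ler_wpM2l.
    have [e1le e2le] := unit_le1 nE.
    have rrE : rr = 12 * q / M + L * (12 * q / M) by rewrite /rr /c; ring.
    have b1 : `|x.1 - (y k).1| <= rr.
      rewrite -{1}(frameK p nE x) /=.
      have -> : p.1 + frame1 e p x * e.2 + frame2 e p x * e.1 - (p.1 + s k * e.2 + g (s k) * e.1) =
        (frame1 e p x - s k) * e.2 + (frame2 e p x - g (s k)) * e.1 by ring.
      apply: le_trans (ler_normD _ _) _; rewrite !normrM rrE; apply: lerD.
        by apply: le_trans ds; rewrite ler_piMr.
      by apply: le_trans dt; rewrite ler_piMr.
    have b2 : `|x.2 - (y k).2| <= rr.
      rewrite -{1}(frameK p nE x) /=.
      have -> : p.2 - frame1 e p x * e.1 + frame2 e p x * e.2 - (p.2 - s k * e.1 + g (s k) * e.2) =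
        - ((frame1 e p x - s k) * e.1) + (frame2 e p x - g (s k)) * e.2 by ring.
      apply: le_trans (ler_normD _ _) _; rewrite normrN !normrM rrE; apply: lerD.
        by apply: le_trans ds; rewrite ler_piMr.
      by apply: le_trans dt; rewrite ler_piMr.
    by move: b1 b2; rewrite !ler_distl => b1 b2; split; rewrite /= in_itv.
  apply: (@le_trans _ _ (mu (\big[setU/set0]_(k < N.+1) Q k))).
    by apply: le_measure => //; rewrite inE//; apply: bigsetU_measurable.
  apply: (@le_trans _ _ (\sum_(k < N.+1) mu (Q k))%E).
    by apply: Boole_inequality => i _; exact: mQ.
  have E k : mu (Q k) = (4 * rr ^+ 2)%:E.
    by rewrite ccrect_measure; [congr (_%:E); ring|lra|lra].
  rewrite (eq_bigr (fun=> (4 * rr ^+ 2)%:E)) => [|i _]; last exact: E.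
  rewrite sumEFin sumr_const card_ord lee_fin.
  have -> : (4 * rr ^+ 2) *+ N.+1 = 4 * rr ^+ 2 * M by rewrite -MN mulr_natr.
  rewrite /rr.
  by rewrite le_eqVlt; apply/orP; left; apply/eqP; field; rewrite gt_eqF.
apply/eqP; rewrite eq_le measure_ge0 andbT; apply/lee_addgt0Pr => d d0; rewrite add0e.
apply: le_trans (bound (Num.truncn (4 * c ^+ 2 / d))) _; rewrite lee_fin.
rewrite ler_pdivrMr//; apply: ltW; have := truncnS_gt (4 * c ^+ 2 / d).
by rewrite ltr_pdivrMr// [X in _ < X]mulrC.
Qed.

Lemma frontier_null w : open w -> bounded_set w -> lipschitz_boundary w ->
  mu.-negligible (frontier w).
Proof.
move=> ow bw lw.
have /choice[r hr] : forall p, exists r, frontier w p -> 0 < r /\ mu.-negligible (frontier w `&` ball p r).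
  move=> p; have [fp|nfp] := pselect (frontier w p); last by exists 0.
  by have [r r0 gr] := frontier_null_near ow lw fp; exists r.
have cf : compact (frontier w).
  apply: subclosed_compact (closure_compact bw) (@subDsetl _ _ _).
  by apply: closedI; [exact: closed_closure|apply: open_closedC; exact: open_interior].
have [s hs cs] := finite_ball_cover cf (fun p fp => (hr p fp).1).
have : mu.-negligible (\big[setU/set0]_(p <- s) (frontier w `&` ball p (r p))).
  rewrite big_seq; elim/big_ind : _ => [|A B|p ps]; [exact: negligible_set0|exact: negligibleU|].
  by case: (hr p (hs p ps)).
apply: negligibleS => x fx; have [p /= ps hx] := cs x fx.
by rewrite -bigcup_seq; exists p.
Qed.

End NullFrontier.

Lemma bounded_set_sub (R : realType) (w w' : set (R * R)) : w' `<=` w -> bounded_set w -> bounded_set w'.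
Proof. by move=> s [M [rM hM]]; exists M; split => // x /hM h y /s; exact: h. Qed.

Section Mesh.
Context {R : realType} {m : nat}.
Variables (Omega : set (R * R)) (T : 'I_m -> set (R * R)).
Local Notation mu := (leb2 R).
Hypotheses (oO : open Omega) (bO : bounded_set Omega) (hT : is_mesh Omega T).

Lemma mesh_open i : open (T i). Proof. by case: hT => /(_ i)[[]]. Qed.
Lemma mesh_sub i : T i `<=` Omega. Proof. by case: hT => /(_ i)[]. Qed.
Lemma mesh_lipschitz i : lipschitz_boundary (T i). Proof. by case: hT => /(_ i)[]. Qed.
Lemma mesh_meas i : pmeas (T i). Proof. exact: (open_measurable2 (@mesh_open i)). Qed.
Lemma mesh_bounded i : bounded_set (T i).
Proof. exact: (bounded_set_sub (@mesh_sub i) bO). Qed.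

(** A point of [Omega] outside all elements lies in the closure of one of
    them, hence on its frontier. *)
Lemma mesh_null : mu.-negligible [set x | Omega x /\ forall i, ~ T i x].
Proof.
have : mu.-negligible (\big[setU/set0]_i frontier (T i)).
  elim/big_ind : _ => [|A B|i _]; [exact: negligible_set0|exact: negligibleU|].
  exact: (frontier_null (@mesh_open i) (@mesh_bounded i) (@mesh_lipschitz i)).
apply: negligibleS => x [Ox nT].
have : closure Omega x by exact: subset_closure.
case: hT => _ _ -> [i _ cx].
rewrite (bigD1 i)//=; left; split => // h; apply: (nT i); exact: interior_subset h.
Qed.

Lemma mesh_Rintegral (h : R * R -> R) : mu.-integrable Omega (EFin \o h) ->
  \int[mu]_(x in Omega) h x = \sum_i \int[mu]_(x in T i) h x.
Proof.
move=> ih; have mO := open_measurable2 oO.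
have iT i : mu.-integrable setT (EFin \o (h \_ (T i))).
  rewrite -restrict_EFin -(integrable_mkcond _ (@mesh_meas i)).
  exact: (integrableS mO (@mesh_meas i) (@mesh_sub i) ih).
have iO : mu.-integrable setT (EFin \o (h \_ Omega)).
  by rewrite -restrict_EFin -(integrable_mkcond _ mO).
rewrite Rintegral_mkcond; under eq_bigr do rewrite Rintegral_mkcond.
rewrite -Rintegral_sum//; congr fine; apply: ae_eq_integral => //.
- exact: (measurable_int _ iO).
- have := integrable_sum measurableT (index_enum 'I_m) (P := xpredT) (fun k _ => iT k).
  move=> /(measurable_int _); apply: eq_measurable_fun => x _ /=; by rewrite sumEFin.
apply: negligibleS mesh_null => x /not_implyP[_] /eqP nx; apply: contrapT => hx; case/negP: nx.
apply/eqP; congr EFin.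
have off i : ~ T i x -> (h \_ (T i)) x = 0.
  by move=> nx; rewrite patchE ifF//; apply/negP => /set_mem.
have [Ox|nOx] := pselect (Omega x); last first.
  rewrite patchE ifF; last by apply/negP => /set_mem.
  by rewrite big1// => i _; apply: off => /mesh_sub.
have [i Tx] : exists i, T i x by apply: contrapT => /forallNP nT; apply: hx.
rewrite (bigD1 i)//= big1 ?addr0.
  by rewrite !patchE !mem_set.
move=> j ji; apply: off => Tjx; have [_ /(_ _ _ ji) h0 _] := hT.
by have : (T j `&` T i) x by []; rewrite h0.
Qed.

Lemma mesh_ip f g : L2 Omega f -> L2 Omega g -> ip Omega f g = \sum_i ip (T i) f g.
Proof. by move=> Lf Lg; apply: mesh_Rintegral; exact: L2_mul_integrable (open_measurable2 oO) Lf Lg. Qed.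

End Mesh.

(** * Symmetric positive definite tensors *)

Section Tensor.
Context {R : realType}.
Implicit Types (A B : 'M[R]_2) (D : {linear 'M[R]_2 -> 'M[R]_2}).

Lemma ddotC A B : ddot A B = ddot B A.
Proof. by apply: eq_bigr => i _; apply: eq_bigr => j _; rewrite mulrC. Qed.

Lemma ddot_linl (a : R) A A' B : ddot (a *: A + A') B = a * ddot A B + ddot A' B.
Proof.
rewrite /ddot mulr_sumr -big_split; apply: eq_bigr => i _.
rewrite mulr_sumr -big_split; apply: eq_bigr => j _.
by rewrite !mxE /=; ring.
Qed.

Lemma ddot_linr (a : R) A A' B : ddot B (a *: A + A') = a * ddot B A + ddot B A'.
Proof. by rewrite ddotC ddot_linl !(ddotC B). Qed.

Lemma ddot_ge0 A : 0 <= ddot A A.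
Proof. by apply: sumr_ge0 => i _; apply: sumr_ge0 => j _; rewrite -expr2 sqr_ge0. Qed.

Lemma ddot_entry A i j : A i j ^+ 2 <= ddot A A.
Proof.
rewrite /ddot (bigD1 i)//= (bigD1 j)//= -expr2 -addrA lerDl; apply: addr_ge0.
  by apply: sumr_ge0 => k _; rewrite -expr2 sqr_ge0.
by apply: sumr_ge0 => k _; apply: sumr_ge0 => l _; rewrite -expr2 sqr_ge0.
Qed.

Lemma linear_entry D A i j : D A i j = \sum_k \sum_l A k l * D (delta_mx k l) i j.
Proof.
rewrite {1}(matrix_sum_delta A) linear_sum summxE; apply: eq_bigr => k _.
rewrite linear_sum summxE; apply: eq_bigr => l _.
by rewrite linearZ mxE.
Qed.

Lemma linear_bound D : exists2 c, 0 <= c & forall A, ddot (D A) (D A) <= c * ddot A A.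
Proof.
pose m i j : R := \sum_k \sum_l `|D (delta_mx k l) i j|.
have m0 i j : 0 <= m i j by apply: sumr_ge0 => k _; apply: sumr_ge0.
exists (\sum_i \sum_j m i j ^+ 2).
  by apply: sumr_ge0 => i _; apply: sumr_ge0 => j _; exact: sqr_ge0.
move=> A; have a0 := ddot_ge0 A.
have ent k l : `|A k l| <= Num.sqrt (ddot A A).
  by rewrite -sqrtr_sqr; apply: ler_wsqrtr; exact: ddot_entry.
have h i j : `|D A i j| <= m i j * Num.sqrt (ddot A A).
  rewrite linear_entry; apply: le_trans (ler_norm_sum _ _ _) _; rewrite mulr_suml.
  apply: ler_sum => k _; apply: le_trans (ler_norm_sum _ _ _) _; rewrite mulr_suml.
  apply: ler_sum => l _; rewrite normrM mulrC; exact: ler_wpM2l.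
rewrite /ddot mulr_suml; apply: ler_sum => i _; rewrite mulr_suml; apply: ler_sum => j _.
rewrite -expr2 -real_normK ?num_real// -[X in _ * X]sqr_sqrtr// -exprMn.
by rewrite ler_pXn2r ?nnegrE// mulr_ge0 ?sqrtr_ge0.
Qed.

Section Spd.
Variable C : {linear 'M[R]_2 -> 'M[R]_2}.
Hypothesis hC : spd_tensor C.

Lemma sym_subspace : subspace (@symmetric_tensor R).
Proof.
split; first by rewrite /symmetric_tensor trmx0.
by move=> a A B sA sB; rewrite /symmetric_tensor linearP /= sA sB.
Qed.

Lemma C_inner : semi_inner (@symmetric_tensor R) (fun A B => ddot (C A) B).
Proof.
have [S0 SL] := sym_subspace; have [c1 c2 c3] := hC; split => //.
- by move=> A B sA sB; rewrite c2// ddotC.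
- by move=> a A B D sA sB sD; rewrite linearP ddot_linl.
- move=> A sA; have [->|A0] := eqVneq A 0; last by apply: ltW; exact: c3.
  by rewrite linear0 ddot_ge0.
Qed.

Lemma C_inj A : symmetric_tensor A -> C A = 0 -> A = 0.
Proof.
have [c1 c2 c3] := hC; move=> sA CA; apply/eqP; apply: contraT => A0.
have := c3 A sA A0; rewrite CA /ddot.
by rewrite big1 ?ltxx// => i _; rewrite big1// => j _; rewrite mxE mul0r.
Qed.

(** C extended by the identity on skew matrices is an automorphism of all
    matrices; its inverse is a linear extension of the inverse of C. *)
Lemma spd_inverse : exists D : {linear 'M[R]_2 -> 'M[R]_2},
  [/\ forall A, symmetric_tensor A -> symmetric_tensor (D A),
      forall A, symmetric_tensor A -> C (D A) = A &
      forall A, symmetric_tensor A -> tensor_inv C A = D A].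
Proof.
have [c1 c2 c3] := hC.
pose sy A := 2^-1 *: (A + A^T); pose sk A := 2^-1 *: (A - A^T).
have sysk A : sy A + sk A = A.
  by apply/matrixP => i j; rewrite !mxE; lra.
have symsy A : symmetric_tensor (sy A).
  by apply/matrixP => i j; rewrite !mxE addrC.
have skT A : (sk A)^T = - sk A by apply/matrixP => i j; rewrite !mxE; ring.
pose F A := C (sy A) + sk A.
have linF : linear F.
  move=> a A B; rewrite /F.
  have -> : sy (a *: A + B) = a *: sy A + sy B.
    by apply/matrixP => i j; rewrite !mxE; ring.
  have -> : sk (a *: A + B) = a *: sk A + sk B.
    by apply/matrixP => i j; rewrite !mxE; ring.
  by rewrite linearP scalerDr addrACA.
pose FL : {linear 'M[R]_2 -> 'M[R]_2} := HB.pack F (GRing.isLinear.Build _ _ _ _ F linF).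
have skew0 (X Y : 'M[R]_2) : symmetric_tensor X -> Y^T = - Y -> symmetric_tensor (X + Y) -> Y = 0.
  move=> sX tY; rewrite /symmetric_tensor linearD/= sX tY => /addrI /matrixP e.
  by apply/matrixP => i j; have := e i j; rewrite !mxE; lra.
have inj : lker (linfun FL) == 0%VS.
  apply/eqP/vspaceP => A; rewrite memv_ker memv0 lfunE /=; apply/eqP/eqP; last first.
    by move=> ->; exact: (linear0 FL).
  rewrite /F => h; have s0 : sk A = 0.
    by apply: (skew0 (C (sy A))) => //; [exact: c1|rewrite h; case: sym_subspace].
  by move: h; rewrite s0 addr0 => /(C_inj (symsy A)) sy0; rewrite -(sysk A) sy0 s0 addr0.
pose D : {linear 'M[R]_2 -> 'M[R]_2} := ((linfun FL)^-1)%VF.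
have FD A : F (D A) = A by have := lker0_lfunVK inj A; rewrite lfunE.
have key A : symmetric_tensor A -> sk (D A) = 0.
  by move=> sA; apply: (skew0 (C (sy (D A)))); [exact: c1|exact: skT|rewrite -/(F (D A)) FD].
have symD A : symmetric_tensor A -> symmetric_tensor (D A).
  by move=> /key h; rewrite -(sysk (D A)) h addr0.
have CD A : symmetric_tensor A -> C (D A) = A.
  by move=> /key h; rewrite -[RHS]FD /F h addr0 -{1}(sysk (D A)) h addr0.
exists D; split => // A sA; rewrite /tensor_inv.
have [] := @getPex _ [set B | symmetric_tensor B /\ C B = A] (ex_intro _ (D A) (conj (symD A sA) (CD A sA))).
set B := get _ => sB CB; apply/eqP; rewrite -subr_eq0; apply/eqP; apply: C_inj.
  rewrite -scaleN1r addrC; apply: (sym_subspace.2) => //; exact: symD.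
by rewrite linearB/= CB CD// subrr.
Qed.

Lemma tensor_inv_nonsym A : ~ symmetric_tensor A -> tensor_inv C A = get set0.
Proof.
have [c1 c2 c3] := hC; move=> nA; rewrite /tensor_inv; congr (get _); apply/seteqP; split => B //=.
by case=> sB CB; apply: nA; rewrite -CB; exact: c1.
Qed.

(** Cauchy--Schwarz for the energy form applied to [A] and [C^-1 A] bounds
    [|A|^4] by [(C A, A) (A, C^-1 A)], and [C^-1] is bounded. *)
Lemma spd_coercive : exists2 c, 0 < c & forall A, symmetric_tensor A -> ddot A A <= c * ddot (C A) A.
Proof.
have [D [symD CD _]] := spd_inverse; have [c c0 hc] := linear_bound D.
have [c1 c2 c3] := hC.
exists (1 + c); first by rewrite ltr_pwDl.
move=> A sA; have sDA := symD A sA; have a0 := ddot_ge0 A.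
have q0 : 0 <= ddot (C A) A := si_ge0 C_inner sA.
have := cauchy_schwarz C_inner sDA sA; rewrite (CD A sA) expr2.
have := ddot_ge0 (-1 *: D A + A); rewrite !ddot_linl !ddot_linr (ddotC (D A) A).
have := hc A; move: q0 a0.
move: (ddot A A) (ddot (C A) A) (ddot A (D A)) (ddot (D A) (D A)) => n q s t q0 n0 h1 h2 h3.
have [->|n1] := eqVneq n 0; first by rewrite mulr_ge0// addr_ge0.
have n2 : 0 < n by rewrite lt_neqAle eq_sym n1.
rewrite -(ler_pM2l n2); apply: le_trans h3 _; rewrite mulrA; apply: ler_wpM2r => //; nra.
Qed.

End Spd.
End Tensor.

Section TensorFields.
Context {R : realType}.
Implicit Types (P Q : R * R -> 'M[R]_2) (x : R * R) (i j : 'I_2) (w : set (R * R)).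
Local Notation mu := (leb2 R).

Lemma L2_sum w (I : Type) (s : seq I) (F : I -> R * R -> R) : pmeas w ->
  (forall k, L2 w (F k)) -> L2 w (fun x => \sum_(k <- s) F k x).
Proof.
move=> mw LF; elim: s => [|k s IH].
  have -> : (fun x => \sum_(k <- [::]) F k x) = 0 by apply/funext => x; rewrite big_nil.
  exact: L2_0.
have -> : (fun x => \sum_(k <- k :: s) F k x) = F k + (fun x => \sum_(k <- s) F k x).
  by apply/funext => x; rewrite big_cons.
exact: (si_add (L2_semi_inner mw)).
Qed.

Lemma LM_linear w (D : {linear 'M[R]_2 -> 'M[R]_2}) Q : pmeas w -> LM w Q -> LM w (fun x => D (Q x)).
Proof.
move=> mw LQ i j.
have -> : ent (fun x => D (Q x)) i j = fun x => \sum_k \sum_l (D (delta_mx k l) i j *: ent Q k l) x.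
  apply/funext => x; rewrite /ent linear_entry; apply: eq_bigr => k _; apply: eq_bigr => l _.
  by rewrite mulrC.
by apply: L2_sum => // k; apply: L2_sum => // l; exact: (si_scale (L2_semi_inner mw)).
Qed.

Lemma ipM_linear_bound w (D : {linear 'M[R]_2 -> 'M[R]_2}) c Q : pmeas w -> LM w Q ->
  (forall A, ddot (D A) (D A) <= c * ddot A A) ->
  ipM w (fun x => D (Q x)) (fun x => D (Q x)) <= c * ipM w Q Q.
Proof.
move=> mw LQ hc; have LD := LM_linear D mw LQ.
have ii P : LM w P -> mu.-integrable w (EFin \o (fun x => ddot (P x) (P x))).
  move=> LP; apply: (@eq_integrable _ _ _ mu w mw (fun x => \sum_i \sum_j (ent P i j x * ent P i j x)%:E)%E).
    by move=> x _ /=; rewrite /ddot -sumEFin; apply: eq_bigr => i _; rewrite -sumEFin.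
  by apply: integrable_sum => // i _; apply: integrable_sum => // j _; exact: L2_mul_integrable.
rewrite /ipM -RintegralZl//; last exact: ii.
apply: le_Rintegral => //; [exact: ii|].
have := integrableZl mw c (ii _ LQ); apply: eq_integrable => // x _ /=; by rewrite EFinM.
Qed.

Variable C : {linear 'M[R]_2 -> 'M[R]_2}.
Hypothesis hC : spd_tensor C.

Lemma tensor_inv_ae w Q (D : {linear 'M[R]_2 -> 'M[R]_2}) : L2s w Q ->
  (forall A, symmetric_tensor A -> tensor_inv C A = D A) ->
  ae_eq mu w (fun x => tensor_inv C (Q x)) (fun x => D (Q x)).
Proof. by move=> [sQ _] h; apply: negligibleS sQ => x nx hx; apply: nx => /hx; exact: h. Qed.

(** Off the symmetric tensors the inverse of C is a constant, so it preserves
    measurability. *)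
Lemma LM_tensor_inv w Q : pmeas w -> L2s w Q -> LM w (fun x => tensor_inv C (Q x)).
Proof.
move=> mw hQ; have [_ LQ] := hQ; have [D [_ _ hD]] := spd_inverse hC.
have LD := LM_linear D mw LQ; have E := tensor_inv_ae hQ hD.
have i0 : 'I_2 := ord0; pose i1 : 'I_2 := lift ord0 ord0.
have mQ i j : pmfun w (ent Q i j) by have /L2P[] := LQ i j.
pose S := [set x | ent Q ord0 i1 x - ent Q i1 ord0 x = 0].
have symE x : S x <-> symmetric_tensor (Q x).
  rewrite /S /= /ent; split=> [/eqP|/matrixP/(_ ord0 i1)]; last by rewrite mxE => <-; rewrite subrr.
  rewrite subr_eq0 => /eqP e; apply/matrixP => i j; rewrite mxE.
  have two (k : 'I_2) : k = ord0 \/ k = i1.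
    by case: k => -[|[|//]] hk; [left|right]; exact/val_inj.
  by have [->|->] := two i; have [->|->] := two j.
have mS : pmeas (w `&` S).
  have := measurable_funB (mQ ord0 i1) (mQ i1 ord0).
  by move=> /(_ mw [set 0] (measurable_set1 0)).
move=> i j; apply/L2P.
have mT : pmfun w (ent (fun x => tensor_inv C (Q x)) i j).
  pose k := (get set0 : 'M[R]_2) i j.
  pose h := fun x => (ent (fun x => D (Q x)) i j x - k) * \1_(w `&` S) x + k.
  have mh : pmfun w h.
    have /L2P[mD _] := LD i j.
    apply: measurable_funD; last exact: measurable_cst.
    apply: measurable_funM; first by apply: measurable_funB => //; exact: measurable_cst.
    by apply: measurable_funTS; exact: measurable_indic.
  apply: eq_measurable_fun mh => x /set_mem wx; rewrite /h /ent indicE.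
  have [Sx|nS] := pselect (S x).
    by rewrite mem_set//= mulr1 subrK hD//; apply/symE.
  rewrite memNset/=; last by case.
  by rewrite mulr0 add0r tensor_inv_nonsym// => /symE.
split => //.
have /L2P[mD iD] := LD i j.
apply/integrableP; split.
  by apply/measurable_EFinP; apply: measurable_funX.
have /integrableP[_] := iD; congr (_ < _)%E; apply: ae_eq_integral => //.
- by do 2 apply: measurableT_comp => //; apply: measurable_funX.
- by do 2 apply: measurableT_comp => //; apply: measurable_funX.
- apply: filterS E => x hx wx /=; congr (`|(_ ^+ 2)%:E|)%E; rewrite /ent hx//.
Qed.

End TensorFields.

(** * Boundary conditions and the Poincare inequality *)

Section Closures.
Context {R : realType} {X : lmodType R}.
Implicit Types (S : set X) (B F : X -> X -> R) (l : X -> R).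

Definition clo S B S0 v := S v /\ forall e, 0 < e -> exists2 p, S0 p & B (v - p) (v - p) < e.

Lemma si_sum_le S B x y : semi_inner S B -> S x -> S y ->
  B (x + y) (x + y) <= 2 * B x x + 2 * B y y.
Proof.
move=> HB Sx Sy.
have := si_quad HB 1 Sy Sx; have := si_quad HB (-1) Sy Sx.
have := si_ge0 HB (si_lin HB (-1) Sx Sy); rewrite scale1r; lra.
Qed.

Lemma si_subC S B x y : semi_inner S B -> S x -> S y -> B (x - y) (x - y) = B (y - x) (y - x).
Proof.
move=> HB Sx Sy; have Sd := si_sub HB Sy Sx.
have -> : x - y = (-1) *: (y - x) by rewrite scaleN1r opprB.
by rewrite (si_scalel HB) ?(si_scaler HB)//; [ring|exact: (si_scale HB)].
Qed.

Lemma clo_subspace S B S0 : semi_inner S B -> subspace S0 -> S0 `<=` S -> subspace (clo S B S0).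
Proof.
move=> HB [S00 S0L] sS; split.
  split=> [|e e0]; first exact: (si_0 HB).
  exists 0 => //; rewrite subrr; have := si_scalel HB 0 (si_0 HB) (si_0 HB).
  by rewrite scale0r mul0r => ->.
move=> a x y [Sx hx] [Sy hy]; split; first exact: (si_lin HB).
move=> e e0; have a1 : 0 < 4 * (a ^+ 2 + 1) by rewrite mulr_gt0// ltr_wpDl// sqr_ge0.
have k0 := divr_gt0 e0 a1.
have [p Sp hp] := hx _ k0; have e4 : 0 < e / 4 by lra.
have [q Sq hq] := hy _ e4.
have Sxp := si_sub HB Sx (sS _ Sp); have Syq := si_sub HB Sy (sS _ Sq).
exists (a *: p + q); first exact: S0L.
have -> : a *: x + y - (a *: p + q) = a *: (x - p) + (y - q) by rewrite scalerBr opprD addrACA.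
apply: le_lt_trans (si_sum_le HB (si_scale HB a Sxp) Syq) _.
rewrite (si_scalel HB)// ?(si_scaler HB)//; last exact: (si_scale HB).
move: hp hq (si_ge0 HB Sxp); rewrite ltr_pdivlMr//.
move: (B (x - p) (x - p)) (B (y - q) (y - q)) => b1 b2 h1 h2 b0.
have : a * (a * b1) = a ^+ 2 * b1 by ring.
lra.
Qed.

Lemma clo_limit S B S0 u v : semi_inner S B -> S0 `<=` S -> (forall n, clo S B S0 (u n)) -> S v ->
  cvg_wrt B u v -> clo S B S0 v.
Proof.
move=> HB sS hu Sv uv; split => // e e0; have e4 : 0 < e / 4 by lra.
have [N hN] := uv _ e4; have hn := hN N (leqnn N).
have [Su /(_ _ e4)[p Sp hp]] := hu N.
exists p => //; have -> : v - p = (v - u N) + (u N - p) by rewrite addrA subrK.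
apply: le_lt_trans (si_sum_le HB (si_sub HB Sv Su) (si_sub HB Su (sS _ Sp))) _.
rewrite (si_subC HB Sv Su); lra.
Qed.

(** Inequalities between quadratic forms extend from a dense set, with a
    factor 4 from the triangle inequality. *)
Lemma clo_ineq S B S0 F1 F2 c : semi_inner S B -> semi_inner S F1 -> semi_inner S F2 -> S0 `<=` S ->
  0 <= c -> (forall x, S x -> F1 x x <= B x x) -> (forall x, S x -> F2 x x <= B x x) ->
  (forall p, S0 p -> F1 p p <= c * F2 p p) ->
  forall v, clo S B S0 v -> F1 v v <= 4 * c * F2 v v.
Proof.
move=> HB H1 H2 sS c0 h1 h2 h v [Sv hv]; apply/ler_addgt0Pl => e e0.
have k0 : 0 < e / (2 + 4 * c) by rewrite divr_gt0// ltr_pwDl// mulr_ge0.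
have [p Sp] := hv _ k0; rewrite ltr_pdivlMr; last by rewrite ltr_pwDl// mulr_ge0.
have Sp' := sS _ Sp; have Sd := si_sub HB Sv Sp'; have Sd' := si_sub HB Sp' Sv.
have a1 := si_sum_le H1 Sd Sp'; have a2 := si_sum_le H2 Sd' Sv.
rewrite !subrK in a1 a2; rewrite (si_subC H2 Sp' Sv) in a2.
have b1 := h1 _ Sd; have b2 := ler_wpM2l c0 (h2 _ Sd); have b3 := h _ Sp.
have a2' := ler_wpM2l c0 a2.
lra.
Qed.

Lemma clo_vanish S B S0 l c : semi_inner S B -> S0 `<=` S ->
  (forall a x y, S x -> S y -> l (a *: x + y) = a * l x + l y) ->
  (forall x, S x -> l x ^+ 2 <= c * B x x) -> (forall p, S0 p -> l p = 0) ->
  forall v, clo S B S0 v -> l v = 0.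
Proof.
move=> HB sS ll lc l0 v [Sv hv]; apply/eqP; rewrite -sqrf_eq0 eq_le sqr_ge0 andbT.
apply/ler_addgt0Pl => e e0; rewrite addr0.
have k0 : 0 < e / (`|c| + 1) by rewrite divr_gt0// ltr_wpDl.
have [p Sp] := hv _ k0; rewrite ltr_pdivlMr ?ltr_wpDl// => hp.
have Sd := si_sub HB Sv (sS _ Sp).
have -> : l v = l (v - p).
  have -> : v - p = (-1) *: p + v by rewrite scaleN1r addrC.
  by rewrite (ll _ _ _ (sS _ Sp) Sv) (l0 _ Sp) mulr0 add0r.
apply: le_trans (lc _ Sd) _; apply: ltW; apply: le_lt_trans hp; rewrite mulrC.
apply: ler_wpM2l; first exact: (si_ge0 HB).
by apply: le_trans (ler_norm c) _; rewrite lerDl.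
Qed.

Lemma complete_sub S S' B : S' `<=` S ->
  (forall u v, (forall n, S' (u n)) -> S v -> cvg_wrt B u v -> S' v) ->
  complete_wrt S B -> complete_wrt S' B.
Proof.
move=> ss hl hc u hu cu; have [v Sv uv] := hc u (fun n => ss _ (hu n)) cu.
by exists v => //; exact: hl uv.
Qed.

Lemma complete_equiv S B B' c : semi_inner S B -> semi_inner S B' ->
  (forall x, S x -> B x x <= c * B' x x) -> (forall x, S x -> B' x x <= c * B x x) ->
  complete_wrt S B -> complete_wrt S B'.
Proof.
move=> HB HB' h h' hc u Su cu.
wlog c0 : c h h' / 0 < c.
  move=> H; apply: (H (`|c| + 1)); last by rewrite ltr_wpDl.
  - move=> x Sx; apply: le_trans (h x Sx) _; apply: ler_wpM2r; first exact: (si_ge0 HB').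
    by apply: le_trans (ler_norm c) _; rewrite lerDl.
  - move=> x Sx; apply: le_trans (h' x Sx) _; apply: ler_wpM2r; first exact: (si_ge0 HB).
    by apply: le_trans (ler_norm c) _; rewrite lerDl.
have [|v Sv uv] := hc u Su.
  move=> e e0; have [N hN] := cu _ (divr_gt0 e0 c0); exists N => m n hm hn.
  apply: le_lt_trans (h _ (si_sub HB (Su m) (Su n))) _.
  by rewrite mulrC -ltr_pdivlMr//; exact: hN.
exists v => // e e0; have [N hN] := uv _ (divr_gt0 e0 c0); exists N => n hn.
apply: le_lt_trans (h' _ (si_sub HB (Su n) Sv)) _.
by rewrite mulrC -ltr_pdivlMr//; exact: hN.
Qed.

Lemma cvg_wrt_le S B B' u v : semi_inner S B -> (forall n, S (u n)) -> S v ->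
  (forall x, S x -> B' x x <= B x x) -> cvg_wrt B u v -> cvg_wrt B' u v.
Proof.
move=> HB Su Sv h uv e e0; have [N hN] := uv e e0; exists N => n hn.
by apply: le_lt_trans (hN n hn); apply: h; exact: (si_sub HB).
Qed.

End Closures.

Section Coordinates.
Context {R : realType}.
Implicit Types (x : R * R) (i j : 'I_2).

Lemma smooth_crd i : smooth (crd i : R * R -> R).
Proof.
apply: (@smooth_stable _ [set F | exists a b, F = fun x => a * crd i x + b]); last first.
  by exists 1, 0; apply/funext => x; rewrite mul1r addr0.
have key a b j x : is_derive x (ebase j) (fun x => a * crd i x + b) (if i == j then a else 0).
  have := @is_derive_comp_crd R id i j x a b 1 (is_derive_id _ _).
  by rewrite mul1r.
move=> _ [a [b ->]]; split.
- move=> x; apply: cvgD; last exact: cvg_cst.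
  by apply: cvgM; [exact: cvg_cst|exact: crd_continuous].
- by move=> j x; case: (key a b j x).
- move=> j; exists 0, (if i == j then a else 0); apply/funext => x.
  by rewrite mul0r add0r /partial derive_val.
Qed.

Lemma partial_crd i x : partial i (crd i) x = 1 :> R.
Proof.
have := @is_derive_comp_crd R id i i x 1 0 1 (is_derive_id _ _).
rewrite eqxx mul1r => -[_].
have -> // : (fun y : R * R => id (1 * crd i y + 0)) = crd i by apply/funext => y; rewrite /= mul1r addr0.
Qed.

End Coordinates.

Opaque partial ip.

Section Poincare.
Context {R : realType}.
Implicit Types (f g u v phi : R * R -> R) (x : R * R) (i j : 'I_2) (w : set (R * R)).
Local Notation mu := (leb2 R).
Notation i0 := (ord0 : 'I_2).

Lemma sum2 (F : 'I_2 -> R) : \sum_i F i = F i0 + F (lift ord0 ord0).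
Proof. by rewrite big_ord_recl big_ord1. Qed.

Lemma test_subspace w : subspace (@test_fun R w).
Proof. by split=> [|a x y]; [exact: test_fun0|exact: test_fun_lin]. Qed.

Lemma H10E w v : H10 w v <-> clo (H1 w) (@H1form R w) (test_fun w) v.
Proof.
by split=> -[hv h]; split => // e /h[phi tphi hp]; exists phi => //; move: hp; rewrite H1normsqE.
Qed.

Lemma H20E w v : H20 w v <-> clo (H2 w) (@H2form R w) (test_fun w) v.
Proof.
by split=> -[hv h]; split => // e /h[phi tphi hp]; exists phi => //; move: hp; rewrite H2normsqE.
Qed.

Lemma H1form_le w v : H1form w v v <= H2form w v v.
Proof. by rewrite lerDl; apply: sumr_ge0 => i _; apply: sumr_ge0 => j _; exact: ip_ge0. Qed.

Lemma H20_H2s w v : H20 w v -> H2s w v.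
Proof.
move=> [hv h]; split => //; split; first exact: H2_H1.
move=> e /h[phi tphi hp]; exists phi => //; apply: le_lt_trans hp.
by rewrite H1normsqE H2normsqE; exact: H1form_le.
Qed.

(** Integrate the derivative of [x1 * phi ^+ 2]. *)
Lemma poincare_test w r phi : pmeas w -> 0 < r -> w `<=` box r -> test_fun w phi ->
  ip w phi phi <= 4 * r ^+ 2 * ip w (partial i0 phi) (partial i0 phi).
Proof.
move=> mw r0 wr t; have s := test_fun_smooth t; have sc := @smooth_crd R i0.
have HL := L2_semi_inner mw.
have L0 := test_fun_L2 mw t.
pose q := fun x => phi x * crd i0 x.
have tq : test_fun w q := test_funM t sc.
have Lq := test_fun_L2 mw tq; have Lp := test_fun_L2 mw (test_fun_partial i0 t).
have E : ip w phi phi = - 2 * ip w q (partial i0 phi).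
  have h := ip_partial_smooth i0 mw t (smoothM s sc); rewrite -/q in h.
  have e : partial i0 q = phi + (fun x => crd i0 x * partial i0 phi x).
    rewrite /q partialM_smooth//; apply/funext => x.
    have -> : (phi + (fun x => crd i0 x * partial i0 phi x)) x = phi x + crd i0 x * partial i0 phi x by [].
    by rewrite partial_crd mulr1.
  have Lc : L2 w (fun x => crd i0 x * partial i0 phi x).
    have := test_fun_L2 mw (test_funM (test_fun_partial i0 t) sc); congr (L2 w).
    by apply/funext => x; rewrite mulrC.
  rewrite e -[X in X + _]scale1r (si_linl HL 1 L0 Lc L0) in h.
  have -> : ip w phi phi = 1 * ip w phi phi by rewrite mul1r.
  have e2 : ip w (fun x => crd i0 x * partial i0 phi x) phi = ip w q (partial i0 phi).
    by apply: ip_eq => x; rewrite /q; ring.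
  rewrite e2 in h; lra.
have C := cauchy_schwarz HL Lq Lp.
have Q : ip w q q <= r ^+ 2 * ip w phi phi.
  have -> : r ^+ 2 * ip w phi phi = ip w (r *: phi) (r *: phi).
    by rewrite (si_scalel HL r L0 (si_scale HL r L0)) (si_scaler HL r L0 L0); ring.
  apply: (ip_le mw Lq (si_scale HL r L0)) => x /wr[h1 _].
  have -> : (r *: phi) x = r * phi x by [].
  rewrite /q !normrM mulrC (ger0_norm (ltW r0)); apply: ler_wpM2r => //.
  by rewrite /crd eqxx ler_norml; move: h1; rewrite /= in_itv.
have p0 := ip_ge0 w phi; have g0 := ip_ge0 w (partial i0 phi).
move: E C Q p0 g0; move: (ip w phi phi) (ip w q (partial i0 phi)) (ip w q q) (ip w (partial i0 phi) (partial i0 phi)) => a m c g E C Q a0 g0.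
have [->|an] := eqVneq a 0; first by apply: mulr_ge0 => //; apply: mulr_ge0 => //; exact: sqr_ge0.
have ap : 0 < a by rewrite lt_neqAle eq_sym an.
rewrite -(ler_pM2l ap) -expr2 E exprMn.
have := ler_wpM2r g0 Q; nra.
Qed.

Lemma D1form_inner w : open w -> semi_inner (H1 w) (fun u v => \sum_i ip w (D1 w i u) (D1 w i v)).
Proof.
move=> ow; have mw := open_measurable2 ow; have S := H1_subspace ow.
exact: (si_sum S (fun i => L2map_inner mw S (D1_map i ow))).
Qed.

Lemma H1_ip_inner w : open w -> semi_inner (H1 w) (@ip R w).
Proof.
move=> ow; have mw := open_measurable2 ow; have S := H1_subspace ow.
exact: (L2map_inner mw S (@id_map R w (H1 w) (fun v hv => hv.1))).
Qed.

Lemma H1_test w phi : open w -> test_fun w phi -> H1 w phi.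
Proof. by move=> ow t; exact: (H2_H1 (H2_test ow t)). Qed.

Lemma D1_test_ip w phi v i : open w -> test_fun w phi -> L2 w v ->
  ip w (D1 w i phi) v = ip w (partial i phi) v.
Proof.
move=> ow t Lv; have mw := open_measurable2 ow.
apply: (ip_ae mw _ (test_fun_L2 mw (test_fun_partial i t)) Lv (D1_test_ae i ow t)).
by have [] := H1_D1 i (H1_test ow t).
Qed.

Lemma poincare_H10 w r v : open w -> 0 < r -> w `<=` box r -> H10 w v ->
  ip w v v <= 16 * r ^+ 2 * \sum_i ip w (D1 w i v) (D1 w i v).
Proof.
move=> ow r0 wr /H10E hv; have mw := open_measurable2 ow.
have -> : 16 * r ^+ 2 = 4 * (4 * r ^+ 2) by ring.
apply: (clo_ineq (H1form_inner ow) (H1_ip_inner ow) (D1form_inner ow) _ _ _ _ _ hv).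
- by move=> phi; exact: H1_test.
- by rewrite mulr_ge0// sqr_ge0.
- by move=> x _; rewrite lerDl; apply: sumr_ge0 => i _; exact: ip_ge0.
- by move=> x _; rewrite lerDr; exact: ip_ge0.
- move=> phi t; apply: le_trans (poincare_test mw r0 wr t) _.
  rewrite ler_pM2l; last by rewrite mulr_gt0// exprn_gt0.
  have Lp := test_fun_L2 mw (test_fun_partial i0 t).
  have [Ld _] := H1_D1 i0 (H1_test ow t).
  rewrite -(D1_test_ip i0 ow t Lp) ip_sym -(D1_test_ip i0 ow t Ld).
  by rewrite sum2 lerDl ip_ge0.
Qed.

(** Integrate by parts against test functions, then approximate [v] itself by
    them in the H1 norm. *)
Lemma grad_laplace w v : open w -> H2s w v ->
  \sum_i ip w (D1 w i v) (D1 w i v) = - \sum_i ip w (D2 w i i v) v.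
Proof.
move=> ow [hv /H10E h0]; have mw := open_measurable2 ow; have HL := L2_semi_inner mw.
have LD i : L2 w (D1 w i v) by have [] := H2_D1 i hv.
have LDD i : L2 w (D2 w i i v) by have [] := H2_D2 i i hv.
pose l phi := \sum_i (ip w (D1 w i v) (D1 w i phi) + ip w (D2 w i i v) phi).
suff : l v = 0 by rewrite /l big_split /= => /eqP; rewrite addr_eq0 => /eqP.
pose c := \sum_i (2 * ip w (D1 w i v) (D1 w i v) + 2 * ip w (D2 w i i v) (D2 w i i v)).
apply: (@clo_vanish _ _ (H1 w) (@H1form R w) (test_fun w) l (2 * c) (H1form_inner ow)) h0.
- by move=> phi; exact: H1_test.
- move=> a x y hx hy; rewrite /l mulr_sumr -big_split; apply: eq_bigr => i _ /=.
  have L1 : L2 w (D1 w i x) by have [] := H1_D1 i hx.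
  have L1' : L2 w (D1 w i y) by have [] := H1_D1 i hy.
  have hxy := (H1_subspace ow).2 a _ _ hx hy.
  have Lxy : L2 w (D1 w i (a *: x + y)) by have [] := H1_D1 i hxy.
  rewrite (ip_ae2 mw Lxy (L2_lin a mw L1 L1') (LD i) (L2map_lin (D1_map i ow) a hx hy)).
  rewrite (si_linr HL a L1 L1' (LD i)) (si_linr HL a hx.1 hy.1 (LDD i)); ring.
- move=> x hx.
  have key i : (ip w (D1 w i v) (D1 w i x) + ip w (D2 w i i v) x) ^+ 2 <=
     (2 * ip w (D1 w i v) (D1 w i v) + 2 * ip w (D2 w i i v) (D2 w i i v)) * H1form w x x.
    apply: le_trans (sq_sum_le _ _) _; rewrite mulrDl.
    have Lx : L2 w (D1 w i x) by have [] := H1_D1 i hx.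
    have c1 := cauchy_schwarz HL (LD i) Lx; have c2 := cauchy_schwarz HL (LDD i) hx.1.
    have f1 : ip w x x <= H1form w x x by rewrite lerDl; apply: sumr_ge0 => j _; exact: ip_ge0.
    have f2 : ip w (D1 w i x) (D1 w i x) <= H1form w x x.
      rewrite /H1form (bigD1 i)//= addrCA lerDl addr_ge0 ?ip_ge0//; apply: sumr_ge0 => j _; exact: ip_ge0.
    have g1 := ler_wpM2l (ip_ge0 w (D1 w i v)) f2; have g2 := ler_wpM2l (ip_ge0 w (D2 w i i v)) f1.
    lra.
  rewrite /l sum2; apply: le_trans (sq_sum_le _ _) _; rewrite /c sum2.
  have := key i0; have := key (lift ord0 ord0); lra.
- move=> phi t; rewrite /l big1// => i _; have [_ h] := H2_D2 i i hv.
  rewrite ip_sym (D1_test_ip i ow t (LD i)) ip_sym (h _ t); exact: addNr.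
Qed.

Lemma H2_hess_formE w u v : open w -> H2 w u -> H2 w v ->
  \sum_i \sum_j ip w (D2 w i j u) (D2 w i j v) = ipM w (Eps w u) (Eps w v).
Proof.
move=> ow hu hv; have mw := open_measurable2 ow.
rewrite (ipME mw (H2_LM ow hu) (H2_LM ow hv)); apply: eq_bigr => i _; apply: eq_bigr => j _.
have [L1 _] := H2_D2 i j hu; have [L2' _] := H2_D2 i j hv.
have a := ip_ae mw (H2_LM ow hu i j) L1 L2' (Eps_D2_ae i j ow hu).
have b := ip_ae2 mw (H2_LM ow hv i j) L2' (H2_LM ow hu i j) (Eps_D2_ae i j ow hv).
by rewrite b a.
Qed.

(** The gradient is controlled by [|v| |Laplacian v|], and [|v|] by the
    gradient; vanishing boundary values of the function itself suffice, which
    covers both boundary conditions. *)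
Theorem poincare w : open w -> bounded_set w -> exists2 c, 0 < c & forall v, H2s w v ->
  H2form w v v <= c * ipM w (Eps w v) (Eps w v).
Proof.
move=> ow bw; have [r r0 wr] := bounded_in_box bw; have mw := open_measurable2 ow.
pose k := 16 * r ^+ 2; have k0 : 0 < k by rewrite mulr_gt0// exprn_gt0.
exists (2 * k ^+ 2 + 2 * k + 1); first by rewrite !addr_gt0// mulr_gt0// exprn_gt0.
move=> v hv; have [h2 h1] := hv; have HL := L2_semi_inner mw.
have p := poincare_H10 ow r0 wr h1; rewrite -/k in p.
rewrite /H2form /H1form -(H2_hess_formE ow h2 h2).
have E := grad_laplace ow hv.
have LD i : L2 w (D2 w i i v) by have [] := H2_D2 i i h2.
have c1 := cauchy_schwarz HL (LD i0) (H2_L2 h2).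
have c2 := cauchy_schwarz HL (LD (lift ord0 ord0)) (H2_L2 h2).
have hh : ip w (D2 w i0 i0 v) (D2 w i0 i0 v) + ip w (D2 w (lift ord0 ord0) (lift ord0 ord0) v) (D2 w (lift ord0 ord0) (lift ord0 ord0) v)
   <= \sum_i \sum_j ip w (D2 w i j v) (D2 w i j v).
  rewrite !sum2; apply: lerD; [rewrite lerDl|rewrite lerDr]; exact: ip_ge0.
rewrite [in RHS]sum2 in E.
have g0 : 0 <= \sum_i ip w (D1 w i v) (D1 w i v) by apply: sumr_ge0 => i _; exact: ip_ge0.
have n0 := ip_ge0 w v.
have d1 := ip_ge0 w (D2 w i0 i0 v); have d2 := ip_ge0 w (D2 w (lift ord0 ord0) (lift ord0 ord0) v).
move: c1 c2 E p hh g0 n0 d1 d2.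
move: (ip w v v) (\sum_i ip w (D1 w i v) (D1 w i v)) (\sum_i \sum_j ip w (D2 w i j v) (D2 w i j v)).
move: (ip w (D2 w i0 i0 v) v) (ip w (D2 w (lift ord0 ord0) (lift ord0 ord0) v) v) (ip w (D2 w i0 i0 v) (D2 w i0 i0 v)) (ip w (D2 w (lift ord0 ord0) (lift ord0 ord0) v) (D2 w (lift ord0 ord0) (lift ord0 ord0) v)).
move=> m1 m2 q1 q2 N Gd HH c1 c2 E p hh g0 n0 d1 d2.
have G2 : Gd <= 2 * k * HH.
  have [->|Gn] := eqVneq Gd 0; first by apply: mulr_ge0; [apply: mulr_ge0 => //; exact: ltW|lra].
  have Gp : 0 < Gd by rewrite lt_neqAle eq_sym Gn.
  rewrite -(ler_pM2r Gp) -expr2.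
  have e1 : Gd ^+ 2 <= 2 * m1 ^+ 2 + 2 * m2 ^+ 2 by rewrite E sqrrN; exact: sq_sum_le.
  have e2 : (q1 + q2) * N <= HH * (k * Gd) by apply: ler_pM => //; exact: addr_ge0.
  lra.
have := ler_wpM2l (ltW k0) G2; lra.
Qed.

End Poincare.

Section Completeness.
Context {R : realType}.
Implicit Types (f g u v phi : R * R -> R) (x : R * R) (i j : 'I_2) (w : set (R * R)) (a : bc).
Local Notation mu := (leb2 R).

Definition H2part w (k : option (option 'I_2 * 'I_2)) v : R * R -> R :=
  match k with
  | None => v
  | Some (None, i) => D1 w i v
  | Some (Some i, j) => D2 w i j v
  end.

Lemma H2part_map w k : open w -> L2map (H2 w) w (H2part w k).
Proof.
move=> ow; case: k => [[[i|] j]|] /=.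
- exact: D2_map.
- exact: L2map_subset (@H2_H1 R w) (D1_map j ow).
- by apply: id_map => v hv; exact: H2_L2.
Qed.

Lemma H2part_le w k v : ip w (H2part w k v) (H2part w k v) <= H2form w v v.
Proof.
have n0 := ip_ge0 w v.
have g0 : 0 <= \sum_i ip w (D1 w i v) (D1 w i v) by apply: sumr_ge0 => i _; exact: ip_ge0.
have h0 i : 0 <= \sum_j ip w (D2 w i j v) (D2 w i j v) by apply: sumr_ge0 => j _; exact: ip_ge0.
have hh0 : 0 <= \sum_i \sum_j ip w (D2 w i j v) (D2 w i j v) by apply: sumr_ge0.
rewrite /H2form /H1form; case: k => [[[i|] j]|] /=.
- apply: (@le_trans _ _ (\sum_i \sum_j ip w (D2 w i j v) (D2 w i j v))); last by rewrite lerDr addr_ge0.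
  rewrite (bigD1 i)//= (bigD1 j)//= -addrA lerDl addr_ge0//; apply: sumr_ge0 => // k _; exact: ip_ge0.
- apply: (@le_trans _ _ (\sum_i ip w (D1 w i v) (D1 w i v))).
    by rewrite (bigD1 j)//= lerDl; apply: sumr_ge0 => // k _; exact: ip_ge0.
  by rewrite -addrA addrCA lerDl addr_ge0.
- by rewrite -addrA lerDl addr_ge0.
Qed.

Lemma H2part_ge w v : H2form w v v <= 7 * \sum_k ip w (H2part w k v) (H2part w k v).
Proof.
set s := \sum_k _.
have le k : ip w (H2part w k v) (H2part w k v) <= s.
  by rewrite /s (bigD1 k)//= lerDl; apply: sumr_ge0 => l _; exact: ip_ge0.
have h0 := le None; have h1 i := le (Some (None, i)); have h2 i j := le (Some (Some i, j)).
rewrite /H2form /H1form !sum2; move: h0 (h1 ord0) (h1 (lift ord0 ord0)).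
move: (h2 ord0 ord0) (h2 ord0 (lift ord0 ord0)) (h2 (lift ord0 ord0) ord0) (h2 (lift ord0 ord0) (lift ord0 ord0)).
rewrite /=; lra.
Qed.

Lemma H2_complete w : open w -> complete_wrt (H2 w) (@H2form R w).
Proof.
move=> ow; have mw := open_measurable2 ow.
apply: (@complete_graph R _ _ (H2 w) (@H2form R w) w (H2part w) 7 mw (H2form_inner ow)).
- by move=> k; exact: H2part_map.
- move=> v k hv; apply: le_trans (H2part_le w k v) _.
  have := si_ge0 (H2form_inner ow) hv; lra.
- by move=> v _; exact: H2part_ge.
- move=> u g hu Lg ug.
  have L1 i n : L2 w (D1 w i (u n)) by have [] := H2_D1 i (hu n).
  have L2' i j n : L2 w (D2 w i j (u n)) by have [] := H2_D2 i j (hu n).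
  have w1 i : is_wpartial w i (g None) (g (Some (None, i))).
    apply: (is_wpartial_limit mw (fun n => H2_L2 (hu n)) (Lg _) (L1 i) (Lg _) (ug None) (ug (Some (None, i)))).
    by move=> n; have [] := H2_D1 i (hu n).
  have w2 i j : is_wpartial w j (g (Some (None, i))) (g (Some (Some i, j))).
    apply: (is_wpartial_limit mw (L1 i) (Lg _) (L2' i j) (Lg _) (ug (Some (None, i))) (ug (Some (Some i, j)))).
    by move=> n; have [] := H2_D2 i j (hu n).
  exists (g None).
    exact: (@H2_intro _ _ _ (fun i => g (Some (None, i))) (fun i j => g (Some (Some i, j))) ow).
  case=> [[[i|] j]|] /=.
  + exact: (D2_ae ow (Lg (Some (None, i))) (Lg _) (w1 i) (w2 i j)).
  + exact: (D1_ae ow (Lg _) (w1 j)).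
  + exact: ae_eq_refl.
Qed.

Lemma H2bc_H2s a w v : H2bc a w v -> H2s w v.
Proof. by case: a => //=; exact: H20_H2s. Qed.

Lemma H2bc_H2 a w v : H2bc a w v -> H2 w v.
Proof. by move=> /H2bc_H2s[]. Qed.

Lemma H2bc_test a w phi : open w -> test_fun w phi -> H2bc a w phi.
Proof.
move=> ow t; suff h : H20 w phi by case: a => //=; exact: H20_H2s.
split; first exact: H2_test.
move=> e e0; exists phi => //; rewrite H2normsqE subrr.
have := si_scalel (H2form_inner ow) 0 (si_0 (H2form_inner ow)) (si_0 (H2form_inner ow)).
by rewrite scale0r mul0r => ->.
Qed.

Lemma H2bc_subspace a w : open w -> subspace (H2bc a w).
Proof.
move=> ow; have tt := @test_subspace R w.
case: a => /=.
  have [h0 hL] := clo_subspace (H2form_inner ow) tt (fun phi => @H2_test R w phi ow).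
  by split=> [|a x y /H20E hx /H20E hy]; apply/H20E => //; exact: hL.
have [h0 hL] := clo_subspace (H1form_inner ow) tt (fun phi => @H1_test R w phi ow).
have [k0 kL] := H2_subspace ow.
split; first by split => //; apply/H10E.
by move=> a x y [hx /H10E hx'] [hy /H10E hy']; split; [exact: kL|apply/H10E; exact: hL].
Qed.

Lemma H2bc_limit a w (u : nat -> R * R -> R) v : open w -> (forall n, H2bc a w (u n)) -> H2 w v ->
  cvg_wrt (@H2form R w) u v -> H2bc a w v.
Proof.
move=> ow hu hv uv; case: a hu => /= hu.
  apply/H20E; apply: (clo_limit (H2form_inner ow) _ _ hv uv).
    by move=> phi; exact: H2_test.
  by move=> n; exact/H20E.
split => //; apply/H10E; apply: (clo_limit (H1form_inner ow) (u := u)).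
- by move=> phi; exact: H1_test.
- by move=> n; apply/H10E; case: (hu n).
- exact: H2_H1.
- apply: (cvg_wrt_le (H2form_inner ow) _ hv _ uv); first by move=> n; case: (hu n).
  by move=> x _; exact: H1form_le.
Qed.

Lemma H2bc_complete a w : open w -> complete_wrt (H2bc a w) (@H2form R w).
Proof.
move=> ow; apply: (complete_sub _ _ (H2_complete ow)); first by move=> v; exact: H2bc_H2.
by move=> u v hu hv; exact: H2bc_limit.
Qed.

Lemma Eps_inner w : open w -> semi_inner (H2 w) (fun u v => ipM w (Eps w u) (Eps w v)).
Proof.
move=> ow; have mw := open_measurable2 ow; have S := H2_subspace ow.
have h := si_sum S (fun i => si_sum S (fun j => L2map_inner mw S (Eps_map i j ow))).
have E u v : H2 w u -> H2 w v -> ipM w (Eps w u) (Eps w v) =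
   \sum_i \sum_j ip w (ent (Eps w u) i j) (ent (Eps w v) i j).
  by move=> hu hv; rewrite (ipME mw (H2_LM ow hu) (H2_LM ow hv)).
split.
- exact: (si_0 h).
- exact: (si_lin h).
- by move=> x y Sx Sy; rewrite ipM_sym.
- move=> a x y z Sx Sy Sz; have Sxy := si_lin h a Sx Sy.
  exact: (etrans (E _ _ Sxy Sz) (etrans (si_linl h a Sx Sy Sz)
    (esym (congr2 (fun s t => a * s + t) (E _ _ Sx Sz) (E _ _ Sy Sz))))).
- by move=> x Sx; rewrite (E _ _ Sx Sx); exact: (si_ge0 h).
Qed.

Definition dform (d : R) w u v : R := d * ip w u v + ipM w (Eps w u) (Eps w v).

Lemma H2_ip_inner w : open w -> semi_inner (H2 w) (@ip R w).
Proof. by move=> ow; exact: (si_subset (H2_subspace ow) (@H2_H1 R w) (H1_ip_inner ow)). Qed.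

Lemma dform_inner d w : open w -> 0 <= d -> semi_inner (H2 w) (dform d w).
Proof.
move=> ow d0; have := si_plus (Eps_inner ow) (H2_ip_inner ow) d0.
by congr (semi_inner _ _); apply/funext => u; apply/funext => v; rewrite addrC.
Qed.

(** A Cauchy sequence has a limit whose distributional Hessian is square
    integrable; the regularity theorem makes it an H2 function although the
    norm does not control first derivatives. *)
Lemma dform_complete d w : open w -> bounded_set w -> lipschitz_boundary w -> 0 < d ->
  complete_wrt (H2 w) (dform d w).
Proof.
move=> ow bw lw d0; have mw := open_measurable2 ow.
pose A (k : option ('I_2 * 'I_2)) v := if k is Some (i, j) then ent (Eps w v) i j else v.
have EE v : H2 w v -> ipM w (Eps w v) (Eps w v) = \sum_i \sum_j ip w (ent (Eps w v) i j) (ent (Eps w v) i j).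
  by move=> hv; rewrite (ipME mw (H2_LM ow hv) (H2_LM ow hv)).
have nE v : 0 <= \sum_i \sum_j ip w (ent (Eps w v) i j) (ent (Eps w v) i j).
  by apply: sumr_ge0 => i _; apply: sumr_ge0 => j _; exact: ip_ge0.
have d'0 : 0 < d^-1 by rewrite invr_gt0.
apply: (@complete_graph R _ _ (H2 w) (dform d w) w A (1 + d^-1 + d + 4) mw (dform_inner ow (ltW d0))).
- case=> [[i j]|]; first exact: Eps_map.
  by apply: id_map => v; exact: H2_L2.
- move=> v k hv; rewrite /dform (EE v hv); have n0 := ip_ge0 w v; have e0 := nE v.
  have dn : 0 <= d * ip w v v by rewrite mulr_ge0// ltW.
  have key : ip w (A k v) (A k v) <= (1 + d^-1) * (d * ip w v v + \sum_i \sum_j ip w (ent (Eps w v) i j) (ent (Eps w v) i j)).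
    case: k => [[i j]|] /=.
      apply: (@le_trans _ _ (\sum_i \sum_j ip w (ent (Eps w v) i j) (ent (Eps w v) i j))).
        rewrite (bigD1 i)//= (bigD1 j)//= -addrA lerDl addr_ge0//; apply: sumr_ge0 => *; [exact: ip_ge0|].
        by apply: sumr_ge0 => *; exact: ip_ge0.
      have := mulr_ge0 (ltW d'0) (addr_ge0 dn e0); lra.
    have E : ip w v v = d^-1 * (d * ip w v v) by rewrite mulrA mulVf ?mul1r// gt_eqF.
    have := mulr_ge0 (ltW d'0) e0; lra.
  apply: le_trans key _; apply: ler_wpM2r; [exact: addr_ge0|lra].
- move=> v hv; rewrite /dform (EE v hv).
  set s := \sum_k ip w (A k v) (A k v).
  have le k : ip w (A k v) (A k v) <= s.
    by rewrite /s (bigD1 k)//= lerDl; apply: sumr_ge0 => l _; exact: ip_ge0.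
  have s0 : 0 <= s by apply: sumr_ge0 => l _; exact: ip_ge0.
  have h0 := le None; have h2 i j := le (Some (i, j)).
  rewrite !sum2; move: h0 (h2 ord0 ord0) (h2 ord0 (lift ord0 ord0)) (h2 (lift ord0 ord0) ord0) (h2 (lift ord0 ord0) (lift ord0 ord0)).
  rewrite /= => h0 h1 h3 h4 h5; have := ler_wpM2l (ltW d0) h0; have := mulr_ge0 (ltW d'0) s0; lra.
- move=> u g hu Lg ug.
  pose G x := \matrix_(i, j) g (Some (i, j)) x.
  have entG i j : ent G i j = g (Some (i, j)) by apply/funext => x; rewrite /ent mxE.
  have LG : LM w G by move=> i j; rewrite entG.
  have wG : weak_hess w (g None) G.
    move=> i j phi t; rewrite entG.
    have Lp := test_fun_L2 mw t; have Lpp := test_fun_L2 mw (test_fun_partial i (test_fun_partial j t)).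
    rewrite -[RHS]mul1r.
    apply: (ip_limit mw (fun n => H2_L2 (hu n)) (Lg None) Lpp (fun n => H2_LM ow (hu n) i j) (Lg (Some (i, j))) Lp (ug None) (ug (Some (i, j)))) => n.
    by rewrite mul1r; exact: (H2_weak_hess ow (hu n) i j t).
  have hv : H2 w (g None) := weak_hess_H2 ow bw lw (Lg None) LG wG.
  exists (g None) => // -[[i j]|] /=; last exact: ae_eq_refl.
  by rewrite -entG; exact: (Eps_ae ow hv LG wG).
Qed.

End Completeness.

(** * The double divergence *)

Section DivDiv.
Context {R : realType}.
Implicit Types (f g q u v phi psi : R * R -> R) (P Q G : R * R -> 'M[R]_2) (x : R * R) (i j k l : 'I_2) (w : set (R * R)).
Local Notation mu := (leb2 R).

Lemma L2sP w Q : L2s w Q <-> LM w Q /\ forall i j, ae_eq mu w (ent Q i j) (ent Q j i).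
Proof.
have E i j : ent (fun x => (Q x)^T) i j = ent Q j i by apply/funext => x; rewrite /ent mxE.
split=> [[sQ LQ]|[LQ h]]; split => //.
  by move=> i j; rewrite -[ent Q j i]E; apply: ae_eq_sym; exact: ((ent_ae w _ _).2 sQ).
have : ae_eq mu w (fun x => (Q x)^T) Q by apply/ent_ae => i j; rewrite E; exact: h.
exact.
Qed.

Lemma L2s_LM w Q : L2s w Q -> LM w Q. Proof. by case. Qed.

Lemma L2s_subspace w : pmeas w -> subspace (@L2s R w).
Proof.
move=> mw; split.
  apply/L2sP; split; first exact: LM_0.
  by move=> i j; apply: aeW => x _; rewrite /ent !mxE.
move=> a P Q /L2sP[LP sP] /L2sP[LQ sQ]; apply/L2sP; split.
  exact: ((LM_subspace mw).2 a P Q LP LQ).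
move=> i j; rewrite !entL; apply: filterS (filterI (sP i j) (sQ i j)) => x [h1 h2] wx.
by rewrite !linE h1// h2.
Qed.

Lemma L2s_sym w Q : LM w Q -> (forall x, symmetric_tensor (Q x)) -> L2s w Q.
Proof. by move=> LQ sQ; split => //; apply: aeW => x _. Qed.

Lemma L2s_sub w w' Q : pmeas w -> pmeas w' -> w' `<=` w -> L2s w Q -> L2s w' Q.
Proof.
move=> mw mw' sw /L2sP[LQ sQ]; apply/L2sP; split; first exact: LM_sub LQ.
by move=> i j; apply: filterS (sQ i j) => x h /sw.
Qed.

Lemma HdivDiv_intro w Q q : L2s w Q -> L2 w q -> is_divDiv w Q q -> HdivDiv w Q.
Proof. by move=> LQ Lq h; split => //; exists q. Qed.

Lemma dd_spec w Q : HdivDiv w Q -> L2 w (dd w Q) /\ is_divDiv w Q (dd w Q).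
Proof. by move=> [_ h]; rewrite -ddE; exact: (@getPex _ [set q | L2 w q /\ is_divDiv w Q q]). Qed.

Lemma is_divDiv_uniq w Q q q' : open w -> L2 w q -> L2 w q' -> is_divDiv w Q q -> is_divDiv w Q q' ->
  ae_eq mu w q q'.
Proof.
move=> ow Lq Lq' h h'; apply: (L2_eq_tested ow Lq Lq') => a1 b1 a2 b2 n hr.
by have t := rect_test_fun n hr; exact: (etrans (h _ t) (esym (h' _ t))).
Qed.

Lemma dd_ae w Q q : open w -> L2s w Q -> L2 w q -> is_divDiv w Q q -> ae_eq mu w (dd w Q) q.
Proof.
move=> ow LQ Lq h; have [L1 h1] := dd_spec (HdivDiv_intro LQ Lq h).
exact: (is_divDiv_uniq ow L1 Lq h1 h).
Qed.

Lemma is_divDiv_lin w a P Q p q : pmeas w -> LM w P -> LM w Q -> L2 w p -> L2 w q ->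
  is_divDiv w P p -> is_divDiv w Q q -> is_divDiv w (a *: P + Q) (a *: p + q).
Proof.
move=> mw LP LQ Lp Lq hp hq phi t; have Lt := test_fun_L2 mw t; have Lh := LM_hessian mw t.
rewrite (si_linl (L2_semi_inner mw) a Lp Lq Lt) (si_linl (LM_ipM_inner mw) a LP LQ Lh).
by congr (_ * _ + _); [exact: hp|exact: hq].
Qed.

Lemma is_divDiv0 w : pmeas w -> is_divDiv w (0 : R * R -> 'M[R]_2) 0.
Proof.
move=> mw phi t; have Lt := test_fun_L2 mw t; have Lh := LM_hessian mw t.
have := si_scalel (L2_semi_inner mw) 0 (L2_0 mw) Lt.
have := si_scalel (LM_ipM_inner mw) 0 (LM_0 mw) Lh.
by rewrite !scale0r !mul0r => -> ->.
Qed.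

Lemma HdivDiv_L2s w Q : HdivDiv w Q -> L2s w Q. Proof. by case. Qed.
Lemma HdivDiv_LM w Q : HdivDiv w Q -> LM w Q. Proof. by case=> /L2s_LM. Qed.

Lemma HdivDiv_subspace w : open w -> subspace (@HdivDiv R w).
Proof.
move=> ow; have mw := open_measurable2 ow; have [S0 SL] := L2s_subspace mw; split.
  exact: (HdivDiv_intro S0 (L2_0 mw) (is_divDiv0 mw)).
move=> a P Q hP hQ; have [L1 h1] := dd_spec hP; have [L2' h2] := dd_spec hQ.
apply: (HdivDiv_intro (SL a _ _ (HdivDiv_L2s hP) (HdivDiv_L2s hQ)) (L2_lin a mw L1 L2')).
exact: (is_divDiv_lin a mw (HdivDiv_LM hP) (HdivDiv_LM hQ) L1 L2' h1 h2).
Qed.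

Lemma dd_map w : open w -> L2map (@HdivDiv R w) w (dd w).
Proof.
move=> ow; have mw := open_measurable2 ow; split=> [Q hQ|a P Q hP hQ]; first by case: (dd_spec hQ).
have [L1 h1] := dd_spec hP; have [L2' h2] := dd_spec hQ.
apply: (dd_ae ow (HdivDiv_L2s ((HdivDiv_subspace ow).2 a _ _ hP hQ)) (L2_lin a mw L1 L2')).
exact: (is_divDiv_lin a mw (HdivDiv_LM hP) (HdivDiv_LM hQ) L1 L2' h1 h2).
Qed.

Lemma is_divDiv_sub w w' Q q : pmeas w -> pmeas w' -> w' `<=` w -> LM w Q ->
  is_divDiv w Q q -> is_divDiv w' Q q.
Proof.
move=> mw mw' sw LQ h phi t; have t' := test_fun_subset sw t.
rewrite -(ip_test q mw mw' sw t); apply: (etrans (h _ t')).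
rewrite (ipME mw LQ (LM_hessian mw t')) (ipME mw' (LM_sub mw mw' sw LQ) (LM_hessian mw' t)).
apply: eq_bigr => i _; apply: eq_bigr => j _; rewrite ent_hessian.
exact: (ip_test _ mw mw' sw (test_fun_partial j (test_fun_partial i t))).
Qed.

Lemma HdivDiv_sub w w' Q : open w -> open w' -> w' `<=` w -> HdivDiv w Q -> HdivDiv w' Q.
Proof.
move=> ow ow' sw hQ; have mw := open_measurable2 ow; have mw' := open_measurable2 ow'.
have [L1 h1] := dd_spec hQ.
apply: (HdivDiv_intro (L2s_sub mw mw' sw (HdivDiv_L2s hQ)) (L2_subset mw mw' sw L1)).
exact: (is_divDiv_sub mw mw' sw (HdivDiv_LM hQ) h1).
Qed.

Lemma dd_sub w w' Q : open w -> open w' -> w' `<=` w -> HdivDiv w Q -> ae_eq mu w' (dd w' Q) (dd w Q).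
Proof.
move=> ow ow' sw hQ; have mw := open_measurable2 ow; have mw' := open_measurable2 ow'.
have [L1 h1] := dd_spec hQ.
apply: (dd_ae ow' (L2s_sub mw mw' sw (HdivDiv_L2s hQ)) (L2_subset mw mw' sw L1)).
exact: (is_divDiv_sub mw mw' sw (HdivDiv_LM hQ) h1).
Qed.

Lemma is_divDiv_ae w Q Q' q : pmeas w -> LM w Q -> LM w Q' ->
  (forall i j, ae_eq mu w (ent Q i j) (ent Q' i j)) -> is_divDiv w Q q -> is_divDiv w Q' q.
Proof.
move=> mw LQ LQ' E h phi t; apply: (etrans (h _ t)).
exact: (ipM_ae mw LQ LQ' (LM_hessian mw t) E).
Qed.

Definition Qform (c : R) w P Q : R := ipM w P Q + c * ip w (dd w P) (dd w Q).

Lemma Qform_inner c w : open w -> 0 <= c -> semi_inner (@HdivDiv R w) (Qform c w).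
Proof.
move=> ow c0; have mw := open_measurable2 ow; have S := HdivDiv_subspace ow.
have h1 := si_subset S (@HdivDiv_LM w) (LM_ipM_inner mw).
have h2 := L2map_inner mw S (dd_map ow).
exact: (si_plus h1 h2 c0).
Qed.

Lemma L2_limit_uniq w (u u' : nat -> R * R -> R) g g' : pmeas w -> (forall n, L2 w (u n)) ->
  (forall n, L2 w (u' n)) -> L2 w g -> L2 w g' ->
  cvg_wrt (@ip R w) u g -> cvg_wrt (@ip R w) u' g' -> (forall n, ae_eq mu w (u n) (u' n)) -> ae_eq mu w g g'.
Proof.
move=> mw Lu Lu' Lg Lg' ug ug' E; have HL := L2_semi_inner mw.
have Ld := si_sub HL Lg Lg'.
have H : ae_eq mu w (g - g') 0.
  apply: (ip_eq0_ae mw Ld); rewrite (si_subl HL Lg Lg' Ld).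
  have -> : ip w g (g - g') = 1 * ip w g' (g - g').
    apply: (ip_limit mw Lu Lg Ld Lu' Lg' Ld ug ug') => n; rewrite mul1r.
    exact: (ip_ae mw (Lu n) (Lu' n) Ld (E n)).
  by rewrite mul1r subrr.
apply: filterS H => x h wx; apply/eqP; rewrite -subr_eq0; apply/eqP; exact: h.
Qed.

(** The distributional double divergence is a closed operator. *)
Lemma Qform_complete c w : open w -> 0 < c -> complete_wrt (@HdivDiv R w) (Qform c w).
Proof.
move=> ow c0; have mw := open_measurable2 ow.
pose A (k : option ('I_2 * 'I_2)) Q := if k is Some (i, j) then ent Q i j else dd w Q.
have EE Q : HdivDiv w Q -> ipM w Q Q = \sum_i \sum_j ip w (ent Q i j) (ent Q i j).
  by move=> hQ; rewrite (ipME mw (HdivDiv_LM hQ) (HdivDiv_LM hQ)).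
have nE Q : 0 <= \sum_i \sum_j ip w (ent Q i j) (ent Q i j).
  by apply: sumr_ge0 => i _; apply: sumr_ge0 => j _; exact: ip_ge0.
have c'0 : 0 < c^-1 by rewrite invr_gt0.
apply: (@complete_graph R _ _ (@HdivDiv R w) (Qform c w) w A (1 + c^-1 + c + 4) mw (Qform_inner ow (ltW c0))).
- case=> [[i j]|]; last exact: dd_map.
  by apply: L2map_subset (ent_map w i j) => Q; exact: HdivDiv_LM.
- move=> Q k hQ; rewrite /Qform (EE Q hQ); have n0 := ip_ge0 w (dd w Q); have e0 := nE Q.
  have dn : 0 <= c * ip w (dd w Q) (dd w Q) by rewrite mulr_ge0// ltW.
  have key : ip w (A k Q) (A k Q) <= (1 + c^-1) * (\sum_i \sum_j ip w (ent Q i j) (ent Q i j) + c * ip w (dd w Q) (dd w Q)).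
    case: k => [[i j]|] /=.
      apply: (@le_trans _ _ (\sum_i \sum_j ip w (ent Q i j) (ent Q i j))).
        rewrite (bigD1 i)//= (bigD1 j)//= -addrA lerDl addr_ge0//; apply: sumr_ge0 => *; [exact: ip_ge0|].
        by apply: sumr_ge0 => *; exact: ip_ge0.
      have := mulr_ge0 (ltW c'0) (addr_ge0 dn e0); lra.
    have E : ip w (dd w Q) (dd w Q) = c^-1 * (c * ip w (dd w Q) (dd w Q)) by rewrite mulrA mulVf ?mul1r// gt_eqF.
    have := mulr_ge0 (ltW c'0) e0; lra.
  apply: le_trans key _; apply: ler_wpM2r; [exact: addr_ge0|lra].
- move=> Q hQ; rewrite /Qform (EE Q hQ).
  set s := \sum_k ip w (A k Q) (A k Q).
  have le (kk : option ('I_2 * 'I_2)) : ip w (A kk Q) (A kk Q) <= s.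
    by rewrite /s (bigD1 kk)//= lerDl; apply: sumr_ge0 => l _; exact: ip_ge0.
  have s0 : 0 <= s by apply: sumr_ge0 => l _; exact: ip_ge0.
  have h0 := le None; have h2 i j := le (Some (i, j)).
  rewrite !sum2; move: h0 (h2 ord0 ord0) (h2 ord0 (lift ord0 ord0)) (h2 (lift ord0 ord0) ord0) (h2 (lift ord0 ord0) (lift ord0 ord0)).
  rewrite /= => h0 h1 h3 h4 h5; have := ler_wpM2l (ltW c0) h0; have := mulr_ge0 (ltW c'0) s0; lra.
- move=> u g hu Lg ug.
  pose G x := \matrix_(i, j) g (Some (i, j)) x.
  have entG i j : ent G i j = g (Some (i, j)) by apply/funext => x; rewrite /ent mxE.
  have LG : LM w G by move=> i j; rewrite entG.
  have Lu i j n : L2 w (ent (u n) i j) := HdivDiv_LM (hu n) i j.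
  have sG : L2s w G.
    apply/L2sP; split => // i j; rewrite !entG.
    apply: (L2_limit_uniq mw (Lu i j) (Lu j i) (Lg _) (Lg _) (ug (Some (i, j))) (ug (Some (j, i)))) => n.
    by have /L2sP[_] := HdivDiv_L2s (hu n); exact.
  have wG : is_divDiv w G (g None).
    move=> phi t; have Lt := test_fun_L2 mw t; have Lh := LM_hessian mw t.
    have Ldd n : L2 w (dd w (u n)) by case: (dd_spec (hu n)).
    rewrite (ipME mw LG Lh).
    apply: (cvg_wrt_ip mw Ldd (Lg None) Lt (ug None) (fun n => (dd_spec (hu n)).2 phi t)) => e e0.
    have e4 : 0 < e / 4 by lra.
    have /choice[N hN] : forall ij : 'I_2 * 'I_2, exists N, forall n, (N <= n)%N ->
        `|ip w (ent (u n) ij.1 ij.2) (ent (hessian phi) ij.1 ij.2) - ip w (ent G ij.1 ij.2) (ent (hessian phi) ij.1 ij.2)| < e / 4.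
      move=> [i j] /=; rewrite entG.
      exact: (cvg_wrt_inner (L2_semi_inner mw) (Lu i j) (Lg _) (Lh i j) (ug (Some (i, j))) e4).
    exists (\sum_ij N ij)%N => n hn.
    have h ij := hN ij n (leq_trans (leq_trans (leq_addr _ _) (eq_leq (esym (bigD1 ij isT)))) hn).
    rewrite (ipME mw (HdivDiv_LM (hu n)) Lh) !sum2.
    move: (h (ord0, ord0)) (h (ord0, lift ord0 ord0)) (h (lift ord0 ord0, ord0)) (h (lift ord0 ord0, lift ord0 ord0)).
    rewrite /=.
    move: (ip w (ent (u n) ord0 ord0) _) (ip w (ent (u n) ord0 (lift ord0 ord0)) _) (ip w (ent (u n) (lift ord0 ord0) ord0) _) (ip w (ent (u n) (lift ord0 ord0) (lift ord0 ord0)) _).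
    move: (ip w (ent G ord0 ord0) _) (ip w (ent G ord0 (lift ord0 ord0)) _) (ip w (ent G (lift ord0 ord0) ord0) _) (ip w (ent G (lift ord0 ord0) (lift ord0 ord0)) _).
    move=> b1 b2 b3 b4 a1 a2 a3 a4; rewrite !ltr_norml => /andP[p1 p2] /andP[p3 p4] /andP[p5 p6] /andP[p7 p8].
    lra.
  have hG : HdivDiv w G := HdivDiv_intro sG (Lg None) wG.
  exists G => // -[[i j]|] /=; first by rewrite entG; exact: ae_eq_refl.
  exact: (dd_ae ow sG (Lg None) wG).
Qed.

(** Symmetric fields with a single pair of nonzero entries; testing with them
    isolates one second derivative. *)
Definition sym_unit i j phi : R * R -> 'M[R]_2 :=
  fun x => phi x *: (delta_mx i j + delta_mx j i).

Lemma delta_sum (H : 'I_2 -> 'I_2 -> R) i j :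
  \sum_k \sum_l (((k == i) && (l == j))%:R + ((k == j) && (l == i))%:R) * H k l = H i j + H j i.
Proof.
have ne : (lift ord0 ord0 == ord0 :> 'I_2) = false by [].
have ne' : (ord0 == lift ord0 ord0 :> 'I_2) = false by [].
by rewrite !sum2; case: (ord2 i) => ->; case: (ord2 j) => ->; rewrite !eqxx ?ne ?ne' /=; ring.
Qed.

Lemma ipM_sym_unit w i j phi G : pmeas w -> test_fun w phi -> LM w G ->
  LM w (sym_unit i j phi) /\ ipM w (sym_unit i j phi) G = ip w phi (ent G i j) + ip w phi (ent G j i).
Proof.
move=> mw t LG; have Lt := test_fun_L2 mw t; have HL := L2_semi_inner mw.
pose c k l : R := ((k == i) && (l == j))%:R + ((k == j) && (l == i))%:R.
have E k l : ent (sym_unit i j phi) k l = c k l *: phi.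
  by apply/funext => x; rewrite /ent /sym_unit !mxE /c mulrC.
have LS : LM w (sym_unit i j phi) by move=> k l; rewrite E; exact: (si_scale HL).
split => //; rewrite (ipME mw LS LG).
have F k l : ip w (ent (sym_unit i j phi) k l) (ent G k l) = c k l * ip w phi (ent G k l).
  by rewrite E (si_scalel HL _ Lt (LG k l)).
rewrite -(delta_sum (fun k l => ip w phi (ent G k l))).
by apply: eq_bigr => k _; apply: eq_bigr => l _; exact: F.
Qed.

Lemma HdivDiv_sym_unit w i j phi : open w -> test_fun w phi ->
  HdivDiv w (sym_unit i j phi) /\
  ae_eq mu w (dd w (sym_unit i j phi)) (partial i (partial j phi) + partial j (partial i phi)).
Proof.
move=> ow t; have mw := open_measurable2 ow; have s := test_fun_smooth t.
have Lij i' j' : L2 w (partial i' (partial j' phi)) := test_fun_L2 mw (test_fun_partial i' (test_fun_partial j' t)).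
have Ls := si_add (L2_semi_inner mw) (Lij i j) (Lij j i).
have [LM0 _] := ipM_sym_unit i j mw t (LM_0 mw).
have sS : L2s w (sym_unit i j phi).
  apply: (L2s_sym LM0) => x; rewrite /symmetric_tensor /sym_unit linearZ/= linearD/=.
  by rewrite !trmx_delta addrC.
have h : is_divDiv w (sym_unit i j phi) (partial i (partial j phi) + partial j (partial i phi)).
  move=> psi t'; have Lt' := test_fun_L2 mw t'.
  have [_ E] := ipM_sym_unit i j mw t (LM_hessian mw t'); apply/esym; apply: (etrans E).
  have K k l : ip w phi (ent (hessian psi) k l) = ip w (partial k (partial l phi)) psi.
    rewrite ent_hessian.
    have e1 := ip_partial_smooth l mw (test_fun_partial k t') s.
    have e2 := ip_partial_smooth k mw t' (smooth_partial l s).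
    by apply: (etrans e1); apply: (etrans (congr1 -%R e2)); exact: opprK.
  rewrite -[X in ip w (X + _) psi]scale1r (si_linl (L2_semi_inner mw) 1 (Lij i j) (Lij j i) Lt') mul1r.
  by congr (_ + _); exact: K.
by split; [exact: (HdivDiv_intro sS Ls h)|exact: (dd_ae ow sS Ls h)].
Qed.

End DivDiv.

(** * Green's formula and traces on the skeleton *)

Section Conforming.
Context {R : realType}.
Implicit Types (f g q u v phi : R * R -> R) (P Q G : R * R -> 'M[R]_2) (x : R * R) (i j k l : 'I_2) (w : set (R * R)) (a : bc).
Local Notation mu := (leb2 R).

Lemma H2form_ext w v v' : pmeas w -> L2 w v -> L2 w v' -> ae_eq mu w v v' -> H2form w v v = H2form w v' v'.
Proof.
move=> mw Lv Lv' E.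
have e0 : ip w v v = ip w v' v' := etrans (ip_ae mw Lv Lv' Lv E) (ip_ae2 mw Lv Lv' Lv' E).
have e1 i : ip w (D1 w i v) (D1 w i v) = ip w (D1 w i v') (D1 w i v').
  by rewrite (D1_ext i mw Lv Lv' E).
have e2 i j : ip w (D2 w i j v) (D2 w i j v) = ip w (D2 w i j v') (D2 w i j v').
  by rewrite (D2_ext i j mw Lv Lv' E).
rewrite /H2form /H1form e0; congr (_ + _ + _); first by apply: eq_bigr => i _.
by apply: eq_bigr => i _; apply: eq_bigr => j _.
Qed.

Lemma H2bc_ae a w v v' : open w -> L2 w v' -> ae_eq mu w v v' -> H2bc a w v -> H2bc a w v'.
Proof.
move=> ow Lv' E hv; have mw := open_measurable2 ow; have h2 := H2bc_H2 hv.
have Lv := H2_L2 h2.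
apply: (H2bc_limit ow (u := fun=> v) (fun=> hv)); first exact: (H2_ae ow Lv' E h2).
move=> e e0; exists 0 => n _.
have Ld := si_sub (L2_semi_inner mw) Lv Lv'.
have E0 : ae_eq mu w (v - v') 0.
  apply: filterS E => x h wx; have -> : (v - v') x = v x - v' x by [].
  by rewrite h// subrr.
rewrite (H2form_ext mw Ld (L2_0 mw) E0).
have := si_scalel (H2form_inner ow) 0 (si_0 (H2form_inner ow)) (si_0 (H2form_inner ow)).
by rewrite scale0r mul0r => ->.
Qed.

Lemma ip_Eps_le w v : open w -> H2 w v -> ip w v v + ipM w (Eps w v) (Eps w v) <= H2form w v v.
Proof.
move=> ow hv; rewrite -(H2_hess_formE ow hv hv) /H2form /H1form lerD2r lerDl.
by apply: sumr_ge0 => i _; exact: ip_ge0.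
Qed.

Lemma H2bc_complete_equiv a w B c : open w -> semi_inner (H2bc a w) B ->
  (forall v, H2bc a w v -> H2form w v v <= c * B v v) ->
  (forall v, H2bc a w v -> B v v <= c * H2form w v v) -> complete_wrt (H2bc a w) B.
Proof.
move=> ow HB h h'.
have HH := si_subset (H2bc_subspace a ow) (@H2bc_H2 R a w) (H2form_inner ow).
by apply: (complete_equiv HH HB h h'); exact: H2bc_complete.
Qed.

Lemma ipM_test w Q phi : open w -> LM w Q -> test_fun w phi -> ipM w Q (Eps w phi) = ipM w Q (hessian phi).
Proof.
move=> ow LQ t; have mw := open_measurable2 ow; rewrite ipM_sym [RHS]ipM_sym.
apply: (ipM_ae mw (H2_LM ow (H2_test ow t)) (LM_hessian mw t) LQ) => i j.
rewrite ent_hessian; exact: (Eps_test_ae i j ow t).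
Qed.

Lemma Eps_L2s w v : open w -> H2 w v -> L2s w (Eps w v).
Proof. by move=> ow hv; apply: (L2s_sym (H2_LM ow hv)) => x; exact: Eps_sym. Qed.

Lemma L2s_subr w P Q : pmeas w -> L2s w P -> L2s w Q -> L2s w (P - Q).
Proof. by move=> mw hP hQ; rewrite addrC -scaleN1r; exact: ((L2s_subspace mw).2). Qed.

Lemma ipM_eq0_ae w Q : pmeas w -> LM w Q -> ipM w Q Q = 0 -> forall i j, ae_eq mu w (ent Q i j) 0.
Proof.
move=> mw LQ h i j; apply: (ip_eq0_ae mw (LQ i j)); apply/eqP; rewrite eq_le ip_ge0 andbT -h (ipME mw LQ LQ).
rewrite (bigD1 i)//= (bigD1 j)//= -addrA lerDl addr_ge0//; apply: sumr_ge0 => *; [exact: ip_ge0|].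
by apply: sumr_ge0 => *; exact: ip_ge0.
Qed.

Lemma ipM_ge0 w Q : 0 <= ipM w Q Q.
Proof. by apply: Rintegral_ge0 => x _; exact: ddot_ge0. Qed.

(** Both sides are continuous for the H2 norm and agree on test functions by
    the definition of the double divergence. *)
Lemma green_H20 w v Q : open w -> H20 w v -> HdivDiv w Q -> ip w v (dd w Q) = ipM w (Eps w v) Q.
Proof.
move=> ow /H20E hv hQ; have mw := open_measurable2 ow.
have [Ld hd] := dd_spec hQ; have LQ := HdivDiv_LM hQ.
pose l v := ip w v (dd w Q) - ipM w (Eps w v) Q.
suff : l v = 0 by move=> /eqP; rewrite subr_eq0 => /eqP.
have HM := LM_ipM_inner mw; have HL := L2_semi_inner mw.
apply: (@clo_vanish _ _ (H2 w) (@H2form R w) (test_fun w) l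
  (2 * (ip w (dd w Q) (dd w Q) + ipM w Q Q)) (H2form_inner ow)) hv.
- by move=> phi; exact: H2_test.
- move=> c x y hx hy; have hxy := (H2_subspace ow).2 c _ _ hx hy.
  have e1 : ipM w (Eps w (c *: x + y)) Q = c * ipM w (Eps w x) Q + ipM w (Eps w y) Q.
    rewrite -(si_linl HM c (H2_LM ow hx) (H2_LM ow hy) LQ).
    apply: (ipM_ae mw (H2_LM ow hxy) ((LM_subspace mw).2 c _ _ (H2_LM ow hx) (H2_LM ow hy)) LQ) => i j.
    by rewrite entL; exact: (L2map_lin (Eps_map i j ow) c hx hy).
  rewrite /l e1 (si_linl HL c (H2_L2 hx) (H2_L2 hy) Ld); ring.
- move=> x hx; have b := ip_Eps_le ow hx.
  have c1 := cauchy_schwarz HL (H2_L2 hx) Ld; have c2 := cauchy_schwarz HM (H2_LM ow hx) LQ.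
  have n1 := ip_ge0 w x; have n2 := ipM_ge0 w (Eps w x).
  have n3 := ip_ge0 w (dd w Q); have n4 := ipM_ge0 w Q.
  rewrite /l; move: b c1 c2 n1 n2 n3 n4.
  move: (ip w x (dd w Q)) (ipM w (Eps w x) Q) (ip w x x) (ipM w (Eps w x) (Eps w x)) (ip w (dd w Q) (dd w Q)) (ipM w Q Q) (H2form w x x).
  move=> s t a1 a2 a3 a4 a5 b c1 c2 n1 n2 n3 n4.
  apply: le_trans (sq_sum_le _ _) _; rewrite sqrrN.
  have : (a3 + a4) * (a1 + a2) <= (a3 + a4) * a5 by apply: ler_wpM2l => //; exact: addr_ge0.
  have := mulr_ge0 n1 n4; have := mulr_ge0 n2 n3; lra.
- move=> phi t; rewrite /l ip_sym ipM_sym (ipM_test ow LQ t).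
  by apply/eqP; rewrite subr_eq0; apply/eqP; exact: (hd _ t).
Qed.

End Conforming.

Section Broken.
Context {R : realType} {m : nat}.
Variables (Omega : set (R * R)) (T : 'I_m -> set (R * R)).
Implicit Types (f g q u v phi : R * R -> R) (P Q G : R * R -> 'M[R]_2) (a : bc).
Local Notation mu := (leb2 R).
Hypotheses (oO : open Omega) (bO : bounded_set Omega) (hT : is_mesh Omega T).

Let mO : pmeas Omega := open_measurable2 oO.
Let oT i : open (T i) := @mesh_open R m Omega T hT i.
Let sT i : T i `<=` Omega := @mesh_sub R m Omega T hT i.
Let mT i : pmeas (T i) := open_measurable2 (@oT i).

(** The traces of [v] and of [Q] are the two partial applications of this
    form; it vanishes when both arguments are conforming. *)
Definition skeleton_pairing (v : 'I_m -> R * R -> R) (Q : 'I_m -> R * R -> 'M[R]_2) : R :=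
  \sum_i ip (T i) (v i) (dd (T i) (Q i)) - \sum_i ipM (T i) (Eps (T i) (v i)) (Q i).

Lemma trGgradE (v : bscal) (Q : btens) : trGgrad T v Q = skeleton_pairing v Q.
Proof. by congr (_ - _); apply: eq_bigr => i _; [rewrite ddE|rewrite EpsE]. Qed.

Lemma trdDivE (Q : btens) (v : bscal) : trdDiv T Q v = skeleton_pairing v Q.
Proof.
by congr (_ - _); apply: eq_bigr => i _; [rewrite ddE ip_sym|rewrite EpsE ipM_sym].
Qed.

Lemma mesh_ipM P Q : LM Omega P -> LM Omega Q -> ipM Omega P Q = \sum_i ipM (T i) P Q.
Proof.
move=> LP LQ; rewrite (ipME mO LP LQ).
rewrite (eq_bigr (fun n => \sum_i \sum_j ip (T n) (ent P i j) (ent Q i j))); last first.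
  by move=> n _; exact: (ipME (@mT n) (LM_sub mO (@mT n) (@sT n) LP) (LM_sub mO (@mT n) (@sT n) LQ)).
rewrite [RHS]exchange_big; apply: eq_bigr => i _; rewrite [RHS]exchange_big; apply: eq_bigr => j _.
exact: (mesh_ip oO bO hT (LP i j) (LQ i j)).
Qed.

Lemma H2b_conf v : H2 Omega v -> H2b T (fun=> v).
Proof. by move=> hv i; exact: (H2_sub oO (@oT i) (@sT i) hv). Qed.

Lemma HdivDivb_conf Q : HdivDiv Omega Q -> HdivDivb T (fun=> Q).
Proof. by move=> hQ i; exact: (HdivDiv_sub oO (@oT i) (@sT i) hQ). Qed.

Lemma conf_dd u Q : L2 Omega u -> HdivDiv Omega Q ->
  \sum_i ip (T i) u (dd (T i) Q) = ip Omega u (dd Omega Q).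
Proof.
move=> Lu hQ; have [Ld _] := dd_spec hQ; rewrite (mesh_ip oO bO hT Lu Ld); apply: eq_bigr => i _.
have [Ld' _] := dd_spec (HdivDivb_conf hQ i).
exact: (ip_ae2 (@mT i) Ld' (L2_subset mO (@mT i) (@sT i) Ld) (L2_subset mO (@mT i) (@sT i) Lu) (dd_sub oO (@oT i) (@sT i) hQ)).
Qed.

Lemma conf_Eps v P : H2 Omega v -> LM Omega P ->
  \sum_i ipM (T i) (Eps (T i) v) P = ipM Omega (Eps Omega v) P.
Proof.
move=> hv LP; rewrite (mesh_ipM (H2_LM oO hv) LP); apply: eq_bigr => n _.
apply: (ipM_ae (@mT n) (H2_LM (@oT n) (H2b_conf hv n)) (LM_sub mO (@mT n) (@sT n) (H2_LM oO hv)) (LM_sub mO (@mT n) (@sT n) LP)).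
exact: (Eps_sub oO (@oT n) (@sT n) hv).
Qed.

Lemma bd_conf v Q : H2 Omega v -> HdivDiv Omega Q ->
  skeleton_pairing (fun=> v) (fun=> Q) = ip Omega v (dd Omega Q) - ipM Omega (Eps Omega v) Q.
Proof. by move=> hv hQ; rewrite /skeleton_pairing conf_dd ?conf_Eps//; [exact: HdivDiv_LM|exact: H2_L2]. Qed.

Lemma HdivDivbc_HdivDiv a Q : HdivDivbc a Omega T Q -> HdivDiv Omega Q.
Proof. by case: a => //= -[]. Qed.

Lemma bd_conf0 a v Q : H2bc a Omega v -> HdivDivbc a Omega T Q -> skeleton_pairing (fun=> v) (fun=> Q) = 0.
Proof.
case: a => /= [hv hQ|hv [hQ h]]; last by rewrite -trdDivE; exact: h.
rewrite (bd_conf (H20_H2s hv).1 hQ); apply/eqP; rewrite subr_eq0; apply/eqP; exact: green_H20.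
Qed.

Lemma green_bc a v Q : H2bc a Omega v -> HdivDivbc a Omega T Q ->
  ip Omega v (dd Omega Q) = ipM Omega (Eps Omega v) Q.
Proof.
move=> hv hQ; have := bd_conf0 hv hQ.
by rewrite (bd_conf (H2bc_H2 hv) (HdivDivbc_HdivDiv hQ)) => /eqP; rewrite subr_eq0 => /eqP.
Qed.

(** A tensor that satisfies Green's formula against all conforming functions
    has a double divergence, because test functions are conforming, and has no
    trace on the boundary where the conforming functions are free. *)
Lemma HdivDivbc_intro a Q q : L2s Omega Q -> L2 Omega q ->
  (forall v, H2bc a Omega v -> ip Omega q v = ipM Omega Q (Eps Omega v)) -> 
  HdivDivbc a Omega T Q /\ ae_eq mu Omega (dd Omega Q) q.
Proof.
move=> LQ Lq h.
have hd : is_divDiv Omega Q q.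
  move=> phi t; rewrite (h _ (H2bc_test a oO t)); exact: (ipM_test oO (L2s_LM LQ) t).
have hQ := HdivDiv_intro LQ Lq hd; have E := dd_ae oO LQ Lq hd.
split => //; case: a h => //= h; split => // dv hv.
have h2 := H2bc_H2 (hv : H2bc SimplySupported Omega dv).
have [Ld _] := dd_spec hQ.
rewrite trdDivE (bd_conf h2 hQ) (ip_ae2 mO Ld Lq (H2_L2 h2) E) ip_sym (h _ hv).
by rewrite ipM_sym subrr.
Qed.

(** The operator is the adjoint of its adjoint. The projection [p] of [(e, G)]
    onto the graph of the conforming Hessian leaves a defect whose tensor part
    is itself an admissible moment tensor; testing with it shows that the
    defect vanishes. *)
Lemma adjoint_char a e G : L2 Omega e -> L2s Omega G ->
  (forall Q, HdivDivbc a Omega T Q -> ip Omega e (dd Omega Q) = ipM Omega G Q) ->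
  H2bc a Omega e /\ forall i j, ae_eq mu Omega (ent (Eps Omega e) i j) (ent G i j).
Proof.
move=> Le sG h; have LG := L2s_LM sG.
have HL := L2_semi_inner mO; have HM := LM_ipM_inner mO.
have [c c0 hP] := poincare oO bO.
have HA := si_subset (H2bc_subspace a oO) (@H2bc_H2 R a Omega) (dform_inner oO ler01).
have cA : complete_wrt (H2bc a Omega) (dform 1 Omega).
  apply: (H2bc_complete_equiv (c := c + 1) oO HA) => v hv; have h2 := H2bc_H2 hv.
    have b := hP _ (H2bc_H2s hv); have n1 := ip_ge0 Omega v; have n2 := ipM_ge0 Omega (Eps Omega v).
    rewrite /dform mul1r; apply: le_trans b _; apply: ler_pM => //; [exact: ltW|lra|lra].
  have b := ip_Eps_le oO h2; rewrite /dform mul1r; apply: le_trans b _.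
  have := si_ge0 (H2form_inner oO) h2; have := mulr_ge0 (ltW c0) (si_ge0 (H2form_inner oO) h2); lra.
have [||p hp pE] := riesz HA (l := fun v => ip Omega e v + ipM Omega G (Eps Omega v))
   (c := 2 * (ip Omega e e + ipM Omega G G)) cA.
- move=> s x y /H2bc_H2 hx /H2bc_H2 hy; have hxy := (H2_subspace oO).2 s _ _ hx hy.
  have e1 : ipM Omega G (Eps Omega (s *: x + y)) = s * ipM Omega G (Eps Omega x) + ipM Omega G (Eps Omega y).
    rewrite -(si_linr HM s (H2_LM oO hx) (H2_LM oO hy) LG) ipM_sym [RHS]ipM_sym.
    apply: (ipM_ae mO (H2_LM oO hxy) ((LM_subspace mO).2 s _ _ (H2_LM oO hx) (H2_LM oO hy)) LG) => i j.
    by rewrite entL; exact: (L2map_lin (Eps_map i j oO) s hx hy).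
  rewrite e1 (si_linr HL s (H2_L2 hx) (H2_L2 hy) Le); ring.
- move=> x /H2bc_H2 hx.
  have c1 := cauchy_schwarz HL Le (H2_L2 hx); have c2 := cauchy_schwarz HM LG (H2_LM oO hx).
  have n1 := ip_ge0 Omega x; have n2 := ipM_ge0 Omega (Eps Omega x).
  have n3 := ip_ge0 Omega e; have n4 := ipM_ge0 Omega G.
  rewrite /dform; move: c1 c2 n1 n2 n3 n4.
  move: (ip Omega e x) (ipM Omega G (Eps Omega x)) (ip Omega x x) (ipM Omega (Eps Omega x) (Eps Omega x)) (ip Omega e e) (ipM Omega G G).
  move=> s t a1 a2 a3 a4 c1 c2 n1 n2 n3 n4.
  apply: le_trans (sq_sum_le _ _) _.
  have := mulr_ge0 n1 n4; have := mulr_ge0 n2 n3; lra.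
have hp2 := H2bc_H2 hp; have Lp := H2_L2 hp2; have LEp := H2_LM oO hp2.
pose q := e - p; pose Q := G - Eps Omega p.
have Lq : L2 Omega q := si_sub HL Le Lp.
have sQ : L2s Omega Q := L2s_subr mO sG (Eps_L2s oO hp2).
have LQ := L2s_LM sQ; have L0 := L2_0 mO.
have LNq : L2 Omega (- q) by rewrite -sub0r; exact: (si_sub HL L0 Lq).
have [hQ dQ] : HdivDivbc a Omega T Q /\ ae_eq mu Omega (dd Omega Q) (- q).
  apply: (HdivDivbc_intro sQ LNq) => v hv; have h2 := H2bc_H2 hv.
  have := pE v hv; rewrite /dform mul1r.
  rewrite -scaleN1r (si_scalel HL (-1) Lq (H2_L2 h2)) (si_subl HL Le Lp (H2_L2 h2)).
  rewrite (si_subl HM LG LEp (H2_LM oO h2)); lra.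
have hQ' := HdivDivbc_HdivDiv hQ; have [Ld _] := dd_spec hQ'.
have e1 := h _ hQ; have e2 := green_bc hp hQ.
have e3 : ip Omega q (dd Omega Q) = ipM Omega Q Q.
  by rewrite (si_subl HL Le Lp Ld) (si_subl HM LG LEp LQ) e1 e2.
rewrite (ip_ae2 mO Ld LNq Lq dQ) -scaleN1r (si_scaler HL (-1) Lq Lq) in e3.
have n1 := ip_ge0 Omega q; have n2 := ipM_ge0 Omega Q.
have q0 : ip Omega q q = 0 by lra.
have Q0 : ipM Omega Q Q = 0 by lra.
have aq := ip_eq0_ae mO Lq q0; have aQ := ipM_eq0_ae mO LQ Q0.
have aep : ae_eq mu Omega p e.
  apply: filterS aq => x hx Ox; apply/esym/eqP; rewrite -subr_eq0; apply/eqP; exact: hx.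
split; first exact: (H2bc_ae oO Le aep hp).
move=> i j; rewrite -(Eps_ext mO Lp Le aep).
have := aQ i j; rewrite entB => hx0; apply: filterS hx0 => x hx Ox.
by apply/esym/eqP; rewrite -subr_eq0; apply/eqP; exact: hx.
Qed.

End Broken.

(** * The bending problem *)

Section TensorIntegrals.
Context {R : realType}.
Variable C : {linear 'M[R]_2 -> 'M[R]_2}.
Hypothesis hC : spd_tensor C.
Implicit Types (P Q : R * R -> 'M[R]_2) (w : set (R * R)) (i j : 'I_2).
Local Notation mu := (leb2 R).

Definition stiff Q : R * R -> 'M[R]_2 := fun x => C (Q x).
Definition compl Q : R * R -> 'M[R]_2 := fun x => tensor_inv C (Q x).

Lemma tensor_inv_sym A : symmetric_tensor A -> symmetric_tensor (tensor_inv C A).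
Proof. by move=> sA; have [D [sD _ hD]] := spd_inverse hC; rewrite hD//; exact: sD. Qed.

Lemma tensor_invK A : symmetric_tensor A -> tensor_inv C (C A) = A.
Proof.
move=> sA; have [D [sD CD hD]] := spd_inverse hC; have [c1 _ _] := hC.
rewrite hD; last exact: c1.
apply/eqP; rewrite -subr_eq0; apply/eqP; apply: (C_inj hC).
  rewrite -scaleN1r addrC; apply: (sym_subspace.2) => //; exact/sD/c1.
by rewrite linearB/= CD ?subrr//; exact: c1.
Qed.

Lemma C_tensor_inv A : symmetric_tensor A -> C (tensor_inv C A) = A.
Proof. by move=> sA; have [D [_ CD hD]] := spd_inverse hC; rewrite hD//; exact: CD. Qed.

Lemma ddot_compl A B : symmetric_tensor A -> symmetric_tensor B ->
  ddot A (tensor_inv C B) = ddot (tensor_inv C A) B.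
Proof.
move=> sA sB; have [_ c2 _] := hC.
rewrite -{1}(C_tensor_inv sA) c2 ?C_tensor_inv//; exact: tensor_inv_sym.
Qed.

(** Symmetric classes have a representative that is symmetric everywhere, to
    which the pointwise identities for C apply. *)
Definition symz Q : R * R -> 'M[R]_2 := fun x => 2^-1 *: (Q x + (Q x)^T).

Lemma symz_sym Q x : symmetric_tensor (symz Q x).
Proof. by apply/matrixP => i j; rewrite !mxE addrC. Qed.

Lemma symz_ae w Q i j : L2s w Q -> ae_eq mu w (ent Q i j) (ent (symz Q) i j).
Proof.
move=> /L2sP[_ /(_ i j)]; apply: filterS => x h wx; have := h wx.
by rewrite /ent !mxE; lra.
Qed.

Lemma symz_LM w Q : pmeas w -> LM w Q -> LM w (symz Q).
Proof.
move=> mw LQ i j; have -> : ent (symz Q) i j = 2^-1 *: (ent Q i j + ent Q j i).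
  by apply/funext => x; rewrite /ent !mxE.
apply: (si_scale (L2_semi_inner mw)); exact: (si_add (L2_semi_inner mw) (LQ i j) (LQ j i)).
Qed.

Lemma symz_L2s w Q : pmeas w -> LM w Q -> L2s w (symz Q).
Proof. by move=> mw LQ; apply: (L2s_sym (symz_LM mw LQ)) => x; exact: symz_sym. Qed.

Lemma ipM_ext w P P' Q Q' : pmeas w -> LM w P -> LM w P' -> LM w Q -> LM w Q' ->
  (forall i j, ae_eq mu w (ent P i j) (ent P' i j)) -> (forall i j, ae_eq mu w (ent Q i j) (ent Q' i j)) ->
  ipM w P Q = ipM w P' Q'.
Proof.
move=> mw LP LP' LQ LQ' EP EQ; apply: (etrans (ipM_ae mw LP LP' LQ EP)).
rewrite ipM_sym [RHS]ipM_sym; exact: ipM_ae.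
Qed.

Lemma stiff_LM w Q : pmeas w -> LM w Q -> LM w (stiff Q).
Proof. exact: LM_linear. Qed.

Lemma stiff_L2s w Q : pmeas w -> L2s w Q -> L2s w (stiff Q).
Proof.
move=> mw [sQ LQ]; split; last exact: stiff_LM.
have [c1 _ _] := hC; apply: negligibleS sQ => x nx hx; apply: nx => /hx; exact: c1.
Qed.

Lemma compl_L2s w Q : pmeas w -> L2s w Q -> L2s w (compl Q).
Proof.
move=> mw hQ; split; last exact: LM_tensor_inv.
have [sQ _] := hQ; apply: negligibleS sQ => x nx hx; apply: nx => /hx; exact: tensor_inv_sym.
Qed.

Lemma compl_LM w Q : pmeas w -> L2s w Q -> LM w (compl Q).
Proof. by move=> mw hQ; exact: (L2s_LM (compl_L2s mw hQ)). Qed.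

Lemma ent_eq_ae w P Q : ae_eq mu w P Q -> forall i j, ae_eq mu w (ent P i j) (ent Q i j).
Proof. by move=> h; apply/ent_ae. Qed.

Lemma comp_ae w (F : 'M[R]_2 -> 'M[R]_2) P Q : (forall i j, ae_eq mu w (ent P i j) (ent Q i j)) ->
  forall i j, ae_eq mu w (ent (fun x => F (P x)) i j) (ent (fun x => F (Q x)) i j).
Proof. by move=> /ent_ae h; apply/ent_ae; apply: filterS h => x h wx; rewrite h. Qed.

Lemma stiff_sym w P Q : pmeas w -> L2s w P -> L2s w Q -> ipM w (stiff P) Q = ipM w P (stiff Q).
Proof.
move=> mw hP hQ; have [c1 c2 _] := hC; have LP := L2s_LM hP; have LQ := L2s_LM hQ.
have LP' := symz_LM mw LP; have LQ' := symz_LM mw LQ.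
have eP i j := symz_ae i j hP; have eQ i j := symz_ae i j hQ.
rewrite (ipM_ext mw (stiff_LM mw LP) (stiff_LM mw LP') LQ LQ' (comp_ae C eP) eQ).
rewrite (ipM_ext mw LP LP' (stiff_LM mw LQ) (stiff_LM mw LQ') eP (comp_ae C eQ)).
by apply: eq_Rintegral => x _; apply: c2; exact: symz_sym.
Qed.

Lemma compl_sym w P Q : pmeas w -> L2s w P -> L2s w Q -> ipM w P (compl Q) = ipM w (compl P) Q.
Proof.
move=> mw hP hQ; have LP := L2s_LM hP; have LQ := L2s_LM hQ.
have LP' := symz_LM mw LP; have LQ' := symz_LM mw LQ.
have sP := symz_L2s mw LP; have sQ := symz_L2s mw LQ.
have eP i j := symz_ae i j hP; have eQ i j := symz_ae i j hQ.
rewrite (ipM_ext mw LP LP' (compl_LM mw hQ) (compl_LM mw sQ) eP (comp_ae (tensor_inv C) eQ)).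
rewrite (ipM_ext mw (compl_LM mw hP) (compl_LM mw sP) LQ LQ' (comp_ae (tensor_inv C) eP) eQ).
by apply: eq_Rintegral => x _; apply: ddot_compl; exact: symz_sym.
Qed.

Lemma compl_stiff w P : L2s w P -> forall i j, ae_eq mu w (ent (compl (stiff P)) i j) (ent P i j).
Proof.
move=> [sP _]; apply/ent_ae; apply: negligibleS sP => x nx hx; apply: nx => /hx.
exact: tensor_invK.
Qed.

Lemma stiff_compl w P : L2s w P -> forall i j, ae_eq mu w (ent (stiff (compl P)) i j) (ent P i j).
Proof.
move=> [sP _]; apply/ent_ae; apply: negligibleS sP => x nx hx; apply: nx => /hx.
exact: C_tensor_inv.
Qed.

Lemma stiff_lin (s : R) P Q : stiff (s *: P + Q) = s *: stiff P + stiff Q.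
Proof. by apply/funext => x; rewrite /stiff; exact: linearP. Qed.

Lemma compl_lin w (s : R) P Q : pmeas w -> L2s w P -> L2s w Q -> forall i j,
  ae_eq mu w (ent (compl (s *: P + Q)) i j) (ent (s *: compl P + compl Q) i j).
Proof.
move=> mw hP hQ; have [D [_ _ hD]] := spd_inverse hC.
have h1 := tensor_inv_ae hP hD; have h2 := tensor_inv_ae hQ hD.
have h3 := tensor_inv_ae ((L2s_subspace mw).2 s _ _ hP hQ) hD.
apply/ent_ae; apply: filterS (filterI (filterI h1 h2) h3) => x [[k1 k2] k3] wx.
rewrite /compl (k3 wx); have -> : (s *: P + Q) x = s *: P x + Q x by [].
by rewrite linearP -(k1 wx) -(k2 wx).
Qed.

Lemma compl_bound : exists2 c, 0 <= c & forall w Q, pmeas w -> L2s w Q ->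
  ipM w (compl Q) (compl Q) <= c * ipM w Q Q.
Proof.
have [D [_ _ hD]] := spd_inverse hC; have [c c0 hc] := linear_bound D.
exists c => // w Q mw hQ; have LQ := L2s_LM hQ.
have E := ent_eq_ae (tensor_inv_ae hQ hD).
rewrite (ipM_ext mw (compl_LM mw hQ) (LM_linear D mw LQ) (compl_LM mw hQ) (LM_linear D mw LQ) E E).
exact: ipM_linear_bound.
Qed.

Lemma stiff_bound : exists2 c, 0 <= c & forall w Q, pmeas w -> LM w Q ->
  ipM w (stiff Q) (stiff Q) <= c * ipM w Q Q.
Proof.
have [c c0 hc] := linear_bound C; exists c => // w Q mw LQ; exact: ipM_linear_bound.
Qed.

Lemma stiff_coercive : exists2 c, 0 < c & forall w Q, pmeas w -> L2s w Q ->
  ipM w Q Q <= c * ipM w (stiff Q) Q.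
Proof.
have [c c0 hc] := spd_coercive hC; exists c => // w Q mw hQ; have LQ := L2s_LM hQ.
have LQ' := symz_LM mw LQ; have eQ i j := symz_ae i j hQ.
rewrite (ipM_ext mw LQ LQ' LQ LQ' eQ eQ).
rewrite (ipM_ext mw (stiff_LM mw LQ) (stiff_LM mw LQ') LQ LQ' (comp_ae C eQ) eQ).
have ii P P' : LM w P -> LM w P' -> mu.-integrable w (EFin \o (fun x => ddot (P x) (P' x))).
  move=> LP LP'; apply: (@eq_integrable _ _ _ mu w mw (fun x => \sum_i \sum_j (ent P i j x * ent P' i j x)%:E)%E).
    by move=> x _ /=; rewrite /ddot -sumEFin; apply: eq_bigr => i _; rewrite -sumEFin.
  by apply: integrable_sum => // i _; apply: integrable_sum => // j _; exact: L2_mul_integrable.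
rewrite /ipM -RintegralZl//; last exact: (ii _ _ (stiff_LM mw LQ') LQ').
apply: le_Rintegral => //; [exact: ii| |by move=> x _; apply: hc; exact: symz_sym].
have := integrableZl mw c (ii _ _ (stiff_LM mw LQ') LQ'); apply: eq_integrable => // x _ /=; by rewrite EFinM.
Qed.

End TensorIntegrals.

Section Energy.
Context {R : realType}.
Variable C : {linear 'M[R]_2 -> 'M[R]_2}.
Hypothesis hC : spd_tensor C.
Variables (Omega : set (R * R)) (a : bc).
Hypotheses (oO : open Omega) (bO : bounded_set Omega).
Let mO : pmeas Omega := open_measurable2 oO.

Lemma ipM_Eps_lin (G : R * R -> 'M[R]_2) w s u v : open w -> LM w G -> H2 w u -> H2 w v ->
  ipM w G (Eps w (s *: u + v)) = s * ipM w G (Eps w u) + ipM w G (Eps w v).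
Proof.
move=> ow LG hx hy; have mw := open_measurable2 ow; have hxy := (H2_subspace ow).2 s _ _ hx hy.
rewrite -(si_linr (LM_ipM_inner mw) s (H2_LM ow hx) (H2_LM ow hy) LG) ipM_sym [RHS]ipM_sym.
apply: (ipM_ae mw (H2_LM ow hxy) ((LM_subspace mw).2 s _ _ (H2_LM ow hx) (H2_LM ow hy)) LG) => i j.
by rewrite entL; exact: (L2map_lin (Eps_map i j ow) s hx hy).
Qed.

(** The bending problem with load [g] and prestress [P]; the form is an inner
    product equivalent to the H2 norm by the Poincare inequality, so the Riesz
    theorem solves it. *)
Lemma energy_solve g P : L2 Omega g -> L2s Omega P -> exists2 u, H2bc a Omega u &
  forall v, H2bc a Omega v -> ipM Omega (stiff C (Eps Omega u)) (Eps Omega v) =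
    ip Omega g v + ipM Omega P (Eps Omega v).
Proof.
move=> Lg sP; have LP := L2s_LM sP.
have HL := L2_semi_inner mO; have HM := LM_ipM_inner mO.
have S := H2bc_subspace a oO; have [S0 SL] := S.
have sE v : H2bc a Omega v -> L2s Omega (Eps Omega v) by move=> /H2bc_H2 h; exact: Eps_L2s.
have LE v : H2bc a Omega v -> LM Omega (Eps Omega v) by move=> /sE; exact: L2s_LM.
have [c c0 hP] := poincare oO bO; have [k k0 hk] := stiff_coercive hC; have [k' k'0 hk'] := stiff_bound C.
have HB : semi_inner (H2bc a Omega) (fun u v => ipM Omega (stiff C (Eps Omega u)) (Eps Omega v)).
  have sy x y : H2bc a Omega x -> H2bc a Omega y ->
      ipM Omega (stiff C (Eps Omega x)) (Eps Omega y) = ipM Omega (stiff C (Eps Omega y)) (Eps Omega x).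
    by move=> Sx Sy; rewrite (stiff_sym hC mO (sE _ Sx) (sE _ Sy)) ipM_sym.
  split; [exact: S0|exact: SL|exact: sy| |].
  - move=> s x y z Sx Sy Sz; have Lz := stiff_LM C mO (LE _ Sz).
    have e := ipM_Eps_lin s oO Lz (H2bc_H2 Sx) (H2bc_H2 Sy).
    exact: (etrans (sy _ _ (SL s _ _ Sx Sy) Sz) (etrans e
      (esym (congr2 (fun p q => s * p + q) (sy _ _ Sx Sz) (sy _ _ Sy Sz))))).
  - move=> x Sx; have h1 := ipM_ge0 Omega (Eps Omega x); have h2 := hk _ _ mO (sE _ Sx).
    have := le_trans h1 h2; rewrite (pmulr_rge0 _ k0); exact.
have low v : H2bc a Omega v -> H2form Omega v v <= c * k * ipM Omega (stiff C (Eps Omega v)) (Eps Omega v).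
  move=> hv; apply: le_trans (hP _ (H2bc_H2s hv)) _; rewrite -mulrA.
  by apply: ler_wpM2l; [exact: ltW|exact: hk (sE _ hv)].
have b0 v : H2bc a Omega v -> 0 <= ipM Omega (stiff C (Eps Omega v)) (Eps Omega v) := si_ge0 HB (x := v).
have ck : 0 < c * k by exact: mulr_gt0.
apply: (riesz HB (c := 2 * (ip Omega g g + ipM Omega P P) * (c * k))).
- apply: (H2bc_complete_equiv (c := c * k + (1 + k')) oO HB) => v hv; have h2 := H2bc_H2 hv.
    apply: le_trans (low v hv) _; apply: ler_wpM2r; [exact: b0|lra].
  have cs := cauchy_schwarz HM (stiff_LM C mO (LE _ hv)) (LE _ hv).
  have bb := hk' _ _ mO (LE _ hv); have e0 := ipM_ge0 Omega (Eps Omega v).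
  have he := ip_Eps_le oO h2; have n0 := ip_ge0 Omega v; have h0 := si_ge0 (H2form_inner oO) h2.
  move: (b0 v hv) cs bb e0 he n0 h0.
  move: (ipM Omega (stiff C (Eps Omega v)) (Eps Omega v)) (ipM Omega (stiff C (Eps Omega v)) (stiff C (Eps Omega v))) (ipM Omega (Eps Omega v) (Eps Omega v)) (ip Omega v v) (H2form Omega v v).
  move=> q t e n h q0 cs bb e0 he n0 h0.
  have q2 : q ^+ 2 <= ((1 + k') * e) ^+ 2.
    apply: le_trans cs _; apply: (@le_trans _ _ (k' * e * e)); first exact: ler_wpM2r.
    rewrite -mulrA -expr2 exprMn; apply: ler_wpM2r; [exact: sqr_ge0|nra].
  have q1 : q <= (1 + k') * e by move: q2; rewrite ler_pXn2r ?nnegrE// mulr_ge0// addr_ge0.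
  apply: le_trans q1 _; apply: (@le_trans _ _ ((1 + k') * h)).
    by apply: ler_wpM2l; [rewrite addr_ge0|lra].
  by apply: ler_wpM2r => //; rewrite lerDr ltW.
- move=> s x y /H2bc_H2 hx /H2bc_H2 hy.
  rewrite (ipM_Eps_lin s oO LP hx hy) (si_linr HL s (H2_L2 hx) (H2_L2 hy) Lg); ring.
- move=> x hx; have h2 := H2bc_H2 hx.
  have c1 := cauchy_schwarz HL Lg (H2_L2 h2); have c2 := cauchy_schwarz HM LP (LE _ hx).
  have n1 := ip_ge0 Omega x; have n2 := ipM_ge0 Omega (Eps Omega x).
  have n3 := ip_ge0 Omega g; have n4 := ipM_ge0 Omega P.
  have he := le_trans (ip_Eps_le oO h2) (low x hx).
  move: c1 c2 n1 n2 n3 n4 he.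
  move: (ipM Omega (stiff C (Eps Omega x)) (Eps Omega x)) (ip Omega g x) (ipM Omega P (Eps Omega x)) (ip Omega x x) (ipM Omega (Eps Omega x) (Eps Omega x)) (ip Omega g g) (ipM Omega P P) (c * k).
  move=> q s t a1 a2 a3 a4 kk c1 c2 n1 n2 n3 n4 he.
  apply: le_trans (sq_sum_le _ _) _.
  have : (a3 + a4) * (a1 + a2) <= (a3 + a4) * (kk * q) by apply: ler_wpM2l => //; exact: addr_ge0.
  have := mulr_ge0 n1 n4; have := mulr_ge0 n2 n3; lra.
Qed.

End Energy.

Lemma si_oppl (R : realType) (X : lmodType R) (S : set X) (B : X -> X -> R) x z :
  semi_inner S B -> S x -> S z -> B (- x) z = - B x z.
Proof. by move=> HB Sx Sz; rewrite -scaleN1r (si_scalel HB)// mulN1r. Qed.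

(** * The variational formulation and the plate problem *)

Section Variational.
Context {R : realType} {m : nat}.
Variable C : {linear 'M[R]_2 -> 'M[R]_2}.
Hypothesis hC : spd_tensor C.
Variables (Omega : set (R * R)) (T : 'I_m -> set (R * R)) (a : bc).
Hypotheses (oO : open Omega) (bO : bounded_set Omega) (hT : is_mesh Omega T).
Implicit Types (f u : R * R -> R) (M : R * R -> 'M[R]_2) (v : 'I_m -> R * R -> R) (Q : 'I_m -> R * R -> 'M[R]_2)
  (uh : ('I_m -> R * R -> 'M[R]_2) -> R) (mh : ('I_m -> R * R -> R) -> R).
Local Notation mu := (leb2 R).
Let mO : pmeas Omega := open_measurable2 oO.
Let oT i : open (T i) := @mesh_open R m Omega T hT i.
Let sT i : T i `<=` Omega := @mesh_sub R m Omega T hT i.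
Let mT i : pmeas (T i) := open_measurable2 (@oT i).
Local Notation bd := (skeleton_pairing T).

Lemma bE u M uh mh v Q : L2s Omega M -> H2b T v -> HdivDivb T Q ->
  b C T ((u, M, uh, mh) : trial R m) (v, Q) =
  \sum_i ipM (T i) M (Eps (T i) (v i)) + \sum_i ipM (T i) (compl C M) (Q i) +
  \sum_i ip (T i) u (dd (T i) (Q i)) - uh Q + mh v.
Proof.
move=> hM hv hQ; rewrite /b /=; congr (_ + _ - _ + _); last first.
  by apply: eq_bigr => i _; rewrite ddE.
rewrite -big_split; apply: eq_bigr => i _ /=; rewrite EpsE.
have sM := L2s_sub mO (@mT i) (@sT i) hM; have sQ := HdivDiv_L2s (hQ i).
have -> : (fun x => Eps (T i) (v i) x + tensor_inv C (Q i x)) = 1 *: Eps (T i) (v i) + compl C (Q i).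
  by apply/funext => x; rewrite scale1r.
rewrite (si_linr (LM_ipM_inner (@mT i)) 1 (H2_LM (@oT i) (hv i)) (compl_LM hC (@mT i) sQ) (L2s_LM sM)) mul1r.
by congr (_ + _); exact: compl_sym.
Qed.

Lemma LE v f : L T f (v, fun=> 0 : R * R -> 'M[R]_2) = - \sum_i ip (T i) f (v i).
Proof. by []. Qed.

(** The plate problem in terms of the sealed operators; in the clamped case
    the condition on the tensor reduces to its regularity. *)
Definition weakKL f u M := [/\ H2bc a Omega u, HdivDivbc a Omega T M,
  ae_eq mu Omega (dd Omega M) (- f) &
  forall i j, ae_eq mu Omega (ent M i j) (ent (- stiff C (Eps Omega u)) i j)].

Lemma solves_KLE f u M : solves_KL C a Omega T f u M <-> weakKL f u M.
Proof.
have E1 : ae_eq mu Omega (fun x => - divDiv Omega M x) f <-> ae_eq mu Omega (dd Omega M) (- f).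
  rewrite ddE; split; apply: filterS => x h wx; have := h wx.
    by move=> e; transitivity (- - dd Omega M x); [rewrite opprK|congr (- _); exact: e].
  by move=> e; transitivity (- - f x); [congr (- _); exact: e|rewrite opprK].
have E2 : ae_eq mu Omega (fun x => M x + C (epsgrad Omega u x)) (fun=> 0) <->
    forall i j, ae_eq mu Omega (ent M i j) (ent (- stiff C (Eps Omega u)) i j).
  rewrite EpsE; split=> [h|/ent_ae h]; [apply/ent_ae|]; apply: filterS h => x h wx.
    by apply/eqP; rewrite -addr_eq0; apply/eqP; exact: (h wx).
  by have k : M x = - C (Eps Omega u x) := h wx; rewrite k addNr.
split=> [[[hu hM] /E1 h1 /E2 h2]|[hu hM /E1 h1 /E2 h2]].
  by rewrite /weakKL; case: a => [h|[h h']]; split.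
split => //; first by split; [exact: (H2bc_H2 hu)|exact: (HdivDivbc_HdivDiv hM)].
by case: a hu hM.
Qed.

(** The moments of the bending problem satisfy Green's formula against all
    conforming functions and are therefore admissible. *)
Lemma KL_exists f : L2 Omega f -> exists u M, weakKL f u M.
Proof.
move=> Lf; have S0 : L2s Omega (0 : R * R -> 'M[R]_2) := (L2s_subspace mO).1.
have [u hu uE] := energy_solve hC a oO bO Lf S0.
have h2 := H2bc_H2 hu; have sE := Eps_L2s oO h2; have sS := stiff_L2s hC mO sE.
have HL := L2_semi_inner mO; have HM := LM_ipM_inner mO.
have sM : L2s Omega (- stiff C (Eps Omega u)) by rewrite -sub0r; exact: L2s_subr.
have LN : L2 Omega (- f) by rewrite -sub0r; exact: (si_sub HL (L2_0 mO) Lf).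
exists u, (- stiff C (Eps Omega u)).
have [hQ dQ] : HdivDivbc a Omega T (- stiff C (Eps Omega u)) /\ ae_eq mu Omega (dd Omega (- stiff C (Eps Omega u))) (- f).
  apply: (HdivDivbc_intro oO bO hT sM LN) => v hv; have := uE v hv; have hv2 := H2bc_H2 hv.
  have := si_scalel HM 0 (L2s_LM S0) (H2_LM oO hv2); rewrite scale0r mul0r => ->.
  rewrite addr0 -[in - f]scaleN1r -[in - stiff _ _]scaleN1r.
  by rewrite (si_scalel HL (-1) Lf (H2_L2 hv2)) (si_scalel HM (-1) (L2s_LM sS) (H2_LM oO hv2)) => ->.
by split => // i j; exact: ae_eq_refl.
Qed.

Lemma weakKL_U f u M : L2 Omega f -> weakKL f u M ->
  Uspace a Omega T ((u, M, trGgrad T (fun=> u), trdDiv T (fun=> M)) : trial R m).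
Proof.
move=> Lf [hu hM _ _]; split.
- exact: (H2_L2 (H2bc_H2 hu)).
- exact: (HdivDiv_L2s (HdivDivbc_HdivDiv hM)).
- by exists u.
- by exists M.
Qed.

(** Testing the equations elementwise produces the traces of [u] and [M]
    themselves. *)
Lemma KL_VF f u M : L2 Omega f -> weakKL f u M ->
  solves_VF C a Omega T f ((u, M, trGgrad T (fun=> u), trdDiv T (fun=> M)) : trial R m).
Proof.
move=> Lf hKL; split; first exact: (weakKL_U Lf hKL).
have [hu hM dM eM] := hKL; move=> -[v Q] [hv hQ].
have h2 := H2bc_H2 hu; have hM' := HdivDivbc_HdivDiv hM; have sM := HdivDiv_L2s hM'.
rewrite (bE _ _ _ sM hv hQ) trGgradE trdDivE /skeleton_pairing /L /=.
have e1 : \sum_i ip (T i) (v i) (dd (T i) M) = - \sum_i ip (T i) f (v i).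
  rewrite -sumrN; apply: eq_bigr => i _.
  have LN : L2 Omega (- f) by rewrite -sub0r; exact: (si_sub (L2_semi_inner mO) (L2_0 mO) Lf).
  have [Ld _] := dd_spec (HdivDivb_conf oO hT hM' i).
  have E : ae_eq mu (T i) (dd (T i) M) (- f).
    apply: (ae_eq_trans (dd_sub oO (@oT i) (@sT i) hM')).
    by apply: filterS dM => x h /sT; exact: h.
  have LNi := L2_subset mO (@mT i) (@sT i) LN; have Lfi := L2_subset mO (@mT i) (@sT i) Lf.
  rewrite (ip_ae2 (@mT i) Ld LNi (H2_L2 (hv i)) E) -scaleN1r.
  by rewrite (si_scaler (L2_semi_inner (@mT i)) (-1) Lfi (H2_L2 (hv i))) mulN1r ip_sym.
have e2 : \sum_i ipM (T i) (compl C M) (Q i) = - \sum_i ipM (T i) (Eps (T i) u) (Q i).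
  rewrite -sumrN; apply: eq_bigr => i _.
  have sMi := L2s_sub mO (@mT i) (@sT i) sM; have hui := H2b_conf oO hT h2 i.
  have sEi := Eps_L2s (@oT i) hui; have LEi := L2s_LM sEi.
  have LQ := HdivDiv_LM (hQ i).
  have sNi : L2s (T i) (- Eps (T i) u) by rewrite -sub0r; exact: (L2s_subr (@mT i) (L2s_subspace (@mT i)).1 sEi).
  have E i' j' : ae_eq mu (T i) (ent M i' j') (ent (stiff C (- Eps (T i) u)) i' j').
    have h1 : ae_eq mu (T i) (ent M i' j') (ent (- stiff C (Eps Omega u)) i' j').
      by apply: filterS (eM i' j') => x h /sT; exact: h.
    apply: (ae_eq_trans h1).
    have -> : stiff C (- Eps (T i) u) = - stiff C (Eps (T i) u).
      by apply/funext => x; rewrite /stiff; exact: linearN.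
    have /ent_ae h3 := Eps_sub oO (@oT i) (@sT i) h2.
    apply: (ent_eq_ae _ i' j'); apply: filterS h3 => x h wx.
    have -> : (- stiff C (Eps Omega u)) x = - C (Eps Omega u x) by [].
    by rewrite -(h wx).
  have E2 i' j' : ae_eq mu (T i) (ent (compl C M) i' j') (ent (- Eps (T i) u) i' j').
    exact: (ae_eq_trans (comp_ae (tensor_inv C) E i' j') (compl_stiff hC sNi i' j')).
  rewrite (ipM_ae (@mT i) (compl_LM hC (@mT i) sMi) (L2s_LM sNi) LQ E2) -scaleN1r.
  by rewrite (si_scalel (LM_ipM_inner (@mT i)) (-1) LEi LQ) mulN1r.
rewrite e2 e1; have -> : \sum_i ipM (T i) (Eps (T i) (v i)) M = \sum_i ipM (T i) M (Eps (T i) (v i)).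
  by apply: eq_bigr => i _; rewrite ipM_sym.
ring.
Qed.

Lemma L2map0 (X : lmodType R) (S : set X) w (A : X -> R * R -> R) : subspace S -> L2map S w A -> ae_eq mu w (A 0) 0.
Proof.
move=> [S0 _] [_ h]; apply: filterS (h (-1) 0 0 S0 S0) => x hx wx.
have := hx wx; rewrite scaler0 addr0 => ->.
have -> : (-1 *: A 0 + A 0) x = -1 * A 0 x + A 0 x by [].
by rewrite mulN1r addNr.
Qed.

Lemma bd0l Q : HdivDivb T Q -> bd (fun=> 0) Q = 0.
Proof.
move=> hQ; rewrite /skeleton_pairing !big1 ?subrr// => i _.
  have L0 := L2_0 (@mT i); have LQ := HdivDiv_LM (hQ i).
  have E i' j' := L2map0 (H2_subspace (@oT i)) (Eps_map i' j' (@oT i)).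
  have := si_scalel (LM_ipM_inner (@mT i)) 0 (LM_0 (@mT i)) LQ; rewrite scale0r mul0r => <-.
  apply: (ipM_ae (@mT i) (H2_LM (@oT i) (H2_subspace (@oT i)).1) (LM_0 (@mT i)) LQ) => i' j'.
  by apply: ae_eq_trans (E i' j') _; apply: aeW => x _; rewrite /ent mxE.
have [Ld _] := dd_spec (hQ i).
by have := si_scalel (L2_semi_inner (@mT i)) 0 (L2_0 (@mT i)) Ld; rewrite scale0r mul0r.
Qed.

Lemma bd0r v : H2b T v -> bd v (fun=> 0) = 0.
Proof.
move=> hv; rewrite /skeleton_pairing !big1 ?subrr// => i _.
  by have := si_scaler (LM_ipM_inner (@mT i)) 0 (LM_0 (@mT i)) (H2_LM (@oT i) (hv i)); rewrite scale0r mul0r.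
have S := HdivDiv_subspace (@oT i).
have [Ld _] := dd_spec S.1.
rewrite (ip_ae2 (@mT i) Ld (L2_0 (@mT i)) (H2_L2 (hv i)) (L2map0 S (dd_map (@oT i)))).
by have := si_scaler (L2_semi_inner (@mT i)) 0 (L2_0 (@mT i)) (H2_L2 (hv i)); rewrite scale0r mul0r.
Qed.

Lemma H2b0 : H2b T (fun=> 0). Proof. by move=> i; exact: (H2_subspace (@oT i)).1. Qed.
Lemma HdivDivb0 : HdivDivb T (fun=> 0). Proof. by move=> i; exact: (HdivDiv_subspace (@oT i)).1. Qed.

(** Testing with a tensor alone removes the trace of the moments. *)
Lemma b_left u M uh mh Q : L2s Omega M -> HdivDivb T Q -> tracedDiv a Omega T mh ->
  b C T ((u, M, uh, mh) : trial R m) (fun=> 0, Q) =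
  \sum_i ipM (T i) (compl C M) (Q i) + \sum_i ip (T i) u (dd (T i) (Q i)) - uh Q.
Proof.
move=> sM hQ [Q0 hQ0 hmh]; rewrite (bE _ _ _ sM H2b0 hQ).
rewrite -(hmh _ H2b0) trdDivE (bd0l (HdivDivb_conf oO hT (HdivDivbc_HdivDiv hQ0))).
rewrite [X in X + _ + _ - _ + _]big1 ?add0r ?addr0// => i _.
have LMi := L2s_LM (L2s_sub mO (@mT i) (@sT i) sM).
have E i' j' := L2map0 (H2_subspace (@oT i)) (Eps_map i' j' (@oT i)).
have := si_scalel (LM_ipM_inner (@mT i)) 0 (LM_0 (@mT i)) LMi; rewrite scale0r mul0r => <-; rewrite ipM_sym.
apply: (ipM_ae (@mT i) (H2_LM (@oT i) (H2_subspace (@oT i)).1) (LM_0 (@mT i)) LMi) => i' j'.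
by apply: ae_eq_trans (E i' j') _; apply: aeW => x _; rewrite /ent mxE.
Qed.

Lemma b_right u M uh mh v : L2 Omega u -> L2s Omega M -> H2b T v -> traceGgrad a Omega T uh ->
  b C T ((u, M, uh, mh) : trial R m) (v, fun=> 0) =
  \sum_i ipM (T i) M (Eps (T i) (v i)) + mh v.
Proof.
move=> Lu sM hv [u0 hu0 huh]; rewrite (bE _ _ _ sM hv HdivDivb0).
rewrite -(huh _ HdivDivb0) trGgradE (bd0r (H2b_conf oO hT (H2bc_H2 hu0))) subr0.
rewrite [X in _ + X + _ + _]big1 ?[X in _ + _ + X + _]big1 ?addr0// => i _.
  have S := HdivDiv_subspace (@oT i); have [Ld _] := dd_spec S.1.
  have Lui := L2_subset mO (@mT i) (@sT i) Lu.
  rewrite (ip_ae2 (@mT i) Ld (L2_0 (@mT i)) Lui (L2map0 S (dd_map (@oT i)))).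
  by have := si_scaler (L2_semi_inner (@mT i)) 0 (L2_0 (@mT i)) Lui; rewrite scale0r mul0r.
have LMi := compl_LM hC (@mT i) (L2s_sub mO (@mT i) (@sT i) sM).
by have := si_scaler (LM_ipM_inner (@mT i)) 0 (LM_0 (@mT i)) LMi; rewrite scale0r mul0r.
Qed.

(** Conforming test tensors eliminate the trace unknowns, so that [u] and [-
    C^-1 M] satisfy Green's formula and [adjoint_char] applies. Test functions
    identify the divergence of [M], and the full set of test functions then
    identifies the two traces. *)
Lemma VF_KL f u M uh mh : L2 Omega f -> solves_VF C a Omega T f ((u, M, uh, mh) : trial R m) ->
  [/\ eqGgrad T uh (trGgrad T (fun=> u)), eqdDiv T mh (trdDiv T (fun=> M)) & weakKL f u M].
Proof.
move=> Lf [[Lu sM tu tm] hVF]; have LMM := L2s_LM sM.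
have HM := LM_ipM_inner mO; have HL := L2_semi_inner mO.
have [u0 hu0 huh] := tu; have [Q0 hQ0 hmh] := tm.
have hu02 := H2bc_H2 hu0; have hQ0' := HdivDivbc_HdivDiv hQ0.
have LN : L2 Omega (- f) by rewrite -sub0r; exact: (si_sub HL (L2_0 mO) Lf).
have scM := compl_L2s hC mO sM; have LcM := L2s_LM scM.
have sN : L2s Omega (- compl C M) by rewrite -sub0r; exact: (L2s_subr mO (L2s_subspace mO).1 scM).
(* tensors alone: Green's formula with the trace as defect *)
have t1 Q : HdivDivb T Q ->
    \sum_i ipM (T i) (compl C M) (Q i) + \sum_i ip (T i) u (dd (T i) (Q i)) = uh Q.
  move=> hQ; have := hVF (fun=> 0, Q) (conj H2b0 hQ); rewrite (b_left u uh sM hQ tm) /L /=.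
  have -> : \sum_(i < m) ip (T i) f 0 = 0.
    apply: big1 => i _.
    by have := si_scaler (L2_semi_inner (@mT i)) 0 (L2_0 (@mT i)) (L2_subset mO (@mT i) (@sT i) Lf); rewrite scale0r mul0r.
  by rewrite oppr0 => /eqP; rewrite subr_eq0 => /eqP.
(* deflections alone: the equilibrium of the moments *)
have t2 v : H2b T v -> \sum_i ipM (T i) M (Eps (T i) (v i)) + mh v = - \sum_i ip (T i) f (v i).
  by move=> hv; have := hVF (v, fun=> 0) (conj hv HdivDivb0); rewrite (b_right mh Lu sM hv tu).
have [hu eu] : H2bc a Omega u /\ forall i j, ae_eq mu Omega (ent (Eps Omega u) i j) (ent (- compl C M) i j).
  apply: (adjoint_char oO bO hT Lu sN) => Q hQ; have hQ' := HdivDivbc_HdivDiv hQ.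
  have := t1 _ (HdivDivb_conf oO hT hQ').
  rewrite -(huh _ (HdivDivb_conf oO hT hQ')) trGgradE (bd_conf0 oO bO hT hu0 hQ).
  rewrite (conf_dd oO bO hT Lu hQ') -(mesh_ipM oO bO hT LcM (HdivDiv_LM hQ')).
  rewrite -scaleN1r (si_scalel HM (-1) LcM (HdivDiv_LM hQ')); lra.
have hu2 := H2bc_H2 hu.
have eM i j : ae_eq mu Omega (ent M i j) (ent (- stiff C (Eps Omega u)) i j).
  have h1 := stiff_compl hC sM; have /ent_ae h2 := eu; have /ent_ae h3 := h1.
  apply: (ent_eq_ae _ i j); apply: filterS (filterI h2 h3) => x [k2 k3] wx.
  have -> : (- stiff C (Eps Omega u)) x = - C (Eps Omega u x) by [].
  rewrite (k2 wx) -{1}(k3 wx) (_ : (- compl C M) x = - compl C M x)// linearN opprK//.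
have e1 Q : HdivDivb T Q -> uh Q = bd (fun=> u) Q.
  move=> hQ; rewrite -t1// /skeleton_pairing addrC; congr (_ + _); rewrite -sumrN; apply: eq_bigr => i _.
  have LQ := HdivDiv_LM (hQ i).
  have sNi := L2s_sub mO (@mT i) (@sT i) sN; have sci := L2s_sub mO (@mT i) (@sT i) scM.
  have E i' j' : ae_eq mu (T i) (ent (Eps (T i) u) i' j') (ent (- compl C M) i' j').
    apply: (ae_eq_trans (Eps_sub oO (@oT i) (@sT i) hu2 i' j')).
    by apply: filterS (eu i' j') => x h /sT; exact: h.
  rewrite (ipM_ae (@mT i) (H2_LM (@oT i) (H2b_conf oO hT hu2 i)) (L2s_LM sNi) LQ E).
  by rewrite (si_oppl (LM_ipM_inner (@mT i)) (L2s_LM sci) LQ) opprK.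
have hM : HdivDiv Omega M /\ ae_eq mu Omega (dd Omega M) (- f).
  have hd : is_divDiv Omega M (- f).
    move=> phi t; have h20 : H2bc Clamped Omega phi := H2bc_test Clamped oO t.
    have hp := H2_test oO t.
    have := t2 _ (H2b_conf oO hT hp).
    rewrite -(hmh _ (H2b_conf oO hT hp)) trdDivE (bd_conf0 (a := Clamped) oO bO hT h20 hQ0') addr0.
    rewrite -(mesh_ip oO bO hT Lf (H2_L2 hp)) -(ipM_test oO LMM t).
    rewrite (si_oppl HL Lf (H2_L2 hp)) => <-; rewrite ipM_sym -(conf_Eps oO bO hT hp LMM).
    by apply: eq_bigr => i _; exact: ipM_sym.
  by split; [exact: (HdivDiv_intro sM LN hd)|exact: (dd_ae oO sM LN hd)].
have [hM' dM] := hM.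
have e2 v : H2b T v -> mh v = bd v (fun=> M).
  move=> hv; have := t2 v hv => h.
  have -> : bd v (fun=> M) = - \sum_i ip (T i) f (v i) - \sum_i ipM (T i) M (Eps (T i) (v i)).
    rewrite /skeleton_pairing; congr (_ - _); last by apply: eq_bigr => i _; exact: ipM_sym.
    rewrite -sumrN; apply: eq_bigr => i _.
    have [Ld _] := dd_spec (HdivDivb_conf oO hT hM' i).
    have E : ae_eq mu (T i) (dd (T i) M) (- f).
      apply: (ae_eq_trans (dd_sub oO (@oT i) (@sT i) hM')).
      by apply: filterS dM => x k /sT; exact: k.
    have LNi := L2_subset mO (@mT i) (@sT i) LN; have Lfi := L2_subset mO (@mT i) (@sT i) Lf.
    rewrite (ip_ae2 (@mT i) Ld LNi (H2_L2 (hv i)) E) -scaleN1r.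
    by rewrite (si_scaler (L2_semi_inner (@mT i)) (-1) Lfi (H2_L2 (hv i))) mulN1r ip_sym.
  by rewrite -h; ring.
split.
- by move=> Q hQ; rewrite trGgradE e1.
- by move=> v hv; rewrite trdDivE e2.
- split => //.
  clear -hu0 hQ0 hM' hmh e2 oO bO hT tm; case: a hQ0 tm hu0 => //= -[hQ0 h0] _ _; split => // dv hdv.
  have hb := H2b_conf oO hT hdv.1.
  by rewrite trdDivE -e2// -hmh// h0.
Qed.

End Variational.

(** * The trial space *)

Section Projection.
Context {R : realType} {X : lmodType R}.
Implicit Types (S : set X) (B : X -> X -> R).

(** Orthogonalization; vectors of zero length are orthogonal to everything and
    may be skipped. *)
Lemma projection_span S B n (w : 'I_n -> X) : semi_inner S B -> (forall i, S (w i)) ->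
  forall x, S x -> exists c : 'I_n -> R, forall j, B (x - \sum_i c i *: w i) (w j) = 0.
Proof.
move=> HB; elim: n w => [|n IH] w Sw x Sx; first by exists (fun=> 0) => -[].
have Ssum k (v : 'I_k -> X) (c : 'I_k -> R) : (forall i, S (v i)) -> S (\sum_i c i *: v i).
  move=> Sv; elim/big_ind : _ => [|y z Sy Sz|i _]; [exact: (si_0 HB)|exact: (si_add HB)|exact: (si_scale HB)].
pose v i := w (lift ord0 i).
have Sv i : S (v i) by exact: Sw.
have [c hc] := IH v Sv x Sx; have [e he] := IH v Sv (w ord0) (Sw ord0).
pose p := \sum_i c i *: v i; pose q := \sum_i e i *: v i.
have Sp : S p by exact: Ssum. have Sq : S q by exact: Ssum.
have Sxp := si_sub HB Sx Sp; have Swq := si_sub HB (Sw ord0) Sq.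
pose r := w ord0 - q.
pose s := if B r r == 0 then 0 else B (x - p) r / B r r.
have orth y (Sy : S y) (h : forall j, B y (v j) = 0) (k : 'I_n -> R) : B y (\sum_i k i *: v i) = 0.
  suff : S (\sum_i k i *: v i) /\ B y (\sum_i k i *: v i) = 0 by case.
  elim/big_ind : _ => [|y1 y2 [S1 h1] [S2 h2]|i _].
  - split; first exact: (si_0 HB).
    by have := si_scaler HB 0 (si_0 HB) Sy; rewrite scale0r mul0r.
  - split; first exact: (si_add HB).
    by have := si_linr HB 1 S1 S2 Sy; rewrite scale1r mul1r h1 h2 addr0.
  - split; first exact: (si_scale HB).
    by rewrite (si_scaler HB _ (Sv i) Sy) h mulr0.
have xr : B (x - p) r = s * B r r.
  rewrite /s; case: eqP => [r0|/eqP rn]; last by rewrite divfK.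
  rewrite mul0r; apply/eqP; rewrite -sqrf_eq0 eq_le sqr_ge0 andbT.
  by apply: le_trans (cauchy_schwarz HB Sxp Swq) _; rewrite -/r r0 mulr0.
exists (fun i => if unlift ord0 i is Some k then c k - s * e k else s).
have E : \sum_i (if unlift ord0 i is Some k then c k - s * e k else s) *: w i = p + s *: r.
  rewrite big_ord_recl unlift_none /=.
  have -> : \sum_(i < n) (if unlift ord0 (lift ord0 i) is Some k then c k - s * e k else s) *: w (lift ord0 i) =
     p - s *: q.
    rewrite /p /q scaler_sumr -sumrB; apply: eq_bigr => i _; rewrite liftK scalerBl scalerA.
    by [].
  by rewrite /r scalerBr addrCA.
move=> j; rewrite E.
have Sr : S (s *: r) by exact: (si_scale HB).
have -> : x - (p + s *: r) = (x - p) - s *: r by rewrite opprD addrA.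
have hv k : B ((x - p) - s *: r) (v k) = 0.
  by rewrite (si_subl HB Sxp Sr (Sv k)) (si_scalel HB _ Swq (Sv k)) /p hc /r he mulr0 subr0.
have [k ->|->] := unliftP ord0 j; first exact: hv.
have -> : w ord0 = r + q by rewrite /r subrK.
have Sz := si_sub HB Sxp Sr.
have := si_linr HB 1 Swq Sq Sz; rewrite scale1r mul1r => ->.
by rewrite (orth _ Sz hv) addr0 (si_subl HB Sxp Sr Swq) (si_scalel HB _ Swq Swq) xr subrr.
Qed.

Lemma sum_cauchy_schwarz (I : finType) (Y : lmodType R) (S : I -> set Y) (B : I -> Y -> Y -> R) (x y : I -> Y) :
  (forall i, semi_inner (S i) (B i)) -> (forall i, S i (x i)) -> (forall i, S i (y i)) ->
  (\sum_i B i (x i) (y i)) ^+ 2 <= (\sum_i B i (x i) (x i)) * (\sum_i B i (y i) (y i)).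
Proof.
move=> HB Sx Sy; apply: discriminant_le => [|t].
  by apply: sumr_ge0 => i _; exact: (si_ge0 (HB i)).
rewrite !mulr_sumr -!big_split; apply: sumr_ge0 => i _ /=.
rewrite -(si_quad (HB i) t (Sx i) (Sy i)); exact: (si_ge0 (HB i) (si_lin (HB i) t (Sy i) (Sx i))).
Qed.

End Projection.

Section TrialSpace.
Context {R : realType} {m : nat}.
Variable C : {linear 'M[R]_2 -> 'M[R]_2}.
Hypothesis hC : spd_tensor C.
Variables (Omega : set (R * R)) (T : 'I_m -> set (R * R)) (a : bc).
Hypotheses (oO : open Omega) (bO : bounded_set Omega) (hT : is_mesh Omega T).
Implicit Types (f u : R * R -> R) (M : R * R -> 'M[R]_2) (v : 'I_m -> R * R -> R) (Q : 'I_m -> R * R -> 'M[R]_2)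
  (uh : ('I_m -> R * R -> 'M[R]_2) -> R) (mh : ('I_m -> R * R -> R) -> R) (w z : trial R m).
Local Notation mu := (leb2 R).
Let mO : pmeas Omega := open_measurable2 oO.
Let oT i : open (T i) := @mesh_open R m Omega T hT i.
Let sT i : T i `<=` Omega := @mesh_sub R m Omega T hT i.
Let mT i : pmeas (T i) := open_measurable2 (@oT i).
Local Notation bd := (skeleton_pairing T).
Local Notation b := (b C T).

Lemma bd_linl s v v' Q : H2b T v -> H2b T v' -> HdivDivb T Q ->
  bd (s *: v + v') Q = s * bd v Q + bd v' Q.
Proof.
move=> hv hv' hQ.
have e1 : \sum_i ip (T i) ((s *: v + v') i) (dd (T i) (Q i)) =
    s * (\sum_i ip (T i) (v i) (dd (T i) (Q i))) + \sum_i ip (T i) (v' i) (dd (T i) (Q i)).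
  rewrite mulr_sumr -big_split; apply: eq_bigr => i _; have [Ld _] := dd_spec (hQ i).
  exact: (si_linl (L2_semi_inner (@mT i)) s (H2_L2 (hv i)) (H2_L2 (hv' i)) Ld).
have e2 : \sum_i ipM (T i) (Eps (T i) ((s *: v + v') i)) (Q i) =
    s * (\sum_i ipM (T i) (Eps (T i) (v i)) (Q i)) + \sum_i ipM (T i) (Eps (T i) (v' i)) (Q i).
  rewrite mulr_sumr -big_split; apply: eq_bigr => i _; rewrite ipM_sym.
  rewrite [X in _ = s * X + _]ipM_sym [X in _ = _ + X]ipM_sym.
  exact: (ipM_Eps_lin s (@oT i) (HdivDiv_LM (hQ i)) (hv i) (hv' i)).
by rewrite /skeleton_pairing e1 e2; ring.
Qed.

Lemma bd_linr s v Q Q' : H2b T v -> HdivDivb T Q -> HdivDivb T Q' ->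
  bd v (s *: Q + Q') = s * bd v Q + bd v Q'.
Proof.
move=> hv hQ hQ'.
have e1 : \sum_i ip (T i) (v i) (dd (T i) ((s *: Q + Q') i)) =
    s * (\sum_i ip (T i) (v i) (dd (T i) (Q i))) + \sum_i ip (T i) (v i) (dd (T i) (Q' i)).
  rewrite mulr_sumr -big_split; apply: eq_bigr => i _.
  have [L1 _] := dd_spec (hQ i); have [L2' _] := dd_spec (hQ' i).
  have [L3 _] := dd_spec ((HdivDiv_subspace (@oT i)).2 s _ _ (hQ i) (hQ' i)).
  rewrite (ip_ae2 (@mT i) L3 (L2_lin s (@mT i) L1 L2') (H2_L2 (hv i)) (L2map_lin (dd_map (@oT i)) s (hQ i) (hQ' i))).
  exact: (si_linr (L2_semi_inner (@mT i)) s L1 L2' (H2_L2 (hv i))).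
have e2 : \sum_i ipM (T i) (Eps (T i) (v i)) ((s *: Q + Q') i) =
    s * (\sum_i ipM (T i) (Eps (T i) (v i)) (Q i)) + \sum_i ipM (T i) (Eps (T i) (v i)) (Q' i).
  rewrite mulr_sumr -big_split; apply: eq_bigr => i _.
  exact: (si_linr (LM_ipM_inner (@mT i)) s (HdivDiv_LM (hQ i)) (HdivDiv_LM (hQ' i)) (H2_LM (@oT i) (hv i))).
by rewrite /skeleton_pairing e1 e2; ring.
Qed.

Lemma HdivDivbc_subspace : subspace (HdivDivbc a Omega T).
Proof.
have [S0 SL] := HdivDiv_subspace oO; case: a => //=; split.
  split => // dv hdv; rewrite trdDivE; exact: (bd0r hT (H2b_conf oO hT hdv.1)).
move=> s P Q [hP p0] [hQ q0]; split; first exact: SL.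
move=> dv hdv; have := bd_linr s (H2b_conf oO hT hdv.1) (HdivDivb_conf oO hT hP) (HdivDivb_conf oO hT hQ).
by rewrite -!trdDivE p0// q0// mulr0 addr0.
Qed.

Lemma Uspace_subspace : subspace (Uspace a Omega T).
Proof.
have [S0 SL] := H2bc_subspace a oO; have [P0 PL] := HdivDivbc_subspace.
split.
  split; [exact: (L2_0 mO)|exact: (L2s_subspace mO).1| |].
  - by exists 0 => // Q hQ; rewrite trGgradE; exact: (bd0l hT hQ).
  - by exists 0 => // v hv; rewrite trdDivE; exact: (bd0r hT hv).
move=> s [[[u M] uh] mh] [[[u' M'] uh'] mh'] [Lu sM [u0 hu0 eu] [Q0 hQ0 eQ]] [Lu' sM' [u0' hu0' eu'] [Q0' hQ0' eQ']].
split.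
- exact: (L2_lin s mO Lu Lu').
- exact: ((L2s_subspace mO).2 s _ _ sM sM').
- exists (s *: u0 + u0'); first exact: SL.
  move=> Q hQ; rewrite trGgradE.
  have := bd_linl s (H2b_conf oO hT (H2bc_H2 hu0)) (H2b_conf oO hT (H2bc_H2 hu0')) hQ.
  by rewrite -!trGgradE eu// eu'.
- exists (s *: Q0 + Q0'); first exact: PL.
  move=> v hv; rewrite trdDivE.
  have := bd_linr s hv (HdivDivb_conf oO hT (HdivDivbc_HdivDiv hQ0)) (HdivDivb_conf oO hT (HdivDivbc_HdivDiv hQ0')).
  by rewrite -!trdDivE eQ// eQ'.
Qed.

Lemma b_lin s w z (v : test R m) : Uspace a Omega T w -> Uspace a Omega T z -> Vspace T v ->
  b (s *: w + z) v = s * b w v + b z v.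
Proof.
case: w => [[[u M] uh] mh]; case: z => [[[u' M'] uh'] mh']; case: v => [v Q].
move=> [Lu sM _ _] [Lu' sM' _ _] [hv hQ].
have sl := (L2s_subspace mO).2 s _ _ sM sM'.
rewrite (bE hC oO hT u uh mh sM hv hQ) (bE hC oO hT u' uh' mh' sM' hv hQ).
have -> : s *: ((u, M, uh, mh) : trial R m) + (u', M', uh', mh') =
   (s *: u + u', s *: M + M', s *: uh + uh', s *: mh + mh') by [].
rewrite (bE hC oO hT _ _ _ sl hv hQ).
have -> : \sum_i ipM (T i) (s *: M + M') (Eps (T i) (v i)) =
    s * (\sum_i ipM (T i) M (Eps (T i) (v i))) + \sum_i ipM (T i) M' (Eps (T i) (v i)).
  rewrite mulr_sumr -big_split; apply: eq_bigr => i _.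
  exact: (si_linl (LM_ipM_inner (@mT i)) s (L2s_LM (L2s_sub mO (@mT i) (@sT i) sM)) (L2s_LM (L2s_sub mO (@mT i) (@sT i) sM')) (H2_LM (@oT i) (hv i))).
have -> : \sum_i ipM (T i) (compl C (s *: M + M')) (Q i) =
    s * (\sum_i ipM (T i) (compl C M) (Q i)) + \sum_i ipM (T i) (compl C M') (Q i).
  rewrite mulr_sumr -big_split; apply: eq_bigr => i _.
  have s1 := L2s_sub mO (@mT i) (@sT i) sM; have s2 := L2s_sub mO (@mT i) (@sT i) sM'.
  have c1 := compl_LM hC (@mT i) s1; have c2 := compl_LM hC (@mT i) s2.
  have c3 := compl_LM hC (@mT i) (L2s_sub mO (@mT i) (@sT i) sl).
  have c4 := (LM_subspace (@mT i)).2 s _ _ c1 c2.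
  rewrite (ipM_ae (@mT i) c3 c4 (HdivDiv_LM (hQ i)) (compl_lin hC s (@mT i) s1 s2)).
  exact: (si_linl (LM_ipM_inner (@mT i)) s c1 c2 (HdivDiv_LM (hQ i))).
have -> : \sum_i ip (T i) (s *: u + u') (dd (T i) (Q i)) =
    s * (\sum_i ip (T i) u (dd (T i) (Q i))) + \sum_i ip (T i) u' (dd (T i) (Q i)).
  rewrite mulr_sumr -big_split; apply: eq_bigr => i _; have [Ld _] := dd_spec (hQ i).
  exact: (si_linl (L2_semi_inner (@mT i)) s (L2_subset mO (@mT i) (@sT i) Lu) (L2_subset mO (@mT i) (@sT i) Lu') Ld).
have -> : (s *: uh + uh') Q = s * uh Q + uh' Q by [].
have -> : (s *: mh + mh') v = s * mh v + mh' v by [].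
ring.
Qed.

Lemma b_Ueq w z (v : test R m) : Uspace a Omega T w -> Uspace a Omega T z -> Vspace T v -> Ueq Omega T w z ->
  b w v = b z v.
Proof.
case: w => [[[u M] uh] mh]; case: z => [[[u' M'] uh'] mh']; case: v => [v Q].
move=> [Lu sM _ _] [Lu' sM' _ _] [hv hQ] [eu eM euh emh].
rewrite (bE hC oO hT u uh mh sM hv hQ) (bE hC oO hT u' uh' mh' sM' hv hQ) (euh _ hQ) (emh _ hv).
have K (p q r p' q' r' c d : R) : p = p' -> q = q' -> r = r' -> p + q + r - c + d = p' + q' + r' - c + d.
  by move=> -> -> ->.
apply: K; apply: eq_bigr => i _.
- have s1 := L2s_sub mO (@mT i) (@sT i) sM; have s2 := L2s_sub mO (@mT i) (@sT i) sM'.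
  apply: (ipM_ae (@mT i) (L2s_LM s1) (L2s_LM s2) (H2_LM (@oT i) (hv i))).
  by apply: ent_eq_ae; apply: filterS eM => x h /sT; exact: h.
- have s1 := L2s_sub mO (@mT i) (@sT i) sM; have s2 := L2s_sub mO (@mT i) (@sT i) sM'.
  apply: (ipM_ae (@mT i) (compl_LM hC (@mT i) s1) (compl_LM hC (@mT i) s2) (HdivDiv_LM (hQ i))).
  apply: comp_ae; apply: ent_eq_ae; apply: filterS eM => x h /sT; exact: h.
- have [Ld _] := dd_spec (hQ i).
  apply: (ip_ae (@mT i) (L2_subset mO (@mT i) (@sT i) Lu) (L2_subset mO (@mT i) (@sT i) Lu') Ld).
  by apply: filterS eu => x h /sT; exact: h.
Qed.

(** By [VF_KL] such an element consists of a plate solution without load and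
    its traces; the energy identity makes it vanish. *)
Lemma b_eq0_Ueq w : Uspace a Omega T w -> (forall v : test R m, Vspace T v -> b w v = 0) -> Ueq Omega T w 0.
Proof.
case: w => [[[u M] uh] mh] hU h0.
have L0 := L2_0 mO.
have hVF : solves_VF C a Omega T 0 ((u, M, uh, mh) : trial R m).
  split => // v hv; rewrite h0// /L big1 ?oppr0// => i _.
  by have := si_scalel (L2_semi_inner (@mT i)) 0 (L2_0 (@mT i)) (H2_L2 (hv.1 i)); rewrite scale0r mul0r.
have [euh emh [hu hM dM eM]] := VF_KL hC oO bO hT L0 hVF.
have hu2 := H2bc_H2 hu; have hM' := HdivDivbc_HdivDiv hM; have sM := HdivDiv_L2s hM'.
have sE := Eps_L2s oO hu2; have LE' := L2s_LM sE; have LS := stiff_LM C mO LE'.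
have [c c0 hP] := poincare oO bO; have [k k0 hk] := stiff_coercive hC.
have g := green_bc oO bO hT hu hM; have [Ld _] := dd_spec hM'.
have LN : L2 Omega (- (0 : R * R -> R)) by rewrite oppr0.
have e0 : ip Omega u (dd Omega M) = 0.
  rewrite (ip_ae2 mO Ld LN (H2_L2 hu2) dM) oppr0.
  by have := si_scaler (L2_semi_inner mO) 0 L0 (H2_L2 hu2); rewrite scale0r mul0r.
have LNS : LM Omega (- stiff C (Eps Omega u)).
  have := (LM_subspace mO).2 (-1) _ _ LS (LM_0 mO); rewrite addr0 scaleN1r; exact.
have e1 : ipM Omega (stiff C (Eps Omega u)) (Eps Omega u) = 0.
  move: g; rewrite e0 ipM_sym (ipM_ae mO (L2s_LM sM) LNS LE' eM) (si_oppl (LM_ipM_inner mO) LS LE').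
  by move=> /eqP; rewrite eq_sym oppr_eq0 => /eqP.
have e2 : ipM Omega (Eps Omega u) (Eps Omega u) = 0.
  by apply/eqP; rewrite eq_le ipM_ge0 andbT; have := hk _ _ mO sE; rewrite e1 mulr0.
have e3 : ip Omega u u = 0.
  apply/eqP; rewrite eq_le ip_ge0 andbT; have := hP _ (H2bc_H2s hu); rewrite e2 mulr0.
  by apply: le_trans; apply: le_trans (ip_Eps_le oO hu2); rewrite e2 addr0.
have au := ip_eq0_ae mO (H2_L2 hu2) e3; have aE := ipM_eq0_ae mO LE' e2.
have aM i j : ae_eq mu Omega (ent M i j) 0.
  apply: (ae_eq_trans (eM i j)).
  have /ent_ae h : forall i j, ae_eq mu Omega (ent (Eps Omega u) i j) (ent 0 i j).
    by move=> i' j'; apply: (ae_eq_trans (aE i' j')); apply: aeW => x _; rewrite /ent mxE.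
  apply: filterS h => x h wx; rewrite /ent (_ : (- stiff C (Eps Omega u)) x = - C (Eps Omega u x))//.
  by rewrite (h wx) linear0 oppr0 mxE.
split.
- exact: au.
- by apply/ent_ae => i j; apply: (ae_eq_trans (aM i j)); apply: aeW => x _; rewrite /ent mxE.
- move=> Q hQ; rewrite euh// trGgradE -[RHS](bd0l hT hQ) /skeleton_pairing; congr (_ - _); apply: eq_bigr => i _.
    have [Ld' _] := dd_spec (hQ i); apply: (ip_ae (@mT i) (L2_subset mO (@mT i) (@sT i) (H2_L2 hu2)) (L2_0 (@mT i)) Ld').
    by apply: filterS au => x h /sT; exact: h.
  rewrite (Eps_ext (@mT i) (L2_subset mO (@mT i) (@sT i) (H2_L2 hu2)) (L2_0 (@mT i)))//.
  by apply: filterS au => x h /sT; exact: h.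
- move=> v hv; rewrite emh// trdDivE -[RHS](bd0r hT hv) /skeleton_pairing; congr (_ - _); apply: eq_bigr => i _.
    have [L1 _] := dd_spec (HdivDivb_conf oO hT hM' i); have S := HdivDiv_subspace (@oT i).
    have [L2' _] := dd_spec S.1; apply: (ip_ae2 (@mT i) L1 L2' (H2_L2 (hv i))).
    apply: (ae_eq_trans (dd_sub oO (@oT i) (@sT i) hM')).
    apply: (@ae_eq_trans _ _ _ _ _ _ _ 0); last by apply: ae_eq_sym; exact: (L2map0 S (dd_map (@oT i))).
    by apply: filterS dM => x h /sT /h ->; rewrite oppr0.
  rewrite ipM_sym [RHS]ipM_sym.
  apply: (ipM_ae (@mT i) (L2s_LM (L2s_sub mO (@mT i) (@sT i) sM)) (LM_0 (@mT i)) (H2_LM (@oT i) (hv i))) => i' j'.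
  apply: (@ae_eq_trans _ _ _ _ _ _ _ 0); last by apply: aeW => x _; rewrite /ent mxE.
  by apply: filterS (aM i' j') => x h /sT; exact: h.
Qed.

Lemma Ueq_sub w z : Ueq Omega T (w - z) 0 -> Ueq Omega T w z.
Proof.
case: w => [[[u M] uh] mh]; case: z => [[[u' M'] uh'] mh'] [h1 h2 h3 h4]; split.
- by apply: filterS h1 => x h wx; apply/eqP; rewrite -subr_eq0; apply/eqP; exact: h.
- by apply: filterS h2 => x h wx; apply/eqP; rewrite -subr_eq0; apply/eqP; exact: h.
- by move=> Q hQ; apply/eqP; rewrite -subr_eq0; apply/eqP; exact: (h3 Q hQ).
- by move=> v hv; apply/eqP; rewrite -subr_eq0; apply/eqP; exact: (h4 v hv).
Qed.

End TrialSpace.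

(** * The trial-to-test operator and the energy form *)

Section Scalars.
Context {R : realType}.

Lemma cs_plus (s t a1 a2 b1 b2 : R) : 0 <= a1 -> 0 <= a2 -> 0 <= b1 -> 0 <= b2 ->
  s ^+ 2 <= a1 * b1 -> t ^+ 2 <= a2 * b2 -> (s + t) ^+ 2 <= (a1 + a2) * (b1 + b2).
Proof.
move=> h1 h2 h3 h4 hs ht.
have p0 : 0 <= a1 * b2 by exact: mulr_ge0.
have q0 : 0 <= a2 * b1 by exact: mulr_ge0.
have : s ^+ 2 * t ^+ 2 <= (a1 * b2) * (a2 * b1).
  have -> : (a1 * b2) * (a2 * b1) = (a1 * b1) * (a2 * b2) by ring.
  by apply: ler_pM => //; exact: sqr_ge0.
rewrite -exprMn => hst.
have : (2 * (s * t)) ^+ 2 <= (a1 * b2 + a2 * b1) ^+ 2.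
  have := sqr_ge0 (a1 * b2 - a2 * b1); rewrite exprMn; nra.
move=> h; have h5 : 2 * (s * t) <= a1 * b2 + a2 * b1.
  apply: le_trans (ler_norm _) _; rewrite -(ler_pXn2r (n := 2)) ?nnegrE ?addr_ge0//.
  by rewrite real_normK ?num_real.
lra.
Qed.

Lemma sq_cancel (x y : R) : 0 <= x -> 0 <= y -> x ^+ 2 <= y * x -> x <= y.
Proof.
move=> x0 y0; have [->|xn] := eqVneq x 0; first by [].
by rewrite expr2 ler_pM2r// lt_neqAle eq_sym xn.
Qed.

End Scalars.

Section TestSpace.
Context {R : realType} {m : nat}.
Variable C : {linear 'M[R]_2 -> 'M[R]_2}.
Hypothesis hC : spd_tensor C.
Variables (Omega : set (R * R)) (T : 'I_m -> set (R * R)) (a : bc) (d : R).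
Hypotheses (oO : open Omega) (bO : bounded_set Omega) (hT : is_mesh Omega T) (d0 : 0 < d).
Implicit Types (f u : R * R -> R) (M : R * R -> 'M[R]_2) (v : 'I_m -> R * R -> R) (Q : 'I_m -> R * R -> 'M[R]_2)
  (uh : ('I_m -> R * R -> 'M[R]_2) -> R) (mh : ('I_m -> R * R -> R) -> R) (w z : trial R m).
Local Notation mu := (leb2 R).
Let mO : pmeas Omega := open_measurable2 oO.
Let oT i : open (T i) := @mesh_open R m Omega T hT i.
Let sT i : T i `<=` Omega := @mesh_sub R m Omega T hT i.
Let mT i : pmeas (T i) := open_measurable2 (@oT i).
Local Notation bd := (skeleton_pairing T).
Local Notation b := (b C T).
Local Notation D := (d ^- 4).
Local Notation c4 := (d ^+ 4).
Let D0 : 0 < D. Proof. by rewrite invr_gt0 exprn_gt0. Qed.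
Let c0 : 0 < c4. Proof. by rewrite exprn_gt0. Qed.
Let Dc : D * c4 = 1. Proof. by rewrite mulVf// gt_eqF. Qed.

Definition vform v v' : R := \sum_i dform D (T i) (v i) (v' i).
Definition qform Q Q' : R := \sum_i Qform c4 (T i) (Q i) (Q' i).

Lemma ipVE (x y : test R m) : ipV d T x y = vform x.1 y.1 + qform x.2 y.2.
Proof.
rewrite /ipV /vform /qform /dform /Qform !big_split /= -!mulr_sumr -!addrA.
have e1 : \sum_i ipM (T i) (epsgrad (T i) (x.1 i)) (epsgrad (T i) (y.1 i)) =
  \sum_i ipM (T i) (Eps (T i) (x.1 i)) (Eps (T i) (y.1 i)) by apply: eq_bigr => i _; rewrite !EpsE.
have e2 : \sum_i ip (T i) (divDiv (T i) (x.2 i)) (divDiv (T i) (y.2 i)) =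
  \sum_i ip (T i) (dd (T i) (x.2 i)) (dd (T i) (y.2 i)) by apply: eq_bigr => i _; rewrite !ddE.
by rewrite e1 e2.
Qed.

Lemma H2b_subspace : subspace (H2b T).
Proof.
split=> [i|s x y hx hy i]; first exact: (H2_subspace (@oT i)).1.
exact: ((H2_subspace (@oT i)).2 s _ _ (hx i) (hy i)).
Qed.

Lemma HdivDivb_subspace : subspace (HdivDivb T).
Proof.
split=> [i|s x y hx hy i]; first exact: (HdivDiv_subspace (@oT i)).1.
exact: ((HdivDiv_subspace (@oT i)).2 s _ _ (hx i) (hy i)).
Qed.

Lemma vform_inner : semi_inner (H2b T) vform.
Proof.
apply: si_sum => [|i]; first exact: H2b_subspace.
have HD := dform_inner (@oT i) (ltW D0); have [S0 SL] := H2b_subspace; split => //.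
- by move=> x y Sx Sy; exact: (si_sym HD (Sx i) (Sy i)).
- by move=> s x y z Sx Sy Sz; exact: (si_linl HD s (Sx i) (Sy i) (Sz i)).
- by move=> x Sx; exact: (si_ge0 HD (Sx i)).
Qed.

Lemma qform_inner : semi_inner (HdivDivb T) qform.
Proof.
apply: si_sum => [|i]; first exact: HdivDivb_subspace.
have HD := Qform_inner (@oT i) (ltW c0); have [S0 SL] := HdivDivb_subspace; split => //.
- by move=> x y Sx Sy; exact: (si_sym HD (Sx i) (Sy i)).
- by move=> s x y z Sx Sy Sz; exact: (si_linl HD s (Sx i) (Sy i) (Sz i)).
- by move=> x Sx; exact: (si_ge0 HD (Sx i)).
Qed.

Lemma V_inner : semi_inner (Vspace T) (ipV d T : test R m -> test R m -> R).
Proof.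
have HV := vform_inner; have HQ := qform_inner; split.
- by split; [exact: (si_0 HV)|exact: (si_0 HQ)].
- by move=> s x y [x1 x2] [y1 y2]; split; [exact: (si_lin HV s x1 y1)|exact: (si_lin HQ s x2 y2)].
- by move=> x y [x1 x2] [y1 y2]; rewrite !ipVE (si_sym HV x1 y1) (si_sym HQ x2 y2).
- move=> s x y z [x1 x2] [y1 y2] [z1 z2].
  have e : ipV d T (s *: x + y) z = vform (s *: x.1 + y.1) z.1 + qform (s *: x.2 + y.2) z.2 := ipVE _ _.
  rewrite e (si_linl HV s x1 y1 z1) (si_linl HQ s x2 y2 z2) !ipVE; ring.
- by move=> x [x1 x2]; rewrite ipVE addr_ge0//; [exact: (si_ge0 HV)|exact: (si_ge0 HQ)].
Qed.

Hypothesis lT : forall i, bounded_set (T i) /\ lipschitz_boundary (T i).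

(** Completeness of H2 for the scaled norm, which rests on the regularity
    theorem, represents every functional of this form. *)
Lemma riesz_v i P g : LM (T i) P -> L2 (T i) g -> exists2 y, H2 (T i) y &
  forall x, H2 (T i) x -> dform D (T i) y x = ipM (T i) P (Eps (T i) x) + ip (T i) g x.
Proof.
move=> LP Lg; have [bT lTi] := lT i; have HM := LM_ipM_inner (@mT i); have HL := L2_semi_inner (@mT i).
apply: (riesz (dform_inner (@oT i) (ltW D0)) (c := (ipM (T i) P P + c4 * ip (T i) g g))).
- exact: (dform_complete (@oT i) bT lTi D0).
- move=> s x y hx hy; rewrite (ipM_Eps_lin s (@oT i) LP hx hy) (si_linr HL s (H2_L2 hx) (H2_L2 hy) Lg); ring.
- move=> x hx; have c1 := cauchy_schwarz HM LP (H2_LM (@oT i) hx); have c2 := cauchy_schwarz HL Lg (H2_L2 hx).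
  rewrite /dform [X in _ * X]addrC; apply: cs_plus => //; rewrite ?ipM_ge0//.
  + by apply: mulr_ge0; [exact: ltW|exact: ip_ge0].
  + by apply: mulr_ge0; [exact: ltW|exact: ip_ge0].
  + have -> // : c4 * ip (T i) g g * (D * ip (T i) x x) = (D * c4) * (ip (T i) g g * ip (T i) x x) by ring.
    by rewrite Dc mul1r.
Qed.

Lemma riesz_q i P g : LM (T i) P -> L2 (T i) g -> exists2 Y, HdivDiv (T i) Y &
  forall X, HdivDiv (T i) X -> Qform c4 (T i) Y X = ipM (T i) P X + ip (T i) g (dd (T i) X).
Proof.
move=> LP Lg; have HM := LM_ipM_inner (@mT i); have HL := L2_semi_inner (@mT i).
apply: (riesz (Qform_inner (@oT i) (ltW c0)) (c := (ipM (T i) P P + D * ip (T i) g g))).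
- exact: (Qform_complete (@oT i) c0).
- move=> s x y hx hy; have S := HdivDiv_subspace (@oT i); have [Lx _] := dd_spec hx; have [Ly _] := dd_spec hy.
  have [Lxy _] := dd_spec (S.2 s _ _ hx hy).
  rewrite (si_linr HM s (HdivDiv_LM hx) (HdivDiv_LM hy) LP).
  rewrite (ip_ae2 (@mT i) Lxy (L2_lin s (@mT i) Lx Ly) Lg (L2map_lin (dd_map (@oT i)) s hx hy)).
  rewrite (si_linr HL s Lx Ly Lg); ring.
- move=> x hx; have [Lx _] := dd_spec hx.
  have c1 := cauchy_schwarz HM LP (HdivDiv_LM hx); have c2 := cauchy_schwarz HL Lg Lx.
  rewrite /Qform; apply: cs_plus => //; rewrite ?ipM_ge0//.
  + by apply: mulr_ge0; [exact: ltW|exact: ip_ge0].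
  + by apply: mulr_ge0; [exact: ltW|exact: ip_ge0].
  + have -> // : D * ip (T i) g g * (c4 * ip (T i) (dd (T i) x) (dd (T i) x)) = (D * c4) * (ip (T i) g g * ip (T i) (dd (T i) x) (dd (T i) x)) by ring.
    by rewrite Dc mul1r.
Qed.

(** The bilinear form splits over the elements and the two components of the
    test space; on each, its part is represented by the Riesz theorem. *)
Lemma Theta_spec w : Uspace a Omega T w ->
  Vspace T (Theta C d T w) /\ forall v : test R m, Vspace T v -> ipV d T (Theta C d T w) v = b w v.
Proof.
move=> hU; apply: (@getPex _ [set v : test R m | Vspace T v /\ forall dv, Vspace T dv -> ipV d T v dv = b w dv]).
case: w hU => [[[u M] uh] mh] [Lu sM [u0 hu0 euh] [Q0 hQ0 emh]].
have h2 := H2bc_H2 hu0; have hQ := HdivDivbc_HdivDiv hQ0.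
have sMi i := L2s_sub mO (@mT i) (@sT i) sM; have hQi := HdivDivb_conf oO hT hQ; have h2i := H2b_conf oO hT h2.
have Lui i := L2_subset mO (@mT i) (@sT i) Lu; have cMi i := compl_LM hC (@mT i) (sMi i).
have HM i := LM_ipM_inner (@mT i); have HL i := L2_semi_inner (@mT i).
have LEi i := H2_LM (@oT i) (h2i i).
have Ldi i : L2 (T i) (dd (T i) Q0) by case: (dd_spec (hQi i)).
have /choice[y hy] : forall i, exists y, H2 (T i) y /\ forall x, H2 (T i) x ->
    dform D (T i) y x = ipM (T i) (M - Q0) (Eps (T i) x) + ip (T i) (dd (T i) Q0) x.
  move=> i; have [||y hy ey] := @riesz_v i (M - Q0) (dd (T i) Q0); last by exists y.
    exact: (si_sub (HM i) (L2s_LM (sMi i)) (HdivDiv_LM (hQi i))).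
  exact: Ldi.
have /choice[Y hY] : forall i, exists Y, HdivDiv (T i) Y /\ forall X, HdivDiv (T i) X ->
    Qform c4 (T i) Y X = ipM (T i) (compl C M + Eps (T i) u0) X + ip (T i) (u - u0) (dd (T i) X).
  move=> i; have [||Y hY eY] := @riesz_q i (compl C M + Eps (T i) u0) (u - u0); last by exists Y.
    exact: (si_add (HM i) (cMi i) (LEi i)).
  exact: (si_sub (HL i) (Lui i) (H2_L2 (h2i i))).
exists (y, Y); split; first by split=> i; [case: (hy i)|case: (hY i)].
move=> [v Q] [hv hQQ]; rewrite ipVE (bE hC oO hT u uh mh sM hv hQQ) -(euh _ hQQ) -(emh _ hv) trGgradE trdDivE.
rewrite /vform /qform /skeleton_pairing /=.
have -> : \sum_i dform D (T i) (y i) (v i) = \sum_i ipM (T i) M (Eps (T i) (v i)) -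
   \sum_i ipM (T i) (Eps (T i) (v i)) Q0 + \sum_i ip (T i) (v i) (dd (T i) Q0).
  rewrite -sumrB -big_split; apply: eq_bigr => i _ /=; rewrite (hy i).2; last exact: hv.
  rewrite (si_subl (HM i) (L2s_LM (sMi i)) (HdivDiv_LM (hQi i)) (H2_LM (@oT i) (hv i))).
  by rewrite (ip_sym _ (v i)) (ipM_sym _ (Eps (T i) (v i)) Q0).
have -> : \sum_i Qform c4 (T i) (Y i) (Q i) = \sum_i ipM (T i) (compl C M) (Q i) +
   \sum_i ipM (T i) (Eps (T i) u0) (Q i) + \sum_i ip (T i) u (dd (T i) (Q i)) - \sum_i ip (T i) u0 (dd (T i) (Q i)).
  rewrite -!big_split -sumrB; apply: eq_bigr => i _ /=; rewrite (hY i).2; last exact: hQQ.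
  have [Lq _] := dd_spec (hQQ i).
  rewrite -[compl C M]scale1r (si_linl (HM i) 1 (cMi i) (LEi i) (HdivDiv_LM (hQQ i))) mul1r scale1r.
  by rewrite (si_subl (HL i) (Lui i) (H2_L2 (h2i i)) Lq) -!addrA.
ring.
Qed.

(** The form [b] composed with the trial-to-test operator; as an inner product
    it measures the norm of [b w] in the dual of the test space. *)
Definition energy w z : R := b w (Theta C d T z).

Lemma energyE w z : Uspace a Omega T w -> Uspace a Omega T z ->
  energy w z = ipV d T (Theta C d T w) (Theta C d T z).
Proof. by move=> hw hz; rewrite (Theta_spec hw).2//; case: (Theta_spec hz). Qed.

Lemma energy_inner : semi_inner (Uspace a Omega T) energy.
Proof.
have [S0 SL] := Uspace_subspace a oO hT; have HV := V_inner; split => //.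
- move=> w z hw hz; rewrite (energyE hw hz) (energyE hz hw).
  exact: (si_sym HV (Theta_spec hw).1 (Theta_spec hz).1).
- move=> s x y z hx hy hz; exact: (b_lin hC oO hT s hx hy (Theta_spec hz).1).
- by move=> w hw; rewrite (energyE hw hw); exact: (si_ge0 HV (Theta_spec hw).1).
Qed.

Lemma b_energy w (v : test R m) : Uspace a Omega T w -> Vspace T v -> b w v ^+ 2 <= energy w w * ipV d T v v.
Proof.
move=> hw hv; have [tw ew] := Theta_spec hw; rewrite -(ew _ hv) (energyE hw hw).
exact: (cauchy_schwarz V_inner tw hv).
Qed.

(** Zero energy means that [b w] vanishes on the test space. *)
Lemma energy_eq0 w : Uspace a Omega T w -> energy w w = 0 -> Ueq Omega T w 0.
Proof.
move=> hw e0; apply: (b_eq0_Ueq hC oO bO hT hw) => v hv; apply/eqP.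
by rewrite -sqrf_eq0 eq_le sqr_ge0 andbT; have := b_energy hw hv; rewrite e0 mul0r.
Qed.

Lemma energy_Ueq w z z' : Uspace a Omega T w -> Uspace a Omega T z -> Uspace a Omega T z' ->
  Ueq Omega T z z' -> energy w z = energy w z'.
Proof.
move=> hw hz hz' e; rewrite (si_sym energy_inner hw hz) (si_sym energy_inner hw hz').
exact: (b_Ueq hC oO hT hz hz' (Theta_spec hw).1 e).
Qed.

(** The weights [d ^- 4] and [d ^+ 4] of the two norms cancel. *)
Lemma bd_bound v Q : H2b T v -> HdivDivb T Q -> bd v Q ^+ 2 <= vform v v * qform Q Q.
Proof.
move=> hv hQ; have Ld i : L2 (T i) (dd (T i) (Q i)) by case: (dd_spec (hQ i)).
have s1 := sum_cauchy_schwarz (fun i => L2_semi_inner (@mT i)) (fun i => H2_L2 (hv i)) Ld.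
have s2 := sum_cauchy_schwarz (fun i => LM_ipM_inner (@mT i)) (fun i => H2_LM (@oT i) (hv i)) (fun i => HdivDiv_LM (hQ i)).
rewrite /skeleton_pairing /vform /qform /dform /Qform !big_split /= -!mulr_sumr [X in _ * X]addrC.
have n1 : 0 <= \sum_i ip (T i) (v i) (v i) by apply: sumr_ge0 => i _; exact: ip_ge0.
have n2 : 0 <= \sum_i ip (T i) (dd (T i) (Q i)) (dd (T i) (Q i)) by apply: sumr_ge0 => i _; exact: ip_ge0.
apply: cs_plus.
- by apply: mulr_ge0 => //; exact: ltW.
- by apply: sumr_ge0 => i _; exact: ipM_ge0.
- by apply: mulr_ge0 => //; exact: ltW.
- by apply: sumr_ge0 => i _; exact: ipM_ge0.
- apply: le_trans s1 _; rewrite mulrACA Dc mul1r; exact: lexx.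
- by rewrite sqrrN.
Qed.

Lemma vform_conf u : H2 Omega u -> vform (fun=> u) (fun=> u) = dform D Omega u u.
Proof.
move=> hu; rewrite /vform /dform big_split /= -mulr_sumr -(mesh_ip oO bO hT (H2_L2 hu) (H2_L2 hu)); congr (_ + _).
rewrite -(conf_Eps oO bO hT hu (H2_LM oO hu)); apply: eq_bigr => i _.
have hi := H2b_conf oO hT hu i.
have e := Eps_sub oO (@oT i) (@sT i) hu.
have LO := LM_sub mO (@mT i) (@sT i) (H2_LM oO hu).
rewrite [RHS]ipM_sym; exact: (ipM_ae (@mT i) (H2_LM (@oT i) hi) LO (H2_LM (@oT i) hi) e).
Qed.

Lemma qform_conf M : HdivDiv Omega M -> qform (fun=> M) (fun=> M) = Qform c4 Omega M M.
Proof.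
move=> hM; have [Ld _] := dd_spec hM.
rewrite /qform /Qform big_split /= -mulr_sumr -(mesh_ipM oO bO hT (HdivDiv_LM hM) (HdivDiv_LM hM)); congr (_ + _ * _).
rewrite (mesh_ip oO bO hT Ld Ld); apply: eq_bigr => i _.
have [Li _] := dd_spec (HdivDivb_conf oO hT hM i); have e := dd_sub oO (@oT i) (@sT i) hM.
have Lsi := L2_subset mO (@mT i) (@sT i) Ld.
exact: (etrans (ip_ae (@mT i) Li Lsi Li e) (ip_ae2 (@mT i) Li Lsi Lsi e)).
Qed.

Lemma norm2E u : norm2 d Omega u = Num.sqrt (dform D Omega u u).
Proof. by rewrite /norm2 /nrm /nrmM !sqr_sqrtr ?ip_ge0 ?ipM_ge0// EpsE. Qed.

Lemma normdDE M : normdD d Omega M = Num.sqrt (Qform c4 Omega M M).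
Proof. by rewrite /normdD /nrm /nrmM !sqr_sqrtr ?ip_ge0 ?ipM_ge0// ddE. Qed.

Lemma normGgrad_ge0 uh : 0 <= normGgrad d Omega T uh.
Proof.
rewrite /normGgrad; set A := [set _ | _ in _].
have [->|/set0P hA] := eqVneq A set0; first by rewrite inf0.
by apply: lb_le_inf => // _ [v _ <-]; exact: sqrtr_ge0.
Qed.

Lemma normdDiv_ge0 mh : 0 <= normdDiv d Omega T mh.
Proof.
rewrite /normdDiv; set A := [set _ | _ in _].
have [->|/set0P hA] := eqVneq A set0; first by rewrite inf0.
by apply: lb_le_inf => // _ [v _ <-]; exact: sqrtr_ge0.
Qed.

Lemma normGgrad_le uh u : H2 Omega u -> eqGgrad T (trGgrad T (fun=> u)) uh ->
  normGgrad d Omega T uh ^+ 2 <= dform D Omega u u.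
Proof.
move=> hu e; rewrite -[leRHS]sqr_sqrtr; last exact: (si_ge0 (dform_inner oO (ltW D0)) hu).
rewrite ler_pXn2r ?nnegrE ?sqrtr_ge0 ?normGgrad_ge0//; rewrite -norm2E; apply: ge_inf.
  by exists 0 => _ [v _ <-]; exact: sqrtr_ge0.
by exists u.
Qed.

Lemma normdDiv_le mh M : HdivDiv Omega M -> eqdDiv T (trdDiv T (fun=> M)) mh ->
  normdDiv d Omega T mh ^+ 2 <= Qform c4 Omega M M.
Proof.
move=> hM e; rewrite -[leRHS]sqr_sqrtr; last exact: (si_ge0 (Qform_inner oO (ltW c0)) hM).
rewrite ler_pXn2r ?nnegrE ?sqrtr_ge0 ?normdDiv_ge0//; rewrite -normdDE; apply: ge_inf.
  by exists 0 => _ [v _ <-]; exact: sqrtr_ge0.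
by exists M.
Qed.

(** Bounds for all representatives pass to the minimum norm without knowing
    that it is attained. *)
Lemma inf_prod_bound (A : set R) (x y : R) : A !=set0 -> 0 <= y -> (forall r, A r -> x <= r * y) -> x <= inf A * y.
Proof.
move=> A0; rewrite le_eqVlt => /predU1P[<- h|y0 h].
  by have [r /h] := A0; rewrite !mulr0.
rewrite -ler_pdivrMr//; apply: lb_le_inf => // r Ar; rewrite ler_pdivrMr//; exact: h.
Qed.

Lemma traceGgrad_bound uh Q : traceGgrad a Omega T uh -> HdivDivb T Q ->
  uh Q ^+ 2 <= normGgrad d Omega T uh ^+ 2 * qform Q Q.
Proof.
move=> [u0 hu0 e0] hQ; have q0 : 0 <= qform Q Q := si_ge0 qform_inner hQ.
suff h : `|uh Q| <= normGgrad d Omega T uh * Num.sqrt (qform Q Q).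
  rewrite -real_normK ?num_real// -[X in _ * X]sqr_sqrtr// -exprMn ler_pXn2r ?nnegrE//.
  by rewrite mulr_ge0 ?normGgrad_ge0 ?sqrtr_ge0.
apply: inf_prod_bound; [|exact: sqrtr_ge0|].
  by exists (norm2 d Omega u0), u0 => //; split=> //; exact: (H2bc_H2 hu0).
move=> _ [v [hv ev] <-]; rewrite -(ev _ hQ) trGgradE norm2E -sqrtrM; last exact: (si_ge0 (dform_inner oO (ltW D0)) hv).
rewrite -sqrtr_sqr; apply: ler_wsqrtr; rewrite -(vform_conf hv).
exact: (bd_bound (H2b_conf oO hT hv) hQ).
Qed.

Lemma tracedDiv_bound mh v : tracedDiv a Omega T mh -> H2b T v ->
  mh v ^+ 2 <= normdDiv d Omega T mh ^+ 2 * vform v v.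
Proof.
move=> [Q0 hQ0 e0] hv; have q0 : 0 <= vform v v := si_ge0 vform_inner hv.
suff h : `|mh v| <= normdDiv d Omega T mh * Num.sqrt (vform v v).
  rewrite -real_normK ?num_real// -[X in _ * X]sqr_sqrtr// -exprMn ler_pXn2r ?nnegrE//.
  by rewrite mulr_ge0 ?normdDiv_ge0 ?sqrtr_ge0.
apply: inf_prod_bound; [|exact: sqrtr_ge0|].
  by exists (normdD d Omega Q0), Q0 => //; split=> //; exact: (HdivDivbc_HdivDiv hQ0).
move=> _ [M [hM eM] <-]; rewrite -(eM _ hv) trdDivE normdDE -sqrtrM; last exact: (si_ge0 (Qform_inner oO (ltW c0)) hM).
rewrite -sqrtr_sqr; apply: ler_wsqrtr; rewrite -(qform_conf hM) mulrC.
exact: (bd_bound hv (HdivDivb_conf oO hT hM)).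
Qed.

Definition normU2 w : R := let: (u, M, uh, mh) := w in
  D * ip Omega u u + ipM Omega M M + normGgrad d Omega T uh ^+ 2 + normdDiv d Omega T mh ^+ 2.

Lemma normU2_ge0 w : 0 <= normU2 w.
Proof.
case: w => [[[u M] uh] mh]; rewrite !addr_ge0 ?sqr_ge0 ?ipM_ge0//.
by apply: mulr_ge0; [exact: ltW|exact: ip_ge0].
Qed.

Lemma normUE w : normU d Omega T w = Num.sqrt (normU2 w).
Proof. by case: w => [[[u M] uh] mh]; rewrite /normU /nrm /nrmM !sqr_sqrtr ?ip_ge0 ?ipM_ge0. Qed.

Lemma qform_dd Q : HdivDivb T Q -> \sum_i ip (T i) (dd (T i) (Q i)) (dd (T i) (Q i)) <= D * qform Q Q.
Proof.
move=> hQ; rewrite /qform /Qform big_split /= -mulr_sumr mulrDr mulrA Dc mul1r lerDr mulr_ge0//; first exact: ltW.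
by apply: sumr_ge0 => i _; exact: ipM_ge0.
Qed.

Lemma qform_ipM Q : \sum_i ipM (T i) (Q i) (Q i) <= qform Q Q.
Proof.
rewrite /qform /Qform big_split /= lerDl; apply: sumr_ge0 => i _; apply: mulr_ge0; [exact: ltW|exact: ip_ge0].
Qed.

Lemma vform_ipM v : \sum_i ipM (T i) (Eps (T i) (v i)) (Eps (T i) (v i)) <= vform v v.
Proof.
rewrite /vform /dform big_split /= lerDr; apply: sumr_ge0 => i _; apply: mulr_ge0; [exact: ltW|exact: ip_ge0].
Qed.

Section ComplBound.
Variable kc : R.
Hypothesis (kc0 : 0 <= kc).
Hypothesis hkc : forall (w : set (R * R)) (Q : R * R -> 'M[R]_2), pmeas w -> L2s w Q ->
  ipM w (compl C Q) (compl C Q) <= kc * ipM w Q Q.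

Lemma left_terms u M Q : L2 Omega u -> L2s Omega M -> HdivDivb T Q ->
  (\sum_i ipM (T i) (compl C M) (Q i)) ^+ 2 <= kc * ipM Omega M M * qform Q Q /\
  (\sum_i ip (T i) u (dd (T i) (Q i))) ^+ 2 <= D * ip Omega u u * qform Q Q.
Proof.
move=> Lu sM hQ; have Ld i : L2 (T i) (dd (T i) (Q i)) by case: (dd_spec (hQ i)).
have sMi i := L2s_sub mO (@mT i) (@sT i) sM; have Lui i := L2_subset mO (@mT i) (@sT i) Lu.
have cMi i := compl_LM hC (@mT i) (sMi i).
have s1 := sum_cauchy_schwarz (fun i => L2_semi_inner (@mT i)) Lui Ld.
have s2 := sum_cauchy_schwarz (fun i => LM_ipM_inner (@mT i)) cMi (fun i => HdivDiv_LM (hQ i)).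
split.
- apply: le_trans s2 _; apply: ler_pM; [|by apply: sumr_ge0 => i _; exact: ipM_ge0| |exact: qform_ipM].
    by apply: sumr_ge0 => i _; exact: ipM_ge0.
  rewrite (mesh_ipM oO bO hT (L2s_LM sM) (L2s_LM sM)) mulr_sumr; apply: ler_sum => i _; exact: hkc.
- apply: le_trans s1 _; rewrite -(mesh_ip oO bO hT Lu Lu) [D * _]mulrC -mulrA.
  apply: ler_wpM2l; [exact: ip_ge0|exact: qform_dd].
Qed.

Lemma right_term M v : L2s Omega M -> H2b T v ->
  (\sum_i ipM (T i) M (Eps (T i) (v i))) ^+ 2 <= ipM Omega M M * vform v v.
Proof.
move=> sM hv; have LMi i := L2s_LM (L2s_sub mO (@mT i) (@sT i) sM).
have s1 := sum_cauchy_schwarz (fun i => LM_ipM_inner (@mT i)) LMi (fun i => H2_LM (@oT i) (hv i)).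
apply: le_trans s1 _; rewrite -(mesh_ipM oO bO hT (L2s_LM sM) (L2s_LM sM)).
apply: ler_wpM2l; [exact: ipM_ge0|exact: vform_ipM].
Qed.

(** Continuity of [b], each of its five terms being bounded by one part of the
    trial norm. *)
Lemma energy_bound w : Uspace a Omega T w -> energy w w <= 5 * (1 + kc) * normU2 w.
Proof.
move=> hw; have e0 := si_ge0 energy_inner hw.
have k0 : 0 <= 5 * (1 + kc) * normU2 w by rewrite !mulr_ge0 ?normU2_ge0// addr_ge0.
apply: sq_cancel => //; have [tV ew] := Theta_spec hw.
rewrite (energyE hw hw) in e0 *; rewrite {1}(ew _ tV).
move: (Theta C d T w) tV e0 => v hv; rewrite ipVE; case: v hv => [v Q] [hv hQ] /=.
case: w hw k0 {ew} => [[[u M] uh] mh] [Lu sM tu tm] k0 e0.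
rewrite (bE hC oO hT u uh mh sM hv hQ).
have t1 := right_term sM hv; have [t2 t3] := left_terms Lu sM hQ.
have t4 := traceGgrad_bound tu hQ; have t5 := tracedDiv_bound tm hv.
have v0 := si_ge0 vform_inner hv; have q0 := si_ge0 qform_inner hQ.
move: k0 t1 t2 t3 t4 t5 v0 q0; rewrite /normU2.
have := ipM_ge0 Omega M; have := mulr_ge0 (ltW D0) (ip_ge0 Omega u).
have := sqr_ge0 (normGgrad d Omega T uh); have := sqr_ge0 (normdDiv d Omega T mh).
move: (\sum_i ipM (T i) M _) (\sum_i ipM (T i) (compl C M) _) (\sum_i ip (T i) u _) (uh Q) (mh v) => s1 s2 s3 s4 s5.
move: (vform v v) (qform Q Q) (ipM Omega M M) (D * ip Omega u u) (normGgrad d Omega T uh ^+ 2) (normdDiv d Omega T mh ^+ 2).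
move=> V q M2 u2 g2 h2 h20 g20 u20 M20 k0 t1 t2 t3 t4 t5 v0 q0.
have five : (s1 + s2 + s3 - s4 + s5) ^+ 2 <= 5 * (s1 ^+ 2 + s2 ^+ 2 + s3 ^+ 2 + s4 ^+ 2 + s5 ^+ 2).
  have := sqr_ge0 (s1 - s2); have := sqr_ge0 (s1 - s3); have := sqr_ge0 (s1 + s4); have := sqr_ge0 (s1 - s5).
  have := sqr_ge0 (s2 - s3); have := sqr_ge0 (s2 + s4); have := sqr_ge0 (s2 - s5).
  have := sqr_ge0 (s3 + s4); have := sqr_ge0 (s3 - s5); have := sqr_ge0 (s4 + s5); lra.
apply: le_trans five _.
rewrite -!mulrA ler_pM2l//.
have p1 := mulr_ge0 M20 v0; have p2 := mulr_ge0 M20 q0; have p3 := mulr_ge0 u20 v0; have p4 := mulr_ge0 u20 q0.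
have p5 := mulr_ge0 g20 v0; have p6 := mulr_ge0 g20 q0; have p7 := mulr_ge0 h20 v0; have p8 := mulr_ge0 h20 q0.
have r1 := mulr_ge0 kc0 p1; have r3 := mulr_ge0 kc0 p3; have r4 := mulr_ge0 kc0 p4.
have r5 := mulr_ge0 kc0 p5; have r6 := mulr_ge0 kc0 p6; have r7 := mulr_ge0 kc0 p7; have r8 := mulr_ge0 kc0 p8.
lra.
Qed.

End ComplBound.
End TestSpace.

(** * Stability *)

Section InfSup.
Context {R : realType} {m : nat}.
Variable C : {linear 'M[R]_2 -> 'M[R]_2}.
Hypothesis hC : spd_tensor C.
Variables (Omega : set (R * R)) (T : 'I_m -> set (R * R)) (a : bc) (d : R).
Hypotheses (oO : open Omega) (bO : bounded_set Omega) (hT : is_mesh Omega T) (d0 : 0 < d).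
Hypothesis lT : forall i, bounded_set (T i) /\ lipschitz_boundary (T i).
Implicit Types (f u : R * R -> R) (M : R * R -> 'M[R]_2) (v : 'I_m -> R * R -> R) (Q : 'I_m -> R * R -> 'M[R]_2)
  (uh : ('I_m -> R * R -> 'M[R]_2) -> R) (mh : ('I_m -> R * R -> R) -> R) (w z : trial R m).
Local Notation mu := (leb2 R).
Let mO : pmeas Omega := open_measurable2 oO.
Let oT i : open (T i) := @mesh_open R m Omega T hT i.
Let sT i : T i `<=` Omega := @mesh_sub R m Omega T hT i.
Let mT i : pmeas (T i) := open_measurable2 (@oT i).
Local Notation bd := (skeleton_pairing T).
Local Notation b := (b C T).
Local Notation D := (d ^- 4).
Local Notation c4 := (d ^+ 4).
Local Notation vformT := (vform T d).
Local Notation qformT := (qform T d).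
Local Notation energy := (energy C T d).
Let D0 : 0 < D. Proof. by rewrite invr_gt0 exprn_gt0. Qed.
Let c0 : 0 < c4. Proof. by rewrite exprn_gt0. Qed.
Let Dc : D * c4 = 1. Proof. by rewrite mulVf// gt_eqF. Qed.
Let HV := vform_inner hT d0.
Let HQ := qform_inner hT d0.
Let HL := L2_semi_inner mO.
Let HM := LM_ipM_inner mO.

Definition fieldsq u M : R := D * ip Omega u u + ipM Omega M M.

Lemma fieldsq_ge0 u M : 0 <= fieldsq u M.
Proof. by rewrite addr_ge0 ?ipM_ge0// mulr_ge0 ?ip_ge0// ltW. Qed.

Section Fields.
Variables k k' : R.
Hypotheses (k0 : 0 < k) (k'0 : 0 <= k').
Hypothesis hk : forall (w : set (R * R)) (P : R * R -> 'M[R]_2), pmeas w -> L2s w P -> ipM w P P <= k * ipM w (stiff C P) P.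
Hypothesis hk' : forall (w : set (R * R)) (P : R * R -> 'M[R]_2), pmeas w -> LM w P -> ipM w (stiff C P) (stiff C P) <= k' * ipM w P P.
Hypothesis scale : forall v : R * R -> R, H2bc a Omega v -> D * ip Omega v v <= ipM Omega (Eps Omega v) (Eps Omega v).

Definition field_const : R := (2 + 2 * k') * (2 * k ^+ 2 * (1 + k') + 1).

Let kk0 : 0 <= 2 * k ^+ 2 * (1 + k').
Proof. by apply: mulr_ge0; [apply: mulr_ge0 => //; exact: sqr_ge0|exact: addr_ge0]. Qed.

Lemma field_const_ge0 : 0 <= field_const.
Proof. by apply: mulr_ge0; apply: addr_ge0 => //; exact: mulr_ge0. Qed.

(** The adjoint problem with data [(u, M)] yields conforming test functions,
    for which the trace terms vanish. *)
Lemma field_test u M uh mh : Uspace a Omega T ((u, M, uh, mh) : trial R m) -> exists v Q,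
  [/\ H2b T v, HdivDivb T Q, b (u, M, uh, mh) (v, Q) = fieldsq u M &
      vformT v v + qformT Q Q <= field_const * fieldsq u M].
Proof.
move=> [Lu sM [u0 hu0 euh] [Q0 hQ0 emh]]; have LMM := L2s_LM sM.
have sP := stiff_L2s hC mO sM; have LP := L2s_LM sP.
have Lg : L2 Omega (- D *: u) by exact: (si_scale HL).
have [v hv vE] := energy_solve hC a oO bO Lg sP.
have hv2 := H2bc_H2 hv; have sE := Eps_L2s oO hv2; have LE := L2s_LM sE.
have sME := L2s_subr mO sM sE; have sQ := stiff_L2s hC mO sME.
have sSE := stiff_L2s hC mO sE.
have Lq : L2 Omega (D *: u) by exact: (si_scale HL).
have eQ : stiff C (M - Eps Omega v) = stiff C M - stiff C (Eps Omega v).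
  by rewrite addrC -scaleN1r stiff_lin scaleN1r addrC.
have [hQ dQ] : HdivDivbc a Omega T (stiff C (M - Eps Omega v)) /\ ae_eq mu Omega (dd Omega (stiff C (M - Eps Omega v))) (D *: u).
  apply: (HdivDivbc_intro oO bO hT sQ Lq) => y hy; have hy2 := H2bc_H2 hy.
  rewrite eQ (si_subl HM LP (L2s_LM sSE) (H2_LM oO hy2)) (vE _ hy).
  rewrite (si_scalel HL _ Lu (H2_L2 hy2)) (si_scalel HL _ Lu (H2_L2 hy2)); ring.
have hQ' := HdivDivbc_HdivDiv hQ; have [Ld _] := dd_spec hQ'.
have dd_E : ip Omega u (dd Omega (stiff C (M - Eps Omega v))) = D * ip Omega u u.
  by rewrite (ip_ae2 mO Ld Lq Lu dQ) (si_scaler HL _ Lu Lu).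
exists (fun=> v), (fun=> stiff C (M - Eps Omega v)); split.
- exact: (H2b_conf oO hT hv2).
- exact: (HdivDivb_conf oO hT hQ').
- rewrite (bE hC oO hT u uh mh sM (H2b_conf oO hT hv2) (HdivDivb_conf oO hT hQ')).
  rewrite -(euh _ (HdivDivb_conf oO hT hQ')) -(emh _ (H2b_conf oO hT hv2)) trGgradE trdDivE.
  rewrite (bd_conf0 oO bO hT hu0 hQ) (bd_conf0 oO bO hT hv hQ0) subr0 addr0.
  have -> : \sum_i ipM (T i) M (Eps (T i) v) = ipM Omega M (Eps Omega v).
    rewrite ipM_sym -(conf_Eps oO bO hT hv2 LMM); apply: eq_bigr => i _; exact: ipM_sym.
  rewrite (conf_dd oO bO hT Lu hQ') dd_E -(mesh_ipM oO bO hT (compl_LM hC mO sM) (L2s_LM sQ)).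
  have -> : ipM Omega (compl C M) (stiff C (M - Eps Omega v)) = ipM Omega M (M - Eps Omega v).
    rewrite -(compl_sym hC mO sM sQ) ipM_sym [RHS]ipM_sym.
    exact: (ipM_ae mO (compl_LM hC mO sQ) (L2s_LM sME) LMM (compl_stiff hC sME)).
  rewrite (si_subr HM LMM LE LMM) /fieldsq; ring.
rewrite (vform_conf d oO bO hT hv2) (qform_conf d oO bO hT hQ') /Qform /dform.
have -> : ip Omega (dd Omega (stiff C (M - Eps Omega v))) (dd Omega (stiff C (M - Eps Omega v))) = D * (D * ip Omega u u).
  by rewrite (ip_ae2 mO Ld Lq Ld dQ) (si_scaler HL _ Lu Ld) (ip_sym _ _ u) dd_E.
have -> : c4 * (D * (D * ip Omega u u)) = D * ip Omega u u by rewrite mulrCA mulrA Dc mul1r.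
have h1 := scale hv; have h2 := hk' mO (L2s_LM sME).
have h3 : ipM Omega (M - Eps Omega v) (M - Eps Omega v) <= 2 * (ipM Omega M M + ipM Omega (Eps Omega v) (Eps Omega v)).
  have := ipM_ge0 Omega (M + Eps Omega v).
  rewrite (si_subl HM LMM LE (si_sub HM LMM LE)) (si_subr HM LMM LE LMM) (si_subr HM LMM LE LE) (ipM_sym _ _ M).
  rewrite -[X in ipM _ (X + _) _]scale1r -[X in ipM _ _ (X + _)]scale1r.
  rewrite (si_quad HM 1 LE LMM) (ipM_sym _ M (Eps Omega v)).
  move: (ipM Omega _ M) (ipM Omega M M) (ipM Omega _ (Eps Omega v)) => *; lra.
have h4 := hk mO sE; rewrite (vE _ hv) in h4.
have h5 : (ip Omega (- D *: u) v + ipM Omega (stiff C M) (Eps Omega v)) ^+ 2 <=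
   (D * ip Omega u u + k' * ipM Omega M M) * (ipM Omega (Eps Omega v) (Eps Omega v) + ipM Omega (Eps Omega v) (Eps Omega v)).
  apply: cs_plus; rewrite ?ipM_ge0//; [by rewrite mulr_ge0 ?ip_ge0// ltW|by rewrite mulr_ge0 ?ipM_ge0| |].
    rewrite (si_scalel HL _ Lu (H2_L2 hv2)).
    apply: (@le_trans _ _ (D * ip Omega u u * (D * ip Omega v v))).
      have := cauchy_schwarz HL Lu (H2_L2 hv2).
      have -> : D * ip Omega u u * (D * ip Omega v v) = D ^+ 2 * (ip Omega u u * ip Omega v v) by ring.
      rewrite exprMn sqrrN => h; apply: ler_wpM2l => //; exact: sqr_ge0.
    by apply: ler_wpM2l => //; rewrite mulr_ge0 ?ip_ge0// ltW.
  apply: le_trans (cauchy_schwarz HM LP LE) _; apply: ler_wpM2r; first exact: ipM_ge0.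
  exact: hk'.
have n1 := ipM_ge0 Omega (Eps Omega v); have n2 := ipM_ge0 Omega M; have n3 := mulr_ge0 (ltW D0) (ip_ge0 Omega u).
rewrite /fieldsq /field_const; move: h1 h2 h3 h4 h5 n1 n2 n3.
move: (ipM Omega (M - Eps Omega v) (M - Eps Omega v)) (ipM Omega (stiff C (M - Eps Omega v)) (stiff C (M - Eps Omega v))) => x1 x2.
move: (ip Omega (- D *: u) v + ipM Omega (stiff C M) (Eps Omega v)) (D * ip Omega u u) (D * ip Omega v v) (ipM Omega M M) (ipM Omega (Eps Omega v) (Eps Omega v)).
move=> s U2 V2 M2 E h1 h2 h3 h4 h5 n1 n2 n3.
have e1 : E <= 2 * k ^+ 2 * (1 + k') * (U2 + M2).
  apply: sq_cancel => //; first by apply: mulr_ge0; [exact: kk0|exact: addr_ge0].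
  apply: (@le_trans _ _ ((k * s) ^+ 2)).
    rewrite ler_pXn2r ?nnegrE//; exact: le_trans h4.
  rewrite exprMn; have -> : 2 * k ^+ 2 * (1 + k') * (U2 + M2) * E = k ^+ 2 * ((1 + k') * (U2 + M2) * (E + E)) by ring.
  apply: ler_wpM2l; first exact: sqr_ge0.
  apply: le_trans h5 _; apply: ler_wpM2r; first exact: addr_ge0.
  have := mulr_ge0 k'0 n3; lra.
have e2 : x2 <= 2 * k' * (M2 + E) by apply: le_trans h2 _; rewrite -mulrA mulrCA; apply: ler_wpM2l.
have e3 : (2 + 2 * k') * E <= (2 + 2 * k') * (2 * k ^+ 2 * (1 + k') * (U2 + M2)).
  by apply: ler_wpM2l => //; rewrite addr_ge0// mulr_ge0.
have := mulr_ge0 k'0 n3; have := mulr_ge0 k'0 n2; lra.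
Qed.

Lemma fields_bound u M uh mh : Uspace a Omega T ((u, M, uh, mh) : trial R m) ->
  fieldsq u M <= field_const * energy (u, M, uh, mh) (u, M, uh, mh).
Proof.
move=> hU; have [v [Q [hv hQ bvQ le]]] := field_test hU.
have e0 := si_ge0 (energy_inner hC a oO hT d0 lT) hU.
have := b_energy hC oO hT d0 lT hU (conj hv hQ : Vspace T ((v, Q) : test R m)).
rewrite bvQ ipVE => h; apply: sq_cancel; rewrite ?fieldsq_ge0//.
  by rewrite mulr_ge0 ?field_const_ge0.
apply: le_trans h _; have -> : field_const * energy (u, M, uh, mh) (u, M, uh, mh) * fieldsq u M =
  energy (u, M, uh, mh) (u, M, uh, mh) * (field_const * fieldsq u M) by ring.
exact: ler_wpM2l.
Qed.

End Fields.

Lemma vform0 : vformT (fun=> 0) (fun=> 0) = 0.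
Proof. by have := si_scalel HV 0 (H2b0 hT) (H2b0 hT); rewrite scale0r mul0r. Qed.

Lemma qform0 : qformT (fun=> 0) (fun=> 0) = 0.
Proof. by have := si_scalel HQ 0 (HdivDivb0 hT) (HdivDivb0 hT); rewrite scale0r mul0r. Qed.

Lemma test_off (w w' : set (R * R)) phi : w `&` w' = set0 -> test_fun w phi -> ae_eq mu w' phi 0.
Proof.
move=> dis t; apply: aeW => x w'x; apply: (test_fun_off t) => wx.
by have : (w `&` w') x by []; rewrite dis.
Qed.

(** On every element a test function of one of them belongs to H20, so that
    Green's formula holds without boundary terms. *)
Lemma bd_test i phi Q : test_fun (T i) phi -> HdivDivb T Q -> bd (fun=> phi) Q = 0.
Proof.
move=> t hQ; rewrite /skeleton_pairing -sumrB; apply: big1 => j _; apply/eqP; rewrite subr_eq0; apply/eqP.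
apply: (green_H20 (@oT j) _ (hQ j)); have [->|ij] := eqVneq j i; first exact: (H2bc_test Clamped (@oT i) t).
have Lp := L2_subset mO (@mT j) (@sT j) (test_fun_L2 mO (test_fun_subset (@sT i) t)).
apply: (H2bc_ae (a := Clamped) (@oT j) Lp _ (H2bc_subspace Clamped (@oT j)).1).
have [_ /(_ i j) dis _] := hT; apply: ae_eq_sym; apply: test_off t; apply: dis; by rewrite eq_sym.
Qed.

Lemma ipM_hessian_sub (w w' : set (R * R)) P phi : open w -> open w' -> w' `<=` w -> LM w P -> test_fun w' phi ->
  ipM w P (hessian phi) = ipM w' P (hessian phi).
Proof.
move=> ow ow' sw LP t; have mw := open_measurable2 ow; have mw' := open_measurable2 ow'.
have t' := test_fun_subset sw t.
rewrite (ipME mw LP (LM_hessian mw t')) (ipME mw' (LM_sub mw mw' sw LP) (LM_hessian mw' t)).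
apply: eq_bigr => i _; apply: eq_bigr => j _; rewrite ent_hessian.
exact: (ip_test _ mw mw' sw (test_fun_partial j (test_fun_partial i t))).
Qed.

(** The representative [v] of minimal norm is orthogonal to all test functions
    of the elements, so that [- Eps v] has the double divergence [d ^- 4 * v]
    in every element. Hence it is an admissible test tensor of the same norm
    as [v]. *)
Lemma normGgrad_bound uh K : 0 <= K -> traceGgrad a Omega T uh ->
  lipschitz_boundary Omega ->
  (forall Q, HdivDivb T Q -> uh Q ^+ 2 <= K * qformT Q Q) ->
  normGgrad d Omega T uh ^+ 2 <= K.
Proof.
move=> K0 [u0 hu0 euh] lO hK; have hu := H2bc_H2 hu0.
pose Z := [set z : R * R -> R | H2 Omega z /\ forall Q, HdivDivb T Q -> bd (fun=> z) Q = 0].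
have HD := dform_inner oO (ltW D0); have [S0 SL] := H2_subspace oO.
have bl s x y Q : H2 Omega x -> H2 Omega y -> HdivDivb T Q ->
    bd (fun=> s *: x + y) Q = s * bd (fun=> x) Q + bd (fun=> y) Q.
  by move=> hx hy hQ; exact: (bd_linl hT s (H2b_conf oO hT hx) (H2b_conf oO hT hy) hQ).
have sZ : Z `<=` H2 Omega by move=> z [].
have subZ : subspace Z.
  split=> [|s x y [hx zx] [hy zy]]; first by split => // Q hQ; exact: (bd0l hT hQ).
  by split=> [|Q hQ]; [exact: SL|rewrite bl// zx// zy// mulr0 addr0].
have HZ := si_subset subZ sZ HD.
have bdD x Q : H2 Omega x -> HdivDivb T Q -> bd (fun=> x) Q ^+ 2 <= dform D Omega x x * qformT Q Q.
  move=> hx hQ; have := bd_bound hT d0 (H2b_conf oO hT hx) hQ.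
  by rewrite (vform_conf d oO bO hT hx).
have cZ : complete_wrt Z (dform D Omega).
  apply: complete_sub (dform_complete oO bO lO D0) => // x y hx hy xy; split => // Q hQ.
  have q0 := si_ge0 HQ hQ; apply/eqP; rewrite -sqrf_eq0 eq_le sqr_ge0 andbT.
  apply/ler_addgt0Pr => e e0; rewrite add0r.
  have [|N hN] := xy (e / (1 + qformT Q Q)); first by rewrite divr_gt0// ltr_pwDl.
  have [hxN zxN] := hx N.
  have e1 : bd (fun=> y) Q = - bd (fun=> x N - y) Q.
    rewrite (_ : x N - y = -1 *: y + x N); last by rewrite scaleN1r addrC.
    by rewrite bl// zxN// addr0 mulN1r opprK.
  have hd : H2 Omega (x N - y) by exact: (si_sub HD hxN hy).
  rewrite e1 sqrrN; apply: le_trans (bdD _ _ hd hQ) _.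
  have p1 : 0 < 1 + qformT Q Q by rewrite ltr_pwDl.
  have := ltW (hN N (leqnn N)); rewrite ler_pdivlMr// => h.
  apply: le_trans h; apply: ler_wpM2l; [exact: (si_ge0 HD)|by rewrite lerDr].
have [||p [hp zp] pE] := riesz HZ (l := fun x => dform D Omega u0 x) (c := dform D Omega u0 u0) cZ.
- by move=> s x y /sZ hx /sZ hy; exact: (si_linr HD).
- by move=> x /sZ hx; exact: (cauchy_schwarz HD).
pose v := u0 - p; have hv : H2 Omega v by exact: (si_sub HD hu hp).
have ve Q : HdivDivb T Q -> bd (fun=> v) Q = uh Q.
  move=> hQ; rewrite -(euh _ hQ) trGgradE /v (_ : u0 - p = -1 *: p + u0); last by rewrite scaleN1r addrC.
  by rewrite bl// zp// mulr0 add0r.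
have vo x : Z x -> dform D Omega v x = 0.
  by move=> zx; have hx := sZ _ zx; rewrite /v (si_subl HD hu hp hx) (pE _ zx) subrr.
apply: (@le_trans _ _ (dform D Omega v v)).
  by apply: (normGgrad_le oO d0 hv) => Q hQ; rewrite trGgradE; exact: ve.
have sE := Eps_L2s oO hv; have LE := L2s_LM sE; have Lv := H2_L2 hv.
have sN : L2s Omega (- Eps Omega v) by rewrite -sub0r; exact: (L2s_subr mO (L2s_subspace mO).1 sE).
have LN := L2s_LM sN; have LDv : L2 Omega (D *: v) by exact: (si_scale HL).
have dQ i : is_divDiv (T i) (- Eps Omega v) (D *: v).
  move=> phi t; have t' := test_fun_subset (@sT i) t; have hp' := H2_test oO t'.
  have := vo phi; rewrite /dform -(ip_test _ mO (@mT i) (@sT i) t) -(ipM_hessian_sub oO (@oT i) (@sT i) LN t).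
  rewrite (ipM_test oO LE t') (si_oppl HM LE (LM_hessian mO t')) (si_scalel HL _ Lv (test_fun_L2 mO t')) => h.
  apply/eqP; rewrite -addr_eq0; apply/eqP; apply: h; split => // Q hQ; exact: bd_test t hQ.
have sNi i := L2s_sub mO (@mT i) (@sT i) sN; have LDi i := L2_subset mO (@mT i) (@sT i) LDv.
have hQ : HdivDivb T (fun=> - Eps Omega v) by move=> i; exact: (HdivDiv_intro (sNi i) (LDi i) (dQ i)).
have ddE' i := dd_ae (@oT i) (sNi i) (LDi i) (dQ i).
have Ld i : L2 (T i) (dd (T i) (- Eps Omega v)) by case: (dd_spec (hQ i)).
have e1 : bd (fun=> v) (fun=> - Eps Omega v) = dform D Omega v v.
  rewrite /skeleton_pairing /dform; have -> : \sum_i ip (T i) v (dd (T i) (- Eps Omega v)) = D * ip Omega v v.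
    rewrite -(si_scaler HL D Lv Lv) (mesh_ip oO bO hT Lv LDv); apply: eq_bigr => i _.
    exact: (ip_ae2 (@mT i) (Ld i) (LDi i) (L2_subset mO (@mT i) (@sT i) Lv) (ddE' i)).
  rewrite (conf_Eps oO bO hT hv LN) ipM_sym (si_oppl HM LE LE) opprK; reflexivity.
have e2 : qformT (fun=> - Eps Omega v) (fun=> - Eps Omega v) = dform D Omega v v.
  rewrite /qform /Qform big_split /= -mulr_sumr -(mesh_ipM oO bO hT LN LN).
  rewrite (si_oppl HM LE LN) ipM_sym (si_oppl HM LE LE) opprK /dform addrC; congr (_ + _).
  rewrite (eq_bigr (fun i => ip (T i) (D *: v) (D *: v))); last first.
    move=> i _; rewrite (ip_ae (@mT i) (Ld i) (LDi i) (Ld i) (ddE' i)).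
    exact: (ip_ae2 (@mT i) (Ld i) (LDi i) (LDi i) (ddE' i)).
  rewrite -(mesh_ip oO bO hT LDv LDv) (si_scalel HL D Lv LDv) (si_scaler HL D Lv Lv).
  by rewrite mulrCA mulrA Dc mul1r.
have := hK _ hQ; rewrite -(ve _ hQ) e1 e2 => h; apply: sq_cancel => //; exact: (si_ge0 HD).
Qed.

(** On its own element the weak Hessian of [v i] is tested with [phi]; on the
    others the field vanishes. *)
Lemma bd_sym_unit l i j phi v : test_fun (T l) phi -> H2b T v -> bd v (fun=> sym_unit i j phi) = 0.
Proof.
move=> t hv; rewrite /skeleton_pairing -sumrB; apply: big1 => n _; apply/eqP; rewrite subr_eq0; apply/eqP.
have LE := H2_LM (@oT n) (hv n); have Lvn := H2_L2 (hv n).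
have [nl|nl] := eqVneq n l.
  subst l; have [hS dS] := HdivDiv_sym_unit i j (@oT n) t; have [_ eS] := ipM_sym_unit i j (@mT n) t LE.
  have [LS _] := dd_spec hS; have wh := H2_weak_hess (@oT n) (hv n); have HLn := L2_semi_inner (@mT n).
  have Lp i' j' := test_fun_L2 (@mT n) (test_fun_partial i' (test_fun_partial j' t)).
  have Ls := si_add HLn (Lp i j) (Lp j i).
  rewrite ipM_sym eS (ip_ae2 (@mT n) LS Ls Lvn dS) -[X in ip _ _ (X + _)]scale1r.
  rewrite (si_linr HLn 1 (Lp i j) (Lp j i) Lvn) mul1r.
  exact: (congr2 +%R (etrans (wh i j _ t) (ip_sym _ _ _)) (etrans (wh j i _ t) (ip_sym _ _ _))).
have t' := test_fun_subset (@sT l) t; have [hS _] := HdivDiv_sym_unit i j oO t'.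
have sSn := L2s_sub mO (@mT n) (@sT n) (HdivDiv_L2s hS); have S0 := LM_0 (@mT n).
have [_ /(_ l n) dis _] := hT.
have pz : ae_eq mu (T n) phi 0 by apply: test_off t; apply: dis; rewrite eq_sym.
have E i' j' : ae_eq mu (T n) (ent (0 : R * R -> 'M[R]_2) i' j') (ent (sym_unit i j phi) i' j').
  apply: filterS pz => x h wx; have h0 : phi x = 0 := h wx.
  by rewrite /ent /sym_unit h0 scale0r.
have L0 := L2_0 (@mT n).
have dz : ae_eq mu (T n) (dd (T n) (sym_unit i j phi)) 0.
  apply: (dd_ae (@oT n) sSn L0); exact: (is_divDiv_ae (@mT n) S0 (L2s_LM sSn) E (is_divDiv0 (@mT n))).
have [Ld _] := dd_spec (HdivDivb_conf oO hT hS n).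
rewrite (ip_ae2 (@mT n) Ld L0 Lvn dz) ipM_sym -(ipM_ae (@mT n) S0 (L2s_LM sSn) LE E).
have := si_scaler (L2_semi_inner (@mT n)) 0 L0 Lvn; rewrite scale0r mul0r => ->.
by have := si_scalel (LM_ipM_inner (@mT n)) 0 S0 LE; rewrite scale0r mul0r => ->.
Qed.

Lemma ent_opp (P : R * R -> 'M[R]_2) i j : ent (- P) i j = -1 *: ent P i j.
Proof.
apply/funext => x; rewrite /ent (_ : (- P) x = - P x)// mxE.
by rewrite (_ : (-1 *: (fun y => P y i j)) x = -1 * P x i j)// mulN1r.
Qed.

Lemma double_cancel (c x1 x2 y1 y2 : R) : x2 = x1 -> y2 = y1 -> x1 + x2 + c * (y1 + y2) = 0 -> c * y1 = -1 * x1.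
Proof. move=> -> ->; lra. Qed.

(** Dually, the representative [Q] of minimal norm satisfies [Eps (d ^+ 4 *
    divDiv Q) = - Q] in every element. That this multiple of its divergence
    belongs to H2 of the element, hence to the test space, is the regularity
    theorem. *)
Lemma normdDiv_bound mh K : 0 <= K -> tracedDiv a Omega T mh ->
  (forall v, H2b T v -> mh v ^+ 2 <= K * vformT v v) ->
  normdDiv d Omega T mh ^+ 2 <= K.
Proof.
move=> K0 [Q0 hQ0 emh] hK; have hQ0' := HdivDivbc_HdivDiv hQ0.
pose Z := [set P : R * R -> 'M[R]_2 | HdivDiv Omega P /\ forall v, H2b T v -> bd v (fun=> P) = 0].
have HD := Qform_inner oO (ltW c0); have [S0 SL] := HdivDiv_subspace oO.
have bl s x y v : HdivDiv Omega x -> HdivDiv Omega y -> H2b T v ->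
    bd v (fun=> s *: x + y) = s * bd v (fun=> x) + bd v (fun=> y).
  by move=> hx hy hv; exact: (bd_linr hT s hv (HdivDivb_conf oO hT hx) (HdivDivb_conf oO hT hy)).
have sZ : Z `<=` @HdivDiv R Omega by move=> z [].
have subZ : subspace Z.
  split=> [|s x y [hx zx] [hy zy]]; first by split => // v hv; exact: (bd0r hT hv).
  by split=> [|v hv]; [exact: SL|rewrite bl// zx// zy// mulr0 addr0].
have HZ := si_subset subZ sZ HD.
have bdD x v : HdivDiv Omega x -> H2b T v -> bd v (fun=> x) ^+ 2 <= Qform c4 Omega x x * vformT v v.
  move=> hx hv; have := bd_bound hT d0 hv (HdivDivb_conf oO hT hx).
  by rewrite (qform_conf d oO bO hT hx) mulrC.
have cZ : complete_wrt Z (Qform c4 Omega).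
  apply: complete_sub (Qform_complete oO c0) => // x y hx hy xy; split => // v hv.
  have q0 := si_ge0 HV hv; apply/eqP; rewrite -sqrf_eq0 eq_le sqr_ge0 andbT.
  apply/ler_addgt0Pr => e e0; rewrite add0r.
  have [|N hN] := xy (e / (1 + vformT v v)); first by rewrite divr_gt0// ltr_pwDl.
  have [hxN zxN] := hx N.
  have e1 : bd v (fun=> y) = - bd v (fun=> x N - y).
    rewrite (_ : x N - y = -1 *: y + x N); last by rewrite scaleN1r addrC.
    by rewrite bl// zxN// addr0 mulN1r opprK.
  have hd : HdivDiv Omega (x N - y) by exact: (si_sub HD hxN hy).
  rewrite e1 sqrrN; apply: le_trans (bdD _ _ hd hv) _.
  have p1 : 0 < 1 + vformT v v by rewrite ltr_pwDl.
  have := ltW (hN N (leqnn N)); rewrite ler_pdivlMr// => h.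
  apply: le_trans h; apply: ler_wpM2l; [exact: (si_ge0 HD)|by rewrite lerDr].
have [||p [hp zp] pE] := riesz HZ (l := fun x => Qform c4 Omega Q0 x) (c := Qform c4 Omega Q0 Q0) cZ.
- by move=> s x y /sZ hx /sZ hy; exact: (si_linr HD).
- by move=> x /sZ hx; exact: (cauchy_schwarz HD).
pose Q := Q0 - p; have hQ : HdivDiv Omega Q by exact: (si_sub HD hQ0' hp).
have ve v : H2b T v -> bd v (fun=> Q) = mh v.
  move=> hv; rewrite -(emh _ hv) trdDivE /Q (_ : Q0 - p = -1 *: p + Q0); last by rewrite scaleN1r addrC.
  by rewrite bl// zp// mulr0 add0r.
have vo x : Z x -> Qform c4 Omega Q x = 0.
  by move=> zx; have hx := sZ _ zx; rewrite /Q (si_subl HD hQ0' hp hx) (pE _ zx) subrr.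
apply: (@le_trans _ _ (Qform c4 Omega Q Q)).
  by apply: (normdDiv_le oO d0 hQ) => v hv; rewrite trdDivE; exact: ve.
have sQ := HdivDiv_L2s hQ; have LQ := L2s_LM sQ; have [Ld _] := dd_spec hQ.
have sN : L2s Omega (- Q) by rewrite -sub0r; exact: (L2s_subr mO (L2s_subspace mO).1 sQ).
have LN := L2s_LM sN; pose psi := c4 *: dd Omega Q; have Lpsi : L2 Omega psi by exact: (si_scale HL).
have /L2sP[_ symQ] := sQ.
have wh l : weak_hess (T l) psi (- Q).
  move=> i j phi t; have t' := test_fun_subset (@sT l) t; have Lphi := test_fun_L2 mO t'.
  rewrite -(ip_test _ mO (@mT l) (@sT l) (test_fun_partial i (test_fun_partial j t))) -(ip_test _ mO (@mT l) (@sT l) t).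
  have [hS dS] := HdivDiv_sym_unit i j oO t'; have [_ eS] := ipM_sym_unit i j mO t' LQ.
  have [LS _] := dd_spec hS.
  have := vo (sym_unit i j phi) (conj hS (fun v hv => bd_sym_unit i j t hv)).
  have Lp i' j' := test_fun_L2 mO (test_fun_partial i' (test_fun_partial j' t')).
  rewrite /Qform ipM_sym eS (ip_ae2 mO LS (si_add HL (Lp i j) (Lp j i)) Ld dS).
  rewrite -[X in ip _ (dd _ _) (X + _)]scale1r (si_linr HL 1 (Lp i j) (Lp j i) Ld) mul1r.
  have Ep : ae_eq mu Omega (partial j (partial i phi)) (partial i (partial j phi)).
    have h1 := D2_test_ae i j oO t'; have h2 := D2_test_ae j i oO t'; have h3 := H2_hess_sym i j oO (H2_test oO t').
    exact: (ae_eq_trans (ae_eq_sym h1) (ae_eq_trans h3 h2)).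
  have q1 := ip_ae2 mO (Lp j i) (Lp i j) Ld Ep; have q2 := ip_ae2 mO (LQ j i) (LQ i j) Lphi (symQ j i).
  move=> /(double_cancel q2 q1) e; rewrite ent_opp.
  apply: (etrans (si_scalel HL c4 Ld (Lp i j))); apply: (etrans e).
  by apply/esym/(etrans (si_scalel HL (-1) (LQ i j) Lphi)); congr (_ * _); exact: ip_sym.
have Lpi l := L2_subset mO (@mT l) (@sT l) Lpsi; have LNi l := LM_sub mO (@mT l) (@sT l) LN.
have hpsi : H2b T (fun=> psi).
  by move=> l; have [bl' ll] := lT l; exact: (weak_hess_H2 (@oT l) bl' ll (Lpi l) (LNi l) (wh l)).
have Epsi l := Eps_ae (@oT l) (hpsi l) (LNi l) (wh l).
have LEl l := H2_LM (@oT l) (hpsi l).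
have e1 : bd (fun=> psi) (fun=> Q) = Qform c4 Omega Q Q.
  rewrite /skeleton_pairing /Qform (conf_dd oO bO hT Lpsi hQ) (si_scalel HL c4 Ld Ld) addrC; congr (_ + _).
  rewrite -[RHS]opprK -(si_oppl HM LQ LQ); congr (- _); rewrite (mesh_ipM oO bO hT LN LQ).
  by apply: eq_bigr => l _; exact: (ipM_ae (@mT l) (LEl l) (LNi l) (LM_sub mO (@mT l) (@sT l) LQ) (Epsi l)).
have e2 : vformT (fun=> psi) (fun=> psi) = Qform c4 Omega Q Q.
  rewrite /vform /dform /Qform big_split /= -mulr_sumr -(mesh_ip oO bO hT Lpsi Lpsi) addrC; congr (_ + _).
    rewrite -[RHS]opprK -(si_oppl HM LQ LQ) ipM_sym -(si_oppl HM LQ LN) (mesh_ipM oO bO hT LN LN).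
    apply: eq_bigr => l _; exact: (ipM_ext (@mT l) (LEl l) (LNi l) (LEl l) (LNi l) (Epsi l) (Epsi l)).
  have e2 : ip Omega psi psi = c4 * (c4 * ip Omega (dd Omega Q) (dd Omega Q)).
    apply: (etrans (si_scalel HL c4 Ld Lpsi)); congr (_ * _); exact: (si_scaler HL c4 Ld Ld).
  by rewrite e2 mulrA Dc mul1r.
have := hK _ hpsi; rewrite -(ve _ hpsi) e1 e2 => h; apply: sq_cancel => //; exact: (si_ge0 HD).
Qed.

End InfSup.

(** * Well-posedness and quasi-optimality *)

Section Results.
Context {R : realType} {m : nat}.
Variable C : {linear 'M[R]_2 -> 'M[R]_2}.
Hypothesis hC : spd_tensor C.
Variables (Omega : set (R * R)) (T : 'I_m -> set (R * R)) (a : bc).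
Hypotheses (oO : open Omega) (bO : bounded_set Omega) (lO : lipschitz_boundary Omega) (hT : is_mesh Omega T).
Implicit Types (f u : R * R -> R) (M : R * R -> 'M[R]_2) (v : test R m)
  (uh : ('I_m -> R * R -> 'M[R]_2) -> R) (mh : ('I_m -> R * R -> R) -> R) (w z : trial R m).
Local Notation mu := (leb2 R).
Let mO : pmeas Omega := open_measurable2 oO.
Let oT i : open (T i) := @mesh_open R m Omega T hT i.
Let sT i : T i `<=` Omega := @mesh_sub R m Omega T hT i.
Let mT i : pmeas (T i) := open_measurable2 (@oT i).
Let lT i : bounded_set (T i) /\ lipschitz_boundary (T i).
Proof. by split; [exact: (mesh_bounded bO hT)|exact: (mesh_lipschitz hT)]. Qed.
Let HL := L2_semi_inner mO.
Let HM := LM_ipM_inner mO.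
Local Notation b := (b C T).
Local Notation U := (Uspace a Omega T).
Let SU := Uspace_subspace a oO hT.

Lemma U_sub w z : U w -> U z -> U (w - z).
Proof. by move=> hw hz; rewrite addrC -scaleN1r; exact: SU.2. Qed.

Lemma b_sub w z v : U w -> U z -> Vspace T v -> b (w - z) v = b w v - b z v.
Proof.
move=> hw hz hv; have e : w - z = -1 *: z + w by rewrite scaleN1r addrC.
by rewrite e (b_lin hC oO hT (-1) hz hw hv) mulN1r addrC.
Qed.

Lemma VF_exists f : L2 Omega f -> exists w, solves_VF C a Omega T f w.
Proof.
move=> Lf; have [u [M h]] := KL_exists hC a oO bO hT Lf.
by exists (u, M, trGgrad T (fun=> u), trdDiv T (fun=> M)); exact: (KL_VF hC oO hT Lf h).
Qed.

Lemma VF_unique f w z : solves_VF C a Omega T f w -> solves_VF C a Omega T f z -> Ueq Omega T w z.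
Proof.
move=> [hw ew] [hz ez]; apply: Ueq_sub; apply: (b_eq0_Ueq hC oO bO hT (U_sub hw hz)) => v hv.
by rewrite (b_sub hw hz hv) (ew _ hv) (ez _ hv) subrr.
Qed.

Lemma VF_sub f f' w z : L2 Omega f -> L2 Omega f' ->
  solves_VF C a Omega T f w -> solves_VF C a Omega T f' z -> solves_VF C a Omega T (f - f') (w - z).
Proof.
move=> Lf Lf' [hw ew] [hz ez]; split=> [|v hv]; first exact: U_sub.
rewrite (b_sub hw hz hv) (ew _ hv) (ez _ hv) /L -opprD -sumrB; congr (- _); apply: eq_bigr => i _.
have [hv1 _] := hv; rewrite (si_subl (L2_semi_inner (@mT i)) _ _ (H2_L2 (hv1 i)))//; exact: (L2_subset mO (@mT i) (@sT i)).
Qed.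

(** Green's formula turns the equation into the energy identity. *)
Lemma weakKL_energy k c f u M : 0 <= k -> 0 <= c ->
  ipM Omega (Eps Omega u) (Eps Omega u) <= k * ipM Omega (stiff C (Eps Omega u)) (Eps Omega u) ->
  ip Omega u u <= c * ipM Omega (Eps Omega u) (Eps Omega u) -> L2 Omega f ->
  weakKL C Omega T a f u M -> ipM Omega (Eps Omega u) (Eps Omega u) <= k ^+ 2 * c * ip Omega f f.
Proof.
move=> k0 c0 hk hc Lf [hu hM dM eM]; have hu2 := H2bc_H2 hu; have hM' := HdivDivbc_HdivDiv hM.
have LE := H2_LM oO hu2; have LS := stiff_LM C mO LE; have [Ld _] := dd_spec hM'.
have LN : L2 Omega (- f) by rewrite -sub0r; exact: (si_sub HL (L2_0 mO) Lf).
have LNS : LM Omega (- stiff C (Eps Omega u)) by rewrite -sub0r; exact: (si_sub HM (LM_0 mO) LS).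
have e : ipM Omega (stiff C (Eps Omega u)) (Eps Omega u) = ip Omega f u.
  have := green_bc oO bO hT hu hM.
  rewrite (ip_ae2 mO Ld LN (H2_L2 hu2) dM) ip_sym (si_oppl HL Lf (H2_L2 hu2)).
  rewrite ipM_sym (ipM_ae mO (HdivDiv_LM hM') LNS LE eM) (si_oppl HM LS LE) => /eqP.
  by rewrite eqr_opp => /eqP ->.
rewrite e in hk; have cs := cauchy_schwarz HL Lf (H2_L2 hu2).
have n1 := ipM_ge0 Omega (Eps Omega u); have n2 := ip_ge0 Omega f.
move: hk hc cs n1 n2; move: (ipM Omega _ _) (ip Omega f u) (ip Omega u u) (ip Omega f f) => E s U F hk hc cs n1 n2.
apply: sq_cancel => //; first by rewrite !mulr_ge0 ?sqr_ge0.
apply: (@le_trans _ _ ((k * s) ^+ 2)).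
  by rewrite ler_pXn2r ?nnegrE//; exact: le_trans hk.
have h : s ^+ 2 <= F * (c * E) by apply: le_trans cs _; exact: ler_wpM2l.
rewrite exprMn (_ : k ^+ 2 * c * F * E = k ^+ 2 * (F * (c * E))); last by ring.
exact: (ler_wpM2l (sqr_ge0 k) h).
Qed.

(** The difference of two solutions is a plate solution with the difference of
    the loads, whose traces have norms bounded by its own. *)
Lemma VF_continuous d : 0 < d -> exists2 c : R, 0 < c & forall f f' w z, L2 Omega f -> L2 Omega f' ->
  solves_VF C a Omega T f w -> solves_VF C a Omega T f' z ->
  normU d Omega T (w - z) <= c * nrm Omega (f - f').
Proof.
move=> d0; have D0 : 0 < d ^- 4 by rewrite invr_gt0 exprn_gt0.
have c40 : 0 < d ^+ 4 by rewrite exprn_gt0.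
have [k k0 hk] := stiff_coercive hC; have [k' k'0 hk'] := stiff_bound C; have [c c0 hc] := poincare oO bO.
pose K := (2 * (d ^- 4 * c) + 2 * k' + 1) * (k ^+ 2 * c) + d ^+ 4.
have h0 : 0 <= (2 * (d ^- 4 * c) + 2 * k' + 1) * (k ^+ 2 * c).
  apply: mulr_ge0; last by rewrite mulr_ge0 ?sqr_ge0// ltW.
  by rewrite !addr_ge0// mulr_ge0// mulr_ge0// ltW.
have K0 : 0 < K by rewrite ltr_wpDl.
exists (Num.sqrt K) => [|f f' w z Lf Lf' hw hz]; first by rewrite sqrtr_gt0.
have := VF_sub Lf Lf' hw hz; have Lg : L2 Omega (f - f') := si_sub HL Lf Lf'.
case: (w - z) => [[[u M] uh] mh] hVF; move: (f - f') Lg hVF => g Lg hVF.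
have [eu em hKL] := VF_KL hC oO bO hT Lg hVF; have [hu hM dM eM] := hKL.
have hu2 := H2bc_H2 hu; have hM' := HdivDivbc_HdivDiv hM; have [Ld _] := dd_spec hM'.
rewrite normUE /nrm -sqrtrM; last exact: ltW.
apply: ler_wsqrtr.
have LE := H2_LM oO hu2; have LS := stiff_LM C mO LE.
have LN : L2 Omega (- g) by rewrite -sub0r; exact: (si_sub HL (L2_0 mO) Lg).
have LNS : LM Omega (- stiff C (Eps Omega u)) by rewrite -sub0r; exact: (si_sub HM (LM_0 mO) LS).
have n1 := normGgrad_le oO d0 hu2 (fun Q hQ => esym (eu Q hQ)).
have n2 := normdDiv_le oO d0 hM' (fun y hy => esym (em y hy)).
have pu : ip Omega u u <= c * ipM Omega (Eps Omega u) (Eps Omega u).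
  have := hc _ (H2bc_H2s hu); have := ip_Eps_le oO hu2; have := ipM_ge0 Omega (Eps Omega u); lra.
have e1 := weakKL_energy (ltW k0) (ltW c0) (hk _ _ mO (Eps_L2s oO hu2)) pu Lg hKL.
have e2 : ip Omega (dd Omega M) (dd Omega M) = ip Omega g g.
  rewrite (ip_ae mO Ld LN Ld dM) (ip_ae2 mO Ld LN LN dM) (si_oppl HL Lg LN) ip_sym (si_oppl HL Lg Lg); exact: opprK.
have e3 : ipM Omega M M <= k' * ipM Omega (Eps Omega u) (Eps Omega u).
  rewrite (ipM_ext mO (HdivDiv_LM hM') LNS (HdivDiv_LM hM') LNS eM eM) (si_oppl HM LS LNS) ipM_sym (si_oppl HM LS LS) opprK.
  exact: (hk' _ _ mO LE).
move: n1 n2 e1 e3 pu; rewrite /normU2 /Qform /dform e2 {e2}.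
have := ipM_ge0 Omega (Eps Omega u).
move: (ipM Omega (Eps Omega u) (Eps Omega u)) (ipM Omega M M) (ip Omega u u) (ip Omega g g) => E N V G.
move: (normGgrad _ _ _ _ ^+ 2) (normdDiv _ _ _ _ ^+ 2) => x y E0 n1 n2 e1 e3 pu.
have h1 : d ^- 4 * V <= d ^- 4 * (c * E) by apply: ler_wpM2l => //; exact: ltW.
have h2 : (2 * (d ^- 4 * c) + 2 * k' + 1) * E <= (2 * (d ^- 4 * c) + 2 * k' + 1) * (k ^+ 2 * c * G).
  apply: ler_wpM2l => //; by rewrite !addr_ge0// mulr_ge0// mulr_ge0// ltW.
rewrite /K; move: (d ^- 4) (d ^+ 4) (k ^+ 2) h1 h2 n1 n2 e1 => {}D c4 k2 h1 h2 n1 n2 e1; lra.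
Qed.

Section Scaled.
Variable d : R.
Hypothesis d0 : 0 < d.
Local Notation energy := (energy C T d).
Let HE := energy_inner hC a oO hT d0 lT.

(** The fields are controlled by conforming test functions; once they are, [b
    w] bounds the traces as functionals, and functionals determine the minimum
    norms. All constants stem from the material tensor, since the scaled
    Poincare inequality has constant one. *)
Lemma stability k k' kc : 0 < k -> 0 <= k' -> 0 <= kc ->
  (forall (w : set (R * R)) (P : R * R -> 'M[R]_2), pmeas w -> L2s w P -> ipM w P P <= k * ipM w (stiff C P) P) ->
  (forall (w : set (R * R)) (P : R * R -> 'M[R]_2), pmeas w -> LM w P -> ipM w (stiff C P) (stiff C P) <= k' * ipM w P P) ->
  (forall (w : set (R * R)) (P : R * R -> 'M[R]_2), pmeas w -> L2s w P -> ipM w (compl C P) (compl C P) <= kc * ipM w P P) ->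
  (forall v : R * R -> R, H2bc a Omega v -> d ^- 4 * ip Omega v v <= ipM Omega (Eps Omega v) (Eps Omega v)) ->
  forall w, U w -> normU2 Omega T d w <=
    (field_const k k' + 3 * ((1 + kc) * field_const k k' + 1) + 2 * (1 + field_const k k')) * energy w w.
Proof.
move=> k0 k'0 kc0 hk hk' hkc scale [[[u M] uh] mh] hw.
have := fields_bound hC oO bO hT d0 lT k'0 hk hk' scale hw.
have F0 := field_const_ge0 k k'0; have S0 := si_ge0 HE hw; have [Lu sM tu tm] := hw.
have HV := vform_inner hT d0; have HQ := qform_inner hT d0.
set S := energy _ _ in S0 *; move: (field_const k k') F0 => F F0 hF.
have n1 := ipM_ge0 Omega M.
have n2 : 0 <= d ^- 4 * ip Omega u u by apply: mulr_ge0; [rewrite invr_ge0 exprn_ge0// ltW|exact: ip_ge0].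
have kn : 0 <= kc * (d ^- 4 * ip Omega u u) := mulr_ge0 kc0 n2.
have g1 : normGgrad d Omega T uh ^+ 2 <= 3 * ((1 + kc) * F + 1) * S.
  apply: (normGgrad_bound oO bO hT d0 _ tu lO).
    by apply: mulr_ge0 => //; apply: mulr_ge0 => //; apply: addr_ge0 => //; apply: mulr_ge0 => //; exact: addr_ge0.
  move=> Q hQ; have [t1 t2] := left_terms hC oO bO hT d0 hkc Lu sM hQ.
  have := b_energy hC oO hT d0 lT hw (conj (H2b0 hT) hQ : Vspace T ((fun=> 0, Q) : test R m)).
  rewrite ipVE (vform0 hT d0) add0r (b_left hC oO hT u uh sM hQ tm) -/S.
  have q0 := si_ge0 HQ hQ; move: hF t1 t2 q0 n1 n2 kn; rewrite /fieldsq.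
  move: (\sum_i ipM (T i) _ _) (\sum_i ip (T i) _ _) (uh Q) (qform T d Q Q) (ipM Omega M M) (d ^- 4 * ip Omega u u) => s t r q M2 U2.
  move=> hF t1 t2 q0 n1 n2 kn t3.
  have h1 : (kc * M2 + U2 + S) * q <= ((1 + kc) * F + 1) * S * q.
    apply: ler_wpM2r => //; have : (1 + kc) * (U2 + M2) <= (1 + kc) * (F * S) by apply: ler_wpM2l => //; exact: addr_ge0.
    lra.
  have := sqr_ge0 (s - t); have := sqr_ge0 (s + (s + t - r)); have := sqr_ge0 (t + (s + t - r)); lra.
have g2 : normdDiv d Omega T mh ^+ 2 <= 2 * (1 + F) * S.
  apply: (normdDiv_bound oO bO hT d0 lT _ tm).
    by apply: mulr_ge0 => //; apply: mulr_ge0 => //; exact: addr_ge0.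
  move=> v hv; have t1 := right_term oO bO hT d0 sM hv.
  have := b_energy hC oO hT d0 lT hw (conj hv (HdivDivb0 hT) : Vspace T ((v, fun=> 0) : test R m)).
  rewrite ipVE (qform0 hT d0) addr0 (b_right hC oO hT mh Lu sM hv tu) -/S.
  have q0 := si_ge0 HV hv; move: hF t1 q0 n1 n2; rewrite /fieldsq.
  move: (\sum_i ipM (T i) _ _) (mh v) (vform T d v v) (ipM Omega M M) (d ^- 4 * ip Omega u u) => s t q M2 U2.
  move=> hF t1 q0 n1 n2 t3.
  have h1 : (M2 + S) * q <= (1 + F) * S * q by apply: ler_wpM2r => //; lra.
  have := sqr_ge0 (s + (s + t)); lra.
move: hF; rewrite /normU2 /fieldsq; lra.
Qed.

Section Galerkin.
Variables (f : R * R -> R) (Uh : set (trial R m)).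
Hypotheses (Lf : L2 Omega f) (hUh : fin_dim_subspace a Omega T Uh).

Lemma Uh_U z : Uh z -> U z.
Proof. by move=> hz; have [n [ws [_ hws]]] := hUh; have [] := (hws z).1 hz. Qed.

Lemma VF_Theta w z : solves_VF C a Omega T f w -> Uh z -> energy w z = L T f (Theta C d T z).
Proof. by move=> [_ ew] /Uh_U hz; apply: ew; case: (Theta_spec hC oO hT d0 lT hz). Qed.

(** The scheme is the Galerkin scheme of the energy form. *)
Lemma DPG_orthogonal w wh z : solves_VF C a Omega T f w -> solves_DPG C d T f Uh wh -> Uh z ->
  energy (w - wh) z = 0.
Proof.
move=> hw [hh eh] hz; have e1 : energy wh z = L T f (Theta C d T z) by apply: eh; exists z.
by rewrite (si_subl HE hw.1 (Uh_U hh) (Uh_U hz)) (VF_Theta hw hz) e1 subrr.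
Qed.

Lemma DPG_exists : exists wh, solves_DPG C d T f Uh wh.
Proof.
have [w hw] := VF_exists Lf; have [n [ws [Uws hws]]] := hUh.
have [c hc] := projection_span HE Uws hw.1.
have Usum (c' : 'I_n -> R) : U (\sum_i c' i *: ws i).
  apply: big_ind => [|x y hx hy|i _]; [exact: (si_0 HE)|exact: (si_add HE)|exact: (si_scale HE)].
have hwh : Uh (\sum_i c i *: ws i).
  by apply/hws; split=> //; exists c; case: (\sum_i _) => [[[? ?] ?] ?]; split => //; exact: ae_eq_refl.
exists (\sum_i c i *: ws i); split => // _ [z hz <-].
have [Uz [c' ez]] := (hws z).1 hz; rewrite -(VF_Theta hw hz).
have Ud := U_sub hw.1 (Usum c).
apply/esym/eqP; rewrite -subr_eq0 -[X in X - _]/(energy w z) -[X in _ - X]/(energy (\sum_i c i *: ws i) z).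
rewrite -(si_subl HE hw.1 (Usum c) Uz) (energy_Ueq hC oO hT d0 lT Ud Uz (Usum c') ez).
suff h (s : seq 'I_n) : U (\sum_(i <- s) c' i *: ws i) /\ energy (w - \sum_i c i *: ws i) (\sum_(i <- s) c' i *: ws i) = 0.
  by apply/eqP; case: (h (index_enum 'I_n)).
elim: s => [|i s [IH1 IH2]].
  by rewrite big_nil; split; [exact: (si_0 HE)|have := si_scaler HE 0 (si_0 HE) Ud; rewrite scale0r mul0r].
rewrite big_cons; split; first exact: (si_lin HE).
by rewrite (si_linr HE _ (Uws i) IH1 Ud) hc IH2 mulr0 addr0.
Qed.

(** The difference of two discrete solutions is orthogonal to both, hence to
    itself. *)
Lemma DPG_unique wh wh' : solves_DPG C d T f Uh wh -> solves_DPG C d T f Uh wh' -> Ueq Omega T wh' wh.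
Proof.
move=> hh hh'; have [w hw] := VF_exists Lf; have U1 := Uh_U hh.1; have U2 := Uh_U hh'.1.
have o z : Uh z -> energy (wh' - wh) z = 0.
  move=> hz; have := DPG_orthogonal hw hh hz; have := DPG_orthogonal hw hh' hz.
  have Uz := Uh_U hz; rewrite (si_subl HE hw.1 U2 Uz) (si_subl HE hw.1 U1 Uz) (si_subl HE U2 U1 Uz).
  move: (energy w z) (energy wh z) (energy wh' z) => x y t; lra.
apply: Ueq_sub; have Ud := U_sub U2 U1; apply: (energy_eq0 hC oO bO hT d0 lT Ud).
by rewrite (si_subr HE U2 U1 Ud) (o _ hh'.1) (o _ hh.1) subrr.
Qed.

Lemma DPG_best w wh z : solves_VF C a Omega T f w -> solves_DPG C d T f Uh wh -> Uh z ->
  energy (w - wh) (w - wh) <= energy (w - z) (w - z).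
Proof.
move=> hw hh hz; have Uz := Uh_U hz; have Uw := Uh_U hh.1; have U1 := U_sub hw.1 Uw; have U2 := U_sub Uw Uz.
have -> : w - z = 1 *: (wh - z) + (w - wh) by rewrite scale1r [RHS]addrC subrKA.
rewrite (si_quad HE 1 U1 U2) (si_subr HE Uw Uz U1) (DPG_orthogonal hw hh hh.1) (DPG_orthogonal hw hh hz).
have := si_ge0 HE U2; move: (energy _ _) (energy _ _) => x y; lra.
Qed.

Lemma DPG_quasi_optimal K1 K2 w wh : 0 <= K1 -> 0 <= K2 ->
  (forall z, U z -> normU2 Omega T d z <= K1 * energy z z) ->
  (forall z, U z -> energy z z <= K2 * normU2 Omega T d z) ->
  solves_VF C a Omega T f w -> solves_DPG C d T f Uh wh ->
  normU d Omega T (w - wh) <= Num.sqrt (K1 * K2) * inf [set normU d Omega T (w - z) | z in Uh].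
Proof.
move=> K10 K20 h1 h2 hw hh; rewrite mulrC; apply: inf_prod_bound; rewrite ?sqrtr_ge0//.
  by exists (normU d Omega T (w - wh)), wh => //; exact: hh.1.
move=> _ [z hz <-]; rewrite mulrC !normUE -sqrtrM ?mulr_ge0//; apply: ler_wsqrtr.
have U1 := U_sub hw.1 (Uh_U hh.1); have U2 := U_sub hw.1 (Uh_U hz).
apply: le_trans (h1 _ U1) _; rewrite -mulrA; apply: ler_wpM2l => //.
exact: le_trans (DPG_best hw hh hz) (h2 _ U2).
Qed.

End Galerkin.

Lemma scaling_sq : (forall v : R * R -> R, H2bc a Omega v -> nrm Omega v <= d ^+ 2 * nrmM Omega (epsgrad Omega v)) ->
  forall v : R * R -> R, H2bc a Omega v -> d ^- 4 * ip Omega v v <= ipM Omega (Eps Omega v) (Eps Omega v).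
Proof.
move=> h v hv; rewrite mulrC ler_pdivrMr ?exprn_gt0//.
have := h v hv; rewrite EpsE => hv'.
rewrite -[leLHS]sqr_sqrtr ?ip_ge0// -[X in X * _]sqr_sqrtr ?ipM_ge0// mulrC (_ : 4 = 2 * 2)%N// exprM -exprMn.
rewrite ler_pXn2r ?nnegrE ?sqrtr_ge0//; apply: mulr_ge0; [exact: sqr_ge0|exact: sqrtr_ge0].
Qed.

End Scaled.
End Results.

Theorem theorem9 (R : realType) (C : {linear 'M[R]_2 -> 'M[R]_2})
    (hC : spd_tensor C) :
  exists2 K : R, 0 < K &
  forall (a : bc) (Omega : set (R * R)) (m : nat) (T : 'I_m -> set (R * R)),
  polygonal_lipschitz_domain Omega -> is_mesh Omega T ->
  (* well-posedness *)
  [/\ forall f, L2 Omega f ->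
        exists2 w : trial R m, solves_VF C a Omega T f w &
          forall w', solves_VF C a Omega T f w' -> Ueq Omega T w' w,
      forall d : R, 0 < d -> exists2 c : R, 0 < c &
        forall f f' (w w' : trial R m), L2 Omega f -> L2 Omega f' ->
        solves_VF C a Omega T f w -> solves_VF C a Omega T f' w' ->
        normU d Omega T (w - w') <= c * nrm Omega (f - f'),
  (* equivalence with the Kirchhoff--Love problem *)
      forall f u M, L2 Omega f -> solves_KL C a Omega T f u M ->
        solves_VF C a Omega T f
          ((u, M, trGgrad T (fun=> u), trdDiv T (fun=> M)) : trial R m),
      forall f u M uh mh, L2 Omega f ->
        solves_VF C a Omega T f ((u, M, uh, mh) : trial R m) ->
        [/\ eqGgrad T uh (trGgrad T (fun=> u)),
            eqdDiv T mh (trdDiv T (fun=> M))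
          & solves_KL C a Omega T f u M]
  (* DPG scheme *)
    & forall (f : R * R -> R) (d : R) (Uh : set (trial R m)),
        L2 Omega f -> 0 < d -> fin_dim_subspace a Omega T Uh ->
        (exists2 wh, solves_DPG C d T f Uh wh &
          forall wh', solves_DPG C d T f Uh wh' -> Ueq Omega T wh' wh) /\
        ((forall v, H2bc a Omega v ->
            nrm Omega v <= d ^+ 2 * nrmM Omega (epsgrad Omega v)) ->
         forall w wh, solves_VF C a Omega T f w ->
           solves_DPG C d T f Uh wh ->
           normU d Omega T (w - wh) <=
             K * inf [set normU d Omega T (w - z) | z in Uh])].
Proof.
have [k k0 hk] := stiff_coercive hC; have [k' k'0 hk'] := stiff_bound C.
have [kc kc0 hkc] := compl_bound hC; have F0 := field_const_ge0 k k'0.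
pose K1 := field_const k k' + 3 * ((1 + kc) * field_const k k' + 1) + 2 * (1 + field_const k k').
pose K2 := 5 * (1 + kc).
have K10 : 0 < K1.
  by rewrite /K1; have := mulr_ge0 kc0 F0; lra.
have K20 : 0 < K2 by rewrite /K2; lra.
exists (Num.sqrt (K1 * K2)); first by rewrite sqrtr_gt0 mulr_gt0.
move=> a Omega m T [[oO _ _] bO _ lO] hT.
have lT i : bounded_set (T i) /\ lipschitz_boundary (T i).
  by split; [exact: (mesh_bounded bO hT)|exact: (mesh_lipschitz hT)].
split.
- move=> f Lf; have [w hw] := VF_exists hC a oO bO hT Lf.
  by exists w => // w' hw'; exact: (VF_unique hC oO bO hT hw' hw).
- move=> d d0; exact: (VF_continuous hC a oO bO hT d0).
- by move=> f u M Lf /solves_KLE hKL; exact: (KL_VF hC oO hT Lf hKL).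
- move=> f u M uh mh Lf hVF; have [h1 h2 h3] := VF_KL hC oO bO hT Lf hVF.
  by split=> //; apply/solves_KLE.
- move=> f d Uh Lf d0 hUh; split.
    have [wh hwh] := DPG_exists hC oO bO hT d0 Lf hUh.
    by exists wh => // wh' hwh'; exact: (DPG_unique hC oO bO hT d0 Lf hUh hwh hwh').
  move=> hsc w wh hw hwh.
  apply: (DPG_quasi_optimal hC oO bO hT d0 hUh (ltW K10) (ltW K20) _ _ hw hwh) => z hz.
    exact: (stability hC oO bO lO hT d0 k0 k'0 kc0 hk hk' hkc (scaling_sq d0 hsc) hz).
  exact: (energy_bound hC oO bO hT d0 lT kc0 hkc hz).
Qed.
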